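(* Assume that $A$ is continuous and that assumptions (S) and (D) of the context hold. Let $(Y^i,U^i,Z^i,K^i)_{i\in\mathcal J}$ be the solution to the system of reflected BSDEs: for all $i\in\mathcal J$, $t\in[0,T]$, $$\begin{cases}Y_t^i=\xi^i+\int_t^Tf_s^i\,dA_s+\int_t^T g^i_s\,ds+\int_t^T\int_E U_s^i(e)(\rho_s^i(e)-1)\phi_s(de)dA_s\\ \qquad-\int_t^T\int_EU_s^i(e)\,q(dsde)-\int_t^TZ_s^i\,dW_s+K_T^i-K_t^i,\\ Y_t^i\geq \max_{j\in \mathbb{A}_i}(Y^j_t-C_t(i,j)),\\ \int_0^T\big(Y_t^i- \max_{j\in \mathbb{A}_i}(Y^j_t-C_t(i,j))\big)dK_t^i=0.\end{cases}$$ Then for every $i\in\mathcal J$ and $t\in[0,T]$, $$Y_t^i=\operatorname*{ess\,sup}_{\mathbf a\in\mathcal A_t^i}J(t,i,\mathbf a)=v(t,i)\qquad\mathbb P\text{-a.s.}$$ Moreover, the strategy $\mathbf a^*=(\theta_n^*,\alpha_n^* )_{n\ge0}$ defined by $(\theta_0^*,\alpha_0^* )=(t,i)$ and, for $n\ge1$, $$\theta^*_n=\inf\Big\{ s\geq\theta_{n-1}^* : Y^{\alpha^*_{n-1}}_s=\max_{j\in\mathbb{A}_{\alpha^*_{n-1}}}\big(Y^j_s-C_s(\alpha^*_{n-1},j)\big)\Big\},\qquad \alpha^*_n=\arg\max_{j\in\mathbb{A}_{\alpha^*_{n-1}}}\big(Y^j_{\theta_n^*}-C_{\theta^*_n}(\alpha^*_{n-1},j)\big)$$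 (with $\inf$ over $s\le T$ and $\inf\emptyset=T$) is an optimal strategy, i.e. $\mathbf a^*\in\mathcal A_t^i$ and $J(t,i,\mathbf a^* )=v(t,i)$ $\mathbb P$-a.s.
   Context: Setting. Fix $T>0$. $(\Omega,\mathcal F,\mathbb P)$ is a probability space with expectation $\mathbb E$, $(E,\mathcal E)$ is a Borel space (homeomorphic to a Borel subset of a compact metric space), $W$ is a $d$-dimensional Wiener process and $(T_n,\zeta_n)_{n\ge1}$ is a marked point process with marks $\zeta_n\in E$, independent of $W$: with $T_0=0$, a.s. $T_n\le T_{n+1}$, $T_n<\infty\Rightarrow T_n<T_{n+1}$, and (non-explosion) $T_n\to+\infty$. Its random measure is $p(dtde)=\sum_{n\ge1,\,T_n<\infty}\delta_{(T_n,\zeta_n)}(dtde)$. $\mathbb F=(\mathcal F_t)_{t\ge0}$ is the completed filtration generated by $p$ and $W$, $\mathcal P$ its predictable $\sigma$-algebra. The predictable compensator of $p$ has the form $\phi_t(\omega,de)dA_t(\omega)$, where $\phi_t(\omega,\cdot)$ is a probability on $(E,\mathcal E)$, $\phi_t(C)$ is predictable for every $C\in\mathcal E$, and $A$ is an increasing process with $A_0=0$, assumed continuous. $q(dtde)=p(dtde)-\phi_t(de)dA_t$, and integrals against $q$ are differences of the ordinary integrals against $p$ and $\phi\,dA$. $\int_a^b$ denotes integration over $(a,b]$. Spaces (of equivalence classes). $L^{2,\beta}(A)$: progressive $X$ with $\mathbb E[\int_0^Te^{\beta A_s}|X_s|^2dA_s]<\infty$. $L^{2,\beta}(p)$: $\mathcal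 P\otimes\mathcal E$-measurable $U$ with $\mathbb E[\int_0^T\int_Ee^{\beta A_s}|U_s(e)|^2\phi_s(de)dA_s]<\infty$. $L^{2,\beta}(W)$: progressive $Z$ (real or $\mathbb R^d$-valued as appropriate) with $\mathbb E[\int_0^Te^{\beta A_s}|Z_s|^2ds]<\infty$. $\mathcal I^2$: càdlàg increasing predictable $K$ with $\mathbb E[K_T^2]<\infty$. Data. $\mathcal J=\{1,\dots,m\}$ ($m\ge2$), $\mathbb A_i=\mathcal J\setminus\{i\}$. For each $i$, $\rho^i_s(e)\ge0$ is $\mathcal P\otimes\mathcal E$-measurable. Assumption (S): there is a constant $M$ with $0\le\rho^i_t(e)\le M$ for all $i$, and there is $\eta>3+M^4$ with $\mathbb E[e^{\eta A_T}]<\infty$. Set $M'=\max(|M-1|,1)$. Assumption (D): for some $\hat\beta>(M')^2$ and all $i\in\mathcal J$: (i) $\xi^i$ is $\mathcal F_T$-measurable with $\mathbb E[e^{\hat\beta A_T}|\xi^i|^2]<\infty$; (ii) $f^i$ is progressive in $L^{2,\hat\beta}(A)$; (iii) $g^i$ is progressive in $L^{2,\hat\beta}(W)$; (iv) $C_t(i,j)$, $i,j\in\mathcal J$, are continuous adapted processes, $C_t(i,j)\ge0$ for $i\ne j$, $C_t(i,i)=0$, $\inf_t(C_t(i,j)+C_t(j,l)-C_t(i,l))>0$ for all $i\ne j\ne l$ (that is, $i\neq j$ and $j\neq l$; $i=l$ allowed), and $\mathbb E[\sup_te^{\hat\beta A_t}C_t(i,j)]<\infty$ for all $i,j$; (v)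 $\xi^i\ge\xi^j-C_T(i,j)$ a.s. for all $i,j\in\mathcal J$. Solution of the system: for all $i$ and all $(M')^2<\beta<\hat\beta$, $Y^i$ is adapted càdlàg in $L^{2,\beta}(A)\cap L^{2,\beta}(W)$, $U^i\in L^{2,\beta}(p)$, $Z^i\in L^{2,\beta}(W)$, $K^i\in\mathcal I^2$ is increasing and continuous with $K^i_0=0$. Strategies. A strategy is a sequence $\mathbf a=(\theta_n,\alpha_n)_{n\ge0}$ with $\theta_n$ nondecreasing stopping times with values in $[0,T]$, $\alpha_n$ a $\mathcal J$-valued $\mathcal F_{\theta_n}$-measurable random variable, $\alpha_n\in\mathbb A_{\alpha_{n-1}}$ for $n\ge 1$. It is admissible if $\mathbb P(\theta_n<T\ \forall n)=0$. $\mathcal A_t^i$ is the set of admissible strategies with $(\theta_0,\alpha_0)=(t,i)$. Put $a_s=\sum_{k\ge1}\alpha_{k-1}\mathbf 1_{(\theta_{k-1},\theta_k]}(s)$ (with $a_T=i$ if $t=T$) and $\rho^{\mathbf a}_s(e)=\sum_{k\ge1}\mathbf 1_{(\theta_{k-1},\theta_k]}(s)\rho_s^{\alpha_{k-1}}(e)$. The cumulated switching cost is $D^{\mathbf a}_s=\sum_{n\ge1}C_{\theta_n}(\alpha_{n-1},\alpha_n)\mathbf 1_{\theta_n\le s}$ for $s<T$ and $D^{\mathbf a}_T=\lim_{s\uparrow T}D^{\mathbf a}_s$. Change of measure. $L_t^{\mathbf a}=\prod_{0<T_n\le t}\rho^{\mathbf a}_{T_n}(\zeta_n)\,e^{\int_0^t\int_E(1-\rho_s^{\mathbf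 a}(e))\phi_s(de)dA_s}$ is the density process of $\mathbb P^{\mathbf a}\ll\mathbb P$, $d\mathbb P^{\mathbf a}/d\mathbb P=L_T^{\mathbf a}$. The conditional expectation is taken in the version $\mathbb E^{\mathbf a}[X|\mathcal F_t]=\mathbb E\big[\tfrac{L^{\mathbf a}_T}{L^{\mathbf a}_t}X\,\big|\,\mathcal F_t\big]$, where $\tfrac{L^{\mathbf a}_T}{L^{\mathbf a}_t}:=\prod_{t<T_n\le T}\rho^{\mathbf a}_{T_n}(\zeta_n)\,e^{\int_t^T\int_E(1-\rho_s^{\mathbf a}(e))\phi_s(de)dA_s}$, which is defined $\mathbb P$-a.s. Gain and value. $J(t,i,\mathbf a)=\mathbb E^{\mathbf a}\big[\xi^{a_T}+\int_t^Tf_s^{a_s}dA_s+\int_t^Tg_s^{a_s}ds-D_T^{\mathbf a}\,\big|\,\mathcal F_t\big]$ (with values in $[-\infty,\infty)$) and $v(t,i)=\operatorname{ess\,sup}_{\mathbf a\in\mathcal A_t^i}J(t,i,\mathbf a)$. *)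

(* Defs.v *)
From HB Require Import structures.
From mathcomp Require Import all_boot all_order all_algebra.
From mathcomp Require Import all_classical all_reals all_analysis.
From mathcomp Require Import measurable_realfun.

Set Implicit Arguments.
Unset Strict Implicit.
Unset Printing Implicit Defensive.
Import Order.TTheory GRing.Theory Num.Theory.
Import numFieldNormedType.Exports.

Local Open Scope classical_set_scope.
Local Open Scope ring_scope.

(* Conventions.
   - Time is [R : realType]; processes are total functions [R -> Omega -> _], and
     only their values at times [0 <= t] (or [0 <= t <= T]) are constrained.
   - Sub-sigma-algebras are set systems [set (set _)].
   - Path properties of the data are required almost surely.
   - [J] is ['I_m]; an [R^d]-valued process is a family indexed by ['I_d]. *)

Definition meas_on {X : Type} {dY} {Y : measurableType dY}
    (G : set (set X)) (D : set X) (f : X -> Y) : Prop :=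
  forall B, measurable B -> G (D `&` f @^-1` B).

Definition rect_sigma {X Y : Type} (G : set (set X)) (H : set (set Y)) :
    set (set (X * Y)) :=
  <<s [set S | exists A B, [/\ G A, H B & S = A `*` B]] >>.

(* The measurable type of marks: [E] with its Borel sigma-algebra. *)
Notation marks E := (g_sigma_algebraType (@open E)).

(* A homeomorphism [h] of [E] onto a Borel subset of a compact metric space. *)
Definition borel_space (R : realType) (E : topologicalType) : Prop :=
  exists (X : metricType R) (h : E -> X),
    [/\ compact [set: X], injective h, continuous h,
        forall O : set E, open O -> exists2 V, open V & O = h @^-1` V
      & <<s (@open X) >> (range h)].

Section Stieltjes.
Context {R : realType}.
Implicit Type F : R -> R.

Definition is_cumulative F : Prop := nondecreasing F /\ right_continuous F.

Definition cumulative_of F (h : is_cumulative F) : cumulative R R :=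
  HB.pack F (isCumulative.Build R _ R F h.1 h.2).

(* Junk value: the null measure if [F] is not a distribution function. *)
Definition stieltjes F : {measure set (measurableTypeR R) -> \bar R} :=
  if pselect (is_cumulative F) is left h
  then lebesgue_stieltjes_measure (cumulative_of h) else mzero.

(* [dF] on the half-line: the path is frozen before time [0]. *)
Definition path_diff F : {measure set (measurableTypeR R) -> \bar R} :=
  stieltjes (fun s => F (Num.max s 0)).

Definition cadlag (T : R) F : Prop :=
  (forall t, 0 <= t < T -> F s @[s --> t^'+] --> F t) /\
  (forall t, 0 < t <= T -> cvg (F s @[s --> t^'-])).
End Stieltjes.

Section Filtrations.
Context {R : realType} {dO : measure_display} {Omega : measurableType dO}.
Implicit Types (F : R -> set (set Omega)) (T t : R).

Definition adapted F T (X : R -> Omega -> R) : Prop :=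
  forall t, 0 <= t <= T -> meas_on (F t) setT (X t).

Definition progressive F T (X : R -> Omega -> R) : Prop :=
  forall t, 0 <= t <= T ->
    meas_on (rect_sigma (@measurable _ R) (F t)) (`[0, t] `*` setT)
      (fun x => X x.1 x.2).

Definition predictable_sets F : set (set (R * Omega)) :=
  <<s [set S | exists2 G, F 0 G & S = [set 0] `*` G] `|`
      [set S | exists s t G, [/\ 0 <= s, s <= t, F s G & S = `]s, t] `*` G]] >>.

Definition predictable F (D : set R) (X : R -> Omega -> R) : Prop :=
  meas_on (predictable_sets F) (D `*` setT) (fun x => X x.1 x.2).

Definition mark_predictable {E : ptopologicalType} {dY} {Y : measurableType dY}
    F (D : set R) (U : R -> Omega -> marks E -> Y) : Prop :=
  meas_on (rect_sigma (predictable_sets F) (@measurable _ (marks E)))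
    ((D `*` setT) `*` setT) (fun x => U x.1.1 x.1.2 x.2).

Definition stopping_time F (theta : Omega -> R) : Prop :=
  forall s, 0 <= s -> F s [set w | theta w <= s].

(* The sigma-algebra [F_theta], for a bounded stopping time [theta]. *)
Definition stopped_sigma F (theta : Omega -> R) : set (set Omega) :=
  [set G | forall s, 0 <= s -> F s (G `&` [set w | theta w <= s])].

End Filtrations.

Section Model.
Context {R : realType} {dO : measure_display} {Omega : measurableType dO}
  {E : ptopologicalType} {d : nat}.
Variables (P : probability Omega R) (Tn : nat -> Omega -> \bar R)
  (zeta : nat -> Omega -> marks E) (W : 'I_d -> R -> Omega -> R).

Definition marked_point_process : Prop :=
  [/\ forall n, measurable_fun setT (Tn n),
      forall n, measurable_fun setT (zeta n),
      forall w, Tn 0 w = 0%E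
    & \forall w \ae P,
        [/\ forall n, (Tn n w <= Tn n.+1 w)%E,
            forall n, (Tn n w < +oo)%E -> (Tn n w < Tn n.+1 w)%E
          & Tn n w @[n --> \oo] --> +oo%E]].

(* The random measure [p]. *)
Definition point_measure (w : Omega) :
    {measure set (measurableTypeR R * marks E) -> \bar R} :=
  mseries (fun n : nat =>
    match Tn n w return {measure set (measurableTypeR R * marks E) -> \bar R} with
    | r%:E => dirac (r : measurableTypeR R, zeta n w)
    | _ => mzero
    end) 1.

Definition mpp_events (t : R) : set (set Omega) :=
  [set G | exists s (B : set (marks E)) (Q : set (\bar R)),
    [/\ 0 <= s <= t, measurable B, measurable Q
      & G = [set w | Q (point_measure w (`]0, s] `*` B))]]].

Definition wiener_events (t : R) : set (set Omega) :=
  [set G | exists s (l : 'I_d) (Q : set R),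
    [/\ 0 <= s <= t, measurable Q & G = W l s @^-1` Q]].

(* Given the past, the increment over [(s, t]] has law [N(0, (t - s) I_d)]. *)
Definition wiener_process : Prop :=
  [/\ forall l s, 0 <= s -> measurable_fun setT (W l s),
      \forall w \ae P, forall l,
        W l 0 w = 0 /\ {within `[0, +oo[, continuous (W l ^~ w)}
    & forall s t, 0 <= s < t -> forall G, <<s wiener_events s >> G ->
        forall B : 'I_d -> set R, (forall l, measurable (B l)) ->
        P (G `&` [set w | forall l, B l (W l t w - W l s w)]) =
          (P G * \prod_(l < d) normal_prob 0 (Num.sqrt (t - s)) (B l))%E].

Definition mpp_wiener_independent : Prop :=
  forall G H, <<s \bigcup_t mpp_events t >> G ->
    <<s \bigcup_t wiener_events t >> H -> P (G `&` H) = (P G * P H)%E.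

Definition filtration (t : R) : set (set Omega) :=
  <<s mpp_events t `|` wiener_events t `|` negligible P >>.

Variables (phi : R -> Omega -> probability (marks E) R) (A : R -> Omega -> R).

Definition dA (w : Omega) := path_diff (A ^~ w).

(* [phi_t(de) dA_t] is the predictable compensator of [p], with [A] continuous. *)
Definition continuous_compensator : Prop :=
  [/\ forall C : set (marks E), measurable C ->
        predictable filtration `[0, +oo[ (fun t w => fine (phi t w C)),
      forall t, 0 <= t -> meas_on (filtration t) setT (A t),
      \forall w \ae P,
        [/\ A 0 w = 0,
            forall s t, 0 <= s <= t -> A s w <= A t w
          & {within `[0, +oo[, continuous (A ^~ w)}]
    & forall H : R -> Omega -> marks E -> \bar R,
        (forall t w e, (0 <= H t w e)%E) ->
        mark_predictable filtration `[0, +oo[ H ->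
        (\int[P]_w \int[point_measure w]_(x in `]0%R, +oo[ `*` setT) H x.1 w x.2 =
         \int[P]_w \int[dA w]_(s in `]0%R, +oo[) \int[phi s w]_e H s w e)%E].

End Model.

Section Spaces.
Context {R : realType} {dO : measure_display} {Omega : measurableType dO}.
Variables (P : probability Omega R) (F : R -> set (set Omega)) (T : R)
  (A : R -> Omega -> R).

Definition L2A (beta : R) (X : R -> Omega -> R) : Prop :=
  progressive F T X /\
  (\int[P]_w \int[dA A w]_(s in `]0%R, T])
     (expR (beta * A s w) * X s w ^+ 2)%:E < +oo)%E.

Definition L2W (k : nat) (beta : R) (Z : 'I_k -> R -> Omega -> R) : Prop :=
  (forall l, progressive F T (Z l)) /\
  (\int[P]_w \int[lebesgue_measure]_(s in `]0%R, T])
     (expR (beta * A s w) * \sum_(l < k) Z l s w ^+ 2)%:E < +oo)%E.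

Definition L2W_real (beta : R) (X : R -> Omega -> R) : Prop :=
  L2W beta (fun _ : 'I_1 => X).

Definition L2p {E : ptopologicalType} (phi : R -> Omega -> probability (marks E) R)
    (beta : R) (U : R -> Omega -> marks E -> R) : Prop :=
  mark_predictable F `[0, T] U /\
  (\int[P]_w \int[dA A w]_(s in `]0%R, T]) \int[phi s w]_e
     (expR (beta * A s w) * U s w e ^+ 2)%:E < +oo)%E.

Definition I2 (K : R -> Omega -> R) : Prop :=
  [/\ predictable F `[0, T] K,
      \forall w \ae P, cadlag T (K ^~ w) /\
        forall s t, 0 <= s <= t -> t <= T -> K s w <= K t w
    & (\int[P]_w (K T w ^+ 2)%:E < +oo)%E].

End Spaces.

Section Ito.
Context {R : realType} {dO : measure_display} {Omega : measurableType dO} {d : nat}.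
Variables (P : probability Omega R) (F : R -> set (set Omega)) (T : R)
  (W : 'I_d -> R -> Omega -> R).

(* [sum_(k < N) h_k 1_(]t_k, t_(k+1)])] with [h_k] bounded [F_(t_k)]-measurable. *)
Record elementary := Elementary {
  el_size : nat;
  el_time : nat -> R;
  el_coef : nat -> 'I_d -> Omega -> R }.

Definition elementary_wf (h : elementary) : Prop :=
  forall k,
    [/\ 0 <= el_time h k, el_time h k <= el_time h k.+1, el_time h k.+1 <= T,
        forall l, meas_on (F (el_time h k)) setT (el_coef h k l)
      & exists c, forall l w, `|el_coef h k l w| <= c].

Definition el_val (h : elementary) (l : 'I_d) (s : R) (w : Omega) : R :=
  \sum_(k < el_size h)
    el_coef h k l w * (el_time h k < s <= el_time h k.+1)%R%:R.

Definition el_int (h : elementary) (t : R) (w : Omega) : R :=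
  \sum_(k < el_size h) \sum_(l < d) el_coef h k l w *
    (W l (Num.min t (el_time h k.+1)) w - W l (Num.min t (el_time h k)) w).

(* [I] is a continuous version of [t |-> int_0^t Z dW] on [[0, T]], i.e. the
   [L^2]-limit of the integrals of elementary processes approximating [Z]. *)
Definition is_ito_integral (Z : 'I_d -> R -> Omega -> R) (I : R -> Omega -> R) :
    Prop :=
  [/\ adapted F T I,
      \forall w \ae P, {within `[0, T], continuous (I ^~ w)}
    & exists h : nat -> elementary,
      [/\ forall n, elementary_wf (h n),
          (\int[P]_w \int[lebesgue_measure]_(s in `]0%R, T])
             (\sum_(l < d) (el_val (h n) l s w - Z l s w) ^+ 2)%:E)%E
            @[n --> \oo] --> 0%E
        & forall t, 0 <= t <= T ->
            (\int[P]_w ((el_int (h n) t w - I t w) ^+ 2)%:E)%E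
              @[n --> \oo] --> 0%E]].

End Ito.

Section Conditioning.
Context {R : realType} {dO : measure_display} {Omega : measurableType dO}.
Variable P : probability Omega R.
Implicit Types (X Y : Omega -> \bar R) (G : set (set Omega)).

(* Meant for [X] whose positive (or negative) part is integrable. *)
Definition is_cond_exp G X Y : Prop :=
  meas_on G setT Y /\
  forall B, G B -> (\int[P]_(w in B) Y w = \int[P]_(w in B) X w)%E.

Definition cond_exp G X : Omega -> \bar R := xget (cst 0%E) (is_cond_exp G X).

Definition is_ess_sup (S : set (Omega -> \bar R)) X : Prop :=
  [/\ measurable_fun setT X,
      forall Y, S Y -> \forall w \ae P, (Y w <= X w)%E
    & forall X', measurable_fun setT X' ->
        (forall Y, S Y -> \forall w \ae P, (Y w <= X' w)%E) ->
        \forall w \ae P, (X w <= X' w)%E].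

Definition ess_sup_family (S : set (Omega -> \bar R)) : Omega -> \bar R :=
  xget (cst -oo%E) (is_ess_sup S).

End Conditioning.

Section Assumptions.
Context {R : realType} {dO : measure_display} {Omega : measurableType dO}
  {E : ptopologicalType} {m : nat}.
Variables (P : probability Omega R) (F : R -> set (set Omega)) (T : R)
  (A : R -> Omega -> R).

Definition Mprime (M : R) : R := Num.max `|M - 1| 1.

Definition assumption_S (rho : 'I_m -> R -> Omega -> marks E -> R) (M : R) : Prop :=
  (forall i t w e, 0 <= t <= T -> 0 <= rho i t w e <= M) /\
  exists2 eta, 3 + M ^+ 4 < eta & (\int[P]_w (expR (eta * A T w))%:E < +oo)%E.

Definition assumption_D (M betahat : R) (xi : 'I_m -> Omega -> R)
    (f g : 'I_m -> R -> Omega -> R) (C : 'I_m -> 'I_m -> R -> Omega -> R) : Prop :=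
  [/\ Mprime M ^+ 2 < betahat,
      forall i, meas_on (F T) setT (xi i) /\
        (\int[P]_w (expR (betahat * A T w) * xi i w ^+ 2)%:E < +oo)%E,
      forall i, L2A P F T A betahat (f i) /\ L2W_real P F T A betahat (g i),
      [/\ forall i j, adapted F T (C i j),
          forall i j, \forall w \ae P,
            [/\ {within `[0, T], continuous (C i j ^~ w)},
                i != j -> forall t, 0 <= t <= T -> 0 <= C i j t w
              & i = j -> forall t, 0 <= t <= T -> C i j t w = 0],
          forall i j l, i != j -> j != l -> \forall w \ae P,
            0 < inf [set C i j t w + C j l t w - C i l t w | t in `[0, T]]
        & forall i j, (\int[P]_w ereal_sup
            [set (expR (betahat * A t w) * C i j t w)%:E | t in `[0%R, T]] < +oo)%E]
    & forall i j, \forall w \ae P, xi j w - C i j T w <= xi i w].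

End Assumptions.

Section System.
Context {R : realType} {dO : measure_display} {Omega : measurableType dO}
  {E : ptopologicalType} {d m : nat}.
Variables (P : probability Omega R) (Tn : nat -> Omega -> \bar R)
  (zeta : nat -> Omega -> marks E) (W : 'I_d -> R -> Omega -> R)
  (phi : R -> Omega -> probability (marks E) R) (A : R -> Omega -> R) (T : R)
  (rho : 'I_m -> R -> Omega -> marks E -> R) (xi : 'I_m -> Omega -> R)
  (f g : 'I_m -> R -> Omega -> R) (C : 'I_m -> 'I_m -> R -> Omega -> R).

Local Notation F := (filtration P Tn zeta W).

(* [max_(j in A_i) (Y^j_t - C_t(i, j))]; real since [m >= 2]. *)
Definition barrier (Y : 'I_m -> R -> Omega -> R) (i : 'I_m) (t : R) (w : Omega) : R :=
  fine (\big[Order.max/-oo%E]_(j < m | j != i) (Y j t w - C i j t w)%:E).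

Definition solution_spaces (M betahat : R) (Y : 'I_m -> R -> Omega -> R)
    (U : 'I_m -> R -> Omega -> marks E -> R) (Z : 'I_m -> 'I_d -> R -> Omega -> R)
    (K : 'I_m -> R -> Omega -> R) : Prop :=
  forall i,
    [/\ adapted F T (Y i),
        \forall w \ae P, cadlag T (Y i ^~ w),
        forall beta, Mprime M ^+ 2 < beta < betahat ->
          [/\ L2A P F T A beta (Y i), L2W_real P F T A beta (Y i),
              L2p P F T A phi beta (U i) & L2W P F T A beta (Z i)],
        I2 P F T (K i)
      & \forall w \ae P, K i 0 w = 0 /\ {within `[0, T], continuous (K i ^~ w)}].

Definition solves_reflected_system (M betahat : R) (Y : 'I_m -> R -> Omega -> R)
    (U : 'I_m -> R -> Omega -> marks E -> R) (Z : 'I_m -> 'I_d -> R -> Omega -> R)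
    (K : 'I_m -> R -> Omega -> R) : Prop :=
  solution_spaces M betahat Y U Z K /\
  forall i,
    [/\ exists2 ZW : R -> Omega -> R, is_ito_integral P F T W (Z i) ZW &
          forall t, 0 <= t <= T -> \forall w \ae P,
            Y i t w =
              xi i w
              + \int[dA A w]_(s in `]t, T]) f i s w
              + \int[lebesgue_measure]_(s in `]t, T]) g i s w
              + \int[dA A w]_(s in `]t, T])
                  (\int[phi s w]_e (U i s w e * (rho i s w e - 1)))
              - (\int[point_measure Tn zeta w]_(x in `]t, T] `*` setT) U i x.1 w x.2
                 - \int[dA A w]_(s in `]t, T]) (\int[phi s w]_e U i s w e))
              - (ZW T w - ZW t w)
              + (K i T w - K i t w),
        forall t, 0 <= t <= T -> \forall w \ae P, barrier Y i t w <= Y i t w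
      & \forall w \ae P,
          (\int[path_diff (fun s => K i (Num.min s T) w)]_(s in `]0%R, T])
             (Y i s w - barrier Y i s w)%:E = 0)%E].

Record strategy := Strategy {
  theta : nat -> Omega -> R;
  alpha : nat -> Omega -> 'I_m }.

Definition is_strategy (a : strategy) : Prop :=
  forall n,
    [/\ stopping_time F (theta a n),
        forall w, 0 <= theta a n w <= T,
        forall w, theta a n w <= theta a n.+1 w,
        forall j, stopped_sigma F (theta a n) [set w | alpha a n w = j]
      & forall w, alpha a n.+1 w != alpha a n w].

Definition admissible (a : strategy) : Prop :=
  P [set w | forall n, theta a n w < T] = 0%E.

(* The set [A_t^i]. *)
Definition strategies_from (t : R) (i : 'I_m) : set strategy :=
  [set a | [/\ is_strategy a, admissible a
    & forall w, theta a 0 w = t /\ alpha a 0 w = i]].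

(* [a_s]; outside of the intervals [(theta_k, theta_(k+1)]] (which covers
   [t = s = T]) it is the initial mode [alpha_0]. *)
Definition mode_at (a : strategy) (s : R) (w : Omega) : 'I_m :=
  alpha a (xget 0%N [set k | theta a k w < s <= theta a k.+1 w]) w.

Definition rho_of (a : strategy) (s : R) (w : Omega) (e : marks E) : R :=
  limn (fun N => \sum_(0 <= k < N)
    (theta a k w < s <= theta a k.+1 w)%R%:R * rho (alpha a k w) s w e).

Definition switching_cost (a : strategy) (s : R) (w : Omega) : \bar R :=
  (\sum_(0 <= n <oo)
     (C (alpha a n w) (alpha a n.+1 w) (theta a n.+1 w) w
      * (theta a n.+1 w <= s)%R%:R)%:E)%E.

(* [D_T]: switches decided at time [T] itself are not charged. *)
Definition total_cost (a : strategy) (w : Omega) : \bar R :=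
  lim (switching_cost a s w @[s --> T^'-]).

(* [L_T / L_t]; on almost every path the partial products are eventually
   constant. *)
Definition density_ratio (a : strategy) (t : R) (w : Omega) : R :=
  limn (fun N => \prod_(1 <= n < N | (t%:E < Tn n w <= T%:E)%E)
          rho_of a (fine (Tn n w)) w (zeta n w))
  * expR (\int[dA A w]_(s in `]t, T]) (\int[phi s w]_e (1 - rho_of a s w e))).

Definition payoff (t : R) (a : strategy) (w : Omega) : \bar R :=
  ((xi (mode_at a T w) w
    + \int[dA A w]_(s in `]t, T]) f (mode_at a s w) s w
    + \int[lebesgue_measure]_(s in `]t, T]) g (mode_at a s w) s w)%R%:E
   - total_cost a w)%E.

(* [J(t, i, a)]; the mode [i] is carried by [a]. *)
Definition gain (t : R) (a : strategy) : Omega -> \bar R :=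
  cond_exp P (F t) (fun w => (density_ratio a t w)%:E * payoff t a w)%E.

Definition gains (t : R) (i : 'I_m) : set (Omega -> \bar R) :=
  [set gain t a | a in strategies_from t i].

Definition value (t : R) (i : 'I_m) : Omega -> \bar R :=
  ess_sup_family P (gains t i).

(* [a] is given by the recursion for [a^*]: [theta^*_(n+1)] is the first time
   (capped at [T]) at which the barrier is reached and [alpha^*_(n+1)] is a
   maximiser, ties being broken in an [F_(theta^*_(n+1))]-measurable way. *)
Definition follows_barrier (Y : 'I_m -> R -> Omega -> R) (t : R) (i : 'I_m)
    (a : strategy) : Prop :=
  (forall w, theta a 0 w = t /\ alpha a 0 w = i) /\
  forall n,
    [/\ forall w, theta a n.+1 w =
          inf ([set s | theta a n w <= s <= T /\
                 Y (alpha a n w) s w = barrier Y (alpha a n w) s w] `|` [set T]),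
        forall w, alpha a n.+1 w != alpha a n w /\
          forall j, j != alpha a n w ->
            Y j (theta a n.+1 w) w - C (alpha a n w) j (theta a n.+1 w) w <=
            Y (alpha a n.+1 w) (theta a n.+1 w) w
              - C (alpha a n w) (alpha a n.+1 w) (theta a n.+1 w) w
      & forall j, stopped_sigma F (theta a n.+1) [set w | alpha a n.+1 w = j]].

End System.

(* Main.v *)
Require Import Defs.
From HB Require Import structures.
From mathcomp Require Import all_boot all_order all_algebra.
From mathcomp Require Import all_classical all_reals all_analysis.
From mathcomp Require Import measurable_realfun ring lra zify.

Set Implicit Arguments.
Unset Strict Implicit.
Unset Printing Implicit Defensive.
Import Order.TTheory GRing.Theory Num.Theory.
Import numFieldNormedType.Exports.

Local Open Scope classical_set_scope.
Local Open Scope ring_scope.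

(* Let [a] be a strategy. Gluing the equations of the [Y^i] along the modes of
   [a] gives, path by path, [Y^i_t + M^a = payoff + kappa^a], where [M^a] collects
   the stochastic integrals and [kappa^a >= 0] because each [K^i] increases and
   [Y^i >= Y^j - C(i, j)] at each switch. For [a^*] both contributions vanish.
   Since [E[L^a M^a | F_t] = 0] and [E[L^a Y^i_t | F_t] = Y^i_t], one gets
   [J <= Y^i_t], with equality for [a^*].

   The two orthogonality relations are proved without a Girsanov theorem. For a
   continuous martingale [m], [L m] is expanded along uniform grids: the first
   order terms have mean zero and the sum of the remainders tends to zero once
   [L] is truncated. For the jump part, [L^(r (1 + e h))] has conditional mean one
   for all small [e], and the derivative at [e = 0] is the required relation.
   The moments of [L] come from the same relation with a constant coefficient.

   [a^*] terminates: an infinite chain of switches before [T] would close loops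
   at an accumulation point, where all loops have a positive cost. *)

(** Four difficulties shape the development. The equations and inequalities hold almost surely at
    each fixed time, but are needed at random switching times: they are obtained at rational times,
    extended by right continuity, and collected in the record [regular]. The density [L] is
    unbounded and is controlled through its second moment weighted by [1 + A_T]; the threshold
    [3 + M^4] is what Young's inequality asks for that moment, which lets [L] be paired with
    square-integrable martingales and, by [2 L |U| <= U^2 + L^2], with [U]. A single variable [Gam]
    dominates the densities of all rates bounded by [max(M, 1)] and removes the truncations. The
    filtration is completed but not known to be right-continuous, so no general theorem makes the
    hitting times of the barrier stopping times: between two jumps of [p] the [Y^i] are continuous,
    and reaching the barrier by time [s] becomes a countable condition on values up to [s]. Finally
    the total cost may fail to be integrable, hence a gain is treated as an integrable variable
    minus a nonnegative one. *)

Local Notation rset R D := (D%classic : set (measurableTypeR R)).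
Local Notation itg mu a b X := (mu.-integrable `]a, b]%classic (EFin \o X)).

(** * Expectations and square-integrable variables *)

Section Expectation.
Context {d} {T : measurableType d} {R : realType}.
Variable P : probability T R.
Implicit Types f g h : T -> R.

(** Integrability and expectation for real-valued functions, so that computations stay in [R]. [EX]
    takes a junk value when the integral is not finite, which is why [I1] accompanies the linear
    identities. *)
Definition I1 f := P.-integrable setT (EFin \o f).
Definition EX f : R := \int[P]_w f w.

Lemma I1_meas f : I1 f -> measurable_fun setT f.
Proof. by move=> /integrableP[/measurable_EFinP]. Qed.

Lemma EX_EFin f : I1 f -> (EX f)%:E = (\int[P]_w (f w)%:E)%E.
Proof. by move=> If; rewrite /EX /Rintegral fineK//; exact: integrable_fin_num. Qed.

Lemma I1D f g : I1 f -> I1 g -> I1 (fun w => f w + g w).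
Proof. by move=> If Ig; have := integrableD measurableT If Ig. Qed.

Lemma I1N f : I1 f -> I1 (fun w => - f w).
Proof. by move=> If; have := integrableN If. Qed.

Lemma I1B f g : I1 f -> I1 g -> I1 (fun w => f w - g w).
Proof. by move=> If Ig; apply: I1D => //; exact: I1N. Qed.

Lemma I1Z k f : I1 f -> I1 (fun w => k * f w).
Proof. by move=> If; have := integrableZl measurableT k If. Qed.

Lemma I1_cst k : I1 (fun=> k).
Proof. exact: finite_measure_integrable_cst. Qed.

Lemma I1_sum (I : Type) (s : seq I) (F : I -> T -> R) :
  (forall i, I1 (F i)) -> I1 (fun w => \sum_(i <- s) F i w).
Proof.
move=> IF; elim: s => [|a s IH].
  by rewrite (_ : (fun _ => _) = fun=> 0); [exact: I1_cst|apply/funext => w; rewrite big_nil].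
rewrite (_ : (fun _ => _) = fun w => F a w + \sum_(i <- s) F i w); first exact: I1D.
by apply/funext => w; rewrite big_cons.
Qed.

Lemma EXD f g : I1 f -> I1 g -> EX (fun w => f w + g w) = EX f + EX g.
Proof. by move=> If Ig; rewrite /EX RintegralD. Qed.

Lemma EXB f g : I1 f -> I1 g -> EX (fun w => f w - g w) = EX f - EX g.
Proof. by move=> If Ig; rewrite /EX RintegralB. Qed.

Lemma EXZ k f : I1 f -> EX (fun w => k * f w) = k * EX f.
Proof. by move=> If; rewrite /EX RintegralZl. Qed.

Lemma EX_cst k : EX (fun=> k) = k.
Proof. by rewrite /EX Rintegral_cst//= -[X in fine X]/(P setT) probability_setT mulr1. Qed.

Lemma EX_sum (I : Type) (s : seq I) (F : I -> T -> R) :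
  (forall i, I1 (F i)) -> EX (fun w => \sum_(i <- s) F i w) = \sum_(i <- s) EX (F i).
Proof.
move=> IF; elim: s => [|a s IH].
  by rewrite big_nil -[RHS](EX_cst 0); congr EX; apply/funext => w; rewrite big_nil.
rewrite big_cons -IH -EXD//; last exact: I1_sum.
by congr EX; apply/funext => w; rewrite big_cons.
Qed.

Lemma EX_le f g : I1 f -> I1 g -> (forall w, f w <= g w) -> EX f <= EX g.
Proof. by move=> If Ig fg; apply: le_Rintegral. Qed.

Lemma EX_ge0 f : (forall w, 0 <= f w) -> 0 <= EX f.
Proof. by move=> f0; apply: Rintegral_ge0. Qed.

Lemma I1_abs f : I1 f -> I1 (fun w => `|f w|).
Proof. by move=> If; have := integrable_abse If. Qed.

Lemma EX_abs f : I1 f -> `|EX f| <= EX (fun w => `|f w|).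
Proof. by move=> If; apply: le_normr_Rintegral. Qed.

Lemma I1_le_ae f g : measurable_fun setT f -> I1 g ->
  (\forall w \ae P, `|f w| <= g w) -> I1 f.
Proof.
move=> mf Ig fg; apply/integrableP; split; first exact/measurable_EFinP.
apply: le_lt_trans (integral_funepos_lt_pinfty measurableT Ig).
apply: ae_ge0_le_integral => //.
- exact/measurableT_comp/measurable_EFinP.
- by apply: measurable_funepos; case/integrableP: Ig.
- apply: filterS fg => w fg _ /=.
  by rewrite funeposE /= le_max lee_fin fg.
Qed.

Lemma I1_le f g : measurable_fun setT f -> I1 g -> (forall w, `|f w| <= g w) -> I1 f.
Proof. by move=> mf Ig fg; apply: I1_le_ae Ig _ => //; exact: aeW. Qed.

Lemma I1_bdd f c : measurable_fun setT f -> (forall w, `|f w| <= c) -> I1 f.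
Proof. by move=> mf fc; apply: I1_le (I1_cst c) fc. Qed.

Lemma EX_ae f g : measurable_fun setT f -> measurable_fun setT g ->
  (\forall w \ae P, f w = g w) -> EX f = EX g.
Proof.
move=> mf mg fg; rewrite /EX /Rintegral; congr fine.
apply: ae_eq_integral => //; [exact/measurable_EFinP|exact/measurable_EFinP|].
by apply: filterS fg => w -> _.
Qed.

Lemma I1_ae f g : measurable_fun setT g -> (\forall w \ae P, f w = g w) -> I1 f -> I1 g.
Proof.
move=> mg fg If; apply: I1_le_ae mg (I1_abs If) _.
by apply: filterS fg => w ->.
Qed.

Lemma EX_dct (F : nat -> T -> R) f g : (forall n, measurable_fun setT (F n)) ->
  measurable_fun setT f -> I1 g ->
  (\forall w \ae P, F ^~ w @ \oo --> f w) ->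
  (\forall w \ae P, forall n, `|F n w| <= g w) ->
  I1 f /\ EX (F n) @[n --> \oo] --> EX f.
Proof.
move=> mF mf Ig Ff Fg.
have [] := @dominated_convergence _ T R P setT measurableT
  (fun n => EFin \o F n) (EFin \o f) (EFin \o g) _ _ _ Ig _.
- by move=> n; exact/measurable_EFinP.
- exact/measurable_EFinP.
- by apply: filterS Ff => w Ff _; exact: cvg_EFin (nearW _ _) Ff.
- by apply: filterS Fg => w Fg n _; rewrite /= lee_fin.
move=> If _ cF; split=> //.
have IF n : I1 (F n).
  by apply: I1_le_ae Ig _ => //; apply: filterS Fg => w; exact.
by apply: fine_cvg; move: cF; rewrite -(EX_EFin If).
Qed.

Definition L2 f := measurable_fun setT f /\ I1 (fun w => f w ^+ 2).

Lemma L2_bdd f c : measurable_fun setT f -> (forall w, `|f w| <= c) -> L2 f.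
Proof.
move=> mf fc; split=> //; apply: (@I1_bdd _ (c ^+ 2)); first exact: measurable_funX.
by move=> w; rewrite normrX lerXn2r// nnegrE (le_trans _ (fc w)).
Qed.

Lemma L2M f g : L2 f -> L2 g -> I1 (fun w => f w * g w).
Proof.
move=> [mf f2] [mg g2]; apply: I1_le (I1D f2 g2) _; first exact: measurable_funM.
move=> w; rewrite normrM.
have := sqr_ge0 (`|f w| - `|g w|); rewrite sqrrB !real_normK ?num_real//.
have := normr_ge0 (f w); have := normr_ge0 (g w); nra.
Qed.

Lemma L2_I1 f : L2 f -> I1 f.
Proof.
move=> f2; rewrite (_ : f = fun w => 1 * f w); last by apply/funext => w; rewrite mul1r.
by apply: L2M => //; apply: (@L2_bdd _ 1) => // w; rewrite normr1.
Qed.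

Lemma L2_le_ae f g : measurable_fun setT f -> L2 g ->
  (\forall w \ae P, `|f w| <= `|g w|) -> L2 f.
Proof.
move=> mf [mg g2] fg; split=> //; apply: I1_le_ae g2 _; first exact: measurable_funX.
apply: filterS fg => w fg; rewrite normrX -[X in _ <= X](ger0_norm (sqr_ge0 _)) normrX.
by rewrite lerXn2r.
Qed.

Lemma L2_le f g : measurable_fun setT f -> L2 g -> (forall w, `|f w| <= `|g w|) -> L2 f.
Proof. by move=> mf g2 fg; apply: L2_le_ae g2 _ => //; exact: aeW. Qed.

Lemma L2D f g : L2 f -> L2 g -> L2 (fun w => f w + g w).
Proof.
move=> [mf f2] [mg g2]; split; first exact: measurable_funD.
apply: I1_le (I1Z 2 (I1D f2 g2)) _; first exact/measurable_funX/measurable_funD.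
move=> w; rewrite ger0_norm ?sqr_ge0//; have := sqr_ge0 (f w - g w); nra.
Qed.

Lemma L2Z k f : L2 f -> L2 (fun w => k * f w).
Proof.
move=> [mf f2]; split; first exact: measurable_funM.
rewrite (_ : (fun w => _) = fun w => k ^+ 2 * f w ^+ 2); first exact: I1Z.
by apply/funext => w; rewrite exprMn.
Qed.

Lemma L2B f g : L2 f -> L2 g -> L2 (fun w => f w - g w).
Proof.
move=> f2 g2; rewrite (_ : (fun w => _) = fun w => f w + (-1) * g w).
  by apply: L2D => //; exact: L2Z.
by apply/funext => w; rewrite mulN1r.
Qed.

Lemma L2_bddM f g c : measurable_fun setT f -> (forall w, `|f w| <= c) -> L2 g ->
  L2 (fun w => f w * g w).
Proof.
move=> mf fc g2; apply: L2_le (L2Z c g2) _.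
  by apply: measurable_funM => //; case: g2.
move=> w; rewrite !normrM; apply: ler_wpM2r => //.
by apply: le_trans (fc w) _; exact: ler_norm.
Qed.

Lemma L2_sum (I : Type) (s : seq I) (F : I -> T -> R) :
  (forall i, L2 (F i)) -> L2 (fun w => \sum_(i <- s) F i w).
Proof.
move=> IF; elim: s => [|a s IH].
  rewrite (_ : (fun _ => _) = fun=> 0); last by apply/funext => w; rewrite big_nil.
  by apply: (@L2_bdd _ 0) => // w; rewrite normr0.
rewrite (_ : (fun _ => _) = fun w => F a w + \sum_(i <- s) F i w); first exact: L2D.
by apply/funext => w; rewrite big_cons.
Qed.

(* Splitting [G |f|] according to whether [|f| < G / e] bounds it by [e f^2]
   plus a term dominated by [G^2 / e]. *)
Lemma L2_bounded_cvg0 (F : nat -> T -> R) G c : L2 G ->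
  (forall n, L2 (F n)) -> (forall n, EX (fun w => F n w ^+ 2) <= c) ->
  (\forall w \ae P, F ^~ w @ \oo --> (0:R)) ->
  EX (fun w => G w * F n w) @[n --> \oo] --> (0 : R).
Proof.
move=> G2 F2 Fc F0; apply/cvgr0Pnorm_lt => e e0.
have c0 : 0 <= c by apply: le_trans (Fc 0%N); apply: EX_ge0 => w; exact: sqr_ge0.
(* The part where [|F_n| d'] is at least [|G|] contributes at most [d' E[F_n^2] <= d' c], which this
   choice of [d'] keeps below [e / 2]. *)
have [d' d0 d'c] : exists2 d', 0 < d' & d' * c <= e / 2.
  exists (e / (2 * (c + 1))); first by rewrite divr_gt0// mulr_gt0// ltr_wpDl.
  rewrite invfM mulrA -mulrA; apply: ler_piMr; first by rewrite divr_ge0// ltW.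
  by rewrite mulrC ler_pdivrMr ?ltr_wpDl// mul1r lerDl.
pose H n w := if `|F n w| * d' < `|G w| then `|G w| * `|F n w| else 0.
have mG := G2.1; have mF n := (F2 n).1.
have mH n : measurable_fun setT (H n).
  apply: measurable_fun_ifT => //.
  - apply: measurable_fun_ltr; last exact: measurableT_comp.
    by apply: measurable_funM => //; exact: measurableT_comp.
  - by apply: measurable_funM; exact: measurableT_comp.
have Hle n w : `|H n w| <= d'^-1 * G w ^+ 2.
  rewrite /H; case: ifPn => [FG|_]; last first.
    by rewrite normr0 mulr_ge0 ?sqr_ge0// invr_ge0 ltW.
  rewrite normrM !normr_id -[G w ^+ 2]real_normK ?num_real// expr2 mulrCA.
  by apply: ler_wpM2l => //; rewrite mulrC ler_pdivlMr// ltW.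
have [_ H0] : I1 (fun=> 0) /\ EX (H n) @[n --> \oo] --> EX (fun=> 0).
  apply: (EX_dct (g := fun w => d'^-1 * G w ^+ 2)) => //.
  - by apply: I1Z; case: G2.
  - apply: filterS F0 => w F0; apply/cvgr0Pnorm_lt => e1 e10.
    have p0 : 0 < e1 / (`|G w| + 1) by rewrite divr_gt0// ltr_wpDl.
    have /cvgr0Pnorm_lt/(_ _ p0) := F0; apply: filterS => n Fn.
    rewrite /H; case: ifPn => [_|_]; last by rewrite normr0.
    rewrite normrM !normr_id; move: Fn; rewrite ltr_pdivlMr ?ltr_wpDl// mulrDr mulr1 => Fn.
    by rewrite mulrC; apply: le_lt_trans Fn; rewrite lerDl.
  - by apply: aeW => w n; exact: Hle.
have e20 : 0 < e / 2 by rewrite divr_gt0.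
move: H0; rewrite EX_cst => /cvgr0Pnorm_lt/(_ _ e20); apply: filterS => n Hn.
have IGF : I1 (fun w => G w * F n w) by exact: L2M.
have IH : I1 (H n).
  by apply: I1_le (I1Z d'^-1 G2.2) _ => // w; exact: Hle.
apply: le_lt_trans (EX_abs IGF) _.
have : EX (fun w => `|G w * F n w|) <= EX (fun w => d' * F n w ^+ 2 + H n w).
  apply: EX_le => [||w]; first exact: I1_abs.
    by apply: I1D => //; apply: I1Z; case: (F2 n).
  rewrite /H normrM; case: ifPn => [_|]; first by rewrite lerDr mulr_ge0 ?sqr_ge0// ltW.
  rewrite -leNgt addr0 -[F n w ^+ 2]real_normK ?num_real// expr2 mulrCA mulrC => GF.
  by rewrite [leLHS]mulrC; apply: ler_wpM2l.
rewrite EXD//; last by apply: I1Z; case: (F2 n).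
rewrite EXZ; last by case: (F2 n).
move=> /le_lt_trans; apply.
have := ler_norm (EX (H n)) => Hn'.
have : d' * EX (fun w => F n w ^+ 2) <= e / 2.
  exact: le_trans (ler_wpM2l (ltW d0) (Fc n)) d'c.
by move=> ?; rewrite [ltRHS]splitr; apply: ler_ltD => //; exact: le_lt_trans Hn.
Qed.

End Expectation.

(** * Sub-sigma-algebras as set systems and measurable families of measures *)

Section MeasOn.
Context {X : pointedType} {d} {Y : measurableType d}.
Implicit Types (G : set (set X)) (D : set X) (f : X -> Y).

Lemma meas_onP G D f : sigma_algebra setT G ->
  meas_on G D f -> measurable_fun (D : set (g_sigma_algebraType G)) f.
Proof. by move=> sG mf mD B mB; rewrite measurable_g_measurableTypeE//; exact: mf. Qed.

Lemma measurable_meas_on G D f : sigma_algebra setT G -> G D ->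
  measurable_fun (D : set (g_sigma_algebraType G)) f -> meas_on G D f.
Proof.
move=> sG GD mf B mB; have := mf _ B mB; rewrite !measurable_g_measurableTypeE//.
exact.
Qed.

End MeasOn.

Section RandomMeasure.
Import HBNNSimple.
Context d d' (X : measurableType d) (Y : measurableType d') (R : realType).
Variable l : X -> {measure set Y -> \bar R}.
Hypothesis fin : forall x, (l x setT < +oo)%E.

(** The sets whose mass is a measurable function form a Dynkin class; finiteness of the masses lets
    complements be expressed as differences. *)
Lemma random_measure_pi (G : set (set Y)) : @measurable _ Y = <<s G >> ->
  setI_closed G -> measurable_fun setT (l ^~ setT) ->
  (forall B, G B -> measurable_fun setT (l ^~ B)) ->
  forall B, measurable B -> measurable_fun setT (l ^~ B).
Proof.
move=> GE GI lT lG B mB.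
apply: (@dynkin_induction _ Y G (fun B => measurable_fun setT (l ^~ B))) => //.
- move=> S mS mlS.
  rewrite (_ : l ^~ (~` S) = (fun x => l x setT - l x S)%E); first exact: emeasurable_funB.
  by apply/funext => x; rewrite -setTD; have := measureD measurableT mS (fin x); rewrite setTI.
- move=> F mF tF mlF.
  rewrite (_ : l ^~ _ = (fun x => \sum_(n <oo) l x (F n))%E).
    by apply: ge0_emeasurable_sum => // n _.
  by apply/funext => x; rewrite measure_bigcup//; apply: eq_eseriesl => n; rewrite in_setT.
- by rewrite -GE.
Qed.

Hypothesis ml : forall B, measurable B -> measurable_fun setT (l ^~ B).

#[local] HB.instance Definition _ := isKernel.Build _ _ X Y R l ml.

(** A section argument for kernels whose masses are finite but not uniformly bounded, as is the case
    for [p] and [dA] on a bounded time interval. *)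
Lemma random_integral_measurable (k : X * Y -> \bar R) : (forall z, 0 <= k z)%E ->
  measurable_fun setT k -> measurable_fun setT (fun x => \int[l x]_y k (x, y))%E.
Proof.
move=> k0 mk; pose k_ : {nnsfun (X * Y) >-> R}^nat := nnsfun_approx measurableT mk.
apply: (@measurable_fun_xsection_integral _ _ X Y R k l k_).
- by move=> a b ab; exact/nd_nnsfun_approx.
- by move=> z; exact/cvg_nnsfun_approx.
move=> n r.
rewrite (_ : (fun x => _) = (fun x =>
    mrestr (l x) measurableT (xsection (k_ n @^-1` [set r]) x))); last first.
  by apply/funext => x; rewrite /mrestr setIT.
have := @measurable_prod_subset_xsection_kernel _ _ X Y R l setT measurableT.
move=> sub; suff bd : forall x, exists M : R, forall S, measurable S ->
    (mrestr (l x) measurableT S < M%:E)%E.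
  by have [] := sub bd (k_ n @^-1` [set r]) (measurable_funPTI (k_ n) (measurable_set1 r)).
move=> x; exists (fine (l x setT) + 1); move=> S mS.
rewrite /mrestr setIT EFinD fineK; last by rewrite ge0_fin_numE.
apply: (@le_lt_trans _ _ (l x setT)); first by apply: le_measure; rewrite ?inE.
by rewrite lteDl// ge0_fin_numE.
Qed.

End RandomMeasure.

(** Two Dynkin arguments: one over rectangles and, for a fixed mark set [B], one over the time sets
    generated by [G]. This matches the filtration, which describes [p] on sets []0, s] * B] only. *)
Lemma random_measure_prod d d1 d2 (X : measurableType d) (Y1 : measurableType d1)
    (Y2 : measurableType d2) (R : realType) (l : X -> {measure set (Y1 * Y2) -> \bar R})
    (G : set (set Y1)) : (forall x, (l x setT < +oo)%E) ->
  @measurable _ Y1 = <<s G >> -> setI_closed G ->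
  (forall B : set Y2, measurable B -> measurable_fun setT (fun x => l x (setT `*` B))) ->
  (forall A B, G A -> measurable B -> measurable_fun setT (fun x => l x (A `*` B))) ->
  forall S, measurable S -> measurable_fun setT (l ^~ S).
Proof.
move=> fin GE GI lT lG.
pose C := [set A `*` B | A in @measurable _ Y1 & B in @measurable _ Y2].
apply: (@random_measure_pi _ _ X _ R l fin C).
- exact: measurable_prod_measurableType.
- move=> _ _ [X1 mX1 [X2 mX2 <-]] [Y3 mY3 [Y4 mY4 <-]].
  exists (X1 `&` Y3); first exact: measurableI.
  by exists (X2 `&` Y4); [exact: measurableI|rewrite setXI].
- by rewrite -setXTT; exact: lT.
move=> _ [A mA [B mB <-]].
have mTB : measurable (setT `*` B : set (Y1 * Y2)) by exact: measurableX.
have mfst : measurable_fun setT (fst : Y1 * Y2 -> Y1) by exact: measurable_fst.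
have [l1 l1E] : exists l1 : X -> {measure set Y1 -> \bar R},
    forall x A', l1 x A' = l x (A' `*` B).
  exists (fun x => measure_function_pushforward__canonical__measure_function_Measure
    (mrestr (l x) mTB) mfst) => x A'.
  rewrite /= /pushforward /mrestr; congr (l x _).
  by apply/seteqP; split=> -[a b] /=; tauto.
rewrite (_ : (fun x => _) = l1 ^~ A); last by apply/funext => x; rewrite l1E.
apply: (@random_measure_pi _ _ X _ R l1 _ G) => //.
- move=> x; rewrite l1E; apply: le_lt_trans (fin x).
  by apply: le_measure; rewrite ?inE//; exact: measurableX.
- by rewrite (_ : l1 ^~ _ = fun x => l x (setT `*` B)); [exact: lT|apply/funext => x; rewrite l1E].
- move=> A' GA'; rewrite (_ : l1 ^~ _ = fun x => l x (A' `*` B)); first exact: lG.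
  by apply/funext => x; rewrite l1E.
Qed.

Lemma cvg_maxr (R : realType) (T : Type) (F : set_system T) (FF : Filter F) (f g : T -> R) a b :
  f @ F --> a -> g @ F --> b -> Num.max (f x) (g x) @[x --> F] --> Num.max a b.
Proof.
move=> fa gb; rewrite maxr_absE.
rewrite (_ : (fun x => _) = fun x => (f x + g x + `|f x - g x|) / 2).
  by apply: cvgMr_tmp; apply: cvgD; [exact: cvgD|apply: cvg_norm; exact: cvgB].
by apply/funext => x; rewrite maxr_absE.
Qed.

Lemma cvg_minr (R : realType) (T : Type) (F : set_system T) (FF : Filter F) (f g : T -> R) a b :
  f @ F --> a -> g @ F --> b -> Num.min (f x) (g x) @[x --> F] --> Num.min a b.
Proof.
move=> fa gb; rewrite minr_absE.
rewrite (_ : (fun x => _) = fun x => (f x + g x - `|f x - g x|) / 2).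
  by apply: cvgMr_tmp; apply: cvgB; [exact: cvgD|apply: cvg_norm; exact: cvgB].
by apply/funext => x; rewrite minr_absE.
Qed.

(** * Gaussian variables *)

Section Normal.
Context {R : realType}.
Variable s : R.
Hypothesis s0 : s != 0.
Local Notation mu := (@lebesgue_measure R).
Local Notation N := (normal_prob 0 s).

Lemma normal_probN (A : set R) : measurable A -> N (-%R @^-1` A) = N A.
Proof.
move=> mA; rewrite /normal_prob.
have mf : measurable_fun setT (EFin \o normal_pdf (0:R) s).
  by apply/measurable_EFinP; exact: measurable_normal_pdf.
have mN : measurable (-%R @^-1` A : set R).
  by rewrite -[X in measurable X]setTI; exact: oppr_measurable.
rewrite [RHS](_ : _ = \int[pushforward mu (-%R : _ -> measurableTypeR R)]_(x in A)
    (normal_pdf 0 s x)%:E)%E; last first.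
  by apply: eq_measure_integral => B mB _; exact/esym/lebesgue_measureN.
rewrite ge0_integral_pushforward; last 3 first.
- exact: mA.
- exact: (measurable_funTS mf).
- by move=> x _; rewrite lee_fin normal_pdf_ge0.
apply: eq_integral => x _ /=.
  by rewrite !normal_pdfE// /normal_fun !subr0 sqrrN.
exact: oppr_measurable.
Qed.

Lemma integral_normal_prob (f : R -> \bar R) : measurable_fun setT f ->
  (forall x, 0 <= f x)%E ->
  (\int[N]_x f x = \int[mu]_x (f x * (normal_pdf 0 s x)%:E))%E.
Proof.
move=> mf f0; have dom := normal_prob_dominates (0:R) s.
have If := @Radon_Nikodym_SigmaFinite.f_integrable _ _ _ N mu dom.
have mpdf : measurable_fun setT (EFin \o normal_pdf (0:R) s).
  by apply/measurable_EFinP; exact: measurable_normal_pdf.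
rewrite -(@Radon_Nikodym_SigmaFinite.change_of_variables _ _ _ N mu dom f setT)//.
apply: ae_eq_integral => //.
- by apply: emeasurable_funM => //; exact: measurable_int If.
- exact: emeasurable_funM.
- apply: ae_eqe_mul2l; apply: integral_ae_eq => //.
  by move=> B _ mB; rewrite -Radon_Nikodym_SigmaFinite.f_integral.
Qed.

(* [x^2 <= 4 s^2 exp (x^2 / 4 s^2)] bounds the second moment by the mass of a
   Gaussian density of twice the variance. *)
Lemma normal_sqr_lty : (\int[N]_x (x ^+ 2)%:E < +oo)%E.
Proof.
rewrite integral_normal_prob//; last 2 first.
- exact/measurable_EFinP/measurable_funX.
- by move=> x; rewrite lee_fin sqr_ge0.
pose s' := Num.sqrt 2 * s.
have s'0 : s' != 0 by rewrite mulf_neq0// sqrtr_eq0 -ltNge.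
have s'2 : s' ^+ 2 = 2 * s ^+ 2 by rewrite exprMn sqr_sqrtr.
(* Bound on the ratio of the two integrands: [4 s^2] comes from the exponential bound on [x^2], and
   the peaks rescale one Gaussian density to the other. *)
pose c := normal_peak s * (4 * s ^+ 2) / normal_peak s'.
have p0 : 0 < normal_peak s' by exact: normal_peak_gt0.
have pn0 : normal_peak s' != 0 by rewrite gt_eqF.
have s20 : 0 < s ^+ 2 by rewrite exprn_even_gt0.
have s40 : 0 < 4 * s ^+ 2 by rewrite pmulr_rgt0.
have c0 : 0 <= c.
  apply: mulr_ge0; last by rewrite invr_ge0 ltW.
  by apply: mulr_ge0; [exact: normal_peak_ge0|rewrite mulr_ge0// sqr_ge0].
apply: (@le_lt_trans _ _ (\int[mu]_x (c%:E * (normal_pdf 0 s' x)%:E))%E).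
  apply: ge0_le_integral => //.
  - by move=> x _; rewrite lee_fin mulr_ge0 ?sqr_ge0 ?normal_pdf_ge0.
  - apply/measurable_EFinP/measurable_funM; first exact: measurable_funX.
    exact: measurable_normal_pdf.
  - apply/measurable_EFinP/measurable_funM => //; exact: measurable_normal_pdf.
  move=> x _; rewrite lee_fin !normal_pdfE// /normal_fun !subr0 s'2.
  rewrite /c [X in _ <= X](_ : _ = normal_peak s *
      (4 * s ^+ 2 * expR (- x ^+ 2 / (2 * s ^+ 2 *+ 2)))); last first.
    by field.
  rewrite mulrCA; apply: ler_wpM2l; first exact: normal_peak_ge0.
  have -> : - x ^+ 2 / (s ^+ 2 *+ 2) =
      - x ^+ 2 / (2 * s ^+ 2 *+ 2) - x ^+ 2 / (4 * s ^+ 2).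
    by field.
  rewrite expRD mulrCA mulrC; apply: ler_wpM2r; first exact: expR_ge0.
  rewrite expRN ler_pdivrMr ?expR_gt0// -ler_pdivrMl//.
  rewrite mulrC; apply: le_trans (expR_ge1Dx _).
  by rewrite lerDr.
rewrite ge0_integralZl//; last 2 first.
- by apply/measurable_EFinP; exact: measurable_normal_pdf.
- by move=> x _; rewrite lee_fin normal_pdf_ge0.
by rewrite integral_normal_pdf mule1 ltry.
Qed.

End Normal.

Section SymmetricLaw.
Context {d} {T : measurableType d} {R : realType}.
Variable P : probability T R.

Lemma P_setD (A B : set T) : measurable A -> measurable B ->
  P (A `\` B) = (P A - P (A `&` B))%E.
Proof.
by move=> mA mB; apply: measureD => //; rewrite (le_lt_trans (probability_le1 _ _)) ?ltry.
Qed.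

Lemma P_setU (A B : set T) : measurable A -> measurable B -> A `&` B = set0 ->
  P (A `|` B) = (P A + P B)%E.
Proof. exact: measureU. Qed.

Lemma P_ae_eq (A B : set T) : measurable A -> measurable B ->
  (\forall w \ae P, A w <-> B w) -> P A = P B.
Proof.
suff le A' B' : measurable A' -> measurable B' ->
    (\forall w \ae P, A' w <-> B' w) -> (P A' <= P B')%E.
  move=> mA mB AB; apply/eqP; rewrite eq_le !le//.
  by apply: filterS AB => w [].
move=> mA mB [N [mN N0 sN]].
apply: (@le_trans _ _ (P (B' `|` N))).
  apply: le_measure; rewrite ?inE//; first exact: measurableU.
  move=> w A'w; have [B'w|B'w] := pselect (B' w); first by left.
  by right; apply: sN => /= -[/(_ A'w)].
apply: le_trans (measureU2 P mB mN) _.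
by rewrite -[X in (_ + X)%E]/(P N) N0 adde0.
Qed.

(** The laws of [Z] and [-Z] agree, so the mean equals its opposite. Gaussian increments are seen to
    be centred this way, without computing an integral. *)
Lemma EX_symmetric (Z : T -> R) : I1 P Z ->
  (forall B : set R, measurable B -> P (Z @^-1` B) = P (Z @^-1` (-%R @^-1` B))) ->
  EX P Z = 0.
Proof.
move=> IZ sZ; have mZ := I1_meas IZ.
have mNZ : measurable_fun setT (fun w => - Z w) by exact: measurableT_comp.
have h (f : T -> R) (mf : measurable_fun setT f) : I1 P f ->
    (\int[P]_w (f w)%:E = \int[pushforward P f]_y y%:E)%E.
  move=> If; rewrite integral_pushforward//; exact/measurable_EFinP.
have : EX P Z = EX P (fun w => - Z w).
  rewrite /EX /Rintegral; congr fine.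
  rewrite h// h//; last exact: I1N.
  by apply: eq_measure_integral => B mB _; rewrite /pushforward; exact: sZ.
rewrite [X in _ = X](_ : _ = - EX P Z); last first.
  rewrite -mulN1r -EXZ//; congr EX; apply/funext => w; by rewrite mulN1r.
move=> /eqP; rewrite -subr_eq0 opprK -mulr2n mulrn_eq0/= => /eqP.
exact.
Qed.

End SymmetricLaw.

(** * Square-integrable martingales *)

Section SubAlgebra.
Import HBNNSimple.
Context {d} {T : measurableType d} {R : realType}.
Variable P : probability T R.
Variable G0 : set (set T).
Hypotheses (sG0 : sigma_algebra setT G0) (G0m : G0 `<=` measurable).

Lemma meas_on_measurable d' (Y : measurableType d') (f : T -> Y) :
  meas_on G0 setT f -> measurable_fun setT f.
Proof. by move=> mf _ B mB; apply: G0m; exact: mf. Qed.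

Lemma sub_measurable d' (Y : measurableType d') (f : T -> Y) :
  measurable_fun (setT : set (g_sigma_algebraType G0)) f -> measurable_fun (setT : set T) f.
Proof.
move=> mf _ B mB; apply: G0m; have := mf measurableT B mB.
by rewrite measurable_g_measurableTypeE.
Qed.

(** From indicators to general [X] by simple approximation of its positive and negative parts.
    Dominated convergence applies with the bound [|X D|], so [X] may be unbounded. *)
Lemma EX_orth_ext (D X : T -> R) : I1 P D ->
  (forall B, G0 B -> EX P (fun w => \1_B w * D w) = 0) ->
  meas_on G0 setT X -> I1 P (fun w => X w * D w) ->
  EX P (fun w => X w * D w) = 0.
Proof.
move=> ID oD mX; have mD := I1_meas ID.
have {mX} mX := meas_onP sG0 mX.
suff pos (Y : T -> R) : (forall w, 0 <= Y w) ->
    measurable_fun (setT : set (g_sigma_algebraType G0)) Y ->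
    I1 P (fun w => Y w * D w) -> EX P (fun w => Y w * D w) = 0.
  have mXp : measurable_fun (setT : set (g_sigma_algebraType G0)) (fun w => Num.max (X w) 0).
    exact: measurable_maxr.
  have mXn : measurable_fun (setT : set (g_sigma_algebraType G0)) (fun w => Num.max (- X w) 0).
    by apply: measurable_maxr => //; exact: measurableT_comp.
  move=> IXD.
  have Xp : I1 P (fun w => Num.max (X w) 0 * D w).
    apply: I1_le (I1_abs IXD) _; first exact: measurable_funM (sub_measurable mXp) mD.
    by move=> w; rewrite !normrM ler_wpM2r//; case: (leP 0 (X w)) => // _; rewrite normr0.
  have Xn : I1 P (fun w => Num.max (- X w) 0 * D w).
    apply: I1_le (I1_abs IXD) _; first exact: measurable_funM (sub_measurable mXn) mD.
    move=> w; rewrite !normrM ler_wpM2r//; case: (leP 0 (- X w)) => _.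
      by rewrite normrN.
    by rewrite normr0.
  rewrite (_ : (fun w => _) = fun w => Num.max (X w) 0 * D w - Num.max (- X w) 0 * D w).
    by rewrite EXB// !pos ?subrr// => w; rewrite le_max lexx orbT.
  apply/funext => w; rewrite -mulrBl; congr (_ * _).
  by case: (leP 0 (X w)); case: (leP 0 (- X w)); lra.
move=> Y0 mY IYD.
have mY' : measurable_fun setT (EFin \o Y : g_sigma_algebraType G0 -> \bar R).
  exact/measurable_EFinP.
pose k_ : {nnsfun (g_sigma_algebraType G0) >-> R}^nat := nnsfun_approx measurableT mY'.
have gmeas (B : set T) : measurable (B : set (g_sigma_algebraType G0)) -> G0 B.
  by rewrite measurable_g_measurableTypeE.
have kle n w : k_ n w <= Y w.
  rewrite /k_ nnsfun_approxE -lee_fin.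
  by apply: le_approx => // x _; rewrite lee_fin.
have kcvg w : k_ n w @[n --> \oo] --> Y w.
  have := @cvg_nnsfun_approx _ _ _ _ measurableT _ mY' (fun x _ => Y0 x) w Logic.I.
  by move=> /fine_cvg.
have k0 n : EX P (fun w => k_ n w * D w) = 0.
  pose r := finmap.enum_fset (fset_set (range (k_ n))).
  have mk y : measurable (k_ n @^-1` [set y] : set T).
    by apply/G0m/gmeas; exact: (measurable_funPTI (k_ n) (measurable_set1 y)).
  have I1k y : I1 P (fun w => \1_(k_ n @^-1` [set y]) w * D w).
    apply: I1_le (I1_abs ID) _; first exact/measurable_funM/mD/measurable_indic.
    by move=> w; rewrite normrM ler_piMl// indicE; case: (_ \in _); rewrite ?normr1 ?normr0.
  rewrite (_ : (fun w => _) = fun w =>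
      \sum_(i < size r) r`_i * (\1_(k_ n @^-1` [set r`_i]) w * D w)).
    rewrite EX_sum; last by move=> y; exact: I1Z.
    rewrite big1// => y _; rewrite EXZ// oD ?mulr0//.
    by apply: gmeas; exact: (measurable_funPTI (k_ n) (measurable_set1 _)).
  apply/funext => w; rewrite (fimfunEord (k_ n) w) mulr_suml.
  by apply: eq_bigr => i _; rewrite mulrA.
have [_ cv] : I1 P (fun w => Y w * D w) /\
    EX P (fun w => k_ n w * D w) @[n --> \oo] --> EX P (fun w => Y w * D w).
  apply: (EX_dct (g := fun w => `|Y w * D w|)).
  - move=> n; apply: measurable_funM => //; apply: sub_measurable.
    exact: measurable_funPT.
  - by apply: measurable_funM => //; exact: sub_measurable.
  - exact: I1_abs.
  - by apply: aeW => w; apply: cvgMr_tmp; exact: kcvg.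
  - by apply: aeW => w n; rewrite !normrM ler_wpM2r// !ger0_norm.
move: cv; under eq_fun do rewrite k0.
by move=> /(cvg_unique _ (cvg_cst 0)) ->.
Qed.

End SubAlgebra.

Section Martingale.
Context {dO} {Omega : measurableType dO} {R : realType}.
Variable P : probability Omega R.
Variable F : R -> set (set Omega).
Hypotheses (sF : forall t, sigma_algebra setT (F t)) (mF : forall t, F t `<=` measurable)
  (leF : forall s t, s <= t -> F s `<=` F t).

(** The martingale property is expressed by orthogonality of the increments to indicators of the
    past, so that no conditional expectation has to be manipulated. *)
Definition martingale2 (a b : R) (w : R -> Omega -> R) : Prop :=
  [/\ forall s, a <= s <= b -> meas_on (F s) setT (w s),
      forall s, a <= s <= b -> L2 P (w s)
    & forall u v G, a <= u -> u <= v -> v <= b -> F u G ->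
        EX P (fun x => \1_G x * (w v x - w u x)) = 0].

Lemma meas_on_le s t (X : Omega -> R) : s <= t -> meas_on (F s) setT X -> meas_on (F t) setT X.
Proof. by move=> st mX B mB; apply: leF (mX B mB). Qed.

Lemma F_measP t d (Y : measurableType d) (f : Omega -> Y) :
  meas_on (F t) setT f <-> measurable_fun (setT : set (g_sigma_algebraType (F t))) f.
Proof.
split; first by apply: meas_onP; exact: sF.
by apply: measurable_meas_on; [exact: sF|case: (sF t) => F0 FC _; have := FC _ F0; rewrite setD0].
Qed.

Lemma martingale2_orth a b w u v (X : Omega -> R) : martingale2 a b w -> a <= u -> u <= v -> v <= b ->
  meas_on (F u) setT X -> I1 P (fun x => X x * (w v x - w u x)) ->
  EX P (fun x => X x * (w v x - w u x)) = 0.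
Proof.
move=> [mw w2 ow] au uv vb mX.
apply: (@EX_orth_ext _ _ _ P (F u)) => //; last by move=> B FB; exact: ow.
by apply: I1B; apply: L2_I1; apply: w2; rewrite ?(le_trans au) ?au//= (le_trans uv vb).
Qed.

Definition msum (w : R -> Omega -> R) (s : nat -> R) (H : nat -> Omega -> R) n x :=
  \sum_(k < n) H k x * (w (s k.+1) x - w (s k) x).

Section msum.
Variables (a b : R) (w : R -> Omega -> R) (s : nat -> R) (H : nat -> Omega -> R) (N : nat) (c : R).
Hypotheses (Mw : martingale2 a b w) (s0 : a <= s 0%N) (sN : s N <= b)
  (ss : forall k, s k <= s k.+1)
  (mH : forall k, (k < N)%N -> meas_on (F (s k)) setT (H k))
  (Hc : forall k x, (k < N)%N -> `|H k x| <= c).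

Let sle k l : (k <= l)%N -> s k <= s l.
Proof. by move=> kl; apply: (nondecreasing_seqP s).1 => // n; exact: ss. Qed.

Let sa k : a <= s k. Proof. by apply: le_trans s0 _; exact: sle. Qed.
Let sb k : (k <= N)%N -> s k <= b. Proof. by move=> kN; apply: le_trans sN; exact: sle. Qed.

(** Discrete Ito isometry. Each new term is orthogonal to the past, so second moments add up on both
    sides of the induction, and the coefficients contribute at most [c^2]. The bound depends on the
    partition only through its two end points. *)
Lemma msum_props n : (n <= N)%N ->
  [/\ meas_on (F (s n)) setT (msum w s H n), L2 P (msum w s H n),
      EX P (msum w s H n) = 0 &
      EX P (fun x => msum w s H n x ^+ 2) <= c ^+ 2 * EX P (fun x => (w (s n) x - w (s 0%N) x) ^+ 2)].
Proof.
have [mw w2 ow] := Mw.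
elim: n => [_|n IH nN].
  have -> : msum w s H 0 = fun=> 0 by apply/funext => x; rewrite /msum big_ord0.
  split.
  - by apply/F_measP; exact: measurable_cst.
  - by apply: (@L2_bdd _ _ _ _ _ 0) => // x; rewrite normr0.
  - exact: EX_cst.
  - rewrite (_ : (fun x => 0 ^+ 2) = fun=> 0); last by apply/funext => x; rewrite expr0n.
    rewrite EX_cst mulr_ge0 ?sqr_ge0//; apply: EX_ge0 => x; exact: sqr_ge0.
have [mS S2 S0 Sle] := IH (ltnW nN).
have in_ k : (k <= N)%N -> a <= s k <= b by move=> kN; rewrite sa sb.
have n1 := in_ _ nN; have n0 := in_ _ (ltnW nN); have i0 := in_ 0%N (leq0n _).
pose D x := w (s n.+1) x - w (s n) x.
have D2 : L2 P D by apply: L2B; exact: w2.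
have mHn := mH nN; have mHn' := meas_on_measurable (@mF (s n)) mHn.
have HD2 : L2 P (fun x => H n x * D x).
  by apply: (@L2_bddM _ _ _ _ _ _ c) => // x; exact: Hc.
have SE : msum w s H n.+1 = fun x => msum w s H n x + H n x * D x.
  by apply/funext => x; rewrite /msum big_ord_recr.
have Sn2 : L2 P (msum w s H n.+1) by rewrite SE; exact: L2D.
have orth (X : Omega -> R) : meas_on (F (s n)) setT X -> I1 P (fun x => X x * D x) ->
    EX P (fun x => X x * D x) = 0.
  by move=> mX IX; apply: (martingale2_orth Mw) => //; exact: sb.
split=> //.
- apply/F_measP; rewrite SE; apply: measurable_funD.
    by apply/F_measP; apply: (meas_on_le (ss n)).
  apply: measurable_funM; first by apply/F_measP; apply: (meas_on_le (ss n)).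
  apply: measurable_funB; first by apply/F_measP; exact: mw.
  by apply/F_measP; apply: (meas_on_le (ss n)); exact: mw.
- rewrite SE EXD ?S0 ?add0r; [|exact: L2_I1|exact: L2_I1].
  by apply: orth => //; exact: L2_I1.
have IS2 := S2.2; have IH2 := HD2.2; have ID2 := D2.2.
have ISH : I1 P (fun x => (msum w s H n x * H n x) * D x).
  rewrite (_ : (fun x => _) = fun x => msum w s H n x * (H n x * D x)).
    exact: L2M.
  by apply/funext => x; rewrite mulrA.
have -> : EX P (fun x => msum w s H n.+1 x ^+ 2) =
    EX P (fun x => msum w s H n x ^+ 2) + EX P (fun x => (H n x * D x) ^+ 2).
  transitivity (EX P (fun x => (msum w s H n x ^+ 2 + (H n x * D x) ^+ 2) +
     2 * ((msum w s H n x * H n x) * D x))).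
    by congr EX; apply/funext => x; rewrite SE; ring.
  rewrite EXD; [|exact: I1D|exact: I1Z].
  rewrite EXD// EXZ// orth ?mulr0 ?addr0//.
  apply/F_measP; apply: measurable_funM; exact/F_measP.
have L0 : L2 P (fun x => w (s n) x - w (s 0%N) x) by apply: L2B; exact: w2.
have -> : EX P (fun x => (w (s n.+1) x - w (s 0%N) x) ^+ 2) =
    EX P (fun x => (w (s n) x - w (s 0%N) x) ^+ 2) + EX P (fun x => D x ^+ 2).
  transitivity (EX P (fun x => ((w (s n) x - w (s 0%N) x) ^+ 2 + D x ^+ 2) +
     2 * ((w (s n) x - w (s 0%N) x) * D x))).
    by congr EX; apply/funext => x; rewrite /D; ring.
  have IL : I1 P (fun x => (w (s n) x - w (s 0%N) x) * D x) by exact: L2M.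
  rewrite EXD; [|apply: I1D => //; exact: L0.2|exact: I1Z].
  rewrite EXD//; last exact: L0.2.
  rewrite EXZ// orth ?mulr0 ?addr0//.
  apply/F_measP; apply: measurable_funB; apply/F_measP; first exact: mw.
  by apply: (meas_on_le (sle (leq0n n))); exact: mw.
rewrite mulrDr; apply: lerD => //.
rewrite -EXZ//; apply: EX_le => [//||x]; first exact: I1Z.
rewrite exprMn ler_wpM2r ?sqr_ge0// -[H n x ^+ 2]real_normK ?num_real//.
by rewrite lerXn2r ?nnegrE// ?(le_trans _ (Hc x nN))// Hc.
Qed.

End msum.

(** The convergence hypothesis concerns extended integrals, so square integrability of the
    differences holds only from some index on. It is extracted first and yields that of the
    limit. *)
Lemma martingale2_limit a b (wn : nat -> R -> Omega -> R) (w : R -> Omega -> R) :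
  (forall n, martingale2 a b (wn n)) ->
  (forall s, a <= s <= b -> meas_on (F s) setT (w s)) ->
  (forall s, a <= s <= b ->
     (\int[P]_x ((wn n s x - w s x) ^+ 2)%:E)%E @[n --> \oo] --> 0%E) ->
  martingale2 a b w.
Proof.
move=> Mn mw cw.
have mD s n : a <= s <= b -> measurable_fun setT (fun x => wn n s x - w s x).
  move=> sab; have [mwn _ _] := Mn n.
  by apply: measurable_funB; [exact: meas_on_measurable (mwn s sab)|exact: meas_on_measurable (mw s sab)].
have ev s e : a <= s <= b -> 0 < e -> \forall n \near \oo, L2 P (fun x => wn n s x - w s x) /\
    EX P (fun x => (wn n s x - w s x) ^+ 2) <= e.
  move=> sab e0; have /fine_cvgP[fn fc] := cw s sab.
  have /cvgr0Pnorm_lt/(_ _ e0) fc' := fc.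
  apply: filterS2 fn fc' => n fn fc'; split; last first.
    by move: fc'; rewrite /EX /Rintegral => /ltW; apply: le_trans; exact: ler_norm.
  split; first exact: mD.
  apply/integrableP; split; first exact/measurable_EFinP/measurable_funX/mD.
  under eq_integral do rewrite /= ger0_norm ?sqr_ge0//.
  by rewrite ltey_eq fn.
have w2 s : a <= s <= b -> L2 P (w s).
  move=> sab; have [n _ /(_ _ (leqnn _)) [D2 _]] := ev s 1 sab ltr01.
  rewrite (_ : w s = fun x => wn n s x - (wn n s x - w s x)).
    by apply: L2B => //; have [_ h _] := Mn n; exact: h.
  by apply/funext => x; ring.
split=> // u v G au uv vb FG.
have uab : a <= u <= b by rewrite au (le_trans uv).
have vab : a <= v <= b by rewrite (le_trans au).
have mG : measurable G by exact: mF FG.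
have m1 : measurable_fun setT (\1_G : Omega -> R) by exact: measurable_indic.
have b1 x : `|\1_G x : R| <= 1 by rewrite indicE; case: (_ \in _); rewrite ?normr1 ?normr0.
apply/eqP; rewrite -normr_le0; apply/ler_addgt0Pl => e e0; rewrite addr0.
have e20 : 0 < e / 2 by rewrite divr_gt0.
have [n _ hn] := filterI (ev u (e / 2 * (e / 2)) uab (mulr_gt0 e20 e20))
  (ev v (e / 2 * (e / 2)) vab (mulr_gt0 e20 e20)).
have [[Du2 Due] [Dv2 Dve]] := hn n (leqnn n).
have [_ n2 on] := Mn n.
have IDu : I1 P (fun x => \1_G x * (wn n u x - w u x)).
  by apply: L2_I1; apply: (@L2_bddM _ _ _ _ _ _ 1).
have IDv : I1 P (fun x => \1_G x * (wn n v x - w v x)).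
  by apply: L2_I1; apply: (@L2_bddM _ _ _ _ _ _ 1).
have Iuv : I1 P (fun x => \1_G x * (wn n v x - wn n u x)).
  by apply: L2_I1; apply: (@L2_bddM _ _ _ _ _ _ 1) => //; apply: L2B; exact: n2.
have -> : EX P (fun x => \1_G x * (w v x - w u x)) =
    EX P (fun x => \1_G x * (wn n u x - w u x)) - EX P (fun x => \1_G x * (wn n v x - w v x)).
  rewrite -EXB// -[RHS]addr0 -(on u v G au uv vb FG) -EXD//; last exact: I1B.
  by congr EX; apply/funext => x; ring.
have small (D : Omega -> R) : L2 P D -> EX P (fun x => D x ^+ 2) <= e / 2 * (e / 2) ->
    I1 P (fun x => \1_G x * D x) -> `|EX P (fun x => \1_G x * D x)| <= e / 2.
  move=> D2 De ID; apply: le_trans (EX_abs ID) _.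
  (* [|D| <= e / 4 + D^2 / e] plays the part of the Cauchy-Schwarz inequality; with [E[D^2] <= (e /
     2)^2] the total is [e / 2]. *)
  have : EX P (fun x => `|\1_G x * D x|) <= EX P (fun x => e / 4 + e^-1 * D x ^+ 2).
    apply: EX_le => [||x]; first exact: I1_abs.
      by apply: I1D; [exact: I1_cst|apply: I1Z; case: D2].
    rewrite normrM (@le_trans _ _ `|D x|)//; first by rewrite ler_piMl.
    rewrite -(ler_pM2l e0) mulrDr (mulrA e e^-1) divff ?gt_eqF// mul1r.
    have := sqr_ge0 (`|D x| - e / 2); rewrite sqrrB real_normK ?num_real//; lra.
  have ID2 := D2.2.
  move=> /le_trans; apply; rewrite EXD; [|exact: I1_cst|exact: I1Z].
  rewrite EX_cst EXZ//.
  have : e^-1 * EX P (fun x => D x ^+ 2) <= e^-1 * (e / 2 * (e / 2)).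
    by rewrite ler_wpM2l// invr_ge0 ltW.
  rewrite (_ : e^-1 * (e / 2 * (e / 2)) = e / 4); last by field; rewrite gt_eqF.
  lra.
apply: le_trans (ler_normB _ _) _; rewrite [leRHS]splitr.
by apply: lerD; exact: small.
Qed.

End Martingale.

(** * Path measures, uniform grids and estimates along paths *)

Section PathMeasure.
Context {R : realType}.
Implicit Types f : R -> R.

Lemma within_comp_continuous (D : set R) f (g : R -> R) : {within D, continuous f} ->
  continuous g -> (forall x, D (g x)) -> continuous (f \o g).
Proof.
move=> /subspace_continuousP cf cg gD x.
apply: (@cvg_comp _ _ _ g f _ (within D (nbhs (g x)))); last exact: cf.
move=> B /=; rewrite /within/= => nB.
have h : nbhs x (g @^-1` (fun z => D z -> B z)) by exact: cg.
by apply: filterS h => y; apply; exact: gD.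
Qed.

Lemma maxr0_continuous : continuous (fun s : R => Num.max s 0).
Proof. by move=> s; apply: cvg_maxr; [exact: cvg_id|exact: cvg_cst]. Qed.

Lemma clamp_continuous (a b : R) : continuous (fun s : R => Num.max a (Num.min s b)).
Proof.
move=> s; apply: cvg_maxr; first exact: cvg_cst.
by apply: cvg_minr; [exact: cvg_id|exact: cvg_cst].
Qed.

Definition cont_incr f := [/\ forall s t, 0 <= s <= t -> f s <= f t
  & {within `[0, +oo[, continuous f}].

Lemma cont_incr_continuous f : cont_incr f -> continuous (fun s : R => f (Num.max s 0)).
Proof.
move=> [_ cf]; apply: (within_comp_continuous cf); first exact: maxr0_continuous.
by move=> s; rewrite /= in_itv/= andbT le_max lexx orbT.
Qed.

Lemma cont_incr_cumulative f : cont_incr f -> is_cumulative (fun s => f (Num.max s 0)).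
Proof.
move=> cf; have [incf _] := cf; split.
  move=> s t st; apply: incf; rewrite le_max lexx orbT/=.
  by rewrite ge_max !le_max lexx st !orbT.
exact: (right_continuousW (cont_incr_continuous cf)).
Qed.

Lemma path_diff_itv f a b : cont_incr f -> 0 <= a -> a <= b ->
  path_diff f `]a, b]%classic = (f b - f a)%:E.
Proof.
move=> cf a0 ab; rewrite /path_diff /stieltjes; case: pselect => [h|]; last first.
  by move/(_ (cont_incr_cumulative cf)).
rewrite /= /lebesgue_stieltjes_measure /measure_extension measurable_mu_extE/=; last exact: is_ocitv.
by rewrite wlength_itv_bnd//= !max_l// (le_trans a0).
Qed.

Lemma path_diff_set1 f x : cont_incr f -> 0 < x -> path_diff f [set x] = 0%E.
Proof.
move=> cf x0; apply/eqP; rewrite eq_le measure_ge0 andbT.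
apply/lee_addgt0Pr => e e0; rewrite add0e.
have ccf := cont_incr_continuous cf; have := ccf x => /cvgrPdist_lt/(_ _ e0).
move=> /nbhs_ballP[r /= r0 rb].
pose y := Num.max 0 (x - r / 2).
have yx : y < x by rewrite gt_max x0 ltrBlDr ltrDl divr_gt0.
have y0 : 0 <= y by rewrite le_max lexx.
apply: (@le_trans _ _ (path_diff f `]y, x]%classic)).
  apply: le_measure; rewrite ?inE//=; last by move=> _ ->; rewrite /= in_itv/= yx lexx.
rewrite path_diff_itv ?(ltW yx)// lee_fin.
have : ball x r y.
  rewrite /ball/= ger0_norm ?subr_ge0 ?(ltW yx)// ltrBlDr -ltrBlDl.
  by rewrite lt_max ltrD2l ltrN2 ltr_pdivrMr// ltr_pMr// ltr1n orbT.
move=> /rb /=; rewrite (max_l y0) (max_l (ltW x0)) ger0_norm; first by move/ltW.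
by rewrite subr_ge0; have [+ _] := cf; apply; rewrite y0 ltW.
Qed.

End PathMeasure.

Lemma integrable_bdd d (Y : measurableType d) (R : realType)
    (mu : {measure set Y -> \bar R}) (D : set Y) (f : Y -> R) c :
  measurable D -> (mu D < +oo)%E -> measurable_fun D f ->
  (forall y, D y -> `|f y| <= c) -> mu.-integrable D (EFin \o f).
Proof.
move=> mD muD mf fc; apply: measurable_bounded_integrable => //.
exists c; split; first exact: num_real.
by move=> y cy s /= /fc h; exact: (le_trans h (ltW cy)).
Qed.

(** Heine's theorem for a function continuous on the whole line, by compactness of the segment.
    Paths known on a segment only are first extended by clamping the time. *)
Lemma near_unif_continuous (R : realType) (f : R -> R) a b e : continuous f -> 0 < e ->
  \forall d \near (0:R)^'+, forall x, a <= x <= b -> forall y, `|x - y| < d -> `|f x - f y| < e.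
Proof.
move=> cf e0; have /compact_near_coveringP := @segment_compact R a b.
move=> /(_ R (0:R)^'+ (fun d x => forall y, `|x - y| < d -> `|f x - f y| < e)).
move=> H; have {}H : \forall d \near (0:R)^'+, `[a, b] `<=`
    (fun x => forall y, `|x - y| < d -> `|f x - f y| < e).
  apply: H => x _; have e2 : 0 < e / 2 by rewrite divr_gt0.
  have ccf := cf x; have /cvgrPdist_lt/(_ _ e2)/nbhs_ballP[r /= r0 rb] := ccf.
  have r2 : 0 < r / 2 by rewrite divr_gt0.
  exists (ball x (r / 2), [set d | 0 < d < r / 2]) => /=.
    split; first exact: nbhsx_ballx.
    have h1 : \forall d \near (0:R)^'+, 0 < d by exact: nbhs_right_gt.
    have h2 : \forall d \near (0:R)^'+, d < r / 2 by exact: nbhs_right_lt.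
    by apply: filterS2 h1 h2 => d d0 dr; apply/andP; split.
  move=> [x' d] /= [bx /andP[d0 dr]] y yd.
  have h1 : `|f x - f x'| < e / 2.
    by apply: rb; apply: lt_le_trans bx _; rewrite ler_pdivrMr// ler_pMr// ler1n.
  have h2 : `|f x - f y| < e / 2.
    apply: rb; rewrite /ball/=; rewrite (splitr r) -(subrK x' x) -addrA.
    by apply: le_lt_trans (ler_normD _ _) _; apply: ltrD => //; exact: lt_trans dr.
  rewrite (splitr e) -(subrK (f x) (f x')) -addrA.
  apply: le_lt_trans (ler_normD _ _) _; apply: ltrD => //.
  by rewrite distrC.
by apply: filterS H => d Hd x ab; apply: Hd; rewrite /= in_itv.
Qed.

Lemma measurable_gt d (X : measurableType d) (R : realType) (f : X -> R) a :
  measurable_fun setT f -> measurable [set x | a < f x].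
Proof.
move=> mf; have := mf measurableT _ (measurable_itv `]a, +oo[); rewrite setTI.
by congr measurable; apply/seteqP; split=> x /=; rewrite in_itv/= andbT.
Qed.

Lemma Rint_eq0 d (X : measurableType d) (R : realType) (mu : {measure set X -> \bar R})
    (D : set X) (f : X -> R) :
  (forall x, D x -> f x = 0) -> \int[mu]_(x in D) f x = 0.
Proof. by move=> f0; rewrite /Rintegral integral0_eq// => x Dx; rewrite f0. Qed.

Lemma sum_itv_indicator (a b N : nat) :
  (\sum_(1 <= n < N.+1) (a <= n < b)%N <= b - a)%N.
Proof.
rewrite -big_mkcond sum1_count -size_filter -[leqRHS](size_iota a).
apply: uniq_leq_size; first by rewrite filter_uniq// iota_uniq.
by move=> n; rewrite mem_filter mem_iota => /andP[/andP[an nb] _]; rewrite an; lia.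
Qed.

Section Grid.
Context {R : realType}.
Variables (t T : R).
Hypothesis tT : t < T.

(** Point [k] of the uniform grid with [l + 1] cells: [k = 0] gives [t], [k = l + 1] gives [T], and
    larger [k] overshoot [T], which explains the bounds [k <= l.+1] below. *)
Definition gridpt l k : R := t + (T - t) * k%:R / l.+1%:R.

Lemma gridpt0 l : gridpt l 0 = t.
Proof. by rewrite /gridpt mulr0 mul0r addr0. Qed.

Lemma gridptT l : gridpt l l.+1 = T.
Proof. by rewrite /gridpt mulfK ?pnatr_eq0// addrC subrK. Qed.

Lemma gridptS l k : gridpt l k.+1 - gridpt l k = (T - t) / l.+1%:R.
Proof. by rewrite /gridpt opprD addrACA subrr add0r -mulrBl -mulrBr -natrB// subSnn mulr1. Qed.

Lemma mesh_gt0 l : 0 < (T - t) / l.+1%:R.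
Proof. by rewrite divr_gt0// subr_gt0. Qed.

Lemma gridpt_lt l k : gridpt l k < gridpt l k.+1.
Proof. by rewrite -subr_gt0 gridptS mesh_gt0. Qed.

Lemma gridpt_le l j k : (j <= k)%N -> gridpt l j <= gridpt l k.
Proof. by move=> jk; apply: (nondecreasing_seqP (gridpt l)).1 => // n; exact/ltW/gridpt_lt. Qed.

Lemma gridpt_ge l k : t <= gridpt l k.
Proof. by rewrite -[leLHS](gridpt0 l); exact: gridpt_le. Qed.

Lemma gridpt_leT l k : (k <= l.+1)%N -> gridpt l k <= T.
Proof. by move=> kl; rewrite -[leRHS](gridptT l); exact: gridpt_le. Qed.

Lemma mesh_cvg : (T - t) / l.+1%:R @[l --> \oo] --> (0 : R).
Proof. by rewrite -(mulr0 (T - t)); apply: cvgMl_tmp; exact: cvg_harmonic. Qed.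

Lemma mesh_lt e : 0 < e -> \forall l \near \oo, (T - t) / l.+1%:R < e.
Proof.
move=> e0; have /cvgr0Pnorm_lt/(_ _ e0) := mesh_cvg; apply: filterS => l.
by rewrite ger0_norm// ltW// mesh_gt0.
Qed.

(** The index [l + 1] occurs only for [x = T]; sums that locate a point on the grid therefore need
    [l + 2] terms. *)
Lemma grid_floor l x : t <= x <= T -> exists2 k, (k <= l.+1)%N & gridpt l k <= x < gridpt l k.+1.
Proof.
move=> /andP[tx xT]; have h0 := mesh_gt0 l.
pose k := Num.trunc ((x - t) / ((T - t) / l.+1%:R)).
have y0 : 0 <= (x - t) / ((T - t) / l.+1%:R) by rewrite divr_ge0 ?subr_ge0// ltW.
have /andP[k1 k2] := truncn_itv y0.
have gE j : gridpt l j = t + (T - t) / l.+1%:R * j%:R by rewrite /gridpt mulrAC.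
have kx : gridpt l k <= x by rewrite gE -lerBrDl mulrC -ler_pdivlMr.
exists k; last by rewrite kx gE -ltrBlDl mulrC -ltr_pdivrMr.
rewrite -(ler_nat R) -(ler_pM2l h0) -(lerD2l t) -!gE gridptT.
exact: le_trans xT.
Qed.

(** The grid points of all levels form the countable dense set of times at which the truncation of
    the density is decided. *)
Lemma grid_dense x y : t <= x -> x < y -> y <= T ->
  exists l k, (k <= l.+1)%N /\ x <= gridpt l k < y.
Proof.
move=> tx xy yT; have xy0 : 0 < y - x by rewrite subr_gt0.
have [l _ /(_ l (leqnn l)) hl] := mesh_lt xy0.
have [|k kl /andP[kx xk]] := @grid_floor l x; first by rewrite tx (le_trans (ltW xy)).
have ky : gridpt l k.+1 < y.
  by have := gridptS l k; move: hl kx; move: (_ / _) (gridpt l k) (gridpt l k.+1) => h a b; lra.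
exists l, k.+1; split; last by rewrite ltW.
rewrite ltnNge; apply/negP => lk.
have := lt_le_trans ky yT; rewrite -[X in _ < X](gridptT l) ltNge => /negP; apply.
by apply: gridpt_le; exact: leq_trans lk (leqnSn k).
Qed.

End Grid.

(** Both bounds follow from [1 + b <= exp b] and [exp b (1 - b) <= 1]. *)
Lemma expR_bounds (R : realType) (b : R) : `|b| <= 2^-1 ->
  `|expR b - 1 - b| <= 2 * `|b| ^+ 2 /\ `|expR b - 1| <= 2 * `|b|.
Proof.
move=> b2; have [b2l b2r] : - 2^-1 <= b /\ b <= 2^-1 by move: b2; rewrite ler_norml => /andP.
have e1 : 1 + b <= expR b by exact: expR_ge1Dx.
have e2 : expR b * (1 - b) <= 1.
  have := expR_ge1Dx (- b); rewrite expRN => h.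
  by rewrite mulrC -ler_pdivlMr ?expR_gt0// div1r.
have e3 : expR b <= 1 + b + 2 * b ^+ 2.
  have h : 0 < 1 - b by lra.
  have : expR b * (1 - b) <= (1 + b + 2 * b ^+ 2) * (1 - b).
    apply: le_trans e2 _; have := sqr_ge0 b; rewrite expr2; nra.
  by rewrite ler_pM2r.
rewrite real_normK ?num_real//; split.
  by rewrite ger0_norm; lra.
have [b0|b0] := leP 0 b; [rewrite (ger0_norm b0)|rewrite (ltr0_norm b0)].
  by rewrite ger0_norm; nra.
by rewrite ler_norml; apply/andP; split; nra.
Qed.

Lemma EX_le_cst_ae d (X : measurableType d) (R : realType) (P : probability X R) (f : X -> R) k :
  I1 P f -> (\forall w \ae P, f w <= k) -> EX P f <= k.
Proof.
move=> If fk; have mf := I1_meas If; rewrite -(EX_cst P k).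
have m0 : measurable_fun setT (fun w => Num.min (f w) k) by apply: measurable_minr.
have E : EX P f = EX P (fun w => Num.min (f w) k).
  by apply: EX_ae => //; apply: filterS fk => w fk; rewrite min_l.
rewrite E; apply: EX_le; last by move=> w; rewrite ge_min lexx orbT.
  by apply: I1_ae m0 _ If; apply: filterS fk => w fk; rewrite min_l.
exact: I1_cst.
Qed.

(** Fatou's lemma: truncate at level [k], pass to the limit in [n] by dominated convergence, then in
    [k] by monotone convergence. *)
Lemma I1_fatou d (X : measurableType d) (R : realType) (P : probability X R)
    (f_ : nat -> X -> R) (f : X -> R) K :
  (forall n, I1 P (f_ n)) -> (forall n, EX P (fun w => `|f_ n w|) <= K) ->
  measurable_fun setT f -> (\forall w \ae P, f_ ^~ w @ \oo --> f w) ->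
  I1 P f /\ EX P (fun w => `|f w|) <= K.
Proof.
move=> If fK mf cf; have mf_ n := I1_meas (If n).
pose h (k : nat) w := Num.min `|f w| k%:R.
have mh (g : X -> R) (k : nat) : measurable_fun setT g -> measurable_fun setT (fun w => Num.min `|g w| k%:R).
  by move=> mg; apply: measurable_minr => //; exact: measurableT_comp.
have hb (g : X -> R) (k : nat) w : `|Num.min `|g w| k%:R| <= k%:R.
  by rewrite ger0_norm ?le_min ?normr_ge0 ?ler0n// ge_min lexx orbT.
have hK k : EX P (h k) <= K.
  have [_ cE] := @EX_dct _ _ _ P (fun n w => Num.min `|f_ n w| k%:R) (h k) (fun=> k%:R)
    (fun n => mh _ _ (mf_ n)) (mh _ _ mf) (I1_cst P k%:R)
    (filterS (fun w cf => cvg_minr _ (cvg_norm cf) (cvg_cst _)) cf)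
    (aeW _ (fun w n => hb (f_ n) k w)).
  apply: (@closed_cvg _ _ \oo _ _ (fun x => x <= K) _ _ _ cE); first exact: closed_le.
  apply: nearW => n; apply: le_trans (fK n).
  apply: EX_le; [exact: I1_bdd (mh _ _ (mf_ n)) (hb _ _)|exact: I1_abs|].
  by move=> w; rewrite ge_min lexx.
have hcvg w : (h k w)%:E @[k --> \oo] --> (`|f w|)%:E.
  apply: cvg_near_cst; exists (Num.bound `|f w|) => // k /= kb.
  rewrite /h min_l// ltW// (lt_le_trans (archi_boundP (normr_ge0 (f w))))// ler_nat//.
have fKE : (\int[P]_w (`|f w|)%:E <= K%:E)%E.
  have nd w (_ : [set: X] w) : {homo (fun k => (h k w)%:E) : a b / (a <= b)%N >-> (a <= b)%E}.
    move=> a b ab; rewrite lee_fin /h le_min !ge_min lexx/=.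
    by rewrite ler_nat ab !orbT.
  rewrite (eq_integral (fun w => limn (fun k => (h k w)%:E))); last first.
    by move=> w _; rewrite (cvg_lim _ (hcvg w)).
  rewrite (@monotone_convergence _ _ _ P _ measurableT (fun k w => (h k w)%:E)) => //.
  - apply: lime_le.
      apply: ereal_nondecreasing_is_cvgn => a b ab; apply: ge0_le_integral => //.
      + by move=> w _; rewrite lee_fin /h le_min normr_ge0 ler0n.
      + by apply/measurable_EFinP; exact: mh.
      + by apply/measurable_EFinP; exact: mh.
      + by move=> w _; exact: nd.
    apply: nearW => k; rewrite -EX_EFin ?lee_fin//.
    exact: I1_bdd (mh _ _ mf) (hb _ _).
  - by move=> k; apply/measurable_EFinP; exact: mh.
  - by move=> k w _; rewrite lee_fin /h le_min normr_ge0 ler0n.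
have I : I1 P f.
  apply/integrableP; split; first exact/measurable_EFinP.
  exact: le_lt_trans fKE (ltry _).
by split=> //; rewrite -lee_fin EX_EFin//; exact: I1_abs.
Qed.

Lemma EX_le_ae d (X : measurableType d) (R : realType) (P : probability X R) (f g : X -> R) :
  I1 P f -> I1 P g -> (\forall w \ae P, f w <= g w) -> EX P f <= EX P g.
Proof.
move=> If Ig fg; rewrite -subr_le0 -EXB//; apply: EX_le_cst_ae; first exact: I1B.
by apply: filterS fg => w; rewrite subr_le0.
Qed.

(** The quantity expanded is the factor by which the density changes when the rate [r] becomes
    [r (1 + e h)]: the [x i] are the values of [h] at the jumps and [V] is the compensator. A
    remainder of order [e^2], uniform in the path, allows differentiation under the expectation. *)
Lemma prod_exp_expansion (R : realType) (I : Type) (s : seq I) (p : pred I) (x : I -> R) (e V B : R) :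
  (forall i, 0 <= x i) -> 0 < e -> 0 <= V <= B -> \sum_(i <- s | p i) x i <= B -> e * B <= 2^-1 ->
  `|\prod_(i <- s | p i) (1 + e * x i) * expR (- (e * V)) - 1
    - e * (\sum_(i <- s | p i) x i - V)| <= 7 * B ^+ 2 * e ^+ 2.
Proof.
move=> x0 e0 /andP[V0 VB] SB eB.
set S := \sum_(i <- s | p i) x i in SB *; set pr := \prod_(_ <- _ | _) _.
have S0 : 0 <= S by apply: sumr_ge0.
have [p1 p2] : 1 + e * S <= pr /\ pr <= expR (e * S).
  rewrite /pr /S; elim: s {S pr SB S0} => [|a s [IH1 IH2]]; first by rewrite !big_nil !mulr0 addr0 expR0.
  rewrite !big_cons; case: (p a) => //.
  have s0 : 0 <= \sum_(i <- s | p i) x i by apply: sumr_ge0.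
  have p0 : 0 <= \prod_(i <- s | p i) (1 + e * x i).
    by apply: prodr_ge0 => i _; rewrite addr_ge0// mulr_ge0// ltW.
  have ea : 0 <= e * x a by rewrite mulr_ge0// ltW.
  split; last by rewrite mulrDr expRD ler_pM ?addr_ge0// expR_ge1Dx.
  apply: le_trans (ler_wpM2l _ IH1); last by rewrite addr_ge0.
  by have := mulr_ge0 ea (mulr_ge0 (ltW e0) s0); lra.
have eS0 : 0 <= e * S by exact: mulr_ge0 (ltW e0) S0.
have eV0 : 0 <= e * V by exact: mulr_ge0 (ltW e0) V0.
have eSB : e * S <= e * B by rewrite ler_wpM2l// ltW.
have eVB : e * V <= e * B by rewrite ler_wpM2l// ltW.
have eS2 : `|e * S| <= 2^-1 by rewrite ger0_norm// (le_trans eSB).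
have eV2 : `|- (e * V)| <= 2^-1 by rewrite normrN ger0_norm// (le_trans eVB).
have [h1 _] := expR_bounds eS2; have [h2 _] := expR_bounds eV2.
have q1 : expR (- (e * V)) <= 1 by rewrite -expR0 ler_expR oppr_le0.
have q0 := expR_gt0 (- (e * V)).
have B0 := le_trans V0 VB.
have sq1 : (e * S) ^+ 2 <= (e * B) ^+ 2 by rewrite lerXn2r ?nnegrE// (le_trans eS0).
have sq2 : (e * V) ^+ 2 <= (e * B) ^+ 2 by rewrite lerXn2r ?nnegrE// (le_trans eV0).
have sq3 : (e * S) * (e * V) <= (e * B) ^+ 2 by rewrite expr2 ler_pM.
have sq4 : 0 <= (e * S) * (e * V) by rewrite mulr_ge0.
move: h1 h2; rewrite !real_normK ?num_real// sqrrN.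
set q := expR (- (e * V)) in q1 q0 *.
have -> : 7 * B ^+ 2 * e ^+ 2 = 7 * (e * B) ^+ 2 by ring.
(* With [b = (e B)^2] the three terms are bounded by [2 b], [4 b] and [b], whence the constant 7. *)
have -> : pr * q - 1 - e * (S - V) =
   (pr - 1 - e * S) * q + (q - 1 - - (e * V)) * (1 + e * S) - (e * S) * (e * V) by ring.
rewrite (ger0_norm eS0) in eS2; move: eS2 eS0.
move: p1 p2 sq1 sq2 sq3 sq4; move: (expR (e * S)) (e * S) (e * V) ((e * B) ^+ 2).
move=> ex es ev b p1 p2 sq1 sq2 sq3 sq4 es2 es0 h1 h2.
apply: le_trans (ler_normB _ _) _; rewrite (ger0_norm sq4).
apply: (@le_trans _ _ (2 * b + 4 * b + b)); last by lra.
apply: lerD => //; apply: le_trans (ler_normD _ _) _; apply: lerD; rewrite normrM.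
  rewrite (ger0_norm (ltW q0)) -[leRHS]mulr1; apply: ler_pM => //; first exact: ltW.
  rewrite ger0_norm; last by lra.
  by move: h1; rewrite ler_norml => /andP[_]; lra.
apply: (@le_trans _ _ (2 * b * 2)); last by lra.
have p0 : 0 <= 1 + es by rewrite addr_ge0.
by apply: ler_pM => //; [lra|rewrite ger0_norm//; lra].
Qed.

Lemma Rint_dct d (X : measurableType d) (R : realType) (mu : {measure set X -> \bar R})
    (D : set X) (f_ : nat -> X -> R) (f g : X -> R) : measurable D ->
  (forall n, measurable_fun D (f_ n)) -> measurable_fun D f ->
  (forall x, D x -> f_ ^~ x @ \oo --> f x) -> mu.-integrable D (EFin \o g) ->
  (forall n x, D x -> `|f_ n x| <= g x) ->
  mu.-integrable D (EFin \o f) /\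
  \int[mu]_(x in D) f_ n x @[n --> \oo] --> \int[mu]_(x in D) f x.
Proof.
move=> mD mf_ mf cf ig fg.
have [] := @dominated_convergence _ _ _ mu D mD (fun n => EFin \o f_ n) (EFin \o f) (EFin \o g) _ _ _ ig _.
- by move=> n; exact/measurable_EFinP.
- exact/measurable_EFinP.
- by apply: aeW => x Dx; apply: cvg_EFin; [exact: nearW|exact: cf].
- by apply: aeW => x n Dx; rewrite /= lee_fin; exact: fg.
move=> If _ cE; split=> //; apply: fine_cvg.
by rewrite fineK; [exact: cE|exact: integrable_fin_num].
Qed.

Lemma integrable_le d (X : measurableType d) (R : realType) (mu : {measure set X -> \bar R})
    (D : set X) (f g : X -> R) : measurable D -> measurable_fun D f ->
  mu.-integrable D (EFin \o g) -> (forall x, D x -> `|f x| <= g x) ->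
  mu.-integrable D (EFin \o f).
Proof.
move=> mD mf ig fg; apply: le_integrable ig => //; first exact/measurable_EFinP.
by move=> x Dx /=; rewrite lee_fin (le_trans (fg x Dx))// ler_norm.
Qed.

Section MartingaleSums.
Context {dO} {Omega : measurableType dO} {R : realType}.
Variable P : probability Omega R.
Variable F : R -> set (set Omega).
Hypotheses (sF : forall t, sigma_algebra setT (F t)) (mF : forall t, F t `<=` measurable)
  (leF : forall s t, s <= t -> F s `<=` F t).
Local Notation martingale2 := (martingale2 P F).

Lemma martingale2S a a' b w : a <= a' -> martingale2 a b w -> martingale2 a' b w.
Proof.
move=> aa [mw w2 ow]; split=> [s /andP[as_ sb]|s /andP[as_ sb]|u v G au uv vb FG].
- by apply: mw; rewrite sb (le_trans aa).
- by apply: w2; rewrite sb (le_trans aa).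
- by apply: ow => //; exact: le_trans au.
Qed.

Lemma martingale2_meas a b w s : martingale2 a b w -> a <= s <= b -> forall s', s <= s' ->
  measurable_fun (setT : set (g_sigma_algebraType (F s'))) (w s).
Proof. by move=> [mw _ _] sab s' ss'; apply/(F_measP sF); apply: (meas_on_le leF ss'); exact: mw. Qed.

(** Between [u] and [v] the process only moves on the part of []s1, s2]] that lies in []u, v]], so
    its increment is [H] times an increment of [w] that starts after [s1], when [H] is known. *)
Lemma cell_martingale2 a b w s1 s2 (H : Omega -> R) c : martingale2 a b w ->
  a <= s1 -> s1 <= s2 -> s2 <= b -> meas_on (F s1) setT H -> (forall x, `|H x| <= c) ->
  martingale2 a b (fun v x => H x * (w (Num.min v s2) x - w (Num.min v s1) x)).
Proof.
move=> Mw as1 s12 s2b mH Hc; have [mw w2 ow] := Mw.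
have s1b := le_trans s12 s2b; have as2 := le_trans as1 s12.
have mab s v : a <= s -> a <= v -> v <= b -> a <= Num.min v s <= b.
  by move=> as_ av vb; rewrite le_min av as_ ge_min vb.
have mH' s : s1 <= s -> measurable_fun (setT : set (g_sigma_algebraType (F s))) H.
  by move=> s1s; apply/(F_measP sF); exact: (meas_on_le leF s1s mH).
have mHT : measurable_fun setT H by exact: (meas_on_measurable (@mF s1) mH).
have Z0 v u x : v <= s1 -> u <= v -> H x * (w (Num.min v s2) x - w (Num.min v s1) x) = 0 /\
    H x * (w (Num.min u s2) x - w (Num.min u s1) x) = 0.
  move=> vs1 uv; have us1 := le_trans uv vs1.
  by rewrite !min_l ?subrr ?mulr0// (le_trans _ s12).
split.
- move=> v /andP[av vb]; case/orP: (le_total v s1) => [vs1|s1v].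
    rewrite (_ : (fun x => _) = fun=> 0); first by apply/(F_measP sF); exact: measurable_cst.
    by apply/funext => x; have [-> _] := Z0 v v x vs1 (lexx v).
  apply/(F_measP sF); apply: measurable_funM; first exact: mH'.
  by apply: measurable_funB; apply: (martingale2_meas Mw); rewrite ?mab// ge_min lexx.
- move=> v /andP[av vb]; apply: (L2_bddM mHT Hc).
  by apply: L2B; apply: w2; exact: mab.
- move=> u v G au uv vb FG.
  case/orP: (le_total v s1) => [vs1|s1v].
    rewrite (_ : (fun x => _) = fun=> 0); first exact: EX_cst.
    by apply/funext => x; have [-> ->] := Z0 v u x vs1 uv; rewrite subrr mulr0.
  case/orP: (le_total s2 u) => [s2u|us2].
    rewrite (_ : (fun x => _) = fun=> 0); first exact: EX_cst.
    have s1u := le_trans s12 s2u.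
    apply/funext => x; rewrite !min_r ?subrr ?mulr0//.
    exact: le_trans s2u uv.
  pose u' := Num.max u s1; pose v' := Num.min v s2.
  have u'v' : u' <= v' by rewrite /u' /v' ge_max !le_min uv us2 s1v s12.
  have au' : a <= u' by rewrite le_max au.
  have v'b : v' <= b by rewrite ge_min vb.
  have E x : \1_G x * (H x * (w (Num.min v s2) x - w (Num.min v s1) x) -
      H x * (w (Num.min u s2) x - w (Num.min u s1) x)) = \1_G x * H x * (w v' x - w u' x).
    rewrite -mulrBr mulrA; congr (_ * _); rewrite /u' /v' (min_r s1v) (min_l us2).
    by case: (leP u s1) => us1; ring.
  rewrite (_ : (fun x => _) = fun x => \1_G x * H x * (w v' x - w u' x)); last exact/funext.
  have mGH : meas_on (F u') setT (fun x => \1_G x * H x).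
    apply/(F_measP sF); apply: measurable_funM; last by apply: mH'; rewrite le_max lexx orbT.
    apply: measurable_indic; rewrite measurable_g_measurableTypeE//.
    by apply: (leF _ FG); rewrite le_max lexx.
  apply: (martingale2_orth sF mF Mw au' u'v' v'b mGH).
  have mG : measurable G by exact: mF FG.
  apply: L2_I1; apply: (@L2_bddM _ _ _ P _ _ c).
  + by apply: measurable_funM => //; exact: measurable_indic.
  + move=> x; rewrite normrM -[leRHS]mul1r; apply: ler_pM => //.
    by rewrite indicE; case: (x \in G); rewrite ?normr1 ?normr0.
  + by apply: L2B; apply: w2; rewrite ?v'b ?au' ?(le_trans au')//= ?(le_trans u'v').
Qed.

Lemma martingale2_sum a b (J : Type) (s : seq J) (w : J -> R -> Omega -> R) :
  (forall i, martingale2 a b (w i)) -> martingale2 a b (fun v x => \sum_(i <- s) w i v x).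
Proof.
move=> Mw; split.
- move=> v vab; apply/(F_measP sF); apply: measurable_sum => i.
  exact: (martingale2_meas (Mw i) vab).
- by move=> v vab; apply: L2_sum => i; have [_ + _] := Mw i; exact.
- move=> u v G au uv vb FG.
  have mG : measurable G by exact: mF FG.
  have uab : a <= u <= b by rewrite au (le_trans uv).
  have vab : a <= v <= b by rewrite vb (le_trans au).
  have J1 i : I1 P (fun x => \1_G x * (w i v x - w i u x)).
    apply: L2_I1; apply: (@L2_bddM _ _ _ P _ _ 1).
    + exact: measurable_indic.
    + by move=> x; rewrite indicE; case: (x \in G); rewrite ?normr1 ?normr0.
    + by have [_ w2 _] := Mw i; apply: L2B; exact: w2.
  rewrite (_ : (fun x => _) = fun x => \sum_(i <- s) \1_G x * (w i v x - w i u x)).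
    by rewrite EX_sum// big1// => i _; have [_ _ ow] := Mw i; exact: ow.
  by apply/funext => x; rewrite -mulr_sumr sumrB.
Qed.

Lemma within_min (t T s : R) (z : R -> R) : t <= s -> {within `[t, T], continuous z} ->
  {within `[t, T], continuous (fun v => z (Num.min v s))}.
Proof.
move=> ts /subspace_continuousP cz; apply/subspace_continuousP => x /= xtT.
have mA v : v \in `[t, T] -> Num.min v s \in `[t, T].
  by rewrite !in_itv/= le_min ge_min ts andbT => /andP[-> ->].
have cm : Num.min v s @[v --> within `[t, T] (nbhs x)] --> within `[t, T] (nbhs (Num.min x s)).
  move=> B nB.
  have /(_ _ nB) : Num.min v s @[v --> x] --> Num.min x s.
    by apply: cvg_minr; [exact: cvg_id|exact: cvg_cst].
  move=> nB'; change (nbhs x (fun v => `[t, T]%classic v -> B (Num.min v s))).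
  have {}nB' : nbhs x (fun v => `[t, T]%classic (Num.min v s) -> B (Num.min v s)) by exact: nB'.
  by apply: filterS nB' => v h vtT; apply: h; exact: mA.
have cz' := cz (Num.min x s) (mA _ xtT).
exact: (@cvg_comp _ _ _ (fun v => Num.min v s) z _ _ _ cm cz').
Qed.

End MartingaleSums.

(** The sum telescopes from the first grid point [r >= x] on, and [r - x] is at most the mesh;
    continuity of [z] on [[t, T]] does the rest. *)
Lemma grid_step_cvg (R : realType) (t T x : R) (z : R -> R) : t < T ->
  {within `[t, T], continuous z} -> t <= x <= T ->
  (fun n => \sum_(l < n.+1) (x <= gridpt t T n l)%R%:R *
     (z (gridpt t T n l.+1) - z (gridpt t T n l))) @ \oo --> z T - z x.
Proof.
move=> tT /subspace_continuousP cz xtT; have /andP[tx xT] := xtT.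
set S := fun n => _.
have H n : exists r, [/\ t <= r <= T, x <= r, r - x <= (T - t) / n.+1%:R & S n = z T - z r].
  have [k kn /andP[gx xg]] := grid_floor tT n xtT.
  have [k' [k'n k1 k2 k3]] : exists k', [/\ (k' <= n.+1)%N, x <= gridpt t T n k',
      gridpt t T n k' - x <= (T - t) / n.+1%:R &
      forall l, (x <= gridpt t T n l) = (k' <= l)%N].
    have mono j l : (j < l)%N -> gridpt t T n j < gridpt t T n l.
      by move=> jl; apply: lt_le_trans (gridpt_lt tT n j) _; exact: gridpt_le.
    have [xk|xk] := eqVneq x (gridpt t T n k).
      exists k; rewrite -xk subrr lexx (ltW (mesh_gt0 tT n)); split=> // l.
      have [kl|lk] := leqP k l; first by rewrite xk gridpt_le.
      by apply/negbTE; rewrite -ltNge xk; exact: mono.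
    have {xk}gx : gridpt t T n k < x by rewrite lt_neqAle eq_sym xk.
    have kn' : (k < n.+1)%N.
      rewrite ltn_neqAle kn andbT; apply/eqP => kE.
      by move: gx; rewrite kE gridptT => /lt_le_trans/(_ xT); rewrite ltxx.
    exists k.+1; split=> //; first exact: ltW.
      by rewrite -(gridptS t T n k) lerD2l lerN2 ltW.
    move=> l; have [kl|lk] := leqP k.+1 l.
      by apply: le_trans (ltW xg) _; exact: gridpt_le.
    apply/negbTE; rewrite -ltNge (le_lt_trans _ gx)//; exact: gridpt_le.
  exists (gridpt t T n k'); split=> //; first by rewrite gridpt_ge ?gridpt_leT.
  rewrite /S -(big_mkord xpredT (fun l => (x <= gridpt t T n l)%R%:R *
     (z (gridpt t T n l.+1) - z (gridpt t T n l)))).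
  rewrite (@big_cat_nat _ _ _ k')//= big_nat_cond big1 ?add0r; last first.
    by move=> l /andP[/andP[_ lk] _]; rewrite k3 leqNgt lk mul0r.
  transitivity (\sum_(k' <= l < n.+1) (z (gridpt t T n l.+1) - z (gridpt t T n l))).
    by apply: eq_big_nat => l /andP[kl _]; rewrite k3 kl mul1r.
  by rewrite (telescope_sumr (fun l => z (gridpt t T n l)) k'n) gridptT.
have [r Hr] := choice H.
rewrite (_ : S = fun n => z T - z (r n)); last by apply/funext => n; have [] := Hr n.
apply: cvgB; first exact: cvg_cst.
have rx : r @ \oo --> x.
  apply: (@squeeze_cvgr _ _ _ _ (fun=> x) (fun n => x + (T - t) / n.+1%:R)).
  - by apply: nearW => n; have [_ -> h _] := Hr n; rewrite /= -lerBlDl.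
  - exact: cvg_cst.
  - by rewrite -[X in _ --> X]addr0; apply: cvgD; [exact: cvg_cst|exact: mesh_cvg].
have cr : r @ \oo --> within `[t, T] (nbhs x).
  move=> B nB; have h : \forall n \near \oo, `[t, T]%classic (r n) -> B (r n) := rx _ nB.
  by apply: filterS h => n; apply; have [rtT _ _ _] := Hr n; rewrite /= in_itv.
exact: (@cvg_comp _ _ _ r z _ _ _ cr (cz x xtT)).
Qed.

Lemma ae_measurable_cvg d (X : measurableType d) (R : realType) (P : {measure set X -> \bar R})
    (f : nat -> X -> R) (g : X -> R) : measure_is_complete P -> (forall n, measurable_fun setT (f n)) ->
  (\forall w \ae P, f ^~ w @ \oo --> g w) -> measurable_fun setT g.
Proof.
move=> cP mf [N [mN PN Ng]].
have out w : ~ N w -> f ^~ w @ \oo --> g w by move=> h; apply: contrapT => /Ng.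
pose f' n w := f n w * \1_(~` N) w.
have mg' : measurable_fun setT (fun w => g w * \1_(~` N) w).
  apply: (@measurable_fun_cvg _ X R setT f') => [n|w _].
    by apply: measurable_funM => //; apply: measurable_indic; exact: measurableC.
  rewrite /f' indicE; have [h|h] := pselect (N w).
    by rewrite memNset; [under eq_fun do rewrite mulr0; rewrite mulr0; exact: cvg_cst|move=> /(_ h)].
  by rewrite mem_set// mulr1; under eq_fun do rewrite mulr1; exact: out.
have mgE : measurable_fun setT (EFin \o (fun w => g w * \1_(~` N) w)) by exact/measurable_EFinP.
apply/measurable_EFinP; apply: (@ae_measurable_fun _ _ _ P cP setT _ (EFin \o g) _ mgE).
exists N; split=> // w /= h; apply: contrapT => Nw; apply: h => _.
by rewrite /= indicE mem_set// mulr1.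
Qed.

Lemma integrable_union d (X : measurableType d) (R : realType) (mu : {measure set X -> \bar R})
    (A B : set X) (f : X -> \bar R) : measurable A -> measurable B -> [disjoint A & B] ->
  mu.-integrable A f -> mu.-integrable B f -> mu.-integrable (A `|` B) f.
Proof.
move=> mA mB AB /integrableP[mfA fA] /integrableP[mfB fB].
have mf : measurable_fun (A `|` B) f by apply/measurable_funU.
apply/integrableP; split=> //; rewrite ge0_integral_setU//; first exact: lte_add_pinfty.
exact: measurableT_comp mf.
Qed.

Section StepPath.
Context {R : realType}.
Variables (th : nat -> R).
Hypothesis thS : forall n, th n <= th n.+1.

Lemma step_mono n k : (n <= k)%N -> th n <= th k.
Proof. by move=> nk; exact: (nondecreasing_seqP th).1 thS _ _ nk. Qed.

Lemma step_uniq s n k : th n < s <= th n.+1 -> th k < s <= th k.+1 -> n = k.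
Proof.
move=> /andP[a b] /andP[c e]; apply/eqP; rewrite eqn_leq; apply/andP; split; rewrite leqNgt; apply/negP => h.
  by have := lt_le_trans a (le_trans e (step_mono h)); rewrite ltxx.
by have := lt_le_trans c (le_trans b (step_mono h)); rewrite ltxx.
Qed.

Lemma step_exists s N : th 0 < s -> s <= th N -> exists2 k, (k < N)%N & th k < s <= th k.+1.
Proof.
elim: N => [|N IH] s0 sN; first by have := lt_le_trans s0 sN; rewrite ltxx.
have [h|h] := leP s (th N); last by exists N => //; rewrite h.
by have [k kN kk] := IH s0 h; exists k => //; rewrite ltnS ltnW.
Qed.

(** Left-closed cells are needed at grid points, where the value in force just to the right matters;
    integration and predictability use the left-open cells above. *)
Lemma step_uniq_co s n k : th n <= s < th n.+1 -> th k <= s < th k.+1 -> n = k.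
Proof.
move=> /andP[a b] /andP[c e]; apply/eqP; rewrite eqn_leq; apply/andP; split; rewrite leqNgt; apply/negP => h.
  by have := lt_le_trans e (le_trans (step_mono h) a); rewrite ltxx.
by have := lt_le_trans b (le_trans (step_mono h) c); rewrite ltxx.
Qed.

Lemma step_exists_co s N : th 0 <= s -> s < th N -> exists2 k, (k < N)%N & th k <= s < th k.+1.
Proof.
elim: N => [|N IH] s0 sN; first by have := le_lt_trans s0 sN; rewrite ltxx.
have [h|h] := ltP s (th N); last by exists N => //; rewrite h.
by have [k kN kk] := IH s0 h; exists k => //; rewrite ltnS ltnW.
Qed.

Lemma step_Rintegral (mu : {measure set (measurableTypeR R) -> \bar R}) (X : nat -> R -> R)
    (Y : R -> R) N :
  (forall k, (k < N)%N -> mu.-integrable `]th k, th k.+1] (EFin \o X k)) ->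
  (forall k s, (k < N)%N -> th k < s <= th k.+1 -> Y s = X k s) ->
  mu.-integrable (rset R `]th 0, th N]) (EFin \o Y) /\
  \int[mu]_(s in `]th 0, th N]) Y s = \sum_(k < N) \int[mu]_(s in `]th k, th k.+1]) X k s.
Proof.
elim: N => [|N IH] IX XY.
  rewrite set_itv_ge ?bnd_simp ?ltxx// big_ord0 Rintegral_set0; split=> //.
  exact: integrable_set0.
have [||IY EY] := IH; [by move=> k kN; apply: IX; exact: ltnW|by move=> k s kN; apply: XY; exact: ltnW|].
have mI a b : measurable (rset R `]a, b]) by exact: measurable_itv.
have E : (`]th 0, th N.+1] = `]th 0, th N] `|` `]th N, th N.+1] :> set (measurableTypeR R))%classic.
  by rewrite -itv_bndbnd_setU// bnd_simp step_mono.
have YX : {in (rset R `]th N, th N.+1]), EFin \o X N =1 EFin \o Y}.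
  by move=> s; rewrite inE/= in_itv/= => h; rewrite (XY N).
have IY' : mu.-integrable (rset R `]th N, th N.+1]) (EFin \o Y).
  exact: (@eq_integrable _ (measurableTypeR R) R mu _ (mI (th N) (th N.+1)) (EFin \o X N) (EFin \o Y) YX (IX _ (ltnSn N))).
have dj : [disjoint (`]th 0, th N] : set (measurableTypeR R))%classic & (`]th N, th N.+1] : set (measurableTypeR R))%classic].
  apply/disj_setPS => s [] /=; rewrite !in_itv/= => /andP[_ a] /andP[b _].
  by have := lt_le_trans b a; rewrite ltxx.
have IYU : mu.-integrable (rset R `]th 0, th N.+1]) (EFin \o Y).
  by rewrite E; apply: integrable_union.
split=> //; rewrite E Rintegral_setU//; last first.
  by rewrite -E.
rewrite big_ord_recr/= EY; congr (_ + _).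
by apply: eq_Rintegral => s sI; have [] := YX s sI.
Qed.

End StepPath.

(** The integral of a nonnegative function is a supremum over the simple functions below it, so it
    is monotone for arbitrary functions. The integrands in the definitions of the spaces are only
    known to be measurable on part of their domain. *)
Lemma ge0_le_integral_dom d (X : measurableType d) (R : realType) (mu : {measure set X -> \bar R})
    (D : set X) (f g : X -> \bar R) : (forall x, D x -> 0 <= f x)%E ->
  (forall x, D x -> f x <= g x)%E -> (\int[mu]_(x in D) f x <= \int[mu]_(x in D) g x)%E.
Proof.
move=> f0 fg; rewrite (integral_mkcond D f) (integral_mkcond D g).
have f0' x : (0 <= (f \_ D) x)%E by rewrite patchE; case: ifPn => // /set_mem/f0.
have fg' x : ((f \_ D) x <= (g \_ D) x)%E by rewrite !patchE; case: ifPn => // /set_mem/fg.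
rewrite !ge0_integralTE//; last by move=> x; exact: le_trans (fg' x).
apply: ub_ereal_sup => _ [h hf <-]; apply: ereal_sup_ubound; exists h => // x.
exact: le_trans (hf x) (fg' x).
Qed.

Lemma ae_le_integral_dom d (X : measurableType d) (R : realType) (mu : {measure set X -> \bar R})
    (f g : X -> \bar R) : measurable_fun setT f -> (forall x, 0 <= f x)%E -> (forall x, 0 <= g x)%E ->
  (\forall x \ae mu, (f x <= g x)%E) -> (\int[mu]_x f x <= \int[mu]_x g x)%E.
Proof.
move=> mf f0 g0 [N [mN N0 Nfg]].
rewrite (ge0_negligible_integral mN measurableT mf (fun x _ => f0 x) N0).
apply: (@le_trans _ _ (\int[mu]_(x in setT `\` N) g x)%E).
  by apply: ge0_le_integral_dom => // x [_ Nx]; apply: contrapT => h; apply: Nx; exact: Nfg.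
rewrite [leLHS]integral_mkcond; apply: ge0_le_integral_dom => x _; rewrite patchE; case: ifP => // _.
Qed.

(** [p] is the time coordinate: the identity for [dA] and Lebesgue measure, the first projection for
    the point measure. The proof is dominated convergence along sequences approaching [s] from the
    right. *)
Lemma Rint_right_cont d (X : measurableType d) (R : realType) (mu : {measure set X -> \bar R})
    (h : X -> R) (p : X -> R) (D : set X) (s : R) : measurable D -> measurable_fun setT p ->
  mu.-integrable D (EFin \o h) ->
  \int[mu]_(x in D `&` [set x | v < p x]) h x @[v --> s^'+] --> \int[mu]_(x in D `&` [set x | s < p x]) h x.
Proof.
move=> mD mp ih.
have mh : measurable_fun D h by apply/measurable_EFinP; exact: (measurable_int _ ih).
have mS v : measurable [set x | v < p x].
  by rewrite -[X in measurable X]setTI; exact: (measurable_fun_ltr (measurable_cst v) mp).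
have E v : \int[mu]_(x in D `&` [set x | v < p x]) h x =
    \int[mu]_(x in D) (h x * \1_[set x | v < p x] x).
  rewrite /Rintegral integral_mkcondr; congr fine; apply: eq_integral => x _.
  by rewrite patchE indicE; case: ifP => xv; rewrite ?mulr1 ?mulr0.
apply/cvg_at_rightP => u [us uc]; rewrite E.
under eq_fun do rewrite E.
apply: (@Rint_dct _ _ _ mu D (fun n x => h x * \1_[set x | u n < p x] x) _ (fun x => `|h x|) mD _ _ _ _ _).2.
- by move=> n; apply: measurable_funM => //; apply: measurable_indic.
- by apply: measurable_funM => //; apply: measurable_indic.
- move=> x Dx; apply: cvgMl_tmp; rewrite indicE; have [sp|ps] := ltP s (p x).
    rewrite mem_set//; apply: cvg_near_cst.
    have h0 : \forall n \near \oo, u n < p x := uc _ (lt_nbhsl sp).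
    by apply: filterS h0 => n /= h1; rewrite indicE mem_set.
  rewrite memNset; last by move=> /= h1; have := lt_le_trans h1 ps; rewrite ltxx.
  apply: cvg_near_cst; apply: nearW => n; rewrite indicE memNset//= => h1.
  by have := lt_trans (lt_le_trans h1 ps) (us n); rewrite ltxx.
- exact: (integrable_norm ih).
- by move=> n x Dx; rewrite normrM indicE; case: (x \in _); rewrite ?normr1 ?normr0 ?mulr1 ?mulr0.
Qed.

(** Turns the finite weighted moment [h] in the definition of a space into two usable facts on the
    unweighted integrand [g]: integrability along almost every path and an integrable total. *)
Lemma random_moment d d' (X : measurableType d) (S : measurableType d') (R : realType)
    (P : probability X R) (nu : X -> {measure set S -> \bar R}) (D : set S) (g : S -> X -> R)
    (h : S -> X -> \bar R) : measurable D ->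
  (forall w, measurable_fun D (g ^~ w)) -> (forall s w, 0 <= g s w) -> (forall s w, 0 <= h s w)%E ->
  measurable_fun setT (fun w => \int[nu w]_(s in D) (g s w)%:E)%E ->
  (\forall w \ae P, forall s, D s -> ((g s w)%:E <= h s w)%E) ->
  (\int[P]_w \int[nu w]_(s in D) h s w < +oo)%E ->
  (\forall w \ae P, (nu w).-integrable D (EFin \o (g ^~ w))) /\
  I1 P (fun w => \int[nu w]_(s in D) g s w).
Proof.
move=> mD mg g0 h0 mI gh fin.
pose V w := (\int[nu w]_(s in D) (g s w)%:E)%E.
have V0 w : (0 <= V w)%E by apply: integral_ge0 => s _; rewrite lee_fin.
have VI : P.-integrable setT V.
  apply/integrableP; split=> //; rewrite (eq_integral V); last by move=> w _; rewrite gee0_abs.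
  apply: le_lt_trans fin; apply: ae_le_integral_dom => //.
    by move=> w; apply: integral_ge0.
  by apply: filterS gh => w gh; apply: ge0_le_integral_dom => s Ds; [rewrite lee_fin|exact: gh].
have Vae : \forall w \ae P, (V w < +oo)%E.
  have := integrable_ae measurableT VI; apply: filterS => w /(_ I).
  by rewrite fin_numE -ltey => /andP[].
split.
  apply: filterS Vae => w Vw; apply/integrableP; split; first exact/measurable_EFinP.
  apply: le_lt_trans Vw; rewrite le_eqVlt; apply/orP; left; apply/eqP.
  by apply: eq_integral => s _ /=; rewrite ger0_norm.
apply: (@eq_integrable _ _ _ P setT measurableT (fun w => (fine (V w))%:E)) => [w _ //|].
apply/integrableP; split; first by apply/measurable_EFinP/measurableT_comp.
have [_] := integrableP _ _ _ VI; apply: le_lt_trans; apply: ge0_le_integral_dom => // w _.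
by have := V0 w; case: (V w) => [r||] //= _; rewrite normr0 leey.
Qed.

Lemma ae_and d (X : measurableType d) (R : realType) (mu : {measure set X -> \bar R}) (A B : X -> Prop) :
  (\forall x \ae mu, A x) -> (\forall x \ae mu, B x) -> \forall x \ae mu, A x /\ B x.
Proof. by move=> hA hB; apply: filterS2 hA hB => x. Qed.

(** An identity known almost surely at each fixed time holds simultaneously at all rational times,
    outside one null set; right continuity then carries it to every time. *)
Lemma right_cont_rat_eq0 (R : realType) (D : R -> R) (t T : R) : t < T ->
  D s @[s --> t^'+] --> D t -> (forall q : rat, t < ratr q < T -> D (ratr q) = 0) -> D t = 0.
Proof.
move=> tT cD Dq; apply: contrapT => /eqP Dt.
have e0 : 0 < `|D t| by rewrite normr_gt0.
have [e /= e1 he] : \forall s \near t^'+, `|D t - D s| < `|D t| by move/cvgrPdist_lt: cD; apply.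
have tm : t < Num.min T (t + e) by rewrite lt_min tT ltrDl.
have [q] := rat_in_itvoo tm; rewrite in_itv/= lt_min => /andP[tq /andP[qT qe]].
have hq : `|t - ratr q| < e by rewrite ltr0_norm ?subr_lt0// opprB ltrBlDl.
by have := he (ratr q) hq tq; rewrite /= Dq ?tq ?qT// subr0 ltxx.
Qed.

Lemma Rint_itv_right_cont (R : realType) (mu : {measure set (measurableTypeR R) -> \bar R}) (h : R -> R) (s T : R) :
  0 <= s -> itg mu 0 T h ->
  \int[mu]_(x in `]v, T]) h x @[v --> s^'+] --> \int[mu]_(x in `]s, T]) h x.
Proof.
move=> s0 ih.
have E v : 0 <= v -> (`]0, T]%classic `&` [set x | v < x])%classic = `]v, T]%classic.
  move=> v0; apply/seteqP; split=> x /=; rewrite !in_itv/=; first by move=> [/andP[_ ->] ->].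
  by move=> /andP[vx xT]; rewrite vx xT (le_lt_trans v0).
have := @Rint_right_cont _ (measurableTypeR R) R mu h id `]0, T]%classic s (measurable_itv _) (@measurable_id _ _ setT) ih.
rewrite E//; apply: cvg_trans; apply: near_eq_cvg; near=> v; rewrite E//.
by rewrite (le_trans s0)// ltW//; near: v; exact: nbhs_right_gt.
Unshelve. all: by end_near.
Qed.

Lemma Rint_itv_cat (R : realType) (mu : {measure set (measurableTypeR R) -> \bar R}) (h : R -> R) (u v T : R) :
  0 <= u -> u <= v -> v <= T -> itg mu 0 T h ->
  \int[mu]_(x in `]u, T]) h x = \int[mu]_(x in `]u, v]) h x + \int[mu]_(x in `]v, T]) h x.
Proof.
move=> u0 uv vT ih.
have E : (`]u, T] = `]u, v] `|` `]v, T] :> set (measurableTypeR R))%classic.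
  by rewrite -itv_bndbnd_setU// bnd_simp.
have mE (a b : R) : measurable (rset R `]a, b]) by exact: measurable_itv.
rewrite E Rintegral_setU//.
- rewrite -E; apply: integrableS ih => //.
  by move=> x /=; rewrite !in_itv/= => /andP[ux ->]; rewrite (le_lt_trans u0).
- apply/disj_setPS => s [] /=; rewrite !in_itv/= => /andP[_ a] /andP[b _].
  by have := lt_le_trans b a; rewrite ltxx.
Qed.

(** Unlike right continuity, left continuity requires that [s] carry no mass; continuity of [A]
    enters here. *)
Lemma Rint_left_cont (R : realType) (mu : {measure set (measurableTypeR R) -> \bar R}) (h : R -> R) (s T : R) :
  mu [set s] = 0%E -> 0 < s -> itg mu 0 T h ->
  \int[mu]_(x in `]v, T]) h x @[v --> s^'-] --> \int[mu]_(x in `]s, T]) h x.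
Proof.
move=> mus s0 ih; have mI (a b : R) : measurable (rset R `]a, b]) by exact: measurable_itv.
have mh : measurable_fun (rset R `]0, T]) h.
  by apply/measurable_EFinP; exact: (measurable_int _ ih).
have mS (v : R) : measurable ([set x | v < x] : set (measurableTypeR R)).
  rewrite (_ : [set _ | _] = `]v, +oo[%classic); first exact: measurable_itv.
  by apply/seteqP; split=> x /=; rewrite in_itv/= andbT.
have E v : 0 <= v -> \int[mu]_(x in `]v, T]) h x =
    \int[mu]_(x in `]0, T]) (h x * \1_[set x | v < x] x).
  move=> v0; rewrite /Rintegral (_ : `]v, T]%classic = (`]0, T] `&` [set x | v < x])%classic); last first.
    apply/seteqP; split=> x /=; rewrite !in_itv/=; last by move=> [/andP[_ ->] ->].
    by move=> /andP[vx xT]; rewrite vx xT (le_lt_trans v0).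
  rewrite integral_mkcondr; congr fine; apply: eq_integral => x _.
  by rewrite patchE indicE; case: ifP => xv; rewrite ?mulr1 ?mulr0.
have mi (v : R) : measurable_fun (rset R `]0, T]) (fun x => h x * \1_[set x | v < x] x).
  by apply: measurable_funM => //; apply: measurable_indic.
apply/cvg_at_leftP => u [us uc].
have uc0 : \forall n \near \oo, 0 <= u n.
  have h0 : \forall n \near \oo, 0 < u n := uc _ (lt_nbhsr s0).
  by apply: filterS h0 => n /ltW.
rewrite (E _ (ltW s0)).
have : \int[mu]_(x in `]0, T]) (h x * \1_[set x | u n < x] x) @[n --> \oo] -->
       \int[mu]_(x in `]0, T]) (h x * \1_[set x | s < x] x).
  have [] := @dominated_convergence _ _ _ mu _ (mI 0 T) (fun n x => (h x * \1_[set x | u n < x] x)%:E)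
     (fun x => (h x * \1_[set x | s < x] x)%:E) (fun x => `|(h x)%:E|%E) _ _ _ _ _.
  - by move=> n; exact/measurable_EFinP.
  - exact/measurable_EFinP.
  - exists [set s]; split=> // x /=; apply: contra_notP => /= xs _; apply: cvg_EFin; first exact: nearW.
    have cn (b : R) : (\forall n \near \oo, (\1_[set x | u n < x] x : R) = b) -> (\1_[set x | s < x] x : R) = b ->
        fine \o (fun n => (h x * \1_[set x | u n < x] x)%:E) @ \oo --> h x * \1_[set x | s < x] x.
      by move=> h1 ->; apply: cvg_near_cst; apply: filterS h1 => n /= ->.
    have /orP[sx|xs'] : (s < x) || (x < s) by rewrite orbC -neq_lt; apply/eqP.
      apply: (cn 1); last by rewrite indicE mem_set.
      by apply: nearW => n; rewrite indicE mem_set//=; exact: lt_trans (us n) sx.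
    apply: (cn 0); last by rewrite indicE memNset//= => h1; have := lt_trans h1 xs'; rewrite ltxx.
    have h0 : \forall n \near \oo, x < u n := uc _ (lt_nbhsr xs').
    by apply: filterS h0 => n h1; rewrite indicE memNset//= => h2; have := lt_trans h1 h2; rewrite ltxx.
  - exact: (integrable_abse ih).
  - apply: aeW => x n _; rewrite /= lee_fin normrM indicE; case: (x \in _); rewrite ?normr1 ?normr0 ?mulr1 ?mulr0//.
  move=> If _ cE; apply: fine_cvg.
  by rewrite fineK; [exact: cE|exact: integrable_fin_num].
apply: cvg_trans; apply: near_eq_cvg; apply: filterS uc0 => n /E ->//.
Qed.

Lemma cvg_left_right (R : realType) (f : R -> R) (s : R) :
  f x @[x --> s^'-] --> f s -> f x @[x --> s^'+] --> f s -> f x @[x --> s] --> f s.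
Proof. by move=> fl fr; apply/left_right_continuousP. Qed.

Lemma Rint_continuous (R : realType) (mu : {measure set (measurableTypeR R) -> \bar R}) (h : R -> R) (T : R) :
  0 < T -> (forall s, 0 < s -> mu [set s] = 0%E) ->
  itg mu 0 T h ->
  {within `[0, T], continuous (fun v => \int[mu]_(x in `]v, T]) h x)}.
Proof.
move=> T0 mus ih; apply/(continuous_within_itvP _ T0); split.
- move=> s; rewrite in_itv/= => /andP[s0 sT]; apply: cvg_left_right.
    by apply: Rint_left_cont => //; exact: mus.
  by apply: Rint_itv_right_cont => //; exact: ltW.
- exact: Rint_itv_right_cont.
- by apply: Rint_left_cont => //; exact: mus.
Qed.

Lemma right_cont_rat_ge0 (R : realType) (D : R -> R) (t T : R) : t < T ->
  D s @[s --> t^'+] --> D t -> (forall q : rat, t < ratr q < T -> 0 <= D (ratr q)) -> 0 <= D t.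
Proof.
move=> tT cD Dq; rewrite leNgt; apply/negP => Dt.
have e0 : 0 < - D t by rewrite oppr_gt0.
have [e /= e1 he] : \forall s \near t^'+, `|D t - D s| < - D t by move/cvgrPdist_lt: cD; apply.
have tm : t < Num.min T (t + e) by rewrite lt_min tT ltrDl.
have [q] := rat_in_itvoo tm; rewrite in_itv/= lt_min => /andP[tq /andP[qT qe]].
have hq : `|t - ratr q| < e by rewrite ltr0_norm ?subr_lt0// opprB ltrBlDl.
have := he (ratr q) hq tq; rewrite ltr_distlC => /andP[_].
by rewrite subrr ltNge Dq// tq qT.
Qed.

Lemma within_right_cvg (R : realType) (z : R -> R) (T s : R) : 0 < T -> 0 <= s -> s < T ->
  {within `[0, T], continuous z} -> z v @[v --> s^'+] --> z s.
Proof.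
move=> T0 s0 sT /(continuous_within_itvP _ T0)[cz z0 _].
move: s0; rewrite le_eqVlt => /predU1P[<-//|s0].
by apply: cvg_at_right_filter; apply: cz; rewrite in_itv/= s0.
Qed.

Lemma within_left_cvg (R : realType) (z : R -> R) (T s : R) : 0 < T -> 0 < s -> s <= T ->
  {within `[0, T], continuous z} -> z v @[v --> s^'-] --> z s.
Proof.
move=> T0 s0 sT /(continuous_within_itvP _ T0)[cz _ zT].
move: sT; rewrite le_eqVlt => /predU1P[->//|sT].
by apply: cvg_at_left_filter; apply: cz; rewrite in_itv/= s0.
Qed.

Lemma ord_neq m (i : 'I_m) : (2 <= m)%N -> exists j : 'I_m, j != i.
Proof.
case: m i => [|[|m]] // i _; have [->|i0] := eqVneq i ord0; last by exists ord0; rewrite eq_sym.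
by exists (lift ord0 ord0); rewrite eq_sym neq_lift.
Qed.

Section BarrierValue.
Context {R : realType} {dO : measure_display} {Omega : measurableType dO} {m : nat}.
Variables (C : 'I_m -> 'I_m -> R -> Omega -> R) (Y : 'I_m -> R -> Omega -> R).
Hypothesis m2 : (2 <= m)%N.

Lemma barrierP i t w : (exists2 j, j != i & barrier C Y i t w = Y j t w - C i j t w) /\
  forall j, j != i -> Y j t w - C i j t w <= barrier C Y i t w.
Proof.
have [j0 ji] := ord_neq i m2.
pose G j : \bar R := (Y j t w - C i j t w)%:E.
have E : (\big[Order.max/-oo%E]_(j < m | j != i) G j)%O = G [arg max_(j > j0 | j != i) G j]%O.
  by apply: (@bigmax_eq_arg _ _ _ _ j0 (fun j => j != i) G ji) => j _; exact: leNye.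
have Eb : barrier C Y i t w = Y [arg max_(j > j0 | j != i) G j]%O t w - C i [arg max_(j > j0 | j != i) G j]%O t w.
  by rewrite /barrier -/G E.
case: arg_maxP E Eb => // j jn jmax _ Eb; split; first by exists j.
by move=> k ki; rewrite Eb -lee_fin; exact: jmax.
Qed.

Lemma barrier_path_measurable i w (D : set (measurableTypeR R)) : measurable D ->
  (forall j, measurable_fun D (Y j ^~ w)) -> (forall j, measurable_fun D (C i j ^~ w)) ->
  measurable_fun D (fun s => barrier C Y i s w).
Proof.
move=> mD mY mC; apply: measurableT_comp => //.
have : forall s : seq 'I_m, measurable_fun D (fun x =>
    (\big[Order.max/-oo%E]_(j <- s | j != i) (Y j x w - C i j x w)%:E)%O).
  elim=> [|j s IH]; first by under eq_fun do rewrite big_nil; exact: measurable_cst.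
  under eq_fun do rewrite big_cons.
  case: (j != i) => //; apply: measurable_maxe => //.
  by apply/measurable_EFinP; exact: measurable_funB.
exact.
Qed.

End BarrierValue.

(** Summation by parts. With [a k] and [b k] the values at the beginning and at the end of period
    [k], the decreases over the periods add up to the total decrease minus the drops at the
    switches. *)
Lemma sum_switch (R : realType) (a b : nat -> R) n :
  \sum_(k < n.+1) (a k - b k) = a 0%N - b n - \sum_(k < n) (b k - a k.+1).
Proof.
elim: n => [|n IH]; first by rewrite big_ord_recl !big_ord0 addr0 subr0.
by rewrite big_ord_recr IH /= [in RHS]big_ord_recr/=; ring.
Qed.

(** * Conditional expectations *)

Section SubDensity.
Context {R : realType} {dO : measure_display} {Omega : measurableType dO}.
Variables (P : probability Omega R) (G : set (set Omega)).
Hypotheses (sG : sigma_algebra setT G) (mG : G `<=` measurable).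
Local Notation TG := (g_sigma_algebraType G).

Let TG_measurable (B : set TG) : measurable B -> measurable (B : set Omega).
Proof. by move=> mB; apply: mG; rewrite -(measurable_g_measurableTypeE sG). Qed.

(** The identity as a measurable map into the coarser space; integrals against the restricted
    probability are pushforward integrals along it. *)
Let toG : Omega -> TG := id.

Let mid : measurable_fun setT toG.
Proof. by move=> _ B mB; rewrite setTI; exact: TG_measurable. Qed.

Variable h : Omega -> R.
Hypotheses (mh : measurable_fun setT h) (h0 : forall w, 0 <= h w).

(** Radon-Nikodym on the sub-sigma-algebra: [h dP] and [P], both restricted to [G], are finite
    measures and the first is dominated by the second; the derivative is the conditional expectation
    of [h]. *)
Definition sub_density (B : set TG) : \bar R := (\int[P]_(x in (B : set Omega)) (h x)%:E)%E.

Let d0 : sub_density set0 = 0%E. Proof. exact: integral_set0. Qed.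

Let d_ge0 B : (0 <= sub_density B)%E.
Proof. by apply: integral_ge0 => x _; rewrite lee_fin. Qed.

Let d_add : semi_sigma_additive sub_density.
Proof.
move=> FF mF tF mUF.
have mhE : measurable_fun setT (EFin \o h) by exact/measurable_EFinP.
apply: (@semi_sigma_additive_nng_induced _ Omega R P _ mhE (fun x => _) FF) => //.
- by move=> k; exact: TG_measurable.
- exact: TG_measurable.
Qed.

HB.instance Definition _ := isMeasure.Build _ TG R sub_density d0 d_ge0 d_add.

Hypothesis Ih : I1 P h.

Let d_fin : fin_num_fun sub_density.
Proof.
move=> B mB; rewrite ge0_fin_numE ?d_ge0//.
have [mhE] := integrableP _ _ _ Ih; apply: le_lt_trans.
rewrite /sub_density integral_mkcond; apply: ge0_le_integral_dom => x _; rewrite patchE.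
  by case: ifP => // _; rewrite lee_fin.
by case: ifP => // _; rewrite gee0_abs// lee_fin.
Qed.

HB.instance Definition _ := Measure_isFinite.Build _ TG R sub_density d_fin.

Definition sub_prob (B : set TG) : \bar R := P (B : set Omega).

Let p0 : sub_prob set0 = 0%E. Proof. exact: measure0. Qed.

Let p_ge0 B : (0 <= sub_prob B)%E. Proof. exact: measure_ge0. Qed.

Let p_add : semi_sigma_additive sub_prob.
Proof.
move=> FF mF tF mUF; apply: (@measure_semi_sigma_additive _ _ _ P FF) => //.
- by move=> k; exact: TG_measurable.
- exact: TG_measurable.
Qed.

HB.instance Definition _ := isMeasure.Build _ TG R sub_prob p0 p_ge0 p_add.

Let p_fin : fin_num_fun sub_prob.
Proof. by move=> B mB; exact: (fin_num_measure P _ (TG_measurable mB)). Qed.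

HB.instance Definition _ := Measure_isFinite.Build _ TG R sub_prob p_fin.

Let sub_prob_integral (f : TG -> \bar R) (B : set TG) : measurable B -> measurable_fun setT f ->
  (forall x, 0 <= f x)%E ->
  (\int[sub_prob]_(x in B) f x = \int[P]_(x in (B : set Omega)) f x)%E.
Proof.
move=> mB mf f0; transitivity (\int[pushforward P toG]_(x in B) f x)%E; first exact: eq_measure_integral.
by rewrite ge0_integral_pushforward//; exact: measurable_funTS.
Qed.

Lemma sub_density_exists : exists f : Omega -> \bar R, [/\ forall x, (0 <= f x)%E,
  measurable_fun (setT : set TG) f &
  forall B, G B -> (\int[P]_(x in B) (h x)%:E = \int[P]_(x in B) f x)%E].
Proof.
have dom : sub_density `<< sub_prob.
  apply/null_content_dominatesP => A mA PA.
  apply: null_set_integral; [exact: TG_measurable|exact/measurable_funTS/measurable_EFinP|exact: PA].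
have [f [f0 If fE]] := radon_nikodym_finite dom.
have mf := measurable_int _ If.
exists f; split=> // B GB.
have mB : measurable (B : set TG) by rewrite measurable_g_measurableTypeE.
by have := fE B mB; rewrite sub_prob_integral.
Qed.

End SubDensity.

Lemma integral_le_gen d (X : measurableType d) (R : realType) (mu : {measure set X -> \bar R})
    (D : set X) (f g : X -> \bar R) : (forall x, D x -> f x <= g x)%E ->
  (\int[mu]_(x in D) f x <= \int[mu]_(x in D) g x)%E.
Proof.
move=> fg; rewrite [leLHS]integralE [leRHS]integralE; apply: leeB.
  apply: ge0_le_integral_dom => x Dx; first exact: funepos_ge0.
  rewrite !funeposE ge_max !le_max lexx orbT andbT; apply/orP; left; exact: fg.
apply: ge0_le_integral_dom => x Dx; first exact: funeneg_ge0.
by rewrite !funenegE ge_max !le_max lexx orbT andbT leeN2 fg.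
Qed.

(** [g] may have an infinite integral, in which case both sides equal [-oo]. This case has to be
    covered, since the switching costs of an admissible strategy may fail to be integrable. *)
Lemma integral_sub_ge0 d (X : measurableType d) (R : realType) (mu : {measure set X -> \bar R})
    (D : set X) (f : X -> R) (g : X -> \bar R) : measurable D -> mu.-integrable D (EFin \o f) ->
  measurable_fun D g -> (forall x, 0 <= g x)%E ->
  (\int[mu]_(x in D) ((f x)%:E - g x) = \int[mu]_(x in D) (f x)%:E - \int[mu]_(x in D) g x)%E.
Proof.
move=> mD If mg g0; have [gfin|] := ltP (\int[mu]_(x in D) g x)%E +oo%E.
  apply: integralB => //; apply/integrableP; split=> //.
  by under eq_integral do rewrite gee0_abs//.
rewrite leye_eq => /eqP goo; rewrite goo.
have fe : (\int[mu]_(x in D) (f x)%:E)%E \is a fin_num by exact: integrable_fin_num If.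
rewrite [RHS]addeC addNye ?ltey_eq ?fe// integralE.
have [mfE fa] := integrableP _ _ _ If.
have mfg : measurable_fun D (fun x => (f x)%:E - g x)%E by exact: emeasurable_funB.
have pos : (\int[mu]_(x in D) (fun x => (f x)%:E - g x)%E^\+ x < +oo)%E.
  apply: le_lt_trans fa; apply: ge0_le_integral_dom => x Dx; first exact: funepos_ge0.
  rewrite funeposE ge_max abse_ge0 andbT; apply: le_trans (lee_abs _).
  by rewrite -[leRHS]adde0 leeD2l// oppe_le0.
have neg : (\int[mu]_(x in D) (fun x => (f x)%:E - g x)%E^\- x = +oo)%E.
  apply/eqP; rewrite -leye_eq -goo.
  have : (\int[mu]_(x in D) g x <= \int[mu]_(x in D) ((fun x => (f x)%:E - g x)%E^\- x + `|(f x)%:E|))%E.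
    apply: ge0_le_integral_dom => // x Dx; rewrite funenegE.
    have := g0 x; case: (g x) => [r| |] //= r0.
      rewrite -EFin_max -EFinD lee_fin.
      have := ler_norm (f x); rewrite /Num.max; case: ifP => [|/negbT]; rewrite -?leNgt; lra.
  rewrite ge0_integralD//; last 2 first.
  - exact: measurable_funeneg.
  - exact: measurableT_comp.
  rewrite goo leye_eq => /eqP; rewrite (_ : (\int[mu]_(x in D) `|(f x)%:E|)%E = (\int[mu]_(x in D) `|(EFin \o f) x|)%E)//.
  move: fa; case: (\int[mu]_(x in D) `|(EFin \o f) x|)%E => [r _| |] //=; last by rewrite addeNy.
  by case: (\int[mu]_(x in D) _)%E.
rewrite neg; case: (\int[mu]_(x in D) _^\+ x)%E pos => //.
Qed.

Section CondExp.
Context {R : realType} {dO : measure_display} {Omega : measurableType dO}.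
Variables (P : probability Omega R) (G : set (set Omega)).
Hypotheses (sG : sigma_algebra setT G) (mG : G `<=` measurable).
Local Notation TG := (g_sigma_algebraType G).

Let G_measP d' (Y : measurableType d') (f : Omega -> Y) :
  meas_on G setT f <-> measurable_fun (setT : set TG) f.
Proof.
split=> [h|h]; first exact: meas_onP.
by apply: measurable_meas_on => //; rewrite -(measurable_g_measurableTypeE sG); exact: measurableT.
Qed.

Let G_meas_sub d' (Y : measurableType d') (f : Omega -> Y) : meas_on G setT f -> measurable_fun setT f.
Proof. by move=> h _ B mB; apply: mG; exact: h. Qed.

Let G_set (B : set Omega) : measurable (B : set TG) <-> G B.
Proof. by rewrite measurable_g_measurableTypeE. Qed.

(** The mean of [H] may be infinite, so [H] is cut into the bounded layers between the levels [n]
    and [n + 1], whose conditional expectations are summed. *)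
Lemma cond_exp_nonneg_exists (H : Omega -> R) : measurable_fun setT H -> (forall w, 0 <= H w) ->
  exists Q : Omega -> \bar R, [/\ forall w, (0 <= Q w)%E, meas_on G setT Q &
    forall B, G B -> (\int[P]_(w in B) Q w = \int[P]_(w in B) (H w)%:E)%E].
Proof.
move=> mH H0.
pose h n w := Num.min (H w) n.+1%:R - Num.min (H w) n%:R.
have mh n : measurable_fun setT (h n).
  by apply: measurable_funB; apply: measurable_minr => //; exact: measurable_cst.
have h0 n w : 0 <= h n w.
  by rewrite subr_ge0 le_min !ge_min lexx/= ler_nat leqnSn orbT.
have hb n w : `|h n w| <= n.+1%:R.
  rewrite ger0_norm// /h lerBlDr (@le_trans _ _ n.+1%:R)//; first by rewrite ge_min lexx orbT.
  by rewrite lerDl le_min H0 ler0n.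
have ex n : exists f : Omega -> \bar R, [/\ forall x, (0 <= f x)%E,
  measurable_fun (setT : set TG) f &
  forall B, G B -> (\int[P]_(x in B) (h n x)%:E = \int[P]_(x in B) f x)%E].
  by apply: sub_density_exists => //; apply: (@I1_bdd _ _ _ P _ n.+1%:R).
have [f Hf] := choice ex.
have f0 n w : (0 <= f n w)%E by have [] := Hf n.
have mf n : measurable_fun (setT : set TG) (f n) by have [] := Hf n.
exists (fun w => \sum_(n <oo) f n w)%E; split.
- by move=> w; apply: nneseries_ge0.
- by apply/G_measP; apply: ge0_emeasurable_sum => // n _.
- move=> B GB; have mB := mG GB.
  have mf' n : measurable_fun B (f n) by apply: measurable_funTS; apply: G_meas_sub; exact/G_measP.
  rewrite integral_nneseries//.
  rewrite (eq_eseriesr (g := fun n => (\int[P]_(x in B) (h n x)%:E)%E)); last first.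
    by move=> n _; have [_ _ ->] := Hf n.
  rewrite -integral_nneseries//; last 2 first.
  - by move=> n; apply/measurable_EFinP; exact: measurable_funTS.
  - by move=> n w _; rewrite lee_fin.
  apply: eq_integral => w _.
  apply/cvg_lim; first exact: ereal_hausdorff.
  have [N _ hN] : \forall n \near \oo, H w <= n%:R by exact: nbhs_infty_ger.
  apply: cvg_near_cst; exists N => // n /hN /= Hn.
  rewrite sumEFin; congr EFin.
  rewrite (telescope_sumr (fun n => Num.min (H w) n%:R) (leq0n n)) min_l// min_r ?subr0//.
Qed.

Variables (Yt Z1 H : Omega -> R) (X : Omega -> \bar R).
Hypotheses (mY : meas_on G setT Yt) (IY : I1 P Yt) (IZ : I1 P Z1)
  (YZ : forall B, G B -> EX P (fun w => \1_B w * Z1 w) = EX P (fun w => \1_B w * Yt w))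
  (mH : measurable_fun setT H) (H0 : forall w, 0 <= H w) (mX : measurable_fun setT X)
  (XE : \forall w \ae P, X w = (Z1 w - H w)%:E).

Let int_EX (f : Omega -> R) B : I1 P f -> measurable B ->
  (\int[P]_(w in B) (f w)%:E)%E = (EX P (fun w => \1_B w * f w))%:E.
Proof.
move=> If mB.
have IB : I1 P (fun w => \1_B w * f w).
  apply: I1_le (I1_abs If) _.
    by apply: measurable_funM; [exact: measurable_indic|exact: I1_meas If].
  by move=> w; rewrite normrM indicE; case: (w \in B); rewrite ?normr1 ?normr0 ?mul1r ?mul0r.
rewrite (EX_EFin IB) integral_mkcond; apply: eq_integral => w _.
by rewrite patchE indicE; case: (w \in B); rewrite ?mul1r ?mul0r.
Qed.

Let int_ZY B : G B -> (\int[P]_(w in B) (Z1 w)%:E = \int[P]_(w in B) (Yt w)%:E)%E.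
Proof. by move=> GB; have mB := mG GB; rewrite !int_EX// YZ. Qed.

Let int_X B : G B -> (\int[P]_(w in B) X w = \int[P]_(w in B) (Yt w)%:E - \int[P]_(w in B) (H w)%:E)%E.
Proof.
move=> GB; have mB := mG GB.
have IZB := integrableS measurableT mB (subsetT _) IZ.
have mHB : measurable_fun B (EFin \o H) by apply/measurable_EFinP; exact: measurable_funTS.
rewrite -int_ZY// -(integral_sub_ge0 mB IZB mHB)//.
apply: ae_eq_integral => //; first exact: measurable_funTS.
  by apply: measurable_funTS; apply: emeasurable_funB; apply/measurable_EFinP => //; exact: I1_meas IZ.
by apply: filterS XE => w -> _; rewrite EFinB.
Qed.

(** The choice made in [cond_exp] is sound as soon as one candidate exists; here it is [Yt] minus
    the conditional expectation of [H]. *)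
Lemma cond_exp_is : is_cond_exp P G X (cond_exp P G X).
Proof.
apply: xgetPex; have [Q [Q0 mQ QE]] := cond_exp_nonneg_exists mH H0.
exists (fun w => (Yt w)%:E - Q w)%E; split.
  by apply/G_measP; apply: emeasurable_funB; [apply/measurable_EFinP|]; exact/G_measP.
move=> B GB; have mB := mG GB.
rewrite int_X// -QE// integral_sub_ge0//; first exact: integrableS IY.
by apply: measurable_funTS; exact: G_meas_sub mQ.
Qed.

Let J := cond_exp P G X.

Let mJ : meas_on G setT J. Proof. by have [] := cond_exp_is. Qed.

Let E1 k : R := k.+1%:R^-1.

Let null_of_le (B : set Omega) (s : R) : G B ->
  (\int[P]_(w in B) (Yt w + s)%:E = \int[P]_(w in B) (Yt w)%:E + s%:E * P B)%E.
Proof.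
move=> GB; have mB := mG GB.
under eq_integral do rewrite EFinD.
rewrite integralD//; [by rewrite integral_cst|exact: integrableS IY|exact: (integrableS _ _ _ (I1_cst P s))].
Qed.

Let fin_Y B : G B -> (\int[P]_(w in B) (Yt w)%:E)%E \is a fin_num.
Proof. by move=> GB; rewrite int_EX//; exact: mG. Qed.

(** [J] is known through its integrals over sets of [G], so the inequality is tested on the sets
    where [J] exceeds [Yt] by more than [1 / (k + 1)]; each of them is null. *)
Lemma cond_exp_le : \forall w \ae P, (J w <= (Yt w)%:E)%E.
Proof.
pose B k := [set w | ((Yt w + E1 k)%:E < J w)%E].
have GB k : G (B k).
  apply/G_set; rewrite -[X in measurable X]setTI; apply: emeasurable_fun_lt => //; last exact/G_measP.
  by apply/measurable_EFinP; apply: measurable_funD; [exact/G_measP|exact: measurable_cst].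
have PB k : P (B k) = 0%E.
  have [_ JE] := cond_exp_is.
  have le1 : (\int[P]_(w in B k) (Yt w + E1 k)%:E <= \int[P]_(w in B k) (Yt w)%:E)%E.
    apply: (@le_trans _ _ (\int[P]_(w in B k) J w)%E).
      by apply: integral_le_gen => w /= /ltW.
    rewrite JE// int_X// -[leRHS]adde0 leeD2l// oppe_le0.
    by apply: integral_ge0 => w _; rewrite lee_fin.
  move: le1; rewrite (null_of_le _ (GB k)) -[leRHS]adde0 leeD2lE ?fin_Y//.
  rewrite pmule_rle0 ?lte_fin ?invr_gt0// => h; apply/eqP; rewrite eq_le h/=; exact: measure_ge0.
have : P.-negligible (\bigcup_k B k).
  by apply: negligible_bigcup => k; exists (B k); split; [exact: (mG (GB k))|exact: PB|].
apply: negligibleS => w /= /negP; rewrite -ltNge => YJ.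
have [k hk] : exists k, ((Yt w + E1 k)%:E < J w)%E.
  move: YJ; case: (J w) => [r| |] //=; last by exists 0%N; rewrite ltry.
  rewrite lte_fin => /ltr_add_invr [k hk]; exists k.
  by rewrite lte_fin.
by exists k.
Qed.

Lemma cond_exp_eq : (\forall w \ae P, H w = 0) -> \forall w \ae P, J w = (Yt w)%:E.
Proof.
move=> HE0.
pose B k := [set w | (J w < (Yt w - E1 k)%:E)%E].
have GB k : G (B k).
  apply/G_set; rewrite -[X in measurable X]setTI; apply: emeasurable_fun_lt => //; first exact/G_measP.
  by apply/measurable_EFinP; apply: measurable_funB; [exact/G_measP|exact: measurable_cst].
have PB k : P (B k) = 0%E.
  have [_ JE] := cond_exp_is.
  have Hi : (\int[P]_(w in B k) (H w)%:E = 0)%E.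
    rewrite (@ae_eq_integral _ _ _ P _ (cst 0%E)) ?integral0//.
    - exact: mG.
    - by apply/measurable_EFinP; exact: measurable_funTS.
    - by apply: filterS HE0 => w -> _.
  have le1 : (\int[P]_(w in B k) (Yt w)%:E <= \int[P]_(w in B k) (Yt w + - E1 k)%:E)%E.
    have -> : (\int[P]_(w in B k) (Yt w)%:E = \int[P]_(w in B k) J w)%E.
      by rewrite JE// int_X// Hi sube0.
    by apply: integral_le_gen => w /= /ltW.
  move: le1; rewrite (null_of_le _ (GB k)) -[leLHS]adde0 leeD2lE ?fin_Y//.
  rewrite EFinN mulNe oppe_ge0 pmule_rle0 ?lte_fin ?invr_gt0// => h; apply/eqP; rewrite eq_le h/=; exact: measure_ge0.
have neg : P.-negligible (\bigcup_k B k).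
  by apply: negligible_bigcup => k; exists (B k); split; [exact: (mG (GB k))|exact: PB|].
have ge : \forall w \ae P, ((Yt w)%:E <= J w)%E.
  apply: negligibleS neg => w /= /negP; rewrite -ltNge => YJ.
  have [k hk] : exists k, (J w < (Yt w - E1 k)%:E)%E.
    move: YJ; case: (J w) => [r| |] //=; last by exists 0%N; rewrite ltNyr.
    rewrite lte_fin => /ltr_add_invr [k hk]; exists k.
    by rewrite lte_fin ltrBrDr.
  by exists k.
by apply: filterS2 ge cond_exp_le => w h1 h2; apply/eqP; rewrite eq_le h1 h2.
Qed.

End CondExp.

(** * The filtration and the point process *)

Section Model.
Context {R : realType} {dO : measure_display} {Omega : measurableType dO}
  {E : ptopologicalType} {d : nat}.
Variables (P : probability Omega R) (Tn : nat -> Omega -> \bar R)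
  (zeta : nat -> Omega -> marks E) (W : 'I_d -> R -> Omega -> R)
  (phi : R -> Omega -> probability (marks E) R) (A : R -> Omega -> R).
Hypotheses (cP : measure_is_complete P) (HT : marked_point_process P Tn zeta)
  (HW : wiener_process P W) (HI : mpp_wiener_independent P Tn zeta W)
  (HC : continuous_compensator P Tn zeta W phi A).
Local Notation F := (filtration P Tn zeta W).
Local Notation pm := (point_measure Tn zeta).
Local Notation TE := (measurableTypeR R * marks E)%type.
Local Notation proc := (R -> Omega -> R).
Local Notation hfun := (R -> Omega -> marks E -> R).
Implicit Types r h : hfun.

Lemma F_sigma t : sigma_algebra setT (F t).
Proof. exact: smallest_sigma_algebra. Qed.

Lemma F_setT t : F t setT.
Proof. by have [F0 FC _] := F_sigma t; rewrite -(setD0 setT); exact: FC. Qed.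

Lemma F_setC t G : F t G -> F t (~` G).
Proof. by have [_ FC _] := F_sigma t => FG; rewrite -setTD; exact: FC. Qed.

Lemma F_bigcup t (G : nat -> set Omega) : (forall n, F t (G n)) -> F t (\bigcup_n G n).
Proof. by have [_ _ FU] := F_sigma t; exact: FU. Qed.

Lemma F_setI t G H : F t G -> F t H -> F t (G `&` H).
Proof.
move=> FG FH; rewrite -[X in F t X]setCK setCI; apply: F_setC.
rewrite -bigcup2E; apply: F_bigcup => -[|[|n]] /=; [exact: F_setC|exact: F_setC|].
by have [] := F_sigma t.
Qed.

Lemma F_le s t : s <= t -> F s `<=` F t.
Proof.
move=> st; apply: sub_sigma_algebra2 => G [[|]|nG]; last by right.
- move=> [u [B [Q [/andP[u0 us] mB mQ ->]]]]; left; left.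
  by exists u, B, Q; rewrite u0 (le_trans us st).
- move=> [u [l [Q [/andP[u0 us] mQ ->]]]]; left; right.
  by exists u, l, Q; rewrite u0 (le_trans us st).
Qed.

Lemma F_negligible t G : P.-negligible G -> F t G.
Proof. by move=> nG; apply: sub_sigma_algebra; right. Qed.

Lemma pm_term n w (S : set (measurableTypeR R * marks E)) :
  (match Tn n w return {measure set (measurableTypeR R * marks E) -> \bar R} with
   | r%:E => dirac (r : measurableTypeR R, zeta n w) | _ => mzero end) S =
  (\1_[set w' | Tn n w' \is a fin_num /\ S (fine (Tn n w'), zeta n w')] w)%:E.
Proof.
rewrite indicE; case Tnw: (Tn n w) => [r| |] /=; last 2 first.
- by rewrite memNset//= Tnw => -[].
- by rewrite memNset//= Tnw => -[].
rewrite diracE; congr (((nat_of_bool _)%:R)%:E); apply/idP/idP; rewrite !inE/= Tnw//.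
by case.
Qed.

Lemma pmE w S : point_measure Tn zeta w S = (\sum_(1 <= n <oo)
  (\1_[set w' | Tn n w' \is a fin_num /\ S (fine (Tn n w'), zeta n w')] w)%:E)%E.
Proof. by rewrite /point_measure /= /mseries; apply: eq_eseriesr => n _; rewrite pm_term. Qed.

Lemma Tn_measurable n : measurable_fun setT (Tn n). Proof. by have [] := HT. Qed.
Lemma zeta_measurable n : measurable_fun setT (zeta n). Proof. by have [] := HT. Qed.

Lemma jump_event_measurable n (S : set (measurableTypeR R * marks E)) : measurable S ->
  measurable [set w | Tn n w \is a fin_num /\ S (fine (Tn n w), zeta n w)].
Proof.
move=> mS; have mT := Tn_measurable n.
rewrite (_ : [set _ | _] = (setT `&` [set w | Tn n w \is a fin_num]) `&`
  (fun w => (fine (Tn n w), zeta n w)) @^-1` S); last by rewrite setTI.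
apply: measurableI; first exact: emeasurable_fin_num.
rewrite -[X in measurable X]setTI.
apply: (measurable_fun_pair _ (zeta_measurable n)) => //.
exact: (measurableT_comp (fine_measurable measurableT)).
Qed.

Lemma pm_measurable S : measurable S ->
  measurable_fun setT (fun w => point_measure Tn zeta w S).
Proof.
move=> mS; rewrite (_ : (fun w => _) = fun w => (\sum_(1 <= n <oo)
  (\1_[set w' | Tn n w' \is a fin_num /\ S (fine (Tn n w'), zeta n w')] w)%:E)%E).
  rewrite (_ : (fun w => _) = fun w => (\sum_(0 <= n <oo | (1 <= n)%N)
    (\1_[set w' | Tn n w' \is a fin_num /\ S (fine (Tn n w'), zeta n w')] w)%:E)%E).
    apply: ge0_emeasurable_sum => [n w _ _|n _]; first by rewrite lee_fin.
    exact/measurable_EFinP/measurable_indic/jump_event_measurable.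
  apply/funext => w; rewrite [LHS]eseries_mkcond [RHS]eseries_mkcond.
  by rewrite (ereal_series _ 1%N) eseries_mkcond; apply: eq_eseriesr => n _.
by apply/funext => w; rewrite pmE.
Qed.

Lemma W_measurable l s : 0 <= s -> measurable_fun setT (W l s).
Proof. by have [h _ _] := HW; exact: h. Qed.

Lemma mpp_events_measurable t : mpp_events Tn zeta t `<=` measurable.
Proof.
move=> _ [s [B [Q [_ mB mQ ->]]]].
have := pm_measurable (measurableX (measurable_itv `]0, s]) mB) measurableT mQ.
by rewrite setTI.
Qed.

Lemma wiener_events_measurable t : wiener_events W t `<=` measurable.
Proof.
move=> _ [s [l [Q [/andP[s0 _] mQ ->]]]].
by have := W_measurable l s0 measurableT mQ; rewrite setTI.
Qed.

Lemma F_measurable t : F t `<=` measurable.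
Proof.
apply: smallest_sub; first exact: sigma_algebra_measurable.
move=> G [[|]|nG]; [exact: mpp_events_measurable|exact: wiener_events_measurable|].
exact: cP.
Qed.

(** [wiener_process] gives this law conditionally on the past of [W] alone. Independence of [p] and
    [W] extends it to intersections of a point-process event with a Wiener event, and a Dynkin
    argument to the completed filtration. *)
Lemma W_increment_law l s t G (B : set R) : 0 <= s < t -> F s G -> measurable B ->
  P (G `&` [set w | B (W l t w - W l s w)]) =
  (P G * normal_prob 0 (Num.sqrt (t - s)) B)%E.
Proof.
move=> st FG mB; have /andP[s0 st'] := st; have t0 : 0 <= t by rewrite (le_trans s0)// ltW.
pose D := [set w | B (W l t w - W l s w)].
have mD : measurable D.
  rewrite -[X in measurable X]setTI.
  by apply: (measurable_funB (W_measurable l t0) (W_measurable l s0)).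
have WD : <<s \bigcup_t wiener_events W t >> D.
  pose G0 := \bigcup_t wiener_events W t.
  have mW u : 0 <= u -> measurable_fun (setT : set (g_sigma_algebraType G0)) (W l u).
    move=> u0 _ Q mQ; rewrite setTI; apply: sub_sigma_algebra; exists u => //.
    by exists u, l, Q; rewrite u0 lexx.
  have := measurable_funB (mW t t0) (mW s s0) measurableT mB.
  by rewrite setTI.
have lawW G2 : <<s wiener_events W s >> G2 ->
    P (G2 `&` D) = (P G2 * normal_prob 0 (Num.sqrt (t - s)) B)%E.
  move=> G2s; have [_ _ /(_ s t st G2 G2s (fun l' => if l' == l then B else setT))] := HW.
  rewrite (bigD1 l)//= eqxx big1 ?mule1.
    move=> /(_ _)/[dup] h _; rewrite -h; last by move=> l'; case: ifP.
    congr (P (_ `&` _)); apply/seteqP; split=> w /=.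
      by move=> Bw l'; case: ifPn => // /eqP ->.
    by move=> /(_ l); rewrite eqxx.
  by move=> i /negPf ->; exact: probability_setT.
(* The generating class is closed under measurable changes on null sets, which absorbs the
   negligible events of the filtration. *)
pose pis := [set G | measurable G /\ exists G1 G2, [/\ <<s mpp_events Tn zeta s >> G1,
  <<s wiener_events W s >> G2 & \forall w \ae P, G w <-> G1 w /\ G2 w]].
pose H := [set G | measurable G /\
  P (G `&` D) = (P G * normal_prob 0 (Num.sqrt (t - s)) B)%E].
have mm : <<s mpp_events Tn zeta s >> `<=` measurable.
  by apply: smallest_sub; [exact: sigma_algebra_measurable|exact: mpp_events_measurable].
have mw : <<s wiener_events W s >> `<=` measurable.
  by apply: smallest_sub; [exact: sigma_algebra_measurable|exact: wiener_events_measurable].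
have sT (T' : Type) (G0 : set (set T')) : <<s G0 >> setT.
  have [F0 FC _] : sigma_algebra setT <<s G0 >> by exact: smallest_sigma_algebra.
  by have := FC _ F0; rewrite setD0.
have s0' (T' : Type) (G0 : set (set T')) : <<s G0 >> set0.
  by have [] : sigma_algebra setT <<s G0 >> by exact: smallest_sigma_algebra.
have sI (T' : pointedType) (G0 : set (set T')) A1 A2 :
    <<s G0 >> A1 -> <<s G0 >> A2 -> <<s G0 >> (A1 `&` A2).
  exact: (@measurableI _ (g_sigma_algebraType G0)).
suff : <<s pis >> `<=` H.
  move=> sub; suff: H G by case.
  apply: sub; move: FG; apply: sub_sigma_algebra2 => G' [[mG'|wG']|nG'].
  - split; first exact: mpp_events_measurable mG'.
    exists G', setT; split=> //; first exact: sub_sigma_algebra.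
    by apply: aeW => w; split=> [|[]].
  - split; first exact: wiener_events_measurable wG'.
    exists setT, G'; split=> //; first exact: sub_sigma_algebra.
    by apply: aeW => w; split=> [|[]].
  - split; first exact: cP.
    exists set0, set0; split=> //.
    have : \forall w \ae P, ~ G' w.
      by move: nG'; rewrite /prop_near1 /nbhs /= /almost_everywhere setCK.
    by apply: filterS => w G'w; split=> [//|[]].
apply: lambda_system_subset => //.
- move=> A1 A2 [mA1 [X1 [X2 [sX1 sX2 X12]]]] [mA2 [Y1 [Y2 [sY1 sY2 Y12]]]].
  split; first exact: measurableI.
  exists (X1 `&` Y1), (X2 `&` Y2); split; [exact: sI|exact: sI|].
  apply: filterS2 X12 Y12 => w X12 Y12; rewrite /setI/= X12 Y12; tauto.
- apply/dynkin_lambda_system; split.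
  + by split=> //; rewrite setTI -(setTI D) lawW// probability_setT mul1e.
  + move=> Aq [mA PA]; split; first exact: measurableC.
    rewrite setIC -setDE P_setD//.
    rewrite (setIC D Aq) PA -[X in P X](setTI D) lawW// probability_setT mul1e.
    rewrite probability_setC// muleBl ?mul1e//.
    * by rewrite ge0_fin_numE// (le_lt_trans (probability_le1 _ _)) ?ltry.
  + move=> Aq tA HA; split; first by apply: bigcup_measurable => k _; case: (HA k).
    rewrite setI_bigcupl measure_bigcup//; last 2 first.
    * by move=> k *; apply: measurableI => //; case: (HA k).
    * exact: trivIset_setIr.
    rewrite measure_bigcup//; last by move=> k *; case: (HA k).
    have NBf : normal_prob 0 (Num.sqrt (t - s)) B \is a fin_num by exact: fin_num_measure.
    rewrite muleC -(fineK NBf) -nneseriesZl//; apply: eq_eseriesr => k _.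
    by rewrite fineK// muleC; case: (HA k).
- move=> Aq [mA [G1 [G2 [sG1 sG2 A12]]]]; split=> //.
  have iG1 : <<s \bigcup_t mpp_events Tn zeta t >> G1.
    by move: sG1; apply: sub_sigma_algebra2 => X mX; exists s.
  have iG2 : <<s \bigcup_t wiener_events W t >> G2.
    by move: sG2; apply: sub_sigma_algebra2 => X mX; exists s.
  have := mm _ sG1; have := mw _ sG2 => mG2 mG1.
  rewrite (P_ae_eq (B := G1 `&` (G2 `&` D))); last 3 first.
  + exact: measurableI.
  + by apply: measurableI => //; exact: measurableI.
  + by apply: filterS A12 => w A12; rewrite /setI/= A12; tauto.
  rewrite HI//; last exact: sI.
  rewrite lawW// muleA -HI//; congr (_ * _)%E.
  by apply: P_ae_eq => //; [exact: measurableI|apply: filterS A12 => w A12; rewrite A12].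
Qed.

Lemma W_increment_L2 l s t : 0 <= s < t -> L2 P (fun w => W l t w - W l s w).
Proof.
move=> st; have /andP[s0 st'] := st; have t0 : 0 <= t by rewrite (le_trans s0)// ltW.
have mD := measurable_funB (W_measurable l t0) (W_measurable l s0).
split=> //; apply/integrableP; split; first exact/measurable_EFinP/measurable_funX.
rewrite (_ : (\int[P]_x _)%E = (\int[normal_prob 0 (Num.sqrt (t - s))]_x (x ^+ 2)%:E)%E).
  by apply: normal_sqr_lty; rewrite gt_eqF// sqrtr_gt0 subr_gt0.
transitivity (\int[pushforward P (fun w => W l t w - W l s w : measurableTypeR R)%R]_x (x ^+ 2)%:E)%E.
  rewrite ge0_integral_pushforward//.
  - by apply: eq_integral => w _ /=; rewrite ger0_norm ?sqr_ge0.
  - exact/measurable_EFinP/measurable_funX.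
  - by move=> x _; rewrite lee_fin sqr_ge0.
apply: eq_measure_integral => B mB _; rewrite /pushforward.
have := W_increment_law l st (@F_setT s) mB.
by rewrite setTI probability_setT mul1e.
Qed.

Lemma W_increment_orth l s t G : 0 <= s < t -> F s G ->
  EX P (fun w => \1_G w * (W l t w - W l s w)) = 0.
Proof.
move=> st FG; have mG := F_measurable FG.
have /andP[s0 st'] := st; have t0 : 0 <= t by rewrite (le_trans s0)// ltW.
have mD := measurable_funB (W_measurable l t0) (W_measurable l s0).
have IZ : I1 P (fun w => \1_G w * (W l t w - W l s w)).
  apply: L2M; last exact: W_increment_L2.
  apply: (@L2_bdd _ _ _ _ _ 1); first exact: measurable_indic.
  by move=> w; rewrite indicE; case: (_ \in _); rewrite ?normr1 ?normr0.
apply: EX_symmetric => // B mB.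
have mNB : measurable (-%R @^-1` B : set R).
  by rewrite -[X in measurable X]setTI; exact: oppr_measurable.
(* The law of the product is [P(G) N + P(~G) delta_0], a symmetric law. *)
have key (C : set R) : measurable C ->
    P ((fun w => \1_G w * (W l t w - W l s w)) @^-1` C) =
    (P G * normal_prob 0 (Num.sqrt (t - s)) C + (\1_C 0)%:E * P (~` G))%E.
  move=> mC.
  have mX : measurable (G `&` [set w | C (W l t w - W l s w)]).
    apply: measurableI => //; rewrite -[X in measurable X]setTI.
    exact: mD.
  rewrite [X in P X](_ : _ = (G `&` [set w | C (W l t w - W l s w)]) `|`
      (if 0 \in C then ~` G else set0)); last first.
    apply/seteqP; split=> w /=; rewrite indicE.
      have [/set_mem Gw|/negP Gw] := boolP (w \in G); first by rewrite mul1r; left.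
      rewrite mul0r => C0; right; rewrite mem_set//=.
      by move=> G'; apply: Gw; exact: mem_set.
    move=> [[Gw Cw]|]; first by rewrite mem_set// mul1r.
    by case: ifPn => // /set_mem C0 Gw; rewrite memNset// mul0r.
  rewrite P_setU//.
  - rewrite W_increment_law// indicE; congr (_ + _)%E; case: ifP => _; first by rewrite mul1e.
    by rewrite mul0e measure0.
  - by case: ifP => _ //; exact: measurableC.
  - rewrite -setIA; apply/seteqP; split=> w //= -[Gw [_]]; by case: ifP.
rewrite key// (_ : _ @^-1` (-%R @^-1` B) = (fun w => \1_G w * (W l t w - W l s w)) @^-1` (-%R @^-1` B))//.
rewrite key// normal_probN//; last by rewrite gt_eqF// sqrtr_gt0 subr_gt0.
congr (_ + (_)%:E * _)%E; rewrite !indicE; congr ((nat_of_bool _)%:R).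
by apply/idP/idP; rewrite !inE /= oppr0.
Qed.

Lemma W_diff_L2 l s t : 0 <= s <= t -> L2 P (fun w => W l t w - W l s w).
Proof.
move=> /andP[s0]; rewrite le_eqVlt => /predU1P[<-|st]; last by apply: W_increment_L2; rewrite s0.
rewrite (_ : (fun w => _) = fun=> 0); last by apply/funext => w; rewrite subrr.
by apply: (@L2_bdd _ _ _ _ _ 0) => // w; rewrite normr0.
Qed.

Lemma W_diff_orth l s t (X : Omega -> R) c : 0 <= s <= t -> meas_on (F s) setT X ->
  (forall w, `|X w| <= c) -> EX P (fun w => X w * (W l t w - W l s w)) = 0.
Proof.
move=> /andP[s0]; rewrite le_eqVlt => /predU1P[<-|st] mX Xc.
  rewrite (_ : (fun w => _) = fun=> 0); first exact: EX_cst.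
  by apply/funext => w; rewrite subrr mulr0.
have D2 : L2 P (fun w => W l t w - W l s w) by apply: W_diff_L2; rewrite s0 ltW.
apply: (@EX_orth_ext _ _ _ P (F s)) => //; [exact: F_sigma|exact: F_measurable|exact: L2_I1| |].
- by move=> G FG; apply: W_increment_orth => //; rewrite s0.
- by apply/L2_I1/(@L2_bddM _ _ _ _ _ _ c) => //; exact: (meas_on_measurable (@F_measurable s)).
Qed.

(** Each summand is a coefficient fixed at the left end [a] of its cell times an increment of [W]
    stopped at both ends. According to the position of [u] and [v], its increment vanishes or is the
    coefficient times an increment of [W] started at [max(u, a)]. *)
Lemma el_int_martingale2 T (h : elementary) : elementary_wf F T h -> martingale2 P F 0 T (el_int W h).
Proof.
move=> wf.
have part k l : let J t w := el_coef h k l w *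
    (W l (Num.min t (el_time h k.+1)) w - W l (Num.min t (el_time h k)) w) in
    martingale2 P F 0 T J.
  move=> J; have [a0 ab bT mc [c cc]] := wf k.
  set a := el_time h k in a0 ab mc J *; set b := el_time h k.+1 in ab bT J *.
  have JE t : t <= a -> J t = fun=> 0.
    move=> ta; apply/funext => w; rewrite /J (min_l ta) min_l ?subrr ?mulr0//.
    exact: le_trans ab.
  have mW t l' : 0 <= t -> meas_on (F t) setT (W l' t).
    move=> t0 B mB; apply: sub_sigma_algebra; left; right.
    by exists t, l', B; rewrite t0 lexx setTI.
  have mJ t : 0 <= t -> meas_on (F t) setT (J t).
    move=> t0; have [ta|/ltW at_] := leP t a.
      by rewrite JE//; apply/(F_measP F_sigma); exact: measurable_cst.
    apply/(F_measP F_sigma); apply: measurable_funM.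
      by apply/(F_measP F_sigma); apply: (meas_on_le F_le at_).
    apply: measurable_funB; apply/(F_measP F_sigma).
      apply: (meas_on_le F_le (s := Num.min t b)); first by rewrite ge_min lexx.
      by apply: mW; rewrite le_min t0 (le_trans a0).
    rewrite min_r//; apply: (meas_on_le F_le at_); exact: mW.
  have JL2 t : 0 <= t -> L2 P (J t).
    move=> t0; apply: (@L2_bddM _ _ _ _ _ _ c) => //.
      by apply: (meas_on_measurable (@F_measurable a)).
    by apply: W_diff_L2; rewrite le_min t0 a0/= le_min2.
  split=> [s /andP[s0 _]|s /andP[s0 _]|u v G u0 uv vT FG]; [exact: mJ|exact: JL2|].
  have m1 t : u <= t -> meas_on (F t) setT (\1_G : Omega -> R).
    move=> ut; apply/(F_measP F_sigma); apply: measurable_indic.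
    by rewrite measurable_g_measurableTypeE; [exact: F_le FG|exact: F_sigma].
  have bX w : `|\1_G w * el_coef h k l w| <= c.
    rewrite normrM (le_trans _ (cc l w))// ler_piMl// indicE.
    by case: (_ \in _); rewrite ?normr1 ?normr0.
  have mX t : u <= t -> a <= t -> meas_on (F t) setT (fun w => \1_G w * el_coef h k l w).
    move=> ut at_; apply/(F_measP F_sigma); apply: measurable_funM.
      by apply/(F_measP F_sigma); exact: m1.
    by apply/(F_measP F_sigma); exact: (meas_on_le F_le at_).
  have [ua|/ltW au] := leP u a.
    have [va|/ltW av] := leP v a.
      rewrite (JE u)// (JE v)// (_ : (fun x => _) = fun=> 0); first exact: EX_cst.
      by apply/funext => x; rewrite subrr mulr0.
    rewrite (JE u)// -[RHS](@W_diff_orth l a (Num.min v b) _ _ _ (mX a ua (lexx a)) bX).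
      by congr EX; apply/funext => x; rewrite subr0 /J (min_r av) mulrA.
    by rewrite a0 le_min av.
  have av := le_trans au uv.
  have [bu|/ltW ub] := leP b u.
    rewrite (_ : (fun x => _) = fun=> 0); first exact: EX_cst.
    apply/funext => x; rewrite /J (min_r au) (min_r av) (min_r bu) (min_r (le_trans bu uv)).
    by rewrite subrr mulr0.
  rewrite -[RHS](@W_diff_orth l u (Num.min v b) _ _ _ (mX u (lexx u) au) bX).
    by congr EX; apply/funext => x; rewrite /J (min_r au) (min_r av) (min_l ub); ring.
  by rewrite u0 le_min uv.
have sumM (I : Type) (s : seq I) (J : I -> proc) :
    (forall i, martingale2 P F 0 T (J i)) ->
    martingale2 P F 0 T (fun t w => \sum_(i <- s) J i t w).
  move=> MJ; split.
  - move=> t tT; apply/(F_measP F_sigma); apply: measurable_sum => i.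
    by have [mJ _ _] := MJ i; apply/(F_measP F_sigma); exact: mJ.
  - by move=> t tT; apply: L2_sum => i; have [_ J2 _] := MJ i; exact: J2.
  - move=> u v G u0 uv vT FG.
    rewrite (_ : (fun x => _) = fun x => \sum_(i <- s) \1_G x * (J i v x - J i u x)).
      rewrite EX_sum => [|i]; first by rewrite big1// => i _; have [_ _ oJ] := MJ i; exact: oJ.
      have [_ J2 _] := MJ i; apply: L2_I1; apply: (@L2_bddM _ _ _ _ _ _ 1).
      + by apply: measurable_indic; exact: F_measurable FG.
      + by move=> x; rewrite indicE; case: (_ \in _); rewrite ?normr1 ?normr0.
      + by apply: L2B; apply: J2; rewrite ?u0 ?(le_trans u0 uv)//= (le_trans uv vT).
    by apply/funext => x; rewrite -sumrB mulr_sumr.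
rewrite (_ : el_int W h = fun t w => \sum_(k < el_size h) \sum_(l < d) el_coef h k l w *
    (W l (Num.min t (el_time h k.+1)) w - W l (Num.min t (el_time h k)) w)) //.
by apply: (sumM) => k; apply: (sumM) => l; exact: part.
Qed.

Lemma ito_martingale2 T Z I : is_ito_integral P F T W Z I -> martingale2 P F 0 T I.
Proof.
move=> [aI _ [h [wf _ cI]]].
apply: (@martingale2_limit _ _ _ P F _ 0 T (fun n => el_int W (h n))) => //; first exact: F_measurable.
by move=> n; exact: el_int_martingale2.
Qed.

Section PointMeasure.
(** The almost sure path properties of [A] and of the jump times. The complement is negligible, so
    [good] belongs to every [F t] and functions may be modified off it without losing
    adaptedness. *)
Definition good : set Omega := fun w =>
  [/\ A 0 w = 0, cont_incr (A ^~ w),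
      forall n, (Tn n w <= Tn n.+1 w)%E,
      forall n, (Tn n w < +oo)%E -> (Tn n w < Tn n.+1 w)%E
    & Tn n w @[n --> \oo] --> +oo%E].

Lemma good_ae : \forall w \ae P, good w.
Proof.
have [_ _ _ aT] := HT; have [_ _ aA _] := HC.
by apply: filterS2 aT aA => w [? ? ?] [? ? ?]; split.
Qed.

Definition jump (u v : R) (w : Omega) (n : nat) : bool := (u%:E < Tn n w <= v%:E)%E.

Lemma good_jump_lt w v : good w -> exists N, forall n, (N <= n)%N -> (v%:E < Tn n w)%E.
Proof. by move=> [_ _ _ _ /cvgey_gt/(_ v)[N _ HN]]; exists N => n /HN. Qed.

Lemma jump_fin u v w n :
  jump u v w n = (Tn n w \is a fin_num) && (u < fine (Tn n w) <= v).
Proof.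
rewrite /jump; case: (Tn n w) => [r| |] //=; rewrite ?lte_fin ?lee_fin//.
  by rewrite andbF.
Qed.

Lemma pm_integral w u v (h : TE -> \bar R) : measurable_fun setT h ->
  (forall x, 0 <= h x)%E ->
  (\int[pm w]_(x in `]u, v] `*` setT) h x =
   \sum_(1 <= n <oo) (if jump u v w n then h (fine (Tn n w), zeta n w) else 0))%E.
Proof.
move=> mh h0.
have mD : measurable (`]u, v] `*` setT : set TE) by exact: measurableX.
pose m n : {measure set TE -> \bar R} :=
  match Tn n w return {measure set (measurableTypeR R * marks E) -> \bar R} with
   | r%:E => dirac (r : measurableTypeR R, zeta n w) | _ => mzero end.
rewrite (_ : (\int[_]_(x in _) _)%E =
    (\int[mseries (fun n => m n.+1) 0]_(x in `]u, v] `*` setT) h x)%E); last first.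
  apply: eq_measure_integral => B mB _; rewrite /point_measure /= /mseries.
  rewrite -(@nneseries_addn _ (fun n => m n B) 1) => [|n]; last exact: measure_ge0.
  by apply: eq_eseriesr => n _; rewrite addn1.
rewrite ge0_integral_measure_series//; last by apply: measurable_funS mh.
rewrite -(@nneseries_addn _ (fun n => if jump u v w n then _ else _) 1); last first.
  by move=> n; case: ifP.
apply: eq_eseriesr => n _; rewrite addn1 /m jump_fin.
case: (Tn n.+1 w) => [r| |] /=; rewrite ?integral_measure_zero//.
rewrite integral_dirac//; last by apply: measurable_funS mh.
rewrite diracE; case: ifPn => urv; first by rewrite mem_set ?mul1e//; split.
rewrite memNset ?mul0e// => -[/=]; rewrite in_itv/= => urv' _.
by rewrite urv' in urv.
Qed.

Lemma pm_integral_sum w u v N (h : TE -> \bar R) : measurable_fun setT h ->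
  (forall x, 0 <= h x)%E -> (forall n, (N <= n)%N -> (v%:E < Tn n w)%E) ->
  (\int[pm w]_(x in `]u, v] `*` setT) h x =
   \sum_(1 <= n < N.+1 | jump u v w n) h (fine (Tn n w), zeta n w))%E.
Proof.
move=> mh h0 NT; rewrite pm_integral//.
have f0 n : (0 <= if jump u v w n then h (fine (Tn n w), zeta n w) else 0)%E by case: ifP.
rewrite (nneseries_split 1 N)// eseries0 ?adde0.
  by rewrite add1n [RHS]big_mkcond.
move=> n Nn _; rewrite /jump ifF//; apply/negbTE; rewrite negb_and -!ltNge.
by rewrite NT ?orbT// (leq_trans _ Nn)// add1n.
Qed.

(** By non-explosion only indices below [N] can jump before [v], so an integral against [p] is a
    finite sum, whatever the size of [h]. *)
Lemma pm_Rintegral w u v N (h : TE -> R) : measurable_fun setT h ->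
  (forall n, (N <= n)%N -> (v%:E < Tn n w)%E) ->
  \int[pm w]_(x in `]u, v] `*` setT) h x =
   \sum_(1 <= n < N.+1 | jump u v w n) h (fine (Tn n w), zeta n w).
Proof.
move=> mh NT; rewrite /Rintegral integralE.
have mD : measurable (`]u, v] `*` setT : set TE) by exact: measurableX.
have mh' : measurable_fun setT (EFin \o h) by exact/measurable_EFinP.
rewrite (@pm_integral_sum w u v N)//; last by apply: measurable_funepos.
rewrite (@pm_integral_sum w u v N)//; last by apply: measurable_funeneg.
transitivity (fine (\sum_(1 <= n < N.+1 | jump u v w n) (Num.max (h (fine (Tn n w), zeta n w)) 0)%:E
  - \sum_(1 <= n < N.+1 | jump u v w n) (Num.max (- h (fine (Tn n w), zeta n w)) 0)%:E)%E).
  by congr (fine (_ - _)%E); apply: eq_bigr => n _; rewrite ?funeposE ?funenegE /= EFin_max.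
rewrite !sumEFin -EFinB /= -sumrB; apply: eq_bigr => n _.
set x := h _; case: (leP 0 x); case: (leP 0 (- x)); lra.
Qed.

Lemma pm_lty w u v : good w -> (pm w (`]u, v] `*` setT) < +oo)%E.
Proof.
move=> gw; have [N NT] := good_jump_lt v gw.
have mD : measurable (`]u, v] `*` setT : set TE) by exact: measurableX.
have := @pm_integral_sum w u v N (cst 1%E) (measurable_cst _) (fun=> lee01) NT.
rewrite integral_cst// mul1e => ->.
by rewrite (eq_bigr (fun=> (1:R)%:E))// sumEFin ltry.
Qed.

Lemma dA_itv w a b : good w -> 0 <= a -> a <= b -> dA A w `]a, b]%classic = (A b w - A a w)%:E.
Proof. by move=> [_ cA _ _ _]; exact: path_diff_itv. Qed.

Lemma dA_set1 w x : good w -> 0 < x -> dA A w [set x] = 0%E.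
Proof. by move=> [_ cA _ _ _]; exact: path_diff_set1. Qed.

Definition FT (t : R) := g_sigma_algebraType (F t).

Lemma FT_measurableE t (B : set Omega) : measurable (B : set (FT t)) = F t B.
Proof. by rewrite /FT measurable_g_measurableTypeE//; exact: F_sigma. Qed.

Lemma good_F t : F t good.
Proof.
rewrite -(setCK good); apply: F_setC; apply: F_negligible.
exact: good_ae.
Qed.

Lemma F_ae t d' (Y : measurableType d') (f g : Omega -> Y) :
  (\forall w \ae P, f w = g w) -> meas_on (F t) setT f -> meas_on (F t) setT g.
Proof.
move=> fg mf B mB; rewrite setTI.
pose N := ~` [set w | f w = g w].
have FN : F t N by exact: F_negligible.
rewrite (_ : _ @^-1` _ = (f @^-1` B `&` ~` N) `|` (g @^-1` B `&` N)).
  have FU (X Y' : set Omega) : F t X -> F t Y' -> F t (X `|` Y').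
    by rewrite -!FT_measurableE; exact: measurableU.
  apply: FU; last by apply: F_negligible; apply: negligibleS fg => w [].
  by apply: F_setI; [have := mf B mB; rewrite setTI|exact: F_setC].
apply/seteqP; split=> w /=; rewrite /N/=.
  have [fgw|fgw] := pselect (f w = g w); first by left; rewrite fgw; split=> // /(_ fgw).
  by right.
by move=> [[+ /contrapT <-//]|[]].
Qed.

Lemma measurable_time_itv u v s : measurable ([set z | u < z.2 <= s] : set (FT v * measurableTypeR R)).
Proof.
rewrite (_ : [set _ | _] = setT `*` `]u, s]); first exact: measurableX.
by apply/seteqP; split=> z /=; rewrite in_itv/=; tauto.
Qed.

Section RandomMeasures.
Variable v : R.
Hypothesis v0 : 0 <= v.

(** [p] and, below, [dA] are restricted to []0, v]] and set to zero off [good]: they become finite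
    measures for every [w], hence kernels from [(Omega, F v)]. *)
Definition gpm (w : FT v) : {measure set TE -> \bar R} :=
  match pselect (good w) with
  | left _ => mrestr (pm w) (measurableX (measurable_itv `]0, v]) measurableT)
  | right _ => mzero
  end.

Definition gdA (w : FT v) : {measure set (measurableTypeR R) -> \bar R} :=
  match pselect (good w) with
  | left _ => mrestr (dA A w) (measurable_itv `]0, v])
  | right _ => mzero
  end.

Lemma FT_fun d' (Y : measurableType d') (f : Omega -> Y) :
  meas_on (F v) setT f <-> measurable_fun (setT : set (FT v)) f.
Proof. exact: (F_measP (F_sigma)). Qed.

Lemma gpm_lty w : (gpm w setT < +oo)%E.
Proof.
rewrite /gpm; case: pselect => [gw|_] /=; last by rewrite /mzero ltry.
by rewrite /mrestr setTI; exact: pm_lty.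
Qed.

Lemma gdA_lty w : (gdA w setT < +oo)%E.
Proof.
rewrite /gdA; case: pselect => [gw|_] /=; last by rewrite /mzero ltry.
by rewrite /mrestr setTI dA_itv ?ltry.
Qed.

Lemma pm_F_measurable s (B : set (marks E)) : 0 <= s <= v -> measurable B ->
  measurable_fun (setT : set (FT v)) (fun w => pm w (`]0, s] `*` B)).
Proof.
move=> sv mB; apply/FT_fun => Q mQ; rewrite setTI; apply: sub_sigma_algebra; left; left.
by exists s, B, Q.
Qed.

Lemma good_measurable : measurable (good : set (FT v)).
Proof. by rewrite FT_measurableE; exact: good_F. Qed.

Lemma gpmE w S : gpm w S = ((\1_good w)%:E * pm w (S `&` (`]0%R, v] `*` setT)))%E.
Proof.
rewrite /gpm indicE; case: pselect => gw /=; first by rewrite mem_set// mul1e.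
by rewrite memNset// mul0e.
Qed.

Lemma gdAE w S : gdA w S = ((\1_good w)%:E * dA A w (S `&` `]0%R, v]%classic))%E.
Proof.
rewrite /gdA indicE; case: pselect => gw /=; first by rewrite mem_set// mul1e.
by rewrite memNset// mul0e.
Qed.

Lemma indic_good_measurable : measurable_fun (setT : set (FT v)) (fun w => (\1_good w : R)%:E).
Proof. by apply/measurable_EFinP/measurable_indic; exact: good_measurable. Qed.

Let RGI : setI_closed (@RGenOInfty.G R).
Proof.
move=> _ _ [x ->] [y ->]; exists (Num.max x y).
by apply/seteqP; split=> z /=; rewrite !in_itv/= !andbT gt_max => /andP.
Qed.

Lemma gpm_measurable S : measurable S -> measurable_fun setT (gpm ^~ S).
Proof.
move: S; apply: (@random_measure_prod _ _ _ _ _ _ R gpm (@RGenOInfty.G R)) => //.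
- exact: gpm_lty.
- exact: (RGenOInfty.measurableE R).
- move=> B mB.
  rewrite (_ : (fun w => _) = fun w => ((\1_good w)%:E * pm w (`]0%R, v] `*` B))%E).
    apply: emeasurable_funM; first exact: indic_good_measurable.
    by apply: pm_F_measurable => //; rewrite v0 lexx.
  apply/funext => w; rewrite gpmE; congr (_ * pm w _)%E.
  by apply/seteqP; split=> -[a b] /=; tauto.
(* []x, +oo[] meets []0, v]] in []c, v]], whose mass is the difference of those of []0, v]] and []0,
   c]], both observed at time [v]. *)
- move=> _ B [x ->] mB; pose c := Num.min (Num.max x 0) v.
  have c0 : 0 <= c by rewrite le_min v0 andbT le_max lexx orbT.
  have cv : c <= v by rewrite ge_min lexx orbT.
  rewrite (_ : (fun w => _) = fun w => ((\1_good w)%:E *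
      (pm w (`]0%R, v] `*` B) - pm w (`]0%R, c] `*` B)))%E).
    apply: emeasurable_funM; first exact: indic_good_measurable.
    by apply: emeasurable_funB; apply: pm_F_measurable => //; rewrite ?v0 ?c0 ?lexx.
  apply/funext => w; rewrite gpmE indicE.
  have [/set_mem gw|] := boolP (w \in good); last by rewrite !mul0e.
  rewrite !mul1e.
  have m1 : measurable (`]0, v] `*` B : set TE) by exact: measurableX.
  have m2 : measurable (`]0, c] `*` B : set TE) by exact: measurableX.
  have fin1 : (pm w (`]0%R, v] `*` B) < +oo)%E.
    apply: le_lt_trans (pm_lty 0 v gw); apply: le_measure; rewrite ?inE//.
      exact: measurableX.
    by move=> -[a b] /= [].
  have -> : (`]x, +oo[ `*` B) `&` (`]0, v] `*` setT) =
      (`]0, v] `*` B) `\` (`]0, c] `*` B) :> set TE.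
    apply/seteqP; split=> -[a b] /=; rewrite !in_itv/= andbT.
      move=> [[xa Bb] [/andP[a0 av] _]]; split; first by rewrite a0.
      by move=> [/andP[_]]; rewrite le_min av andbT leNgt gt_max xa a0.
    move=> [[/andP[a0 av] Bb] h]; rewrite a0 av; split=> //; split=> //.
    rewrite ltNge; apply/negP => ax; apply: h; split=> //.
    by rewrite a0 le_min av andbT le_max ax.
  have := measureD m1 m2 fin1 => ->.
  congr (_ - pm w _)%E; apply/seteqP; split=> -[a b] /=; rewrite !in_itv/=; first tauto.
  by move=> [/andP[a0 ac] Bb]; rewrite a0 ac (le_trans ac cv).
Qed.

Lemma gdA_measurable S : measurable S -> measurable_fun setT (gdA ^~ S).
Proof.
have mA t : 0 <= t <= v -> measurable_fun (setT : set (FT v)) (A t).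
  move=> /andP[t0 tv]; have [_ mA _ _] := HC.
  by apply/FT_fun => B mB; apply: (F_le tv); exact: mA.
have h x : measurable_fun setT (fun w => gdA w `]x, +oo[%classic).
  pose c := Num.min (Num.max x 0) v.
  have c0 : 0 <= c by rewrite le_min v0 andbT le_max lexx orbT.
  have cv : c <= v by rewrite ge_min lexx orbT.
  rewrite (_ : (fun w => _) = fun w => (\1_good w * (A v w - A c w))%:E).
    apply/measurable_EFinP; apply: measurable_funM.
      by apply/measurable_indic; exact: good_measurable.
    by apply: measurable_funB; apply: mA; rewrite ?v0 ?c0 ?lexx.
  apply/funext => w; rewrite gdAE indicE.
  have [/set_mem gw|] := boolP (w \in good); last by rewrite mul0r mul0e.
  rewrite mul1e mul1r -dA_itv//; congr (dA A w _).
  apply/seteqP; split=> y /=; rewrite !in_itv/= ?andbT.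
    by move=> [xy /andP[y0 yv]]; rewrite yv andbT gt_min gt_max xy y0.
  move=> /andP[+ yv]; rewrite /c gt_min => /orP[|vy].
    by rewrite gt_max => /andP[xy y0]; split=> //; apply/andP; split.
  by have := lt_le_trans vy yv; rewrite ltxx.
move: S; apply: (@random_measure_pi _ _ _ _ R gdA _ (@RGenOInfty.G R)) => //.
- exact: gdA_lty.
- exact: (RGenOInfty.measurableE R).
- rewrite (_ : (fun w => _) = fun w => gdA w `]0, +oo[%classic); first exact: h.
  apply/funext => w; rewrite !gdAE; congr (_ * dA A w _)%E.
  by apply/seteqP; split=> y /=; rewrite !in_itv/= ?andbT => -[] //; split=> //; case/andP: b.
- by move=> _ [x ->]; exact: h.
Qed.

Lemma dA_integral_measurable (g : R -> Omega -> \bar R) u : 0 <= u ->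
  (forall s w, 0 <= g s w)%E ->
  measurable_fun ([set z | 0 < z.2 <= v] : set (FT v * measurableTypeR R)) (fun z => g z.2 z.1) ->
  meas_on (F v) setT (fun w => \int[dA A w]_(s in `]u, v]) g s w)%E.
Proof.
move=> u0 g0 mg.
have mD : measurable ([set z | 0 < z.2 <= v] : set (FT v * measurableTypeR R)) by exact: measurable_time_itv.
have mDu : measurable ([set z | u < z.2 <= v] : set (FT v * measurableTypeR R)) by exact: measurable_time_itv.
pose k (z : FT v * measurableTypeR R) : \bar R :=
  ((fun z => g z.2 z.1) \_ [set z : FT v * measurableTypeR R | u < z.2 <= v]) z.
have mk : measurable_fun setT k.
  apply/(measurable_restrictT _ mDu); apply: measurable_funS mg => //.
  by move=> z /= /andP[uz zv]; rewrite zv andbT (le_lt_trans u0).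
have k0 z : (0 <= k z)%E by rewrite /k patchE; case: ifP.
apply: (@F_ae v _ _ (fun w => \int[gdA w]_s k (w, s))%E); last first.
  apply/FT_fun; apply: random_integral_measurable => //; first exact: gdA_lty.
  exact: gdA_measurable.
apply: filterS good_ae => w gw.
rewrite [RHS](_ : _ = \int[gdA w]_(s in `]u, v]) g s w)%E; last first.
  apply: eq_measure_integral => B mB Buv; rewrite gdAE indicE mem_set// mul1e.
  congr (dA A w _); apply/seteqP; split=> y /=; rewrite ?in_itv/=; last tauto.
  by move=> By; split=> //; have := Buv _ By; rewrite /= in_itv/= => /andP[uy ->];
    rewrite andbT (le_lt_trans u0).
rewrite [RHS]integral_mkcond; apply: eq_integral => s _.
rewrite /k !patchE; congr (if _ then _ else _).
Qed.

Lemma pm_integral_measurable (g : R -> Omega -> marks E -> \bar R) u : 0 <= u ->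
  (forall s w e, 0 <= g s w e)%E ->
  measurable_fun ([set z | 0 < z.2.1 <= v] : set (FT v * TE)) (fun z => g z.2.1 z.1 z.2.2) ->
  meas_on (F v) setT (fun w => \int[pm w]_(x in `]u, v] `*` setT) g x.1 w x.2)%E.
Proof.
move=> u0 g0 mg.
have mI (x : R) : measurable ([set z | x < z.2.1 <= v] : set (FT v * TE)).
  rewrite (_ : [set _ | _] = setT `*` (`]x, v] `*` setT)).
    by apply: measurableX => //; exact: measurableX.
  by apply/seteqP; split=> z /=; rewrite in_itv/=; tauto.
pose k (z : FT v * TE) : \bar R :=
  ((fun z => g z.2.1 z.1 z.2.2) \_ [set z : FT v * TE | u < z.2.1 <= v]) z.
have mk : measurable_fun setT k.
  apply/(measurable_restrictT _ (mI u)); apply: measurable_funS mg => //.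
  by move=> z /= /andP[uz zv]; rewrite zv andbT (le_lt_trans u0).
have k0 z : (0 <= k z)%E by rewrite /k patchE; case: ifP.
apply: (@F_ae v _ _ (fun w => \int[gpm w]_s k (w, s))%E); last first.
  apply/FT_fun; apply: random_integral_measurable => //; first exact: gpm_lty.
  exact: gpm_measurable.
apply: filterS good_ae => w gw.
rewrite [RHS](_ : _ = \int[gpm w]_(x in `]u, v] `*` setT) g x.1 w x.2)%E; last first.
  apply: eq_measure_integral => B mB Buv; rewrite gpmE indicE mem_set// mul1e.
  congr (pm w _); apply/seteqP; split=> y /=; rewrite ?in_itv/=; last tauto.
  by move=> By; split=> //; split=> //; have [] := Buv _ By; rewrite /= in_itv/= => /andP[uy ->];
    rewrite andbT (le_lt_trans u0).
rewrite [RHS]integral_mkcond; apply: eq_integral => s _.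
rewrite /k !patchE; congr (if _ then _ else _).
by apply/idP/idP; rewrite !inE/= in_itv/=; tauto.
Qed.

End RandomMeasures.

(** Generators of the predictable sigma-algebra on [R * Omega]. With [PT] carrying the generated
    structure, predictability becomes ordinary measurability: [ppred], and [mpred] in the presence
    of marks. *)
Definition PG := [set S | exists2 G, F 0 G & S = [set (0:R)] `*` G] `|`
  [set S | exists s t G, [/\ 0 <= s, s <= t, F s G & S = `]s, t]%classic `*` G]].

Definition PT := g_sigma_algebraType PG.

Definition mpred d' (Y : measurableType d') (H : R -> Omega -> marks E -> Y) :=
  measurable_fun (setT : set (PT * marks E)) (fun x => H x.1.1 x.1.2 x.2).

Definition ppred d' (Y : measurableType d') (X : R -> Omega -> Y) :=
  measurable_fun (setT : set PT) (fun x => X x.1 x.2).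

Lemma rect_sigmaE d1 d2 (X : measurableType d1) (Y : measurableType d2) :
  rect_sigma (@measurable _ X) (@measurable _ Y) = @measurable _ (X * Y)%type.
Proof.
rewrite measurable_prod_measurableType /rect_sigma; congr (<<s _ >>).
apply/seteqP; split=> S; first by move=> [B [C [mB mC ->]]]; exists B => //; exists C.
by move=> [B mB [C mC <-]]; exists B, C.
Qed.

Lemma rect_sigmaFE v :
  rect_sigma (@measurable _ R) (F v) = @measurable _ (measurableTypeR R * FT v)%type.
Proof.
rewrite measurable_prod_measurableType /rect_sigma; congr (<<s _ >>).
apply/seteqP; split=> S.
  by move=> [B [C [mB mC ->]]]; exists B => //; exists C => //; rewrite FT_measurableE.
by move=> [B mB [C mC <-]]; exists B, C; split=> //; rewrite -FT_measurableE.
Qed.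

Lemma progressive_measurable v (X : proc) T : 0 <= v <= T -> progressive F T X ->
  measurable_fun ([set z | 0 < z.2 <= v] : set (FT v * measurableTypeR R)) (fun z => X z.2 z.1).
Proof.
move=> /[dup] /andP[v0 _] vT /(_ v vT) mX.
move=> mD B mB; have mS := mX B mB; rewrite rect_sigmaFE in mS.
rewrite (_ : _ `&` _ = [set z | 0 < z.2 <= v] `&`
    (fun z : FT v * measurableTypeR R => (z.2, z.1)) @^-1` (`[0, v] `*` setT `&`
    (fun x : measurableTypeR R * FT v => X x.1 x.2) @^-1` B)).
  apply: measurableI => //; rewrite -[X in measurable X]setTI.
  exact: (measurable_fun_pair measurable_snd measurable_fst).
apply/seteqP; split=> -[w s] /=; rewrite in_itv/=; last tauto.
by move=> [/andP[s0 ->] h]; rewrite s0 (ltW s0).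
Qed.

Lemma predictable_progressive v : 0 <= v ->
  measurable_fun ([set z | 0 < z.2 <= v] : set (FT v * measurableTypeR R))
    (fun z => (z.2, z.1) : PT).
Proof.
move=> v0 mD; apply: (@measurability _ _ _ PT _ _ PG) => // _ [S [[G FG ->]|[s [t [G [s0 st FG ->]]]]] <-].
  rewrite (_ : _ `&` _ = set0)//; apply/seteqP; split=> -[w s] //= [/andP[+ _] [s0 _]].
  by rewrite s0 ltxx.
have [vs|sv] := leP v s.
  rewrite (_ : _ `&` _ = set0)//; apply/seteqP; split=> -[w r] //= [/andP[_ rv] [+ _]].
  by rewrite in_itv/= => /andP[sr _]; move: (lt_le_trans sr rv); rewrite ltNge vs.
rewrite (_ : _ `&` _ = G `*` `]s, Num.min t v]).
  by apply: measurableX => //; rewrite FT_measurableE; exact: (F_le (ltW sv)).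
apply/seteqP; split=> -[w r] /=; rewrite !in_itv/= le_min.
  by move=> [/andP[r0 ->] [/andP[-> ->]]].
by move=> [Gw /andP[sr /andP[-> ->]]]; rewrite sr (le_lt_trans s0 sr).
Qed.

Lemma ppred_progressive d' (Y : measurableType d') v (X : R -> Omega -> Y) : 0 <= v -> ppred X ->
  measurable_fun ([set z | 0 < z.2 <= v] : set (FT v * measurableTypeR R)) (fun z => X z.2 z.1).
Proof.
move=> v0 mX; exact: (measurableT_comp mX (predictable_progressive v0)).
Qed.

Lemma mpred_progressive d' (Y : measurableType d') v (H : R -> Omega -> marks E -> Y) :
  0 <= v -> mpred H ->
  measurable_fun ([set z | 0 < z.2.1 <= v] : set (FT v * TE)) (fun z => H z.2.1 z.1 z.2.2).
Proof.
move=> v0 mH.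
pose psi (z : FT v * measurableTypeR R) : PT := if 0 < z.2 <= v then (z.2, z.1) else point.
have mpsi : measurable_fun setT psi.
  have mD : measurable ([set z | 0 < z.2 <= v] : set (FT v * measurableTypeR R)) by exact: measurable_time_itv.
  apply: measurable_fun_if => //.
  - by apply: (measurable_fun_bool true); rewrite setTI; exact: mD.
  - by rewrite setTI; exact: predictable_progressive.
have h : measurable_fun (setT : set (FT v * TE))
    (fun z => (psi (z.1, z.2.1), z.2.2) : PT * marks E).
  apply: measurable_fun_pair; last exact: (measurableT_comp measurable_snd measurable_snd).
  apply: (measurableT_comp mpsi); apply: measurable_fun_pair => //.
  exact: (measurableT_comp measurable_fst measurable_snd).
apply: (eq_measurable_fun (fun z : FT v * TE => H (psi (z.1, z.2.1)).1 (psi (z.1, z.2.1)).2 z.2.2)).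
  by move=> z; rewrite inE/= /psi/= => ->.
by apply: measurable_funTS; exact: (measurableT_comp mH h).
Qed.

Lemma measurable_pred_itv (s t : R) (G : set Omega) : 0 <= s -> F s G ->
  measurable (`]s, t]%classic `*` G : set PT).
Proof.
move=> s0 FG; have [st|ts] := leP s t.
  by apply: sub_sigma_algebra; right; exists s, t, G.
by rewrite set_itv_ge ?set0X// bnd_simp -leNgt ltW.
Qed.

Lemma measurable_pred_infty (s : R) (G : set Omega) : 0 <= s -> F s G ->
  measurable (`]s, +oo[%classic `*` G : set PT).
Proof.
move=> s0 FG.
rewrite (_ : _ `*` _ = \bigcup_n (`]s, n%:R]%classic `*` G)).
  by apply: bigcupT_measurable => n; exact: measurable_pred_itv.
apply/seteqP; split=> -[r w] /=.
  rewrite in_itv/= andbT => -[sr Gw]; exists (Num.bound r) => //=.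
  by split=> //; rewrite in_itv/= sr ltW// archi_boundP// (le_trans s0)// ltW.
by move=> [n _ /= []]; rewrite !in_itv/= => /andP[-> _].
Qed.

Lemma measurable_pred_zero (G : set Omega) : F 0 G -> measurable ([set 0] `*` G : set PT).
Proof. by move=> FG; apply: sub_sigma_algebra; left; exists G. Qed.

Lemma measurable_pred_pos : measurable (`[0, +oo[%classic `*` setT : set PT).
Proof.
rewrite (_ : _ `*` _ = ([set 0] `*` setT) `|` (`]0, +oo[%classic `*` setT)).
  apply: measurableU; first by apply: measurable_pred_zero; exact: F_setT.
  by apply: measurable_pred_infty => //; exact: F_setT.
apply/seteqP; split=> -[r w] /=; rewrite !in_itv/= !andbT.
  by rewrite le_eqVlt eq_sym => -[/predU1P[->|r0] _]; [left|right].
by move=> [[->]|[/ltW]].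
Qed.

Lemma measurable_pred_le T : measurable (`[0, T]%classic `*` setT : set PT).
Proof.
have [T0|T0] := leP 0 T; last by rewrite set_itv_ge ?set0X// bnd_simp -ltNge.
rewrite (_ : _ `*` _ = ([set 0] `*` setT) `|` (`]0, T]%classic `*` setT)).
  apply: measurableU; first by apply: measurable_pred_zero; exact: F_setT.
  by apply: measurable_pred_itv => //; exact: F_setT.
apply/seteqP; split=> -[r w] /=; rewrite !in_itv/=.
  by rewrite le_eqVlt eq_sym => -[/andP[/predU1P[->|r0] rT] _]; [left|right; rewrite r0].
by move=> [[->]|[/andP[/ltW ->]]]; rewrite ?lexx.
Qed.

End PointMeasure.

Lemma rect_sigmaPE : rect_sigma (predictable_sets F) (@measurable _ (marks E)) =
  @measurable _ (PT * marks E)%type.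
Proof. exact: (@rect_sigmaE _ _ PT (marks E)). Qed.

Lemma mark_predictable_mpred T (U : R -> Omega -> marks E -> R) :
  mark_predictable F `[0, T] U ->
  mpred (fun s w e => if (0 <= s <= T) then U s w e else 0).
Proof.
move=> mU; rewrite /mpred.
have mD : measurable (`[0, T]%classic `*` setT : set PT) by exact: measurable_pred_le.
have mD' : measurable ((`[0, T]%classic `*` setT) `*` setT : set (PT * marks E)).
  exact: measurableX.
rewrite (_ : (fun x => _) = (fun x : PT * marks E => U x.1.1 x.1.2 x.2) \_
    ((`[0, T]%classic `*` setT) `*` setT)); last first.
  apply/funext => -[[s w] e]; rewrite patchE /=.
  case: ifPn => sT; first by rewrite mem_set//=; split=> //; split=> //=; rewrite in_itv.
  by rewrite memNset//= => -[[+ _] _]; rewrite in_itv/= (negbTE sT).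
apply/(measurable_restrictT _ mD') => _ B mB; rewrite -rect_sigmaPE; exact: mU.
Qed.

Lemma mpred_mark_predictable (H : R -> Omega -> marks E -> \bar R) : mpred H ->
  mark_predictable F `[0, +oo[ H.
Proof.
move=> mH B mB; rewrite rect_sigmaPE; apply: measurableI.
  by apply: measurableX => //; exact: measurable_pred_pos.
by rewrite -[X in measurable X]setTI; exact: mH.
Qed.

(** Predictability of [phi] is given for times [t >= 0], so the kernel is put equal to zero at
    negative times; [phint] below follows the same convention. *)
Definition phiK (x : PT) : {measure set (marks E) -> \bar R} :=
  if 0 <= x.1 is true return {measure set (marks E) -> \bar R} then phi x.1 x.2 else mzero.

Lemma phiK_lty x : (phiK x setT < +oo)%E.
Proof.
by rewrite /phiK; case: ifP => _; rewrite /mzero/= ?ltry//; exact: fin_num_fun_lty.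
Qed.

Lemma phiK_measurable B : measurable B -> measurable_fun setT (phiK ^~ B).
Proof.
move=> mB; have [/(_ B mB) mp _ _ _] := HC.
have mD : measurable (`[0, +oo[%classic `*` setT : set PT) by exact: measurable_pred_pos.
rewrite (_ : phiK ^~ B = EFin \o ((fun x : PT => fine (phi x.1 x.2 B)) \_
    (`[0, +oo[%classic `*` setT))).
  apply/measurable_EFinP; apply/(measurable_restrictT _ mD) => _ C mC; exact: mp.
apply/funext => -[s w]; rewrite /= patchE /phiK /=.
case: ifPn => s0.
  by rewrite mem_set ?fineK ?fin_num_measure//=; split=> //=; rewrite in_itv/= s0.
by rewrite memNset//= => -[+ _]; rewrite in_itv/= (negbTE s0).
Qed.

Lemma phiK_integral_measurable (H : R -> Omega -> marks E -> \bar R) :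
  (forall s w e, 0 <= H s w e)%E -> mpred H ->
  measurable_fun setT (fun x : PT => \int[phiK x]_e H x.1 x.2 e)%E.
Proof.
move=> H0 mH; apply: (@random_integral_measurable _ _ PT (marks E) R phiK _ _
  (fun z => H z.1.1 z.1.2 z.2)) => //.
- exact: phiK_lty.
- exact: phiK_measurable.
Qed.

Definition phint (h : R -> Omega -> marks E -> R) (s : R) (w : Omega) : R :=
  if 0 <= s then \int[phi s w]_e h s w e else 0.

Lemma mpred_section (d' : measure_display) (Y : measurableType d')
    (h : R -> Omega -> marks E -> Y) s w : mpred h -> measurable_fun setT (h s w).
Proof.
move=> mh.
exact: (measurableT_comp mh (measurable_pair1 ((s, w) : PT))).
Qed.

Lemma PT_pair w : measurable_fun (setT : set (measurableTypeR R)) (fun s => (s, w) : PT).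
Proof.
apply: (@measurability _ _ _ PT _ _ (PG)) => //.
move=> _ [S [[G FG ->]|[s [t [G [s0 st FG ->]]]]] <-]; rewrite setTI.
  have [Gw|nGw] := pselect (G w).
    rewrite (_ : _ @^-1` _ = [set 0]); first exact: measurable_set1.
    by apply/seteqP; split=> r //= [].
  rewrite (_ : _ @^-1` _ = set0)//.
  by apply/seteqP; split=> r //= [].
have [Gw|nGw] := pselect (G w).
  rewrite (_ : _ @^-1` _ = `]s, t]%classic); first exact: measurable_itv.
  by apply/seteqP; split=> r //= [].
rewrite (_ : _ @^-1` _ = set0)//.
by apply/seteqP; split=> r //= [].
Qed.

Lemma ppred_path d' (Y : measurableType d') (X : R -> Omega -> Y) w : ppred X ->
  measurable_fun (setT : set (measurableTypeR R)) (X ^~ w).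
Proof. by move=> mX; exact: (measurableT_comp mX (PT_pair w)). Qed.

Lemma mpred_path d' (Y : measurableType d') (h : R -> Omega -> marks E -> Y) w : mpred h ->
  measurable_fun (setT : set TE) (fun x => h x.1 w x.2).
Proof.
move=> mh; apply: (measurableT_comp mh (f := fun x : PT * marks E => h x.1.1 x.1.2 x.2)
  (g := fun x : TE => ((x.1, w) : PT, x.2))).
apply: measurable_fun_pair; last exact: measurable_snd.
exact: (measurableT_comp (PT_pair w) measurable_fst).
Qed.

Lemma F_fun_measurable t d' (Y : measurableType d') (f : Omega -> Y) :
  meas_on (F t) setT f -> measurable_fun setT f.
Proof. exact: (meas_on_measurable (@F_measurable t)). Qed.

Lemma phint_ppred (h : R -> Omega -> marks E -> R) : mpred h -> ppred (phint h).
Proof.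
move=> mh; rewrite /ppred.
have mh' : mpred (fun s w e => (h s w e)%:E) by apply/measurable_EFinP.
rewrite (_ : (fun x => _) = fun x : PT => fine
  (\int[phiK x]_e (((fun e => (h x.1 x.2 e)%:E)^\+)%E e)
   - \int[phiK x]_e (((fun e => (h x.1 x.2 e)%:E)^\-)%E e))%E).
  apply: measurableT_comp => //; apply: emeasurable_funB.
    apply: (phiK_integral_measurable (H := fun s w => ((fun e => (h s w e)%:E)^\+)%E)).
      by move=> *; exact: funepos_ge0.
    rewrite /mpred (_ : (fun x => _) =
      ((fun x : PT * marks E => (h x.1.1 x.1.2 x.2)%:E)^\+)%E); first exact: measurable_funepos.
    by apply/funext => x; rewrite !funeposE.
  apply: (phiK_integral_measurable (H := fun s w => ((fun e => (h s w e)%:E)^\-)%E)).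
    by move=> *; exact: funeneg_ge0.
  rewrite /mpred (_ : (fun x => _) =
    ((fun x : PT * marks E => (h x.1.1 x.1.2 x.2)%:E)^\-)%E); first exact: measurable_funeneg.
  by apply/funext => x; rewrite !funenegE.
apply/funext => x; rewrite /phint /phiK; case: ifPn => _.
  by rewrite -integralE.
by rewrite !integral_measure_zero sube0.
Qed.

Lemma phint_EFin (h : R -> Omega -> marks E -> R) s w c : mpred h -> (forall s w e, `|h s w e| <= c) -> 0 <= s ->
  (phint h s w)%:E = (\int[phi s w]_e (h s w e)%:E)%E.
Proof.
move=> mh hc s0; rewrite /phint s0 -[LHS]/((@EX _ _ _ (phi s w) (h s w))%:E) EX_EFin//.
by apply: (@I1_bdd _ _ _ _ _ c) => //; exact: mpred_section.
Qed.

Lemma I1_phi (h : R -> Omega -> marks E -> R) s w c : mpred h -> (forall s w e, `|h s w e| <= c) -> I1 (phi s w) (h s w).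
Proof. by move=> mh hc; apply: (@I1_bdd _ _ _ _ _ c) => //; exact: mpred_section. Qed.

Lemma phint_bdd (h : R -> Omega -> marks E -> R) s w c : mpred h -> (forall s w e, `|h s w e| <= c) -> `|phint h s w| <= c.
Proof.
move=> mh hc; have c0 : 0 <= c.
  exact: (le_trans (normr_ge0 _) (hc s w point)).
rewrite /phint; case: ifPn => _; last by rewrite normr0.
apply: le_trans (EX_abs (I1_phi s w mh hc)) _.
rewrite -(EX_cst (phi s w) c); apply: EX_le.
- exact/I1_abs/(I1_phi s w mh hc).
- exact: I1_cst.
- by move=> e; exact: hc.
Qed.

Section Path.
Variables (u v : R) (w : Omega).
Hypotheses (u0 : 0 <= u) (uv : u <= v) (gw : good w).

Lemma dA_integrable_bdd (X : R -> R) c :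
  measurable_fun (setT : set (measurableTypeR R)) X ->
  (forall s, u < s <= v -> `|X s| <= c) ->
  itg (dA A w) u v X.
Proof.
move=> mX Xc; apply: integrable_bdd => //.
- by rewrite (dA_itv gw)// ltry.
- exact: measurable_funTS.
- by move=> s /=; rewrite in_itv/=; exact: Xc.
Qed.

Lemma dA_Rint_le (X : R -> R) c :
  measurable_fun (setT : set (measurableTypeR R)) X ->
  (forall s, u < s <= v -> `|X s| <= c) ->
  `| \int[dA A w]_(s in `]u, v]) X s| <= c * (A v w - A u w).
Proof.
move=> mX Xc.
have mI : measurable (rset R `]u, v]) by exact: measurable_itv.
have iX := dA_integrable_bdd mX Xc.
apply: le_trans (le_normr_Rintegral mI iX) _.
have -> : A v w - A u w = fine (dA A w `]u, v]%classic) by rewrite (dA_itv gw).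
rewrite -Rintegral_cst//; apply: le_Rintegral => //.
- exact: (integrable_abse iX).
- exact: (@dA_integrable_bdd (fun=> c) `|c|).
Qed.

End Path.

Lemma dA_Rint_measurable (X : proc) u v : 0 <= u -> 0 <= v ->
  measurable_fun ([set z | 0 < z.2 <= v] : set (FT v * measurableTypeR R)) (fun z => X z.2 z.1) ->
  meas_on (F v) setT (fun w => \int[dA A w]_(s in `]u, v]) X s w).
Proof.
move=> u0 v0 mX; have mX' := measurableT_comp (@EFin_measurable R setT) mX.
apply/FT_fun.
rewrite (_ : (fun w => _) = fun w => fine
  (\int[dA A w]_(s in `]u, v]) maxe (X s w)%:E 0
   - \int[dA A w]_(s in `]u, v]) maxe (- (X s w)%:E) 0)%E); last first.
  apply/funext => w; rewrite /Rintegral integralE; congr (fine (_ - _)%E).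
    by apply: eq_integral => s _; rewrite funeposE.
  by apply: eq_integral => s _; rewrite funenegE.
apply: measurableT_comp => //; apply: emeasurable_funB; apply/FT_fun.
  apply: dA_integral_measurable => //; first by move=> *; rewrite le_max lexx orbT.
  by apply: measurable_maxe => //; exact: measurable_cst.
apply: dA_integral_measurable => //; first by move=> *; rewrite le_max lexx orbT.
by apply: measurable_maxe; [exact: measurableT_comp|exact: measurable_cst].
Qed.

Lemma pm_Rint_measurable (h : R -> Omega -> marks E -> R) u v : 0 <= u -> 0 <= v -> mpred h ->
  meas_on (F v) setT (fun w => \int[pm w]_(x in `]u, v] `*` setT) h x.1 w x.2).
Proof.
move=> u0 v0 /(mpred_progressive v0) mh; have mh' := measurableT_comp (@EFin_measurable R setT) mh.
apply/FT_fun.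
rewrite (_ : (fun w => _) = fun w => fine
  (\int[pm w]_(x in `]u, v] `*` setT) maxe (h x.1 w x.2)%:E 0
   - \int[pm w]_(x in `]u, v] `*` setT) maxe (- (h x.1 w x.2)%:E) 0)%E); last first.
  apply/funext => w; rewrite /Rintegral integralE; congr (fine (_ - _)%E).
    by apply: eq_integral => s _; rewrite funeposE.
  by apply: eq_integral => s _; rewrite funenegE.
apply: measurableT_comp => //; apply: emeasurable_funB; apply/FT_fun.
  apply: (pm_integral_measurable v0 (g := fun s w e => maxe (h s w e)%:E 0)%E) => //.
    by move=> *; rewrite le_max lexx orbT.
  by apply: measurable_maxe => //; exact: measurable_cst.
apply: (pm_integral_measurable v0 (g := fun s w e => maxe (- (h s w e)%:E) 0)%E) => //.
  by move=> *; rewrite le_max lexx orbT.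
by apply: measurable_maxe; [exact: measurableT_comp|exact: measurable_cst].
Qed.

Lemma ppred_cut d' (Y : measurableType d') (X : Omega -> Y) (y : Y) u v : 0 <= u ->
  meas_on (F u) setT X -> ppred (fun s w => if u < s <= v then X w else y).
Proof.
move=> u0 mX; rewrite /ppred.
have mD (G : set Omega) : F u G -> measurable (`]u, v]%classic `*` G : set PT).
  exact: measurable_pred_itv.
rewrite (_ : (fun x => _) = fun x : PT => if u < x.1 <= v then X x.2 else y)//.
apply: measurable_fun_if => //.
- apply: (measurable_fun_bool true); rewrite setTI.
  rewrite (_ : _ @^-1` _ = `]u, v]%classic `*` setT); first by apply: mD; exact: F_setT.
  by apply/seteqP; split=> -[s w] /=; rewrite in_itv/=; tauto.
- rewrite setTI => _ B mB.
  rewrite (_ : _ `&` _ = `]u, v]%classic `*` (X @^-1` B)).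
    by apply: mD; have := mX B mB; rewrite setTI.
  by apply/seteqP; split=> -[s w] /=; rewrite in_itv/=; tauto.
Qed.

Lemma ppred_mpred d' (Y : measurableType d') (X : R -> Omega -> Y) : ppred X ->
  mpred (fun s w _ => X s w).
Proof. by move=> mX; exact: (measurableT_comp mX measurable_fst). Qed.

Lemma mpred_cut (X : Omega -> R) (h : R -> Omega -> marks E -> R) u v : 0 <= u -> meas_on (F u) setT X -> mpred h ->
  mpred (fun s w e => (if u < s <= v then X w else 0) * h s w e).
Proof.
by move=> u0 mX mh; exact: (measurable_funM (ppred_mpred (@ppred_cut _ _ X 0 u v u0 mX)) mh).
Qed.

Lemma comp_ge0 (H : R -> Omega -> marks E -> \bar R) u v : 0 <= u ->
  (forall s w e, 0 <= H s w e)%E -> mpred H ->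
  (\int[P]_w \int[pm w]_(x in `]u, v] `*` setT) H x.1 w x.2 =
   \int[P]_w \int[dA A w]_(s in `]u, v]) \int[phi s w]_e H s w e)%E.
Proof.
move=> u0 H0 mH.
pose H' s w e := ((if (u < s <= v)%R then 1%E else 0%E) * H s w e)%E.
have mH' : mpred H'.
  have m1 : meas_on (F u) setT (fun=> 1%E : \bar R) by apply/FT_fun; exact: measurable_cst.
  exact: (emeasurable_funM (ppred_mpred (@ppred_cut _ _ _ 0%E u v u0 m1)) mH).
have H'0 s w e : (0 <= H' s w e)%E by apply: mule_ge0 => //; case: ifP.
have [_ _ _ /(_ H' H'0 (mpred_mark_predictable mH')) HH] := HC.
rewrite [LHS](_ : _ = (\int[P]_w \int[pm w]_(x in `]0%R, +oo[ `*` setT) H' x.1 w x.2)%E).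
  rewrite HH; apply: eq_integral => w _.
  rewrite [LHS]integral_mkcond [RHS]integral_mkcond; apply: eq_integral => s _; rewrite !patchE.
  rewrite /H'; have [suv|suv] := boolP (s \in `]u, v]%classic); last first.
    case: ifPn => // _; rewrite (_ : (u < s <= v) = false) ?integral0_eq//.
    - by move=> e _; rewrite mul0e.
    - by apply/negbTE; move: suv; apply: contra => suv; apply/mem_set; rewrite /= in_itv.
  move: suv; rewrite inE/= in_itv/= => /[dup] /andP[us _] ->.
  rewrite mem_set/=; last by rewrite in_itv/= (le_lt_trans u0 us).
  by apply: eq_integral => e _; rewrite mul1e.
apply: eq_integral => w _.
rewrite [LHS]integral_mkcond [RHS]integral_mkcond; apply: eq_integral => -[s e] _; rewrite !patchE.
rewrite /H'/=; have [suv|suv] := boolP (u < s <= v); last first.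
  rewrite memNset; first by case: ifP; rewrite ?mul0e.
  by rewrite /= in_itv/= (negbTE suv) => -[].
rewrite !mem_set ?mul1e//=; split=> //; rewrite in_itv//=.
by case/andP: suv => us _; rewrite (le_lt_trans u0 us).
Qed.

Section Bounded.
Variables (u v : R).
Hypotheses (u0 : 0 <= u) (uv : u <= v) (IA : I1 P (A v)).

Lemma dA_phint_meas (h : R -> Omega -> marks E -> R) : mpred h -> measurable_fun setT
  (fun w => \int[dA A w]_(s in `]u, v]) phint h s w).
Proof.
move=> mh; apply: (@F_fun_measurable v); apply: dA_Rint_measurable => //.
  exact: le_trans uv.
by apply: ppred_progressive; [exact: le_trans uv|exact: phint_ppred].
Qed.

Lemma pm_Rint_meas (h : R -> Omega -> marks E -> R) : mpred h -> measurable_fun setT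
  (fun w => \int[pm w]_(x in `]u, v] `*` setT) h x.1 w x.2).
Proof.
move=> mh; apply: (@F_fun_measurable v); apply: pm_Rint_measurable => //.
exact: le_trans uv.
Qed.

Lemma dA_phint_le w (h : R -> Omega -> marks E -> R) c : good w -> mpred h -> (forall s w e, `|h s w e| <= c) ->
  `|\int[dA A w]_(s in `]u, v]) phint h s w| <= c * (A v w - A u w).
Proof.
move=> gw mh hc; apply: (dA_Rint_le u0 uv gw).
  by apply: ppred_path; exact: phint_ppred.
by move=> s _; exact: phint_bdd.
Qed.

Lemma dA_phint_I1 (h : R -> Omega -> marks E -> R) c : mpred h -> (forall s w e, `|h s w e| <= c) ->
  I1 P (fun w => \int[dA A w]_(s in `]u, v]) phint h s w).
Proof.
move=> mh hc; apply: I1_le_ae (dA_phint_meas mh) (I1Z c IA) _.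
have c0 (w : Omega) : 0 <= c by apply: le_trans (hc u w point); exact: normr_ge0.
apply: filterS good_ae => w gw; apply: le_trans (dA_phint_le gw mh hc) _.
apply: ler_wpM2l; first exact: c0.
have [A0 [Ai _] _ _ _] := gw.
by rewrite gerBl -[leLHS]A0; apply: Ai; rewrite lexx.
Qed.

Lemma pm_integrable w (h : R -> Omega -> marks E -> R) c : good w -> mpred h ->
  (forall s w e, `|h s w e| <= c) ->
  (pm w).-integrable (`]u, v] `*` setT) (EFin \o (fun x : TE => h x.1 w x.2)).
Proof.
move=> gw mh hc.
have mD : measurable (`]u, v] `*` setT : set TE) by exact: measurableX.
apply: (@integrable_bdd _ _ _ (pm w) _ (fun x : TE => h x.1 w x.2) c mD (pm_lty u v gw)).
  by apply: measurable_funTS; exact: mpred_path.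
by move=> x _; exact: hc.
Qed.

Lemma pm_RintB w (h h' : R -> Omega -> marks E -> R) c : good w -> mpred h -> mpred h' ->
  (forall s w e, `|h s w e| <= c) -> (forall s w e, `|h' s w e| <= c) ->
  \int[pm w]_(x in `]u, v] `*` setT) (h x.1 w x.2 - h' x.1 w x.2) =
  \int[pm w]_(x in `]u, v] `*` setT) h x.1 w x.2 -
  \int[pm w]_(x in `]u, v] `*` setT) h' x.1 w x.2.
Proof.
move=> gw mh mh' hc hc'.
have mD : measurable (`]u, v] `*` setT : set TE) by exact: measurableX.
exact: (RintegralB mD (pm_integrable gw mh hc) (pm_integrable gw mh' hc')).
Qed.

Lemma dA_phint_integrable w (h : R -> Omega -> marks E -> R) c : good w -> mpred h ->
  (forall s w e, `|h s w e| <= c) ->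
  itg (dA A w) u v (phint h ^~ w).
Proof.
move=> gw mh hc; apply: (dA_integrable_bdd u0 uv gw (X := phint h ^~ w) (c := c)).
  by apply: ppred_path; exact: phint_ppred.
by move=> s _; exact: phint_bdd.
Qed.

Lemma dA_phintB w (h h' : R -> Omega -> marks E -> R) c : good w -> mpred h -> mpred h' ->
  (forall s w e, `|h s w e| <= c) -> (forall s w e, `|h' s w e| <= c) ->
  \int[dA A w]_(s in `]u, v]) phint (fun s w e => h s w e - h' s w e) s w =
  \int[dA A w]_(s in `]u, v]) phint h s w - \int[dA A w]_(s in `]u, v]) phint h' s w.
Proof.
move=> gw mh mh' hc hc'.
have mI : measurable (rset R `]u, v]) by exact: measurable_itv.
rewrite -(RintegralB mI (dA_phint_integrable gw mh hc) (dA_phint_integrable gw mh' hc')).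
apply: eq_Rintegral => s _; rewrite /phint; case: ifP => _; last by rewrite subr0.
exact: (EXB (I1_phi s w mh hc) (I1_phi s w mh' hc')).
Qed.

Lemma comp_ge0_bdd (h : R -> Omega -> marks E -> R) c : mpred h -> (forall s w e, 0 <= h s w e <= c) ->
  I1 P (fun w => \int[pm w]_(x in `]u, v] `*` setT) h x.1 w x.2) /\
  EX P (fun w => \int[pm w]_(x in `]u, v] `*` setT) h x.1 w x.2) =
  EX P (fun w => \int[dA A w]_(s in `]u, v]) phint h s w).
Proof.
move=> mh hc; have hc' s w e : `|h s w e| <= c.
  by case/andP: (hc s w e) => h0 ?; rewrite ger0_norm.
have IR := dA_phint_I1 mh hc'.
have pmE : \forall w \ae P, (\int[pm w]_(x in `]u, v] `*` setT) h x.1 w x.2)%:E =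
    (\int[pm w]_(x in `]u, v] `*` setT) (h x.1 w x.2)%:E)%E.
  apply: filterS good_ae => w gw; rewrite /Rintegral fineK//.
  have mD : measurable (`]u, v] `*` setT : set TE) by exact: measurableX.
  apply: integrable_fin_num => //.
  exact: (pm_integrable gw mh hc').
have cE : (\int[P]_w (\int[pm w]_(x in `]u, v] `*` setT) h x.1 w x.2)%:E =
    \int[P]_w (\int[dA A w]_(s in `]u, v]) phint h s w)%:E)%E.
  transitivity (\int[P]_w \int[pm w]_(x in `]u, v] `*` setT) (h x.1 w x.2)%:E)%E.
    apply: ae_eq_integral => //.
    - by apply/measurable_EFinP; exact: pm_Rint_meas.
    - apply: (@F_fun_measurable v).
      apply: (pm_integral_measurable _ (g := fun s w e => (h s w e)%:E)) => //.
      + exact: le_trans uv.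
      + by move=> s w e; rewrite lee_fin; case/andP: (hc s w e).
      + by apply/measurable_EFinP; apply: mpred_progressive => //; exact: le_trans uv.
    - by apply: filterS pmE => w ->.
  rewrite (@comp_ge0 (fun s w e => (h s w e)%:E))//; last first.
  - by apply/measurable_EFinP.
  - by move=> s w e; rewrite lee_fin; case/andP: (hc s w e).
  apply: ae_eq_integral => //.
  - apply: (@F_fun_measurable v).
    apply: (dA_integral_measurable _ (g := fun s w => \int[phi s w]_e (h s w e)%:E)%E) => //.
    + exact: le_trans uv.
    + by move=> s w; apply: integral_ge0 => e _; rewrite lee_fin; case/andP: (hc s w e).
    + have := ppred_progressive (le_trans u0 uv) (phint_ppred mh).
      move=> /(measurableT_comp (@EFin_measurable R setT)); apply: eq_measurable_fun => z.
      by rewrite inE /= => /andP[/ltW z0 _]; rewrite (phint_EFin _ mh hc').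
  - by apply/measurable_EFinP; case/integrableP: IR => /measurable_EFinP.
  apply: filterS good_ae => w gw _.
  transitivity (\int[dA A w]_(s in `]u, v]) (phint h s w)%:E)%E.
    apply: eq_integral => s; rewrite inE/= in_itv/= => /andP[us _].
    by rewrite (phint_EFin _ mh hc')// (le_trans u0 (ltW us)).
  rewrite /Rintegral fineK//; apply: integrable_fin_num => //.
  exact: (dA_phint_integrable gw mh hc').
have IL : I1 P (fun w => \int[pm w]_(x in `]u, v] `*` setT) h x.1 w x.2).
  apply/integrableP; split; first by apply/measurable_EFinP; exact: pm_Rint_meas.
  rewrite (_ : (\int[P]_x _)%E = (\int[P]_w (\int[pm w]_(x in `]u, v] `*` setT) h x.1 w x.2)%:E)%E).
    by rewrite cE -EX_EFin ?ltry.
  apply: eq_integral => w _ /=; rewrite ger0_norm// /Rintegral fine_ge0//.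
  by apply: integral_ge0 => x _; rewrite lee_fin; case/andP: (hc x.1 w x.2).
by split=> //; apply: EFin_inj; rewrite (EX_EFin IL) (EX_EFin IR).
Qed.

Lemma comp_bdd (h : R -> Omega -> marks E -> R) c : mpred h -> (forall s w e, `|h s w e| <= c) ->
  I1 P (fun w => \int[pm w]_(x in `]u, v] `*` setT) h x.1 w x.2) /\
  EX P (fun w => \int[pm w]_(x in `]u, v] `*` setT) h x.1 w x.2) =
  EX P (fun w => \int[dA A w]_(s in `]u, v]) phint h s w).
Proof.
move=> mh hc.
pose hp s w e := Num.max (h s w e) 0; pose hn s w e := Num.max (- h s w e) 0.
have mhp : mpred hp by apply: (measurable_maxr mh); exact: measurable_cst.
have mhn : mpred hn.
  have mN : mpred (fun s w e => - h s w e).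
    exact: (measurableT_comp (measurable_funN (@measurable_id _ R setT)) mh).
  by apply: (measurable_maxr mN); exact: measurable_cst.
have hpc s w e : 0 <= hp s w e <= c.
  rewrite /hp le_max lexx orbT/= ge_max (le_trans (ler_norm _) (hc s w e)).
  exact: (le_trans (normr_ge0 _) (hc s w e)).
have hnc s w e : 0 <= hn s w e <= c.
  rewrite /hn le_max lexx orbT/= ge_max (le_trans (ler_norm _)) ?normrN ?hc//=.
  exact: (le_trans (normr_ge0 _) (hc s w e)).
have abs (k : R -> Omega -> marks E -> R) : (forall s w e, 0 <= k s w e <= c) ->
    forall s w e, `|k s w e| <= c.
  by move=> kc s w e; case/andP: (kc s w e) => k0 ?; rewrite ger0_norm.
have hE : h = fun s w e => hp s w e - hn s w e.
  apply/funext => s; apply/funext => w; apply/funext => e; rewrite /hp /hn.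
  by case: (leP 0 (h s w e)); case: (leP 0 (- h s w e)); lra.
have [Ip Ep] := comp_ge0_bdd mhp hpc; have [In En] := comp_ge0_bdd mhn hnc.
have aeE : \forall w \ae P,
   \int[pm w]_(x in `]u, v] `*` setT) hp x.1 w x.2 -
   \int[pm w]_(x in `]u, v] `*` setT) hn x.1 w x.2 =
   \int[pm w]_(x in `]u, v] `*` setT) h x.1 w x.2.
  apply: filterS good_ae => w gw; rewrite hE.
  by rewrite (pm_RintB gw mhp mhn (abs _ hpc) (abs _ hnc)).
have mL := pm_Rint_meas mh; have IL := I1B Ip In.
split; first exact: I1_ae aeE IL.
have Jp := dA_phint_I1 mhp (abs _ hpc); have Jn := dA_phint_I1 mhn (abs _ hnc).
rewrite -(EX_ae (I1_meas IL) mL aeE) (EXB Ip In) Ep En -(EXB Jp Jn).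
apply: EX_ae => //.
- exact: (I1_meas (I1B Jp Jn)).
- exact: dA_phint_meas.
- apply: filterS good_ae => w gw.
  by rewrite [in RHS]hE (dA_phintB gw mhp mhn (abs _ hpc) (abs _ hnc)).
Qed.

End Bounded.

(** * The density process attached to a rate *)

Definition jr r w n : R := r (fine (Tn n w)) w (zeta n w).

Definition jprod r u v w : R :=
  limn (fun N => \prod_(1 <= n < N | jump u v w n) jr r w n).

Definition cint r u v w : R :=
  \int[dA A w]_(s in `]u, v]) phint (fun s w e => 1 - r s w e) s w.

(** The ratio [L_v / L_u] of the density process with rate [r]: [jprod] collects the jumps and
    [cint] the compensator. On a path in [good] the partial products are eventually constant, which
    gives multiplicativity in time. *)
Definition Lam r u v w : R := jprod r u v w * expR (cint r u v w).

Lemma jump_lt u v w n : (v%:E < Tn n w)%E -> jump u v w n = false.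
Proof. by move=> vT; rewrite /jump; apply/negbTE; rewrite negb_and -!ltNge vT orbT. Qed.

Lemma jprodE r u v w N : (forall n, (N <= n)%N -> (v%:E < Tn n w)%E) ->
  jprod r u v w = \prod_(1 <= n < N.+1 | jump u v w n) jr r w n.
Proof.
move=> NT; apply: cvg_lim => //; apply: cvg_near_cst; exists N.+1 => // M /= NM.
rewrite (@big_cat_nat _ _ _ N.+1)//= [X in _ * X]big_nat_cond [X in _ * X]big1 ?mulr1//.
by move=> n /andP[/andP[Nn _]]; rewrite jump_lt// NT// ltnW.
Qed.

Lemma jump_cat u v z w n : u <= v -> v <= z ->
  jump u z w n = jump u v w n || jump v z w n.
Proof.
move=> uv vz; rewrite /jump; have [vT|Tv] := ltP v%:E (Tn n w).
  by rewrite andbF/= (le_lt_trans _ vT)// lee_fin.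
by rewrite andbT orbF (le_trans Tv) ?lee_fin// andbT.
Qed.

Lemma jump_disj u v z w n : jump u v w n -> jump v z w n = false.
Proof. by move=> /andP[_ Tv]; rewrite /jump ltNge Tv. Qed.

Lemma good_jump_leq w v z : good w -> v <= z -> exists N, forall n, (N <= n)%N ->
  (v%:E < Tn n w)%E /\ (z%:E < Tn n w)%E.
Proof.
move=> gw vz; have [N NT] := good_jump_lt z gw; exists N => n /NT h; split => //.
by apply: le_lt_trans h; rewrite lee_fin.
Qed.

Lemma jprod_cat r u v z w : good w -> u <= v -> v <= z ->
  jprod r u z w = jprod r u v w * jprod r v z w.
Proof.
move=> gw uv vz; have [N NT] := good_jump_leq gw vz.
rewrite (jprodE r u (N := N)); last by move=> n /NT[].
rewrite (jprodE r u (N := N)); last by move=> n /NT[].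
rewrite (jprodE r v (N := N)); last by move=> n /NT[].
rewrite big_mkcond [X in X * _]big_mkcond [X in _ * X]big_mkcond -big_split/=.
apply: eq_bigr => n _; rewrite (jump_cat w n uv vz).
have [j|nj] := boolP (jump u v w n); last by rewrite mul1r.
by rewrite (jump_disj z j) mulr1.
Qed.

Lemma jprod_same r u w : good w -> jprod r u u w = 1.
Proof.
move=> gw; have [N NT] := good_jump_lt u gw; rewrite (jprodE r u NT) big_pred0// => n.
by apply/negbTE/negP => /andP[a b]; have := lt_le_trans a b; rewrite ltxx.
Qed.

Lemma mpred_1B r : mpred r -> mpred (fun s w e => 1 - r s w e).
Proof. by move=> mr; apply: measurable_funB mr; exact: measurable_cst. Qed.

Lemma bdd_1B r c : 1 <= c -> (forall s w e, 0 <= r s w e <= c) ->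
  forall s w e, `|1 - r s w e| <= c.
Proof.
move=> c1 rc s w e; have /andP[r0 rc'] := rc s w e; rewrite ler_norml.
by apply/andP; split; lra.
Qed.

Lemma dA_Rint_cat (X : R -> R) c u v z w : good w -> 0 <= u -> u <= v -> v <= z ->
  measurable_fun (setT : set (measurableTypeR R)) X ->
  (forall s, u < s <= z -> `|X s| <= c) ->
  \int[dA A w]_(s in `]u, z]) X s =
  \int[dA A w]_(s in `]u, v]) X s + \int[dA A w]_(s in `]v, z]) X s.
Proof.
move=> gw u0 uv vz mX Xc.
have UE : `]u, z]%classic = `]u, v]%classic `|` `]v, z]%classic :> set R.
  by rewrite -(@itv_bndbnd_setU _ _ (BRight u) (BRight v) (BRight z)).
rewrite UE Rintegral_setU//.
- by rewrite -UE; apply: (dA_integrable_bdd u0 _ gw) Xc => //; exact: le_trans vz.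
- apply/disj_setPS => s [] /=; rewrite !in_itv/= => /andP[_ sv] /andP[vs _].
  by have := lt_le_trans vs sv; rewrite ltxx.
Qed.

Lemma cint_cat r c u v z w : good w -> mpred r -> 1 <= c -> (forall s w e, 0 <= r s w e <= c) ->
  0 <= u -> u <= v -> v <= z -> cint r u z w = cint r u v w + cint r v z w.
Proof.
move=> gw mr c1 rc u0 uv vz; rewrite /cint.
have mr1 := mpred_1B mr; have rb := bdd_1B c1 rc.
apply: (dA_Rint_cat (c := c)) => //.
  exact: (ppred_path w (phint_ppred mr1)).
by move=> s _; exact: phint_bdd mr1 rb.
Qed.

Lemma Lam_cat r c u v z w : good w -> mpred r -> 1 <= c -> (forall s w e, 0 <= r s w e <= c) ->
  0 <= u -> u <= v -> v <= z -> Lam r u z w = Lam r u v w * Lam r v z w.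
Proof.
move=> gw mr c1 rc u0 uv vz; rewrite /Lam (jprod_cat r gw uv vz).
by rewrite (cint_cat gw mr c1 rc u0 uv vz) expRD mulrACA.
Qed.

Lemma Lam_same r u w : good w -> Lam r u u w = 1.
Proof.
move=> gw; rewrite /Lam (jprod_same r u gw) /cint set_itv_ge ?bnd_simp ?ltxx//.
by rewrite Rintegral_set0 expR0 mulr1.
Qed.

(* [jprod] is the limit of [exp (int log (max r (1/j)) dp)]. *)
Lemma jprod_meas r u v : (forall s w e, 0 <= r s w e) -> mpred r -> 0 <= u -> 0 <= v ->
  meas_on (F v) setT (jprod r u v).
Proof.
move=> r0 mr u0 v0.
pose rj j s w e := ln (Num.max (r s w e) j.+1%:R^-1).
have mrj j : mpred (rj j).
  have h : mpred (fun s w e => Num.max (r s w e) j.+1%:R^-1).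
    by apply: (measurable_maxr mr); exact: measurable_cst.
  exact: (measurableT_comp (@measurable_ln R) h).
pose G j w := expR (\int[pm w]_(x in `]u, v] `*` setT) rj j x.1 w x.2).
have mG j : measurable_fun (setT : set (FT v)) (fun w => G j w * \1_good w).
  apply: measurable_funM.
    apply: (measurableT_comp (@measurable_expR R)); apply/FT_fun.
    exact: (pm_Rint_measurable u0 v0 (mrj j)).
  by apply: measurable_indic; exact: good_measurable v.
have cG w : good w -> G j w @[j --> \oo] --> jprod r u v w.
  move=> gw; have [N NT] := good_jump_lt v gw; rewrite (jprodE r u NT).
  rewrite (_ : (fun j => _) = fun j =>
      \prod_(1 <= n < N.+1 | jump u v w n) Num.max (jr r w n) j.+1%:R^-1).
    apply: cvg_big => [|n _]; first exact: mul_continuous. rewrite -[X in _ --> X](max_l (r0 _ w (zeta n w))).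
    by apply: cvg_maxr; [exact: cvg_cst|exact: cvg_harmonic].
  apply/funext => j; rewrite /G (pm_Rintegral u (mpred_path w (mrj j)) NT).
  rewrite expR_sum; apply: eq_bigr => n _.
  by rewrite /rj lnK// posrE lt_max invr_gt0 ltr0n orbT.
apply: (@F_ae v _ _
    (fun w => limn (fun j => G j w * \1_good w))).
  apply: filterS good_ae => w gw; apply: cvg_lim => //.
  rewrite indicE mem_set//; under eq_fun do rewrite mulr1.
  exact: cG.
apply/FT_fun; apply: (@measurable_fun_cvg _ (FT v) R setT (fun j w => G j w * \1_good w)) => // w _.
rewrite indicE; have [/set_mem gw|ngw] := boolP (w \in good).
  under eq_fun do rewrite mulr1; rewrite (cvg_lim _ (cG w gw))//.
  exact: cG.
by under eq_fun do rewrite mulr0; rewrite lim_cst//; exact: cvg_cst.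
Qed.

Lemma cint_meas r u v : mpred r -> 0 <= u -> 0 <= v -> meas_on (F v) setT (cint r u v).
Proof.
move=> mr u0 v0.
exact: (dA_Rint_measurable u0 v0 (ppred_progressive v0 (phint_ppred (mpred_1B mr)))).
Qed.

Lemma Lam_meas r u v : (forall s w e, 0 <= r s w e) -> mpred r -> 0 <= u -> 0 <= v ->
  meas_on (F v) setT (Lam r u v).
Proof.
move=> r0 mr u0 v0; apply/FT_fun; apply: measurable_funM.
  by apply/FT_fun; exact: jprod_meas.
by apply: (measurableT_comp (@measurable_expR R)); apply/FT_fun; exact: cint_meas.
Qed.

Lemma Tn_gt0 w n : good w -> (0 < n)%N -> (0 < Tn n w)%E.
Proof.
move=> [_ _ Tm Ts _]; have [_ _ T0 _] := HT.
have h1 : (0 < Tn 1 w)%E by have := Ts 0%N; rewrite T0; apply; exact: ltry.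
case: n => // n _; elim: n => // n IH; exact: (lt_le_trans IH (Tm _)).
Qed.

Lemma Tn_mono w n k : good w -> (n <= k)%N -> (Tn n w <= Tn k w)%E.
Proof. by move=> [_ _ Tm _ _]; move=> nk; exact: (nondecreasing_seqP _).1 Tm _ _ nk. Qed.

Lemma F_setU s (X Y : set Omega) : F s X -> F s Y -> F s (X `|` Y).
Proof. by rewrite -!FT_measurableE; exact: measurableU. Qed.

(** The filtration records the random measure and not the times [Tn]. On a path in [good] the [n]-th
    jump has occurred by time [s] exactly when [p] gives mass at least [n] to []0, s] * E]. *)
Lemma Tn_stopping s n : 0 <= s -> F s [set w | (Tn n w <= s%:E)%E].
Proof.
move=> s0; case: n => [|n].
  rewrite (_ : [set _ | _] = setT); first exact: F_setT.
  by apply/seteqP; split=> w //= _; have [_ _ -> _] := HT; rewrite lee_fin.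
have mk : measurable_fun (setT : set (FT s)) (fun w => pm w (`]0, s] `*` setT)).
  by apply: pm_F_measurable; rewrite ?s0 ?lexx.
have {}mk := mk measurableT _ (emeasurable_itv `[n.+1%:R%:E, +oo[).
rewrite setTI FT_measurableE in mk.
have gF := @good_F s.
rewrite (_ : [set w | _] = (good `&` (fun w => pm w (`]0, s] `*` setT)) @^-1` `[n.+1%:R%:E, +oo[%classic)
   `|` (~` good `&` [set w | (Tn n.+1 w <= s%:E)%E])).
  apply: F_setU; first exact: F_setI.
  by apply: F_negligible; apply: negligibleS good_ae => w [].
have key w : good w -> (n.+1%:R%:E <= pm w (`]0%R, s] `*` setT))%E = (Tn n.+1 w <= s%:E)%E.
  move=> gw; have [N NT] := good_jump_lt s gw.
  have mD : measurable (`]0, s] `*` setT : set TE) by exact: measurableX.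
  have := @pm_integral_sum w 0 s (N + n.+1) (cst 1%E) (measurable_cst _) (fun=> lee01).
  rewrite integral_cst// mul1e => ->; last by move=> k Nk; apply: NT; exact: leq_trans (leq_addr _ _) Nk.
  rewrite (eq_bigr (fun=> (1:R)%:E))// sumEFin lee_fin.
  have [Ts|sT] := leP (Tn n.+1 w) s%:E.
    rewrite (@big_cat_nat _ _ _ n.+2)//=; last by rewrite ltnS leq_addl.
    rewrite [X in X + _](_ : _ = n.+1%:R); first by rewrite lerDl sumr_ge0.
    rewrite big_nat_cond (eq_bigl (fun i => 1 <= i < n.+2)%N); last first.
      move=> i; have [/andP[i1 i2]|//] := boolP (1 <= i < n.+2)%N.
      by rewrite /jump (Tn_gt0 gw i1) (le_trans _ Ts)//; exact: Tn_mono.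
    by rewrite -big_nat big_const_nat iter_addr_0 subn1.
  apply/negbTE; rewrite -ltNge.
  apply: (@le_lt_trans _ _ (\sum_(1 <= i < n.+1) (1 : R))); last first.
    by rewrite big_const_nat iter_addr_0 subn1 ltr_nat.
  rewrite (@big_cat_nat _ _ _ n.+1)//=; last by rewrite ltnS (leq_trans (leqnSn n) (leq_addl _ _)).
  rewrite [X in _ + X]big_nat_cond [X in _ + X]big1 ?addr0.
    by rewrite big_mkcond; apply: ler_sum => i _; case: ifP.
  move=> i /andP[/andP[ni _]]; rewrite jump_lt//.
  by apply: lt_le_trans sT _; exact: Tn_mono.
apply/seteqP; split=> w /=.
  have [gw|ngw] := pselect (good w); last by right.
  by move=> Ts; left; split=> //; rewrite in_itv/= andbT key.
by move=> [[gw]|[]//]; rewrite in_itv/= andbT key.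
Qed.

(** * Densities and continuous martingales *)

Section Truncation.
Variables (t T : R) (r : hfun) (c : R) (n0 : nat) (m : proc).
Hypotheses (t0 : 0 <= t) (tT : t < T) (mr : mpred r) (c1 : 1 <= c)
  (rc : forall s w e, 0 <= r s w e <= c) (Mm : martingale2 P F t T m)
  (cm : \forall w \ae P, {within `[t, T], continuous (m ^~ w)}) (IA : I1 P (A T)).
Local Notation gridpt := (gridpt t T).
(** At time [q] one of three thresholds is exceeded: the growth of [A] since [t], the number of
    jumps since [t] (the jumps [n + 1] to [n + 1 + n0] all lie in []t, q]], that is more than [n0]
    of them), or [|m|]. *)
Definition bad q : set Omega :=
  ([set w | n0%:R < A q w - A t w] `|`
   \bigcup_n [set w | (t%:E < Tn n.+1 w)%E /\ (Tn (n.+1 + n0) w <= q%:E)%E]) `|`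
  [set w | n0%:R < `|m q w|].

(** The times after some grid point that was found bad. Deciding at grid points makes the set a
    countable union of predictable rectangles, while density of the grid makes it as effective as a
    stopping time. *)
Definition Bset : set (R * Omega) :=
  [set x | exists l k, (k <= l.+1)%N /\ gridpt l k < x.1 /\ bad (gridpt l k) x.2].

(** Rate 1 freezes the density: it contributes neither a jump factor nor a compensator. *)
Definition rtr : hfun := fun s w e => if (s, w) \in Bset then 1 else r s w e.

Lemma bad_F q : t <= q <= T -> F q (bad q).
Proof.
move=> /[dup] tqT /andP[tq qT]; have q0 := le_trans t0 tq.
have [_ mA _ _] := HC; have [mm _ _] := Mm.
have hA s : 0 <= s <= q -> measurable_fun (setT : set (FT q)) (A s).
  move=> /andP[s0 sq]; apply/FT_fun.
  by move=> B mB; apply: (F_le sq); exact: mA.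
rewrite -FT_measurableE; apply: measurableU; first apply: measurableU.
- apply: measurable_gt.
  by apply: measurable_funB; apply: hA; rewrite ?q0 ?t0 ?tq ?lexx.
- apply: bigcupT_measurable => n; rewrite FT_measurableE; apply: F_setI.
    rewrite (_ : (fun _ => _) = ~` [set w | (Tn n.+1 w <= t%:E)%E]).
      by apply: F_setC; apply: (F_le tq); exact: Tn_stopping.
    by apply/seteqP; split=> w /=; rewrite ltNge => /negP.
  exact: Tn_stopping.
- apply: measurable_gt.
  by apply: measurableT_comp => //; apply/FT_fun; exact: mm.
Qed.

Lemma gridptTT l k : (k <= l.+1)%N -> t <= gridpt l k <= T.
Proof. by move=> kl; rewrite gridpt_ge// gridpt_leT. Qed.

Lemma Bset_measurable : measurable (Bset : set PT).
Proof.
rewrite (_ : Bset = \bigcup_l \bigcup_(k in [set k | (k <= l.+1)%N])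
    (`]gridpt l k, +oo[%classic `*` bad (gridpt l k))).
  apply: bigcupT_measurable => l; apply: bigcup_measurable => k /= kl.
  apply: measurable_pred_infty; first exact: le_trans (gridpt_ge tT _ _).
  exact: bad_F (gridptTT kl).
apply/seteqP; split=> -[s w] /=.
  by move=> [l [k [kl [gs bg]]]]; exists l => //; exists k => //; split=> //=; rewrite in_itv/= gs.
by move=> [l _ [k kl [/=]]]; rewrite in_itv/= andbT => gs bg; exists l, k.
Qed.

Lemma rtr_mpred : mpred rtr.
Proof.
rewrite /mpred; apply: measurable_fun_ifT => //.
  apply: (measurable_fun_bool true); rewrite setTI.
  rewrite (_ : _ @^-1` _ = Bset `*` setT).
    by apply: measurableX => //; exact: Bset_measurable.
  apply/seteqP; split=> -[[s w] e] /=; first by move/set_mem.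
  by case=> + _; exact: mem_set.
Qed.

Lemma rtr_bdd s w e : 0 <= rtr s w e <= c.
Proof. by rewrite /rtr; case: ifP => _ //; rewrite ler01. Qed.

Lemma rtr_bad l k s w e : (k <= l.+1)%N -> bad (gridpt l k) w -> gridpt l k < s -> rtr s w e = 1.
Proof. by move=> kl b ks; rewrite /rtr mem_set//; exists l, k. Qed.

(** [sigma] is the supremum of the times outside [Bset]. The bound on [A] at [sigma] rests on
    continuity: an excess at [sigma] would already be present at an earlier grid point, which would
    then be bad. *)
Lemma rtr_stop w : good w -> exists sigma,
  [/\ t <= sigma <= T, A sigma w - A t w <= n0%:R,
      forall s e, sigma < s <= T -> rtr s w e = 1
    & forall l k, (k <= l.+1)%N -> gridpt l k < sigma -> ~ bad (gridpt l k) w].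
Proof.
move=> gw; have [_ cA _ _ _] := gw; have [incA _] := cA.
pose S := [set s | t <= s <= T /\ ~ Bset (s, w)].
have St : S t.
  split; first by rewrite lexx ltW.
  by move=> [l [k [kl /= [+ _]]]]; rewrite ltNge gridpt_ge.
have supS : has_sup S by split; [exists t|exists T => s [/andP[_]]].
have tS : t <= sup S by apply: sup_upper_bound.
have ST : sup S <= T by apply: sup_le_ub; [exists t|move=> s [/andP[_]]].
have nbad l k : (k <= l.+1)%N -> gridpt l k < sup S -> ~ bad (gridpt l k) w.
  move=> kl gS bg; have eps : 0 < sup S - gridpt l k by rewrite subr_gt0.
  have [s [_ nB]] := sup_adherent eps supS; rewrite opprB addrC subrK => gs.
  by apply: nB; exists l, k.
exists (sup S); split=> //.
- by rewrite tS.
- rewrite leNgt; apply/negP => AS; move: tS; rewrite le_eqVlt => /predU1P[tS|tS].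
    by move: AS; rewrite -tS subrr ltrn0.
  have e0 : 0 < A (sup S) w - A t w - n0%:R by rewrite subr_gt0.
  have ccA := cont_incr_continuous cA; have := ccA (sup S) => /cvgrPdist_lt/(_ _ e0)/nbhs_ballP.
  move=> [h /= h0 hb].
  pose x := Num.max t (sup S - h / 2).
  have xS : x < sup S by rewrite gt_max tS ltrBlDr ltrDl divr_gt0.
  have tx : t <= x by rewrite le_max lexx.
  have [l [k [kl /andP[xg gS]]]] := grid_dense tT tx xS ST.
  apply: (nbad l k kl gS); left; left => /=.
  have : ball (sup S) h x.
    rewrite /ball/= ger0_norm ?subr_ge0 ?(ltW xS)// ltrBlDr -ltrBlDl.
    by rewrite lt_max ltrD2l ltrN2 ltr_pdivrMr// ltr_pMr// ltr1n orbT.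
  move=> /hb /=; rewrite (max_l (le_trans t0 tx)) (max_l (le_trans t0 (ltW tS))).
  have : A x w <= A (gridpt l k) w by apply: incA; rewrite xg (le_trans t0 tx).
  rewrite ltr_norml => h1 /andP[_ h2]; lra.
- move=> s e /andP[Ss sT]; rewrite /rtr mem_set//.
  apply: contrapT => nB; have : s <= sup S.
    by apply: sup_upper_bound => //; split=> //; rewrite sT andbT (le_trans tS)// ltW.
  by rewrite leNgt Ss.
Qed.

(** The jump that exceeds the quota still counts, since the grid notices it only afterwards; hence
    [n0 + 1] and not [n0]. *)
Lemma rtr_count w N : good w ->
  (\sum_(1 <= n < N.+1) (jump t T w n && (jr rtr w n != 1%R)) <= n0.+1)%N.
Proof.
move=> gw; have [_ _ _ Ts _] := gw.
have [ex|nex] := pselect (exists n, (t%:E < Tn n.+1 w)%E); last first.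
  rewrite big_nat_cond big1// => n /andP[/andP[n1 _] _]; rewrite /jump.
  case: n n1 => // n _; rewrite (_ : (t%:E < Tn n.+1 w)%E = false)//.
  by apply/negbTE/negP => h; apply: nex; exists n.
have [n1 n1t n1min] := ex_minnP ex.
apply: (@leq_trans (\sum_(1 <= n < N.+1) (n1.+1 <= n < n1.+1 + n0.+1)%N)); last first.
  by apply: leq_trans (sum_itv_indicator _ _ _) _; rewrite addKn.
rewrite big_nat_cond [leqRHS]big_nat_cond; apply: leq_sum => n /andP[/andP[n1' _] _].
case: n n1' => // n _; have [/andP[j rn]|//] := boolP (_ && _).
move: (j) => /andP[tTn TnT]; rewrite ltnS n1min//=.
rewrite lt0b ltnNge; apply/negP => nn.
have nn' : (n1.+1 + n0 <= n)%N by move: nn; rewrite addnS ltnS.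
have Tle := Tn_mono gw nn'.
have tT1 : (t%:E < Tn n w)%E.
  by apply: lt_le_trans Tle; apply: lt_le_trans n1t _; exact: (Tn_mono gw (leq_addr _ _)).
have Tnn : (Tn n w < Tn n.+1 w)%E.
  by apply: Ts; apply: le_lt_trans (Tn_mono gw (leqnSn n)) _; exact: le_lt_trans TnT (ltry _).
move: Tle tT1 Tnn tTn TnT rn; rewrite /jr.
case TE1 : (Tn n w) => [x| |]//; case TE2 : (Tn n.+1 w) => [y| |]//.
rewrite !lte_fin lee_fin /= => Tle tx xy ty yT.
(* Some grid point lies after jump [n] and strictly before jump [n + 1]; it is bad, so the rate is 1
   at jump [n + 1]. *)
have [l [k [kl /andP[xg gy]]]] := grid_dense tT (ltW tx) xy yT.
rewrite (rtr_bad (l := l) (k := k)) ?eqxx//.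
left; right; exists n1 => //=; split=> //.
by apply: le_trans Tle _; rewrite lee_fin.
Qed.

Lemma rtr_jprod w v : good w -> t <= v -> v <= T -> 0 <= jprod rtr t v w <= c ^+ n0.+1.
Proof.
move=> gw tv vT; have [N NT] := good_jump_lt T gw.
have NT' n : (N <= n)%N -> (v%:E < Tn n w)%E.
  by move=> /NT; apply: le_lt_trans; rewrite lee_fin.
rewrite (jprodE rtr t NT'); apply/andP; split.
  by apply: prodr_ge0 => n _; have /andP[] := rtr_bdd (fine (Tn n w)) w (zeta n w).
apply: (@le_trans _ _ (\prod_(1 <= n < N.+1) c ^+ (jump t T w n && (jr rtr w n != 1)))).
  rewrite big_mkcond; apply: ler_prod => n _.
  have /andP[j0 jc] := rtr_bdd (fine (Tn n w)) w (zeta n w).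
  rewrite -/(jr rtr w n) in j0 jc; have [j|nj] := boolP (jump t v w n); last first.
    by rewrite ler01 exprn_ege1.
  rewrite j0/= (_ : jump t T w n = true).
    by case: eqP => [->|_]; rewrite ?expr0 ?expr1.
  move: j => /andP[tTn Tnv]; rewrite /jump tTn/=.
  by apply: le_trans Tnv _; rewrite lee_fin.
by rewrite -expr_sum ler_weXn2l//; exact: rtr_count.
Qed.

Lemma rtr_cint w u v : good w -> t <= u -> u <= v -> v <= T -> forall sigma,
  t <= sigma <= T -> (forall s e, sigma < s <= T -> rtr s w e = 1) ->
  `|cint rtr u v w| <= c * (A (Num.min v sigma) w - A (Num.min u sigma) w).
Proof.
move=> gw tu uv vT sigma /andP[ts sT] rs.
have u0 := le_trans t0 tu; have s0 := le_trans t0 ts.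
have mr1 := mpred_1B rtr_mpred; have rb := bdd_1B c1 rtr_bdd.
have mX := ppred_path w (phint_ppred mr1).
have Xc s : `|phint (fun s w e => 1 - rtr s w e) s w| <= c by exact: phint_bdd mr1 rb.
have X0 s : sigma < s <= T -> phint (fun s w e => 1 - rtr s w e) s w = 0.
  move=> sT'; rewrite /phint; case: ifP => // _.
  by apply: Rint_eq0 => e _; rewrite rs// subrr.
have int0 a b : sigma <= a -> b <= T -> cint rtr a b w = 0.
  move=> sa bT.
  apply: Rint_eq0 => s; rewrite /= in_itv/= => /andP[as_ sb]; apply: X0.
  by rewrite (le_lt_trans sa as_) (le_trans sb bT).
have [su|us] := leP sigma u.
  by rewrite int0// normr0 !min_r// ?subrr ?mulr0// (le_trans su uv).
have [vs|sv] := leP v sigma.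
  by apply: (dA_Rint_le u0 uv gw mX) => s _; exact: Xc.
rewrite (cint_cat gw rtr_mpred c1 rtr_bdd u0 (ltW us) (ltW sv)) (int0 _ _ (lexx _) vT) addr0.
by apply: (dA_Rint_le u0 (ltW us) gw mX) => s _; exact: Xc.
Qed.

(** At most [n0 + 1] jump factors differ from 1, each bounded by [c], and the compensator integral
    is at most [c n0]. *)
Definition Cr : R := c ^+ n0.+1 * expR (c * n0%:R).

Lemma rtr_Lam w v : good w -> t <= v -> v <= T -> 0 <= Lam rtr t v w <= Cr.
Proof.
move=> gw tv vT; have /andP[j0 jc] := rtr_jprod gw tv vT.
have [sigma [ts As rs _]] := rtr_stop gw.
rewrite /Lam mulr_ge0 ?expR_ge0//=; apply: ler_pM => //.
rewrite ler_expR; apply: le_trans (ler_norm _) _.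
apply: le_trans (rtr_cint gw (lexx t) tv vT ts rs) _.
rewrite ler_wpM2l ?(le_trans ler01 c1)//; apply: le_trans As.
have [_ [incA _] _ _ _] := gw; have /andP[tsi _] := ts.
rewrite (min_l tsi) lerB//; apply: incA.
by rewrite ge_min lexx orbT andbT le_min !(le_trans t0).
Qed.

End Truncation.

Section Rest.
Definition njump u v w N : nat := \sum_(1 <= n < N.+1) jump u v w n.

Lemma jump_grid t T l w n K : t < T ->
  (\sum_(k < K) jump (gridpt t T l k) (gridpt t T l k.+1) w n)%N =
  jump t (gridpt t T l K) w n.
Proof.
move=> tT; elim: K => [|K IH].
  by rewrite big_ord0 gridpt0 /jump; case: ltP => // h; rewrite leNgt h.
rewrite big_ord_recr/= IH (@jump_cat _ _ _ w n (gridpt_ge tT l K) (ltW (gridpt_lt tT l K))).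
have [j|//] := boolP (jump t _ w n).
by rewrite (jump_disj _ j).
Qed.

Lemma njump_grid t T l w N : t < T ->
  (\sum_(k < l.+1) njump (gridpt t T l k) (gridpt t T l k.+1) w N <= N)%N.
Proof.
move=> tT; rewrite exchange_big/=.
apply: (@leq_trans (\sum_(1 <= n < N.+1) 1)); last by rewrite sum_nat_const_nat muln1 subn1.
apply: leq_sum => n _.
by rewrite jump_grid//; case: jump.
Qed.

(** With at most one jump in the cell the product is affine in [r] and equals its own first order
    expansion; only the exponential factor will leave a remainder. *)
Lemma cell_jump r c u v w N : mpred r -> 1 <= c -> (forall s w e, 0 <= r s w e <= c) ->
  (forall n, (N <= n)%N -> (v%:E < Tn n w)%E) -> (njump u v w N <= 1)%N ->
  [/\ jprod r u v w = 1 + \int[pm w]_(x in `]u, v] `*` setT) (r x.1 w x.2 - 1),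
      0 <= jprod r u v w <= c & `|jprod r u v w - 1| <= c * (njump u v w N)%:R].
Proof.
move=> mr c1 rc NT nj1.
have mr1 : mpred (fun s w e => r s w e - 1) by apply: measurable_funB mr _; exact: measurable_cst.
rewrite (jprodE r u NT) (pm_Rintegral u (mpred_path w mr1) NT).
move: nj1; rewrite /njump -big_mkcond sum1_count -size_filter -big_filter.
rewrite -[\sum_(1 <= _ < _ | _) _]big_filter.
case: [seq _ <- _ | _] => [|n [|]]//= _.
  by rewrite !big_nil addr0 subrr normr0 mulr0 ler01 c1.
rewrite !big_seq1 mulr1 [in X in X = _]/jr; have /andP[r0 rc'] := rc (fine (Tn n w)) w (zeta n w).
split; [by rewrite addrC subrK|by apply/andP; split|].
by rewrite ler_norml /jr; apply/andP; split; lra.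
Qed.

Lemma mesh_jump t T w N : good w -> t < T -> (forall n, (N <= n)%N -> (T%:E < Tn n w)%E) ->
  \forall l \near \oo, forall k, (k <= l)%N ->
    (njump (gridpt t T l k) (gridpt t T l k.+1) w N <= 1)%N.
Proof.
move=> gw tT NT; have [_ _ _ Ts _] := gw.
(* Distance to the next jump; the value 1 is a harmless default when one of the two times is
   infinite. Only finitely many gaps matter before [T]. *)
pose gap n : R := if (Tn n w \is a fin_num) && (Tn n.+1 w \is a fin_num)
  then fine (Tn n.+1 w) - fine (Tn n w) else 1.
have gap0 n : 0 < gap n.
  rewrite /gap; case: ifP => // /andP[f1 f2]; rewrite subr_gt0 -lte_fin !fineK//.
  by apply: Ts; rewrite -(fineK f1) ltry.
have : \forall l \near \oo, forall n : 'I_N.+1, (T - t) / l.+1%:R < gap n.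
  by apply: filter_forall => n; exact: mesh_lt.
apply: filterS => l hl k kl; rewrite /njump -big_mkcond sum1_count -size_filter leqNgt.
have : sorted ltn [seq n <- index_iota 1 N.+1 | jump (gridpt t T l k) (gridpt t T l k.+1) w n].
  by apply: sorted_filter; [exact: ltn_trans|exact: iota_ltn_sorted].
have : all (fun n => (n < N.+1)%N && jump (gridpt t T l k) (gridpt t T l k.+1) w n)
    [seq n <- index_iota 1 N.+1 | jump (gridpt t T l k) (gridpt t T l k.+1) w n].
  by apply/allP => n; rewrite mem_filter mem_index_iota => /andP[-> /andP[_ ->]].
case: [seq _ <- _ | _] => [|n [|n' s]]//= /and3P[/andP[nN jn] /andP[_ jn'] _] /andP[nn' _].
have jS : jump (gridpt t T l k) (gridpt t T l k.+1) w n.+1.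
  have /andP[a1 _] := jn; have /andP[_ a2] := jn'; apply/andP; split.
    exact: lt_le_trans a1 (Tn_mono gw (leqnSn n)).
  exact: le_trans (Tn_mono gw nn') a2.
have := hl (Ordinal nN); rewrite /gap/=.
move: jn jS; rewrite !jump_fin => /andP[-> /andP[a1 _]] /andP[-> /andP[_ a2]] /=.
by rewrite -(gridptS t T l k); lra.
Qed.

Lemma cont_incr_unif w a b e : good w -> 0 < e -> 0 <= a ->
  \forall h \near (0:R)^'+, forall x, a <= x <= b -> forall y, 0 <= y -> `|x - y| < h ->
    `|A x w - A y w| < e.
Proof.
move=> [_ cA _ _ _] e0 a0; have := near_unif_continuous a b (cont_incr_continuous cA) e0.
apply: filterS => h H x /[dup] xab /andP[ax _] y y0 xy; have := H x xab y xy.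
by rewrite (max_l (le_trans a0 ax)) max_l.
Qed.

Lemma near0_ex (Q : R -> Prop) : (\forall h \near (0:R)^'+, Q h) -> exists2 h, 0 < h & Q h.
Proof.
move=> QF.
have h0 : \forall h \near (0:R)^'+, 0 < h by exact: nbhs_right_gt.
have [h [hh Qh]] := @filter_ex _ _ _ _ (filterI h0 QF).
by exists h.
Qed.

(** This is what is left of the increments of [L m] after removing [L m] times the compensated jump
    term and [L] times the increment of [m]. Every remaining term is a product of two increments, at
    least one of them of a continuous path and hence uniformly small, while the total of the
    compensator is finite and at most [N] cells contain a jump. *)
Lemma rest_cvg w r c (mw : R -> R) (t T C : R) : good w -> mpred r -> 1 <= c ->
  (forall s w e, 0 <= r s w e <= c) -> 0 <= t -> t < T ->
  {within `[t, T], continuous mw} -> (forall v, t <= v <= T -> `|Lam r t v w| <= C) ->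
  \sum_(k < l.+1) Lam r t (gridpt t T l k) w *
     ((Lam r (gridpt t T l k) (gridpt t T l k.+1) w - 1 -
       (\int[pm w]_(x in `]gridpt t T l k, gridpt t T l k.+1] `*` setT) (r x.1 w x.2 - 1) +
        cint r (gridpt t T l k) (gridpt t T l k.+1) w)) * mw (gridpt t T l k) +
      (Lam r (gridpt t T l k) (gridpt t T l k.+1) w - 1) *
         (mw (gridpt t T l k.+1) - mw (gridpt t T l k))) @[l --> \oo] --> (0 : R).
Proof.
move=> gw mr c1 rc t0 tT cm LC.
have [N NT] := good_jump_lt T gw.
have T0 := le_trans t0 (ltW tT).
have c0 := le_trans ler01 c1.
pose mc s := mw (Num.max t (Num.min s T)).
have mcE s : t <= s <= T -> mc s = mw s by move=> /andP[ts sT]; rewrite /mc min_l// max_r.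
have cmc : continuous mc.
  apply: (within_comp_continuous cm); first exact: clamp_continuous.
  by move=> x; rewrite /= in_itv/= le_max lexx/= ge_max ge_min lexx orbT (ltW tT).
have [X X0 HX] : exists2 X, 0 <= X & forall s, t <= s <= T -> `|mw s| <= X.
  have cam : {within `[t, T], continuous (fun s => `|mc s|)}.
    by apply: continuous_subspaceT => x; apply: cvg_norm; exact: cmc.
  have [x _ Hx] := EVT_max (ltW tT) cam.
  by exists `|mc x| => // s sT; rewrite -mcE//; apply: Hx; rewrite in_itv.
have C0 : 0 <= C by apply: le_trans (LC t _); rewrite ?lexx ?(ltW tT).
have [D DE] : {D | D = A T w - A t w} by exists (A T w - A t w).
have [_ [incA _] _ _ _] := gw.
have D0 : 0 <= D by rewrite DE subr_ge0; apply: incA; rewrite t0 ltW.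
(* Once the uniform smallness [ep] is factored out, [Kc] is what the sum over the cells amounts to:
   [c * D] bounds the total of the compensator, [N] the number of jumps and [X] the size of [m]. *)
pose Kc := C * ((2 * c * (c * D) + N%:R * c) * X + (N%:R * c + 2 * c * (c * D))).
have Kc0 : 0 <= Kc by rewrite /Kc !(mulr_ge0, addr_ge0, ler0n).
apply/cvgr0Pnorm_lt => e e0.
pose ep := Num.min (2^-1) (e / (Kc + 1)).
have ep0 : 0 < ep by rewrite lt_min invr_gt0 ltr0n/= divr_gt0// ltr_wpDl.
have ep2 : ep <= 2^-1 by rewrite ge_min lexx.
have epK : ep * (Kc + 1) <= e by rewrite -ler_pdivlMr ?ltr_wpDl// ge_min lexx orbT.
have ec0 : 0 < ep / c by rewrite divr_gt0// (lt_le_trans ltr01).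
have [h1 h10 Q1] := near0_ex (cont_incr_unif T gw ec0 t0).
have [h2 h20 Q2] := near0_ex (near_unif_continuous t T cmc ep0).
near=> l.
have nj1 : forall k, (k <= l)%N -> (njump (gridpt t T l k) (gridpt t T l k.+1) w N <= 1)%N.
  by near: l; exact: mesh_jump.
have lh1 : (T - t) / l.+1%:R < h1 by near: l; exact: mesh_lt.
have lh2 : (T - t) / l.+1%:R < h2 by near: l; exact: mesh_lt.
have gab k : (k <= l.+1)%N -> t <= gridpt t T l k <= T.
  by move=> kl; rewrite gridpt_ge// gridpt_leT.
apply: (@le_lt_trans _ _ (\sum_(k < l.+1) (C * ((2 * c * ep * X + 2 * c * ep) *
    (c * (A (gridpt t T l k.+1) w - A (gridpt t T l k) w)) +
    (njump (gridpt t T l k) (gridpt t T l k.+1) w N)%:R * (c * ep * X + c * ep))))).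
  apply: le_trans (ler_norm_sum _ _ _) _; apply: ler_sum => k _.
  have kl : (k <= l)%N by rewrite -ltnS.
  have /andP[tu uT] := gab k (leqW kl); have /andP[tv vT] := gab k.+1 kl.
  have := gridptS t T l k; have := nj1 k kl; have := gridpt_lt tT l k.
  have Lu := LC _ (gab k (leqW kl)); have Xu := HX _ (gab k (leqW kl)).
  have := Q2 _ (gab k (leqW kl)) (gridpt t T l k.+1).
  have := Q1 _ (gab k (leqW kl)) (gridpt t T l k.+1).
  rewrite !mcE ?tu ?tv//.
  move: (gridpt t T l k) (gridpt t T l k.+1) Lu Xu tu uT tv vT => u v Lu Xu tu uT tv vT.
  move=> qA qm uv nj h.
  have NTv n : (N <= n)%N -> (v%:E < Tn n w)%E.
    by move=> /NT; apply: le_lt_trans; rewrite lee_fin.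
  have uvh : `|u - v| = (T - t) / l.+1%:R by rewrite distrC h ger0_norm// ltW// mesh_gt0.
  have {}qA : `|A u w - A v w| < ep / c by apply: qA; rewrite ?uvh// (le_trans t0).
  have {}qm : `|mw u - mw v| < ep by apply: qm; rewrite uvh.
  have [JE /andP[J0 Jc] J1] := cell_jump mr c1 rc NTv nj.
  have dA0 : 0 <= A v w - A u w by rewrite subr_ge0; apply: incA; rewrite (le_trans t0 tu) ltW.
  have bA : `|cint r u v w| <= c * (A v w - A u w).
    apply: (dA_Rint_le (le_trans t0 tu) (ltW uv) gw (ppred_path w (phint_ppred (mpred_1B mr)))).
    by move=> s _; exact: phint_bdd (mpred_1B mr) (bdd_1B c1 rc).
  rewrite /Lam in Lu *.
  move: (jprod r t u w * _) Lu => L Lu.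
  rewrite (_ : \int[pm w]_(x in _) _ = jprod r u v w - 1); last by rewrite JE addrC addKr.
  move: (jprod r u v w) (cint r u v w) J0 Jc J1 bA => J b J0 Jc J1 bA.
  have bep : `|b| <= ep.
    apply: le_trans bA _; rewrite mulrC -ler_pdivlMr ?(lt_le_trans ltr01)//.
    by move: qA; rewrite distrC ger0_norm// => /ltW.
  have [eb1 eb2] := expR_bounds (le_trans bep ep2).
  rewrite normrM; apply: ler_pM => //.
  move: nj J1; move: (njump u v w N)%:R (ler0n R (njump u v w N)) => nu nu0 _ J1.
  have h1' : `|J * expR b - 1 - (J - 1 + b)| <= 2 * c * ep * `|b| + nu * (c * ep).
    rewrite (_ : _ - _ = J * (expR b - 1 - b) + (J - 1) * b); last by ring.
    apply: le_trans (ler_normD _ _) _; rewrite !normrM (ger0_norm J0); apply: lerD.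
      apply: (@le_trans _ _ (c * (2 * `|b| ^+ 2))); first exact: ler_pM.
      rewrite expr2 [leLHS](_ : _ = 2 * c * (`|b| * `|b|)); last by ring.
      by rewrite -[leRHS]mulrA ler_wpM2l ?mulr_ge0// ler_wpM2r.
    by rewrite mulrA [nu * c]mulrC; apply: ler_pM.
  have h2' : `|J * expR b - 1| <= 2 * c * `|b| + nu * c.
    rewrite (_ : _ - 1 = J * (expR b - 1) + (J - 1)); last by ring.
    apply: le_trans (ler_normD _ _) _; rewrite normrM (ger0_norm J0); apply: lerD.
      by rewrite [2 * c]mulrC -mulrA; apply: ler_pM.
    by rewrite mulrC.
  apply: le_trans (ler_normD _ _) _; rewrite !normrM.
  have h3 : `|J * expR b - 1 - (J - 1 + b)| * `|mw u| <= (2 * c * ep * `|b| + nu * (c * ep)) * X.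
    exact: ler_pM.
  have h4 : `|J * expR b - 1| * `|mw v - mw u| <= (2 * c * `|b| + nu * c) * ep.
    by apply: ler_pM => //; rewrite distrC ltW.
  apply: le_trans (lerD h3 h4) _.
  have h5 : (2 * c * ep * X + 2 * c * ep) * `|b| <= (2 * c * ep * X + 2 * c * ep) * (c * (A v w - A u w)).
    by apply: ler_wpM2l => //; rewrite !(mulr_ge0, addr_ge0, ler0n, ltW ep0).
  rewrite [leLHS](_ : _ = (2 * c * ep * X + 2 * c * ep) * `|b| + nu * (c * ep * X + c * ep)); last by ring.
  by rewrite lerD2r.
rewrite -mulr_sumr big_split/= -mulr_sumr -mulr_sumr -mulr_suml.
rewrite (_ : \sum_(k < l.+1) (A _ w - A _ w) = D); last first.
  rewrite -(big_mkord xpredT (fun k => A (gridpt t T l k.+1) w - A (gridpt t T l k) w)).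
  by rewrite telescope_sumr// gridpt0 gridptT DE.
rewrite -natr_sum.
have hN : ((\sum_(k < l.+1) njump (gridpt t T l k) (gridpt t T l k.+1) w N)%:R : R) <= N%:R.
  by rewrite ler_nat; exact: njump_grid.
apply: (@le_lt_trans _ _ (ep * Kc)); last first.
  by apply: lt_le_trans epK; rewrite ltr_pM2l// ltrDl.
have h6 : (\sum_(k < l.+1) njump (gridpt t T l k) (gridpt t T l k.+1) w N)%:R * (c * ep * X + c * ep)
    <= N%:R * (c * ep * X + c * ep).
  by apply: ler_wpM2r => //; rewrite !(mulr_ge0, addr_ge0, ler0n, ltW ep0).
rewrite [leRHS](_ : _ = C * ((2 * c * ep * X + 2 * c * ep) * (c * D) + N%:R * (c * ep * X + c * ep))).
  by rewrite ler_wpM2l// lerD2l.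
by rewrite /Kc; ring.
Unshelve. all: by end_near.
Qed.

End Rest.

Section TruncatedOrth.
Lemma IA_le T u : 0 <= u -> u <= T -> I1 P (A T) -> I1 P (A u).
Proof.
move=> u0 uT IA; have [_ mA _ _] := HC.
apply: I1_le_ae (F_fun_measurable (mA u u0)) IA _.
apply: filterS good_ae => w [A0 [incA _] _ _ _].
by rewrite ger0_norm; [apply: incA; rewrite u0|rewrite -A0; apply: incA; rewrite lexx].
Qed.

(** The factor [X], known at time [u], is moved inside the integrand, where it is predictable on
    []u, v]]. *)
Lemma comp_orth (u v : R) (X : Omega -> R) K h c : 0 <= u -> u <= v -> I1 P (A v) ->
  meas_on (F u) setT X -> (forall w, `|X w| <= K) -> mpred h -> (forall s w e, `|h s w e| <= c) ->
  let q w := \int[pm w]_(x in `]u, v] `*` setT) h x.1 w x.2 -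
             \int[dA A w]_(s in `]u, v]) phint h s w in
  I1 P (fun w => X w * q w) /\ EX P (fun w => X w * q w) = 0.
Proof.
move=> u0 uv IA mX XK mh hc q.
have K0 : 0 <= K by apply: le_trans (XK point); exact: normr_ge0.
have c0 : 0 <= c by apply: le_trans (hc 0 point point); exact: normr_ge0.
pose h' s w e := (if u < s <= v then X w else 0) * h s w e.
have mh' : mpred h' by exact: mpred_cut.
have hc' s w e : `|h' s w e| <= K * c.
  rewrite /h' normrM; apply: ler_pM => //.
  by case: ifP => _; rewrite ?normr0.
have [I1' E1] := comp_bdd u0 uv IA mh' hc'.
have I2' := dA_phint_I1 u0 uv IA mh' hc'.
have [Ih _] := comp_bdd u0 uv IA mh hc.
have Ih2 := dA_phint_I1 u0 uv IA mh hc.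
have mX' := F_fun_measurable mX.
have mq : measurable_fun setT (fun w => X w * q w).
  exact: (measurable_funM mX' (I1_meas (I1B Ih Ih2))).
have aeE : \forall w \ae P, \int[pm w]_(x in `]u, v] `*` setT) h' x.1 w x.2 -
    \int[dA A w]_(s in `]u, v]) phint h' s w = X w * q w.
  apply: filterS good_ae => w gw; rewrite /q mulrBr; congr (_ - _).
    have mD : measurable (`]u, v] `*` setT : set TE) by exact: measurableX.
    rewrite -(RintegralZl _ mD (pm_integrable u v gw mh hc)).
    by apply: eq_Rintegral => -[s e]; rewrite inE/= /h' in_itv/= => -[-> _].
  have mI : measurable (rset R `]u, v]) by exact: measurable_itv.
  rewrite -(RintegralZl _ mI (dA_phint_integrable u0 uv gw mh hc)).
  apply: eq_Rintegral => s; rewrite inE/= in_itv/= /phint => /[dup] suv /andP[us _].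
  rewrite (le_trans u0 (ltW us)) -(RintegralZl _ measurableT (I1_phi s w mh hc)).
  by apply: eq_Rintegral => e _; rewrite /h' suv.
split; first exact: I1_ae aeE (I1B I1' I2').
by rewrite -(EX_ae (I1_meas (I1B I1' I2')) mq aeE) EXB// E1 subrr.
Qed.

Variables (t T : R) (r : hfun) (c : R) (n0 : nat) (m : proc).
Hypotheses (t0 : 0 <= t) (tT : t < T) (mr : mpred r) (c1 : 1 <= c)
  (rc : forall s w e, 0 <= r s w e <= c) (Mm : martingale2 P F t T m)
  (cm : \forall w \ae P, {within `[t, T], continuous (m ^~ w)}) (IA : I1 P (A T)).
Local Notation g := (gridpt t T).
Let rr := rtr t T r n0 m.
Let mrr : mpred rr := rtr_mpred n0 t0 tT mr Mm.
Let rrc := rtr_bdd t T n0 m c1 rc : forall s w e, 0 <= rr s w e <= c.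
Let C := Cr c n0.
Let c0 : 0 <= c := le_trans ler01 c1.

Let C0 : 0 <= C.
Proof. by rewrite /C /Cr mulr_ge0 ?exprn_ge0 ?expR_ge0. Qed.

Let g0 l k : 0 <= g l k.
Proof. exact: le_trans t0 (gridpt_ge tT l k). Qed.

Let q l k w := \int[pm w]_(x in `]g l k, g l k.+1] `*` setT) (rr x.1 w x.2 - 1) +
  cint rr (g l k) (g l k.+1) w.

Let qE l k w : good w -> q l k w =
  - (\int[pm w]_(x in `]g l k, g l k.+1] `*` setT) (1 - rr x.1 w x.2) -
     \int[dA A w]_(s in `]g l k, g l k.+1]) phint (fun s w e => 1 - rr s w e) s w).
Proof.
move=> gw; rewrite /q /cint opprB addrC; congr (_ + _).
have [N NT] := good_jump_lt (g l k.+1) gw.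
have mB : mpred (fun s w e => rr s w e - 1).
  by apply: measurable_funB mrr _; exact: measurable_cst.
rewrite (pm_Rintegral _ (mpred_path w (mpred_1B mrr)) NT).
rewrite (pm_Rintegral _ (mpred_path w mB) NT).
by rewrite -sumrN; apply: eq_bigr => n _; rewrite opprB.
Qed.

(** On good paths the density already lies in [[0, C]], so clipping changes it on a null set only;
    it makes the bound hold everywhere, as is required of the coefficients of [msum]. *)
Let clip x : R := Num.max 0 (Num.min x C).
Let clipC x : `|clip x| <= C.
Proof.
rewrite /clip ger0_norm; first by rewrite ge_max C0 ge_min lexx orbT.
by rewrite le_max lexx.
Qed.

Let clipE x : 0 <= x <= C -> clip x = x.
Proof. by move=> /andP[x0 xC]; rewrite /clip min_l// max_r. Qed.

Let L l k w := clip (Lam rr t (g l k) w).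
(** [L m] with [m] cut at [n0] to be bounded. Nothing is lost: once [|m|] exceeds [n0] at a grid
    point, the rate is 1 afterwards and the jump term [Q] of the cell vanishes. *)
Let X l k w := L l k w * (if `|m (g l k) w| <= n0%:R then m (g l k) w else 0).

Let LE l k w : good w -> (k <= l.+1)%N -> L l k w = Lam rr t (g l k) w.
Proof.
move=> gw kl; apply: clipE.
by apply: (rtr_Lam n0 t0 tT mr c1 rc Mm gw); [exact: gridpt_ge|exact: gridpt_leT].
Qed.

Let L_meas l k : meas_on (F (g l k)) setT (L l k).
Proof.
apply/FT_fun; apply: measurable_maxr => //; apply: measurable_minr => //.
by apply/FT_fun; apply: Lam_meas => // s w e; case/andP: (rrc s w e).
Qed.

Let X_meas l k : (k <= l.+1)%N -> meas_on (F (g l k)) setT (X l k).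
Proof.
move=> kl; have [mm _ _] := Mm.
have mmk : measurable_fun (setT : set (FT (g l k))) (m (g l k)).
  by apply/FT_fun; apply: mm; exact: gridptTT.
apply/FT_fun; apply: measurable_funM; first by apply/FT_fun; exact: L_meas.
apply: measurable_fun_ifT => //.
by apply: measurable_fun_ler => //; exact: measurableT_comp.
Qed.

Let X_bdd l k w : `|X l k w| <= C * n0%:R.
Proof.
rewrite /X normrM; apply: ler_pM => //; first exact: clipC.
by case: ifP => //; rewrite normr0.
Qed.

Let Q l k w := \int[pm w]_(x in `]g l k, g l k.+1] `*` setT) (1 - rr x.1 w x.2) -
  \int[dA A w]_(s in `]g l k, g l k.+1]) phint (fun s w e => 1 - rr s w e) s w.

Let XQ_orth l k : (k <= l)%N ->
  I1 P (fun w => X l k w * Q l k w) /\ EX P (fun w => X l k w * Q l k w) = 0.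
Proof.
move=> kl; have IA' := IA_le (g0 l k.+1) (gridpt_leT tT (l := l) (k := k.+1) kl) IA.
exact: (@comp_orth _ _ _ _ _ _ (g0 l k) (ltW (gridpt_lt tT l k)) IA' (X_meas (leqW kl))
  (@X_bdd l k) (mpred_1B mrr) (bdd_1B c1 rrc)).
Qed.

Let Q0 l k w : good w -> (k <= l)%N -> n0%:R < `|m (g l k) w| -> Q l k w = 0.
Proof.
move=> gw kl bm.
have r1 s e : g l k < s -> rr s w e = 1.
  by move=> gs; exact: (rtr_bad r e (leqW kl) (or_intror bm) gs).
rewrite /Q !Rint_eq0 ?subrr//.
  move=> s; rewrite /= in_itv/= => /andP[gs _]; rewrite /phint; case: ifP => // _.
  by apply: Rint_eq0 => e _; rewrite r1// subrr.
by move=> -[s e] [/=]; rewrite in_itv/= => /andP[gs _] _; rewrite r1// subrr.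
Qed.

(** The bound is independent of the grid: at most [n0 + 1] jumps have a rate different from 1, and
    [A] grows by at most [n0] until the rate is frozen. *)
Let Q_sum l w : good w -> \sum_(k < l.+1) `|Q l k w| <= c * n0.+1%:R + c * n0%:R.
Proof.
move=> gw; apply: (@le_trans _ _ (\sum_(k < l.+1)
    (`|\int[pm w]_(x in `]g l k, g l k.+1] `*` setT) (1 - rr x.1 w x.2)| +
     `|cint rr (g l k) (g l k.+1) w|))).
  by apply: ler_sum => k _; exact: ler_normB.
rewrite big_split/=; apply: lerD.
  have [N NT] := good_jump_lt T gw.
  apply: (@le_trans _ _ (\sum_(k < l.+1) \sum_(1 <= n < N.+1)
      (jump (g l k) (g l k.+1) w n)%:R * (c * (jr rr w n != 1)%:R))).
    apply: ler_sum => k _.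
    have NTk n : (N <= n)%N -> ((g l k.+1)%:E < Tn n w)%E.
      by move=> /NT; apply: le_lt_trans; rewrite lee_fin; apply: gridpt_leT.
    rewrite (pm_Rintegral _ (mpred_path w (mpred_1B mrr)) NTk).
    apply: le_trans (ler_norm_sum _ _ _) _; rewrite big_mkcond; apply: ler_sum => n _.
    case: ifP => _; last by rewrite mul0r.
    rewrite mul1r /=; have := rrc (fine (Tn n w)) w (zeta n w); rewrite -/(jr rr w n).
    case: eqP => [->|_] /= h; first by rewrite subrr normr0 mulr0.
    rewrite mulr1 ler_norml; case/andP: h => h1 h2; move: c1; lra.
  rewrite exchange_big/=.
  apply: (@le_trans _ _ (\sum_(1 <= n < N.+1) (jump t T w n && (jr rr w n != 1))%:R * c)).
    apply: ler_sum => n _; rewrite -mulr_suml -natr_sum (jump_grid l w n l.+1 tT) gridptT.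
    by case: (jump t T w n); case: (_ != _); rewrite ?mul0r ?mulr0 ?mul1r ?mulr1.
  rewrite -mulr_suml mulrC ler_wpM2l// -natr_sum ler_nat.
  exact: (rtr_count r n0 m tT N gw).
have [sigma [ts As rs _]] := rtr_stop r n0 m t0 tT gw; have /andP[tsi siT] := ts.
apply: (@le_trans _ _ (\sum_(k < l.+1)
    c * (A (Num.min (g l k.+1) sigma) w - A (Num.min (g l k) sigma) w))).
  apply: ler_sum => k _; apply: (rtr_cint t0 tT mr c1 rc Mm gw _ _ _ ts rs).
  - exact: gridpt_ge.
  - exact/ltW/gridpt_lt.
  - exact: gridpt_leT.
rewrite -mulr_sumr ler_wpM2l//.
rewrite -(big_mkord xpredT (fun k => A (Num.min (g l k.+1) sigma) w - A (Num.min (g l k) sigma) w)).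
by rewrite telescope_sumr// gridpt0 gridptT min_r// min_l.
Qed.

(** [T1] and [T2] are the sums of first order terms, both of mean zero: [T1] for the jumps, with a
    change of sign since [Q] integrates [1 - r], and [T2] for the increments of [m]. [D] is the sum
    of the remainders. *)
Let T1 l w := \sum_(k < l.+1) X l k w * Q l k w.
Let T2 l := msum m (g l) (L l) l.+1.
Let D l w := Lam rr t T w * m T w - m t w + T1 l w - T2 l w.

Let sF := F_sigma.
Let mF s := @F_measurable s.
Let leF (s s' : R) (h : s <= s') := @F_le s s' h.

Let T2_props l := @msum_props _ _ _ P F sF mF leF t T m (g l) (L l) l.+1 C Mm
  (gridpt_ge tT l 0) (gridpt_leT tT (leqnn l.+1)) (fun k => ltW (gridpt_lt tT l k))
  (fun k _ => @L_meas l k) (fun k x _ => clipC _) l.+1 (leqnn _).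

Let mt2 : L2 P (m t).
Proof. by have [_ m2 _] := Mm; apply: m2; rewrite lexx ltW. Qed.
Let mT2 : L2 P (m T).
Proof. by have [_ m2 _] := Mm; apply: m2; rewrite lexx ltW. Qed.

Let Lm2 : L2 P (fun w => Lam rr t T w * m T w).
Proof.
apply: L2_le_ae (L2Z C mT2) _.
  apply: measurable_funM; last by case: mT2.
  apply: (F_fun_measurable (t := T)); apply: Lam_meas => //.
    by move=> s w e; case/andP: (rrc s w e).
  exact: le_trans t0 (ltW tT).
apply: filterS good_ae => w gw; rewrite normrM [leRHS]normrM (ger0_norm C0) ler_wpM2r//.
have /andP[l0 lC] := rtr_Lam n0 t0 tT mr c1 rc Mm gw (ltW tT) (lexx T).
by rewrite ger0_norm.
Qed.

Let T1_I1 l : I1 P (T1 l) /\ EX P (T1 l) = 0.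
Proof.
have h (k : 'I_l.+1) := @XQ_orth l k (ltn_ord k); split.
  by apply: I1_sum => k; case: (h k).
by rewrite EX_sum => [|k]; [rewrite big1// => k _|]; case: (h k).
Qed.

Let T1_bdd l : \forall w \ae P, `|T1 l w| <= C * n0%:R * (c * n0.+1%:R + c * n0%:R).
Proof.
apply: filterS good_ae => w gw; apply: le_trans (ler_norm_sum _ _ _) _.
apply: le_trans (ler_wpM2l _ (Q_sum l gw)); last by rewrite mulr_ge0.
by rewrite mulr_sumr; apply: ler_sum => k _; rewrite normrM ler_wpM2r.
Qed.

Let T1_L2 l : L2 P (T1 l).
Proof.
apply: L2_le_ae (@L2_bdd _ _ _ P (fun=> C * n0%:R * (c * n0.+1%:R + c * n0%:R)) _ _ (fun=> lexx _)) _ => //.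
  exact: I1_meas (T1_I1 l).1.
by apply: filterS (T1_bdd l) => w /le_trans; apply; exact: ler_norm.
Qed.

Let D_cvg : \forall w \ae P, D ^~ w @ \oo --> (0 : R).
Proof.
apply: filterS2 good_ae cm => w gw cw.
have LC v : t <= v <= T -> `|Lam rr t v w| <= C.
  move=> /andP[tv vT]; have /andP[l0 lC] := rtr_Lam n0 t0 tT mr c1 rc Mm gw tv vT.
  by rewrite ger0_norm.
have := rest_cvg gw mrr c1 rrc t0 tT cw LC.
rewrite [X in X @ _ --> _ -> _](_ : _ = D ^~ w)//.
apply/funext => l; rewrite /D /T1 /T2 /msum.
have -> : Lam rr t T w * m T w - m t w = \sum_(k < l.+1)
   (Lam rr t (g l k.+1) w * m (g l k.+1) w - Lam rr t (g l k) w * m (g l k) w).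
  rewrite -(big_mkord xpredT (fun k => Lam rr t (g l k.+1) w * m (g l k.+1) w -
    Lam rr t (g l k) w * m (g l k) w)) telescope_sumr// gridpt0 gridptT.
  by rewrite (Lam_same rr t gw) mul1r.
rewrite -big_split -sumrB/=; apply: eq_bigr => k _.
have kl : (k <= l)%N by rewrite -ltnS.
rewrite -/(q l k w) qE// -/(Q l k w) LE ?(leqW kl)//.
rewrite (Lam_cat gw mrr c1 rrc t0 (gridpt_ge tT l k) (ltW (gridpt_lt tT l k))).
have -> : X l k w * Q l k w = Lam rr t (g l k) w * m (g l k) w * Q l k w.
  rewrite /X LE ?(leqW kl)//; case: (leP `|m (g l k) w| n0%:R) => // bm.
  by rewrite (Q0 gw kl bm) !mulr0.
move: (Lam rr t (g l k) w) (Lam rr (g l k) (g l k.+1) w) (m (g l k.+1) w) (m (g l k) w) (Q l k w).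
by move=> x1 x2 x3 x4 x5; ring.
Qed.

Let Y4 (a b x y : R) : (a - b + x - y) ^+ 2 <= 4 * (a ^+ 2 + b ^+ 2 + x ^+ 2 + y ^+ 2).
Proof.
have := sqr_ge0 (a + b); have := sqr_ge0 (a - x); have := sqr_ge0 (a + y).
have := sqr_ge0 (b + x); have := sqr_ge0 (b - y); have := sqr_ge0 (x + y).
by rewrite !expr2; nra.
Qed.

(** [E[D_l]] is the same number for every [l]. The [D_l] are bounded in [L^2] and tend to zero
    almost surely, so this number is zero. *)
Lemma truncated_orth : EX P (fun w => Lam rr t T w * m T w) = EX P (m t).
Proof.
have D2 l : L2 P (D l).
  have [_ T22 _ _] := T2_props l.
  exact: (L2B (L2D (L2B Lm2 mt2) (T1_L2 l)) T22).
have ED l : EX P (D l) = EX P (fun w => Lam rr t T w * m T w) - EX P (m t).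
  have [_ /L2_I1 T21 ET2 _] := T2_props l; have [IT1 ET1] := T1_I1 l.
  have I1a := L2_I1 Lm2; have I1b := L2_I1 mt2.
  rewrite /D (EXB (I1D (I1B I1a I1b) IT1) T21) (EXD (I1B I1a I1b) IT1) (EXB I1a I1b).
  by rewrite ET1 ET2 addr0 subr0.
pose K := 4 * (EX P (fun w => (Lam rr t T w * m T w) ^+ 2) + EX P (fun w => m t w ^+ 2) +
  (C * n0%:R * (c * n0.+1%:R + c * n0%:R)) ^+ 2 +
  C ^+ 2 * EX P (fun w => (m T w - m t w) ^+ 2)).
have L21 : L2 P (fun=> 1 : R) by apply: (@L2_bdd _ _ _ P _ 1) => // w; rewrite normr1.
have DK l : EX P (fun w => D l w ^+ 2) <= K.
  have [_ [_ T22] _ T2K] := T2_props l; have [_ T12] := T1_L2 l.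
  have [_ a2] := Lm2; have [_ b2] := mt2.
  have I4 := I1D (I1D (I1D a2 b2) T12) T22.
  apply: (@le_trans _ _ (EX P (fun w => 4 * ((Lam rr t T w * m T w) ^+ 2 + m t w ^+ 2 +
     T1 l w ^+ 2 + T2 l w ^+ 2)))).
    apply: EX_le; [by case: (D2 l)|exact: I1Z|move=> w; exact: Y4].
  rewrite (EXZ 4 I4) (EXD (I1D (I1D a2 b2) T12) T22) (EXD (I1D a2 b2) T12) (EXD a2 b2).
  rewrite ler_pM2l// lerD//; last by rewrite gridptT gridpt0 in T2K.
  rewrite lerD2l; apply: (EX_le_cst_ae T12) => //; apply: filterS (T1_bdd l) => w h.
  by rewrite -real_normK ?num_real// lerXn2r// nnegrE (le_trans _ h).
have := L2_bounded_cvg0 L21 D2 DK D_cvg.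
have -> : (fun l => EX P (fun w => 1 * D l w)) =
    fun=> EX P (fun w => Lam rr t T w * m T w) - EX P (m t).
  by apply/funext => l; rewrite -(ED l); congr EX; apply/funext => w; rewrite mul1r.
move=> h; apply/eqP; rewrite -subr_eq0; apply/eqP.
exact: (cvg_unique _ (cvg_cst _) h).
Qed.

End TruncatedOrth.

Section Orth.
Lemma Lam_eq r r' u v w : (forall s e, u < s <= v -> r s w e = r' s w e) ->
  Lam r u v w = Lam r' u v w.
Proof.
move=> rr; have e1 : jprod r u v w = jprod r' u v w.
  congr (limn _); apply/funext => N; apply: eq_bigr => n.
  by rewrite jump_fin => /andP[_ /rr]; exact.
have e2 : cint r u v w = cint r' u v w.
  apply: eq_Rintegral => s; rewrite inE/= in_itv/= => suv.
  by rewrite /phint; case: ifP => // _; apply: eq_Rintegral => e _; rewrite rr.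
by rewrite /Lam e1 e2.
Qed.

Section Fixed.
Variables (t T : R).
Hypotheses (t0 : 0 <= t) (tT : t < T) (IA : I1 P (A T)).

Lemma within_bdd (f : R -> R) : {within `[t, T], continuous f} ->
  exists n0 : nat, forall s, t <= s <= T -> `|f s| <= n0%:R.
Proof.
move=> cf; pose fc s := f (Num.max t (Num.min s T)).
have fcE s : t <= s <= T -> fc s = f s by move=> /andP[ts sT]; rewrite /fc min_l// max_r.
have cfc : continuous fc.
  apply: (within_comp_continuous cf); first exact: clamp_continuous.
  by move=> x; rewrite /= in_itv/= le_max lexx/= ge_max ge_min lexx orbT (ltW tT).
have cam : {within `[t, T], continuous (fun s => `|fc s|)}.
  by apply: continuous_subspaceT => x; apply: cvg_norm; exact: cfc.
have [x _ Hx] := EVT_max (ltW tT) cam.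
exists (Num.bound `|fc x|) => s sT; rewrite -fcE//.
apply: le_trans (Hx s _) _; first by rewrite in_itv.
by apply: ltW; exact: archi_boundP.
Qed.

(** A given path has finitely many jumps before [T], a finite increase of [A] and a bounded [m]; a
    level beyond these three leaves the rate untouched. *)
Lemma rtr_near r (m : proc) w : good w -> {within `[t, T], continuous (m ^~ w)} ->
  \forall n \near \oo, forall s e, rtr t T r n m s w e = r s w e.
Proof.
move=> gw /within_bdd[n1 Hn1]; have [N NT] := good_jump_lt T gw.
have [_ [incA _] _ _ _] := gw.
pose n2 := Num.bound (A T w - A t w).
exists (n1 + N + n2)%N => // n /= nn s e; rewrite /rtr memNset// => -[l [k [kl [_ +]]]].
have /andP[tg gT] := gridptTT tT (l := l) kl.
have nR a : (a <= n1 + N + n2)%N -> a%:R <= n%:R :> R by move=> h; rewrite ler_nat (leq_trans h).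
case; first case => /=.
- apply/negP; rewrite -leNgt; apply: le_trans (nR n2 (leq_addl _ _)).
  apply: (@le_trans _ _ (A T w - A t w)).
    by rewrite lerB//; apply: incA; rewrite gT (le_trans t0 tg).
  apply/ltW/archi_boundP; rewrite subr_ge0; apply: incA.
  by rewrite t0 ltW.
- move=> [j _ [_ Tj]]; have : (T%:E < Tn (j.+1 + n) w)%E.
    by apply: NT; rewrite (leq_trans _ (leq_addl _ _))// (leq_trans _ nn)// -addnA addnCA leq_addr.
  by rewrite ltNge (le_trans Tj) ?lee_fin.
- apply/negP; rewrite -leNgt; apply: le_trans (nR n1 _); last by rewrite -addnA leq_addr.
  by apply: Hn1; rewrite tg.
Qed.

Lemma Lam_rtr_near r (m : proc) w : good w -> {within `[t, T], continuous (m ^~ w)} ->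
  \forall n \near \oo, Lam (rtr t T r n m) t T w = Lam r t T w.
Proof.
by move=> gw cw; apply: filterS (rtr_near r gw cw) => n H; apply: Lam_eq => s e _; exact: H.
Qed.

Lemma cst_martingale2 (X : Omega -> R) : meas_on (F t) setT X -> L2 P X ->
  martingale2 P F t T (fun=> X).
Proof.
move=> mX X2; split=> //.
  by move=> s /andP[ts _] B mB; apply: (F_le ts); exact: mX.
move=> u v G _ _ _ _; rewrite (_ : (fun x => _) = fun=> 0); first exact: EX_cst.
by apply/funext => x; rewrite subrr mulr0.
Qed.

Lemma Lam_ge0 r u v w : (forall s w e, 0 <= r s w e) -> good w -> 0 <= Lam r u v w.
Proof.
move=> r0 gw; rewrite /Lam mulr_ge0 ?expR_ge0//.
have [N NT] := good_jump_lt v gw; rewrite (jprodE r u NT).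
by apply: prodr_ge0 => n _; exact: r0.
Qed.

Lemma Lam_measurable r : (forall s w e, 0 <= r s w e) -> mpred r ->
  measurable_fun setT (Lam r t T).
Proof.
move=> r0 mr; apply: (F_fun_measurable (t := T)).
by apply: Lam_meas => //; exact: le_trans t0 (ltW tT).
Qed.

(** The truncated densities have mean one, by [truncated_orth] with the constant martingale 1, and
    Fatou's lemma gives integrability of their limit. *)
Lemma Lam_I1 r c : mpred r -> 1 <= c -> (forall s w e, 0 <= r s w e <= c) ->
  I1 P (Lam r t T).
Proof.
move=> mr c1 rc; have r0 s w e : 0 <= r s w e by case/andP: (rc s w e).
have M1 : martingale2 P F t T (fun _ _ => 1 : R).
  apply: cst_martingale2; first by apply/FT_fun; exact: measurable_cst.
  by apply: (@L2_bdd _ _ _ P _ 1) => // w; rewrite normr1.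
have cm1 : \forall w \ae P, {within `[t, T], continuous ((fun _ _ => 1 : R) ^~ w)}.
  by apply: aeW => w; apply: continuous_subspaceT => x; exact: cvg_cst.
pose f_ n := Lam (rtr t T r n (fun _ _ => 1 : R)) t T.
have mrn n := rtr_mpred n t0 tT mr M1.
have rn0 n s w e : 0 <= rtr t T r n (fun _ _ => 1) s w e.
  by case/andP: (rtr_bdd t T n (fun _ _ => 1) c1 rc s w e).
have fC n : \forall w \ae P, 0 <= f_ n w <= Cr c n.
  apply: filterS good_ae => w gw.
  exact: (rtr_Lam n t0 tT mr c1 rc M1 gw (ltW tT) (lexx T)).
have If n : I1 P (f_ n).
  apply: I1_le_ae (Lam_measurable (rn0 n) (mrn n)) (I1_cst P (Cr c n)) _.
  by apply: filterS (fC n) => w /andP[f0 fC']; rewrite ger0_norm.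
have [] := @I1_fatou _ _ _ P f_ (Lam r t T) 1 If _ (Lam_measurable r0 mr) _ => //.
- move=> n; have <- : EX P (f_ n) = EX P (fun w => `|f_ n w|).
    apply: EX_ae; [exact: I1_meas|exact: I1_meas (I1_abs (If n))|].
    by apply: filterS (fC n) => w /andP[f0 _]; rewrite ger0_norm.
  have := truncated_orth n t0 tT mr c1 rc M1 cm1 IA.
  rewrite EX_cst => <-; rewrite le_eqVlt; apply/orP; left; apply/eqP.
  by congr EX; apply/funext => w; rewrite mulr1.
- apply: filterS good_ae => w gw; apply: cvg_near_cst.
  by apply: Lam_rtr_near => //; apply: continuous_subspaceT => x; exact: cvg_cst.
Qed.

(** The truncation is removed by dominated convergence; [G] dominates the densities with truncated
    rates uniformly in the level. *)
Lemma orth r c (m : proc) G : mpred r -> 1 <= c ->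
  (forall s w e, 0 <= r s w e <= c) -> martingale2 P F t T m ->
  (\forall w \ae P, {within `[t, T], continuous (m ^~ w)}) -> L2 P G ->
  (\forall w \ae P, forall n, Lam (rtr t T r n m) t T w <= G w) ->
  I1 P (fun w => Lam r t T w * m T w) /\ EX P (fun w => Lam r t T w * m T w) = EX P (m t).
Proof.
move=> mr c1 rc Mm cm G2 LG.
have r0 s w e : 0 <= r s w e by case/andP: (rc s w e).
have mrn n := rtr_mpred n t0 tT mr Mm.
have rn0 n s w e : 0 <= rtr t T r n m s w e.
  by case/andP: (rtr_bdd t T n m c1 rc s w e).
have mT2 : L2 P (m T) by have [_ m2 _] := Mm; apply: m2; rewrite lexx ltW.
have mmT := mT2.1.
have [|||||IL EL] := @EX_dct _ _ _ P (fun n w => Lam (rtr t T r n m) t T w * m T w)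
  (fun w => Lam r t T w * m T w) (fun w => `|G w * m T w|).
- by move=> n; apply: measurable_funM => //; exact: Lam_measurable.
- by apply: measurable_funM => //; exact: Lam_measurable.
- exact/I1_abs/L2M.
- apply: filterS2 good_ae cm => w gw cw; apply: cvgMr_tmp; apply: cvg_near_cst.
  exact: Lam_rtr_near.
- apply: filterS2 good_ae LG => w gw LG n; rewrite normrM [leRHS]normrM ler_wpM2r//.
  by rewrite ger0_norm ?(Lam_ge0 _ _ (rn0 n) gw)// (le_trans (LG n)) ?ler_norm.
split=> //; apply: (cvg_unique _ EL) => //.
rewrite /= (_ : (fun n => _) = fun=> EX P (m t)); first exact: cvg_cst.
by apply/funext => n; exact: (truncated_orth n t0 tT mr c1 rc Mm cm IA).
Qed.

Lemma phint_cst (k : R) s w : 0 <= s -> phint (fun _ _ _ => k) s w = k.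
Proof. by move=> s0; rewrite /phint s0; exact: EX_cst. Qed.

Lemma dA_cst (k : R) u v w : good w -> 0 <= u -> u <= v ->
  \int[dA A w]_(s in `]u, v]) k = k * (A v w - A u w).
Proof. by move=> gw u0 uv; rewrite Rintegral_cst//= (dA_itv gw). Qed.

Lemma dA_phint_cst (k : R) u v w : good w -> 0 <= u -> u <= v ->
  \int[dA A w]_(s in `]u, v]) phint (fun _ _ _ => k) s w = k * (A v w - A u w).
Proof.
move=> gw u0 uv; rewrite -(dA_cst _ gw u0 uv); apply: eq_Rintegral => s.
by rewrite inE/= in_itv/= => /andP[us _]; rewrite phint_cst// (le_trans u0 (ltW us)).
Qed.

Lemma jprod_cst_exp (a : R) k u v w : good w ->
  jprod (fun _ _ _ => a ^+ k) u v w = jprod (fun _ _ _ => a) u v w ^+ k.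
Proof.
move=> gw; have [N NT] := good_jump_lt v gw; rewrite !(jprodE _ _ NT).
by rewrite prodrXl.
Qed.

Section Moments.
Variables (M eta : R).
Hypotheses (M0 : 0 <= M) (etaM : 3 + M ^+ 4 < eta) (Ieta : I1 P (fun w => expR (eta * A T w))).
Let Mx : R := Num.max M 1.
Let T0 : 0 <= T := le_trans t0 (ltW tT).

Let Mx1 : 1 <= Mx. Proof. by rewrite le_max lexx orbT. Qed.

(** A density in which every jump counts with the maximal rate [max(M, 1)] and the compensator is
    replaced by its upper bound [A_T]. It dominates at once the densities of all rates with values
    in [[0, max(M, 1)]]. *)
Definition Gam w : R := jprod (fun _ _ _ => Mx) t T w * expR (A T w).

Lemma mpred_cst (k : R) : mpred (fun _ _ _ => k).
Proof. exact: measurable_cst. Qed.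

Lemma A_T_meas : measurable_fun setT (A T).
Proof. exact: I1_meas IA. Qed.

Lemma Gam_meas : measurable_fun setT Gam.
Proof.
apply: measurable_funM; last exact: (measurableT_comp (@measurable_expR R) A_T_meas).
apply: (F_fun_measurable (t := T)).
apply: jprod_meas => //; first by move=> *; exact: le_trans ler01 Mx1.
exact: mpred_cst.
Qed.

Lemma A_ge0 w s : good w -> 0 <= s -> 0 <= A s w.
Proof. by move=> [A0 [incA _] _ _ _] s0; rewrite -A0; apply: incA; rewrite lexx. Qed.

(* Young's inequality and [E (kappa^N exp (- (kappa - 1) A)) <= 1] with [kappa = Mx^4]. *)
Lemma Gam_moments : L2 P Gam /\ I1 P (fun w => Gam w ^+ 2 * A T w).
Proof.
have mA := A_T_meas; have mG := Gam_meas.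
pose k := Mx ^+ 4; have k1 : 1 <= k by exact: exprn_ege1.
have IL : I1 P (Lam (fun _ _ _ => k) t T).
  by apply: (Lam_I1 (c := k)) => [||*]; [exact: mpred_cst|exact: k1|rewrite lexx (le_trans ler01 k1)].
(* [2 dl] is the slack in [eta > 3 + M^4]; it pays for the polynomial factor [(1 + A_T)^2]. *)
pose dl := (eta - 3 - M ^+ 4) / 2.
have dl0 : 0 < dl by rewrite /dl divr_gt0//; move: etaM; lra.
pose Kd := (1 + dl^-1) ^+ 2.
have Kd0 : 0 <= Kd by exact: sqr_ge0.
have Kd1 x : 0 <= x -> (1 + x) ^+ 2 <= Kd * expR (2 * dl * x).
  move=> x0; have h : 1 + x <= (1 + dl^-1) * expR (dl * x).
    have h1 := expR_ge1Dx (dl * x); have h2 : 0 < dl^-1 by rewrite invr_gt0.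
    apply: (@le_trans _ _ ((1 + dl^-1) * (1 + dl * x))); last first.
      by rewrite ler_wpM2l// addr_ge0// ltW.
    rewrite mulrDl mul1r mulrDr mulr1 mulrA mulVf ?gt_eqF// mul1r.
    by have := mulr_ge0 (ltW dl0) x0; move: h2; lra.
  rewrite -mulrA -[2 * _]/(_ *+ 2 * _) mulr2n mulrDl mul1r expRD /Kd -expr2 -exprMn.
  by rewrite lerXn2r ?nnegrE ?(le_trans _ h) ?addr_ge0.
(* The factor [1 + A T w] treats both moments at once. *)
have key : \forall w \ae P, Gam w ^+ 2 * (1 + A T w) <=
    Lam (fun _ _ _ => k) t T w + Kd * expR (eta * A T w).
  apply: filterS good_ae => w gw.
  have At0 := A_ge0 gw t0; have AT0 := A_ge0 gw T0.
  have LE : Lam (fun _ _ _ => k) t T w =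
      jprod (fun _ _ _ => Mx) t T w ^+ 4 * expR ((1 - k) * (A T w - A t w)).
    rewrite /Lam jprod_cst_exp//; congr (_ * expR _).
    exact: (dA_phint_cst (1 - k) gw t0 (ltW tT)).
  have L0 : 0 <= Lam (fun _ _ _ => k) t T w.
    by rewrite LE mulr_ge0 ?expR_ge0// -[4%N]/(2 * 2)%N exprM sqr_ge0.
  have Kx := Kd1 _ AT0.
  (* For [M < 1] the maximal rate is 1 and [Gam] reduces to [exp(A_T)], so no moment of the number
     of jumps is involved. *)
  have [M1|M1] := leP 1 M; last first.
    have Mx1' : Mx = 1 by rewrite /Mx max_r// ltW.
    apply: (@le_trans _ _ (Kd * expR (eta * A T w))); last by rewrite lerDr.
    have -> : Gam w = expR (A T w).
      have [N NT] := good_jump_lt T gw; rewrite /Gam (jprodE _ _ NT) Mx1'.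
      by rewrite big1 ?mul1r.
    apply: (@le_trans _ _ (expR (A T w) ^+ 2 * (Kd * expR (2 * dl * A T w)))).
      rewrite ler_wpM2l ?sqr_ge0//; apply: le_trans Kx.
      by rewrite expr2 ler_peMl// ?lerDl// addr_ge0.
    rewrite mulrCA ler_wpM2l// expr2 -!expRD ler_expR.
    rewrite [leLHS](_ : _ = (2 + 2 * dl) * A T w); last by ring.
    rewrite ler_wpM2r//.
    have := exprn_ge0 4 M0; move: etaM; rewrite /dl; lra.
  have MxE : Mx = M by rewrite /Mx max_l.
  (* Half of the compensator exponent [1 - k] goes to [X], so that [X^2] is bounded by the density
     with constant rate [k = M^4]. Then [Y^2] carries the exponent [4 - (1 - k) = 3 + M^4], plus
     [2 dl] for the polynomial factor, which is [eta]. *)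
  pose X := jprod (fun _ _ _ => Mx) t T w ^+ 2 * expR ((1 - k) / 2 * A T w).
  pose Y := expR ((2 - (1 - k) / 2) * A T w) * (1 + A T w).
  have -> : Gam w ^+ 2 * (1 + A T w) = X * Y.
    have e2 : expR (A T w) ^+ 2 = expR ((1 - k) / 2 * A T w) * expR ((2 - (1 - k) / 2) * A T w).
      by rewrite -expRD -expRM_natl; congr expR; lra.
    by rewrite /Gam /X /Y exprMn e2 !mulrA.
  have XL : X ^+ 2 <= Lam (fun _ _ _ => k) t T w.
    rewrite LE /X exprMn -exprM -expRM_natl ler_wpM2l//.
      by rewrite -[(2 * 2)%N]/4%N -[4%N]/(2 * 2)%N exprM sqr_ge0.
    have h0 : 0 <= (k - 1) * A t w by rewrite mulr_ge0// subr_ge0.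
    by rewrite ler_expR; move: h0; lra.
  have YK : Y ^+ 2 <= Kd * expR (eta * A T w).
    rewrite /Y exprMn -expRM_natl mulrC.
    apply: (@le_trans _ _ (Kd * expR (2 * dl * A T w) * expR (2 * ((2 - (1 - k) / 2) * A T w)))).
      by rewrite ler_wpM2r ?expR_ge0.
    rewrite -mulrA ler_wpM2l// -expRD ler_expR /dl /k MxE le_eqVlt; apply/orP; left; apply/eqP.
    by field.
  have X0 := sqr_ge0 X; have Y0 := sqr_ge0 Y; have := sqr_ge0 (X - Y).
  rewrite sqrrB; move: (X ^+ 2) (Y ^+ 2) (X * Y) XL YK X0 Y0 => x y z; lra.
have ID := I1D IL (I1Z Kd Ieta).
have h (f : Omega -> R) : measurable_fun setT f ->
    (forall w, good w -> `|f w| <= Gam w ^+ 2 * (1 + A T w)) -> I1 P f.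
  move=> mf fG; apply: I1_le_ae mf ID _.
  by apply: filterS2 good_ae key => w gw; apply: le_trans (fG w gw).
split; first split=> //.
  apply: h => [|w gw]; first exact: measurable_funX.
  by rewrite ger0_norm ?sqr_ge0// ler_peMr ?sqr_ge0// lerDl A_ge0.
apply: h => [|w gw]; first by apply: measurable_funM => //; exact: measurable_funX.
have A0 := A_ge0 gw T0; rewrite ger0_norm; last by rewrite mulr_ge0 ?sqr_ge0.
by rewrite ler_wpM2l ?sqr_ge0// lerDr.
Qed.

End Moments.

End Fixed.

End Orth.

(** * Densities and compensated jumps *)

Section BoundedOrth.
Section Fixed.
Variables (t T M : R).
Hypotheses (t0 : 0 <= t) (tT : t < T) (IA : I1 P (A T)).
Let c : R := Num.max M 1.
Local Notation Gam := (Gam t T M).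
Hypothesis G2 : L2 P Gam.
Variable r : hfun.
Hypotheses (mr : mpred r) (rc : forall s w e, 0 <= r s w e <= c).

Let c1 : 1 <= c. Proof. by rewrite le_max lexx orbT. Qed.
Let c0 : 0 <= c := le_trans ler01 c1.
Let T0 : 0 <= T := le_trans t0 (ltW tT).

Lemma dA_phint_mono h h' k w : good w -> mpred h -> mpred h' ->
  (forall s w e, `|h s w e| <= k) -> (forall s w e, `|h' s w e| <= k) ->
  (forall s e, h s w e <= h' s w e) ->
  \int[dA A w]_(s in `]t, T]) phint h s w <= \int[dA A w]_(s in `]t, T]) phint h' s w.
Proof.
move=> gw mh mh' hk hk' hh'.
have mI : measurable (rset R `]t, T]) by exact: measurable_itv.
have Ih := dA_phint_integrable t0 (ltW tT) gw mh hk.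
have Ih' := dA_phint_integrable t0 (ltW tT) gw mh' hk'.
apply: (le_Rintegral mI Ih Ih') => s _; rewrite /phint; case: ifP => // _.
exact: (EX_le (I1_phi s w mh hk) (I1_phi s w mh' hk')).
Qed.

Lemma dA_phintZ h k e w : good w -> mpred h -> (forall s w e, `|h s w e| <= k) ->
  \int[dA A w]_(s in `]t, T]) phint (fun s w x => e * h s w x) s w =
  e * \int[dA A w]_(s in `]t, T]) phint h s w.
Proof.
move=> gw mh hk.
have mI : measurable (rset R `]t, T]) by exact: measurable_itv.
rewrite -(RintegralZl _ mI (dA_phint_integrable t0 (ltW tT) gw mh hk)).
apply: eq_Rintegral => s _; rewrite /phint; case: ifP => _; last by rewrite mulr0.
exact: (EXZ _ (I1_phi s w mh hk)).
Qed.

Lemma cint_le r' c' w : mpred r' -> 1 <= c' -> (forall s w e, 0 <= r' s w e <= c') -> good w ->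
  cint r' t T w <= A T w.
Proof.
move=> mr' c1' rc' gw.
have h1 : mpred (fun _ _ _ => 1 : R) by exact: mpred_cst.
have b1 (s : R) (w' : Omega) (e : marks E) : `|1 : R| <= c' by rewrite normr1.
apply: le_trans (dA_phint_mono gw (mpred_1B mr') h1 (bdd_1B c1' rc') b1 _) _.
  by move=> s e; have /andP[r0 _] := rc' s w e; rewrite gerBl.
by rewrite (dA_phint_cst _ gw t0 (ltW tT)) mul1r gerBl (A_ge0 gw t0).
Qed.

Lemma Lam_le_Gam r' w : mpred r' -> (forall s w e, 0 <= r' s w e <= c) -> good w ->
  Lam r' t T w <= Gam w.
Proof.
move=> mr' rc' gw; rewrite /Lam /Gam; have [N NT] := good_jump_lt T gw.
rewrite !(jprodE _ _ NT); apply: ler_pM; first last.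
- by rewrite ler_expR; exact: cint_le mr' c1 rc' gw.
- by apply: ler_prod => n _; exact: rc'.
- exact: expR_ge0.
- by apply: prodr_ge0 => n _; case/andP: (rc' (fine (Tn n w)) w (zeta n w)).
Qed.

Lemma X_mart (X : Omega -> R) kx : meas_on (F t) setT X -> (forall w, `|X w| <= kx) ->
  martingale2 P F t T (fun=> X).
Proof.
move=> mX Xk; apply: cst_martingale2 => //.
exact: L2_bdd (F_fun_measurable mX) Xk.
Qed.

Lemma X_cont (X : Omega -> R) : \forall w \ae P, {within `[t, T], continuous (fun _ : R => X w)}.
Proof. by apply: aeW => w; apply: continuous_subspaceT => x; exact: cvg_cst. Qed.

(** [orth] with the constant martingale [X]: the density has conditional mean one given [F t]. *)
Lemma EX_Lam (X : Omega -> R) kx : meas_on (F t) setT X -> (forall w, `|X w| <= kx) ->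
  I1 P (fun w => Lam r t T w * X w) /\ EX P (fun w => Lam r t T w * X w) = EX P X.
Proof.
move=> mX Xk; have Mm := X_mart mX Xk.
apply: (orth t0 tT IA mr c1 rc Mm (X_cont X) G2).
apply: filterS good_ae => w gw n; apply: Lam_le_Gam => //.
  exact: (rtr_mpred n t0 tT mr Mm).
exact: (rtr_bdd t T n (fun=> X) c1 rc).
Qed.

Variables (X : Omega -> R) (kx : R) (n0 : nat) (h : hfun) (k : R).
Hypotheses (mX : meas_on (F t) setT X) (Xk : forall w, `|X w| <= kx) (mh : mpred h)
  (hk : forall s w e, 0 <= h s w e <= k)
  (hB : forall s w e, (s, w) \in Bset t T n0 (fun=> X) -> h s w e = 0).

Let k0 : 0 <= k.
Proof. by have /andP[a b] := hk 0 point point; exact: le_trans b. Qed.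

Let S w := \int[pm w]_(x in `]t, T] `*` setT) h x.1 w x.2.
Let V w := \int[dA A w]_(s in `]t, T]) phint (fun s w e => r s w e * h s w e) s w.

Let mrh : mpred (fun s w e => r s w e * h s w e).
Proof. exact: measurable_funM mr mh. Qed.

Let rhk s w e : 0 <= r s w e * h s w e <= c * k.
Proof.
by have /andP[a b] := rc s w e; have /andP[a' b'] := hk s w e; rewrite mulr_ge0//= ler_pM.
Qed.

Let rhk' s w e : `|r s w e * h s w e| <= c * k.
Proof. by have /andP[a b] := rhk s w e; rewrite ger0_norm. Qed.

(** For the rate 0 the truncated rate equals 1 exactly on [Bset], so [rtr_count] bounds the number
    of jumps outside [Bset], and [h] charges no others. *)
Let count w N : good w ->
  (\sum_(1 <= n < N.+1) (jump t T w n && (jr h w n != 0%R)) <= n0.+1)%N.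
Proof.
move=> gw; apply: leq_trans (rtr_count (fun _ _ _ => 0) n0 (fun=> X) tT N gw).
apply: leq_sum => n _; case: (jump t T w n) => //=.
rewrite {2}/jr /rtr; case: ifP => [b|_]; last by rewrite [0 == 1]eq_sym oner_eq0 leq_b1.
by rewrite /jr hB// eqxx.
Qed.

Let B := k * n0.+1%:R + c * k * n0%:R.

Let S_bdd w : good w -> 0 <= S w <= B.
Proof.
move=> gw; have [N NT] := good_jump_lt T gw.
rewrite /S (pm_Rintegral t (mpred_path w mh) NT); apply/andP; split.
  by apply: sumr_ge0 => n _; case/andP: (hk (fine (Tn n w)) w (zeta n w)).
apply: (@le_trans _ _ (k * n0.+1%:R)); last by rewrite lerDl !mulr_ge0.
apply: (@le_trans _ _ (\sum_(1 <= n < N.+1) k * (jump t T w n && (jr h w n != 0))%:R)).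
  rewrite big_mkcond; apply: ler_sum => n _; case: (jump t T w n); rewrite /= ?mulr0//.
  rewrite -/(jr h w n); have [->|_] := eqVneq (jr h w n) 0; rewrite /= ?mulr0// mulr1.
  by case/andP: (hk (fine (Tn n w)) w (zeta n w)).
by rewrite -mulr_sumr -natr_sum ler_wpM2l// ler_nat; exact: count.
Qed.

Let V_bdd w : good w -> 0 <= V w <= B.
Proof.
move=> gw; apply/andP; split.
  apply: Rintegral_ge0 => s _; rewrite /phint; case: ifP => // _.
  by apply: EX_ge0 => e; case/andP: (rhk s w e).
apply: (@le_trans _ _ (c * k * n0%:R)); last by rewrite lerDr mulr_ge0.
have [sigma [/andP[ts sT] As rs _]] := rtr_stop (fun (_ : R) (_ : Omega) (_ : marks E) => 0) n0 (fun=> X) t0 tT gw.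
have z s : sigma < s <= T -> phint (fun s w e => r s w e * h s w e) s w = 0.
  move=> sT'; rewrite /phint; case: ifP => // _; apply: Rint_eq0 => e _.
  have := rs s e sT'; rewrite /rtr; case: ifP => [b _|_ /eqP]; first by rewrite hB// mulr0.
  by rewrite eq_sym oner_eq0.
have mp := ppred_path w (phint_ppred mrh).
rewrite /V (dA_Rint_cat (c := c * k) gw t0 ts sT mp); last first.
  by move=> s _; exact: phint_bdd mrh rhk'.
rewrite [X in _ + X]Rint_eq0 ?addr0; last by move=> s; rewrite /= in_itv/=; exact: z.
apply: le_trans (ler_norm _) _; apply: le_trans (dA_Rint_le t0 ts gw mp _) _.
  by move=> s _; exact: phint_bdd mrh rhk'.
by rewrite ler_wpM2l// mulr_ge0.
Qed.

Let re e : hfun := fun s w x => r s w x * (1 + e * h s w x).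

Let re_mpred e : mpred (re e).
Proof.
apply: measurable_funM mr _; apply: measurable_funD; first exact: measurable_cst.
by apply: measurable_funM mh; exact: measurable_cst.
Qed.

Let re_bdd e s w x : 0 < e <= 1 -> 0 <= re e s w x <= c * (1 + k).
Proof.
move=> /andP[e0 e1]; have /andP[a b] := rc s w x; have /andP[a' b'] := hk s w x.
have e0' := ltW e0.
rewrite /re mulr_ge0 ?addr_ge0 ?mulr_ge0//= ler_pM ?addr_ge0 ?mulr_ge0//.
by rewrite lerD2l -[leRHS]mul1r ler_pM.
Qed.

Let ck1 : 1 <= c * (1 + k).
Proof. by rewrite -[leLHS]mulr1 ler_pM// lerDl. Qed.

(** Relative to the rate [r], the rate [r (1 + e h)] multiplies the density by an elementary factor
    in [e], in the form that [prod_exp_expansion] expands. *)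
Let re_Lam e w : 0 < e <= 1 -> good w -> exists N,
  S w = \sum_(1 <= n < N.+1 | jump t T w n) jr h w n /\
  Lam (re e) t T w = Lam r t T w *
    (\prod_(1 <= n < N.+1 | jump t T w n) (1 + e * jr h w n) * expR (- (e * V w))).
Proof.
move=> e01 gw; have [N NT] := good_jump_lt T gw; exists N; split.
  exact: (pm_Rintegral t (mpred_path w mh) NT).
rewrite /Lam !(jprodE _ _ NT) mulrACA -big_split/=.
have ce : cint (re e) t T w = cint r t T w - e * V w.
  have e0 : 0 <= e by case/andP: e01 => /ltW.
  rewrite /cint /V -(dA_phintZ e gw mrh rhk').
  have mz : mpred (fun s w x => e * (r s w x * h s w x)).
    by apply: measurable_funM mrh; exact: measurable_cst.
  rewrite -(@dA_phintB _ _ t0 (ltW tT) w _ _ (c + c * k) gw (mpred_1B mr) mz).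
  - apply: eq_Rintegral => s _; congr (phint _ s w).
    by apply/funext => s'; apply/funext => w'; apply/funext => x; rewrite /re; ring.
  - by move=> s' w' x; rewrite (le_trans (bdd_1B c1 rc _ _ _))// lerDl mulr_ge0.
  - move=> s' w' x; rewrite normrM (ger0_norm e0).
    apply: (@le_trans _ _ (1 * (c * k))); last by rewrite mul1r lerDr.
    by apply: ler_pM => //; case/andP: e01.
by rewrite ce expRD.
Qed.

Let Ge w := (1 + k) ^+ n0.+1 * Gam w.

(** The perturbation enlarges at most [n0 + 1] jump factors, each by at most [1 + k], so one
    square-integrable bound serves all [e] in []0, 1]] and all truncation levels. *)
Let rtr_re_le e n w : 0 < e <= 1 -> good w ->
  Lam (rtr t T (re e) n (fun=> X)) t T w <= Ge w.
Proof.
move=> e01 gw; have Mm := X_mart mX Xk.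
have mrr := rtr_mpred n t0 tT (re_mpred e) Mm.
have rrc := rtr_bdd t T n (fun=> X) ck1 (fun s w x => re_bdd s w x e01).
have k1 : 1 <= 1 + k by rewrite lerDl.
rewrite /Lam /Ge /Gam mulrA; have [N NT] := good_jump_lt T gw.
rewrite !(jprodE _ _ NT); apply: ler_pM; first last.
- by rewrite ler_expR; exact: cint_le mrr ck1 rrc gw.
- apply: (@le_trans _ _ (\prod_(1 <= i < N.+1 | jump t T w i)
      ((1 + k) ^+ (jr h w i != 0) * c))).
    apply: ler_prod => i _; case/andP: (rrc (fine (Tn i w)) w (zeta i w)) => -> _ /=.
    rewrite /jr /rtr; case: ifP => _.
      by rewrite -[leLHS]mulr1 ler_pM// exprn_ege1.
    rewrite /re mulrC; have /andP[a b] := rc (fine (Tn i w)) w (zeta i w).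
    have /andP[a' b'] := hk (fine (Tn i w)) w (zeta i w).
    have /andP[e0 e1] := e01; have e0' := ltW e0.
    apply: ler_pM => //; first by rewrite addr_ge0// mulr_ge0.
    case: eqP => [->|_] /=; first by rewrite mulr0 addr0.
    by rewrite expr1 lerD2l -[leRHS]mul1r ler_pM.
  rewrite big_split/= ler_wpM2r//.
    by apply: prodr_ge0.
  rewrite big_mkcond/= (eq_bigr (fun i => (1 + k) ^+ (jump t T w i && (jr h w i != 0)))).
    by rewrite -expr_sum ler_weXn2l//; exact: count.
  by move=> i _; case: ifP.
- exact: expR_ge0.
- by apply: prodr_ge0 => i _; case/andP: (rrc (fine (Tn i w)) w (zeta i w)).
Qed.

Lemma bounded_comp_orth :
  I1 P (fun w => X w * (Lam r t T w * (S w - V w))) /\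
  EX P (fun w => X w * (Lam r t T w * (S w - V w))) = 0.
Proof.
have mX' := F_fun_measurable mX.
have IL := Lam_I1 t0 tT IA mr c1 rc; have mL := I1_meas IL.
have mS : measurable_fun setT S by exact: (pm_Rint_meas t0 (ltW tT) mh).
have mV : measurable_fun setT V by exact: (dA_phint_meas t0 (ltW tT) mrh).
have L0 w : good w -> 0 <= Lam r t T w.
  by apply: Lam_ge0 => s w' e; case/andP: (rc s w' e).
have kx0 : 0 <= kx by apply: le_trans (Xk point); exact: normr_ge0.
have B0 : 0 <= B by rewrite /B addr_ge0 ?mulr_ge0.
have SVB w : good w -> `|S w - V w| <= B.
  move=> gw; have /andP[a b] := S_bdd gw; have /andP[a' b'] := V_bdd gw.
  by rewrite ler_norml; apply/andP; split; lra.
have I : I1 P (fun w => X w * (Lam r t T w * (S w - V w))).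
  apply: I1_le_ae (I1Z (kx * B) IL) _.
    by apply: measurable_funM => //; apply: measurable_funM => //; exact: measurable_funB.
  apply: filterS good_ae => w gw; rewrite normrM [`|_ * (_ - _)|]normrM (ger0_norm (L0 w gw)).
  have h1 : Lam r t T w * `|S w - V w| <= Lam r t T w * B by apply: ler_wpM2l; [exact: L0|exact: SVB].
  rewrite -mulrA [B * _]mulrC; apply: ler_pM => //.
  by apply: mulr_ge0 => //; exact: L0.
split=> //; have [ILX ELX] := EX_Lam mX Xk.
have EL0 : 0 <= EX P (Lam r t T).
  by rewrite -(EX_cst P 0); apply: (EX_le_ae (I1_cst _ _) IL); apply: filterS good_ae => w /L0.
pose K := 7 * B ^+ 2 * kx * EX P (Lam r t T).
have K0 : 0 <= K by rewrite /K !mulr_ge0 ?sqr_ge0.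
set x := EX P _.
(* The densities with rates [r] and [r (1 + e h)] give [X] the same mean, so the linear term [e x]
   equals, up to sign, the mean of the remainder of the expansion. *)
have key e : 0 < e <= 1 -> e * B <= 2^-1 -> e * `|x| <= e ^+ 2 * K.
  move=> e01 eB; have /andP[e0 e1] := e01.
  have Mm := X_mart mX Xk.
  have [Ie Ee] := orth t0 tT IA (re_mpred e) ck1 (fun s w x => re_bdd s w x e01) Mm (X_cont X)
    (L2Z ((1 + k) ^+ n0.+1) G2) (filterS (fun w gw n => rtr_re_le n e01 gw) good_ae).
  have Ed := I1B (I1B Ie ILX) (I1Z e I).
  have -> : e * `|x| = `|EX P (fun w => Lam (re e) t T w * X w - Lam r t T w * X w -
      e * (X w * (Lam r t T w * (S w - V w))))|.
    have E1 := etrans (EXB (I1B Ie ILX) (I1Z e I))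
      (congr2 (fun a b => a - b) (EXB Ie ILX) (EXZ e I)).
    have {}E1 : EX P (fun w => Lam (re e) t T w * X w - Lam r t T w * X w -
      e * (X w * (Lam r t T w * (S w - V w)))) = EX P X - EX P X - e * x.
      by rewrite -{1}Ee -ELX; exact: E1.
    by rewrite E1 subrr sub0r normrN normrM (gtr0_norm e0).
  apply: le_trans (EX_abs Ed) _.
  have -> : e ^+ 2 * K = EX P (fun w => (e ^+ 2 * (7 * B ^+ 2) * kx) * Lam r t T w).
    by rewrite (EXZ _ IL) /K; ring.
  apply: (EX_le_ae (I1_abs Ed) (I1Z _ IL)).
  apply: filterS good_ae => w gw; have [N [SE ->]] := re_Lam e01 gw.
  have /andP[a b] := S_bdd gw; have Vb := V_bdd gw.
  have hi i : 0 <= jr h w i by case/andP: (hk (fine (Tn i w)) w (zeta i w)).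
  rewrite SE in b.
  have := prod_exp_expansion (p := jump t T w) (s := index_iota 1 N.+1) hi e0 Vb b eB.
  rewrite -SE; set pe := _ * expR _.
  move=> h1; rewrite (_ : _ - _ = X w * Lam r t T w * (pe - 1 - e * (S w - V w))); last by ring.
  rewrite normrM [`|X w * _|]normrM (ger0_norm (L0 w gw)).
  have h2 := ler_pM (normr_ge0 _) (normr_ge0 _) (Xk w) h1.
  rewrite -mulrA mulrCA; apply: le_trans (ler_wpM2l (L0 w gw) h2) _.
  rewrite le_eqVlt; apply/orP; left; apply/eqP.
  by rewrite mulrC; congr (_ * _); rewrite [LHS]mulrC; congr (_ * _); exact: mulrC.
apply/eqP; rewrite -normr_eq0 eq_le normr_ge0 andbT leNgt; apply/negP => x0.
(* The last entry makes [e K] smaller than [|x|], contradicting [|x| <= e K]; the others meet the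
   conditions of [key]. *)
pose e := Num.min 1 (Num.min (2^-1 / (B + 1)) (`|x| / (2 * (K + 1)))).
have e0 : 0 < e by rewrite !lt_min ltr01/= !divr_gt0// ?mulr_gt0// ltr_wpDl.
have e1 : e <= 1 by rewrite ge_min lexx.
have e2 : e * B <= 2^-1.
  apply: (@le_trans _ _ (e * (B + 1))); first by rewrite ler_wpM2l ?(ltW e0)// lerDl.
  by rewrite -ler_pdivlMr ?ltr_wpDl// !ge_min lexx orbT.
have e3 : e * (2 * (K + 1)) <= `|x|.
  by rewrite -ler_pdivlMr ?mulr_gt0 ?ltr_wpDl// !ge_min lexx !orbT.
have := key e; rewrite e0 e1 => /(_ isT e2); rewrite expr2 -mulrA ler_pM2l// => h1.
have eK : 0 <= e * K by rewrite mulr_ge0// ltW.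
by move: h1 e3 e0 eK; lra.
Qed.

End Fixed.

End BoundedOrth.

(** * Compensated jumps with a square-integrable integrand *)

Section CompL2.
Variables (t T M : R).
Hypotheses (t0 : 0 <= t) (tT : t < T) (IA : I1 P (A T)).
Let c : R := Num.max M 1.
Local Notation Gam := (Gam t T M).
Hypotheses (G2 : L2 P Gam) (GA : I1 P (fun w => Gam w ^+ 2 * A T w)).
Variables (r U : hfun).
Hypotheses (mr : mpred r) (rc : forall s w e, 0 <= r s w e <= c) (mU : mpred U).
Hypothesis U2 : forall s w, (\int[phi s w]_e (U s w e ^+ 2)%:E < +oo)%E.
Let u2 : proc := phint (fun s w e => U s w e ^+ 2).
Let Q w : R := \int[dA A w]_(s in `]t, T]) u2 s w.
Hypothesis u2_int : \forall w \ae P,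
  itg (dA A w) t T (u2 ^~ w).
Hypothesis IQ : I1 P Q.

Let c1 : 1 <= c. Proof. by rewrite le_max lexx orbT. Qed.
Let c0 : 0 <= c := le_trans ler01 c1.
Let T0 : 0 <= T := le_trans t0 (ltW tT).
Let mI : measurable (rset R `]t, T]).
Proof. exact: measurable_itv. Qed.

Let U_L2 s w : L2 (phi s w) (U s w).
Proof.
have mUs : measurable_fun setT (U s w) by exact: (mpred_section s w mU).
split=> //; apply/integrableP; split; first by apply/measurable_EFinP; exact: measurable_funX.
apply: le_lt_trans (U2 s w); rewrite le_eqVlt; apply/orP; left; apply/eqP.
by apply: eq_integral => e _ /=; rewrite ger0_norm ?sqr_ge0.
Qed.

Section Dominated.
Variables (v : hfun) (kb : R).
Hypotheses (mv : mpred v) (vU : forall s w e, `|v s w e| <= kb * `|U s w e|) (kb0 : 0 <= kb).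

Lemma dominated_I1 s w : I1 (phi s w) (v s w).
Proof.
apply: I1_le (I1Z kb (I1_abs (L2_I1 (U_L2 s w)))) _; first exact: (mpred_section s w mv).
by move=> e; exact: vU.
Qed.

Let young s w e (g : R) : 0 <= g -> g * `|v s w e| <= kb / 2 * (U s w e ^+ 2 + g ^+ 2).
Proof.
move=> g0; apply: (@le_trans _ _ (g * (kb * `|U s w e|))); first by rewrite ler_wpM2l.
have := sqr_ge0 (`|U s w e| - g); rewrite sqrrB real_normK ?num_real//.
rewrite -[kb / 2 * _]mulrA mulrCA => h; rewrite ler_wpM2l//.
by move: h; rewrite -mulr_natr; move: (`|U s w e| * g) (mulrC g `|U s w e|) => x ->; lra.
Qed.

(** Young's inequality with weight [g]. The weight 1 gives integrability; a density as weight leads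
    to the bound by [Q + Gam^2 A_T], both terms of which are integrable. *)
Lemma dominated_phint s w g : 0 <= s -> 0 <= g ->
  g * `|phint v s w| <= kb / 2 * (u2 s w + g ^+ 2).
Proof.
move=> s0 g0; rewrite /u2 /phint s0.
have I := dominated_I1 s w; have I2' := (U_L2 s w).2.
apply: (@le_trans _ _ (g * EX (phi s w) (fun e => `|v s w e|))).
  by rewrite ler_wpM2l// (EX_abs I).
rewrite -(EXZ g (I1_abs I)) -[\int[phi s w]_e _]/(EX (phi s w) _).
rewrite -(EX_cst (phi s w) (g ^+ 2)) -(EXD I2' (I1_cst _ _)) -(EXZ _ (I1D I2' (I1_cst _ _))).
apply: EX_le; [exact: I1Z (I1_abs I)|exact: I1Z (I1D I2' (I1_cst _ _))|].
by move=> e; exact: young.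
Qed.

Lemma dominated_dA_int w : good w ->
  itg (dA A w) t T (u2 ^~ w) ->
  itg (dA A w) t T (phint v ^~ w).
Proof.
move=> gw iu.
have i1 : itg (dA A w) t T (fun=> 1 : R).
  by apply: (dA_integrable_bdd t0 (ltW tT) gw (c := 1)) => // s _; rewrite normr1.
have i2 : (dA A w).-integrable (rset R `]t, T])
    (EFin \o (fun s => kb / 2 * (u2 s w + 1))).
  exact: (integrableZl mI (kb / 2) (integrableD mI iu i1)).
apply: (integrable_le mI _ i2).
  apply: measurable_funTS; exact: (ppred_path w (phint_ppred mv)).
move=> s; rewrite /= in_itv/= => /andP[ts _].
have := @dominated_phint s w 1 (le_trans t0 (ltW ts)) ler01.
by rewrite mul1r expr1n.
Qed.

Lemma dominated_dA_le w g : good w -> 0 <= g ->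
  itg (dA A w) t T (u2 ^~ w) ->
  g * `|\int[dA A w]_(s in `]t, T]) phint v s w| <= kb / 2 * (Q w + g ^+ 2 * A T w).
Proof.
move=> gw g0 iu; have iv := dominated_dA_int gw iu.
have iav : (dA A w).-integrable (rset R `]t, T])
    (EFin \o (fun s => `|phint v s w|)).
  exact: (integrable_abse iv).
have i1 : itg (dA A w) t T (fun=> g ^+ 2).
  exact: (dA_integrable_bdd t0 (ltW tT) gw (c := `|g ^+ 2|) (measurable_cst _) (fun _ _ => lexx _)).
have iD := integrableD mI iu i1.
apply: (@le_trans _ _ (g * \int[dA A w]_(s in `]t, T]) `|phint v s w|)).
  by rewrite ler_wpM2l// le_normr_Rintegral.
rewrite -(RintegralZl _ mI iav).
apply: (@le_trans _ _ (\int[dA A w]_(s in `]t, T]) (kb / 2 * (u2 s w + g ^+ 2)))).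
  apply: (le_Rintegral mI (integrableZl mI g iav) (integrableZl mI (kb / 2) iD)).
  move=> s; rewrite /= in_itv/= => /andP[ts _].
  by apply: dominated_phint => //; exact: le_trans t0 (ltW ts).
rewrite (RintegralZl _ mI iD) (RintegralD mI iu i1) (dA_cst _ gw t0 (ltW tT)).
rewrite ler_wpM2l ?divr_ge0// lerD2l ler_wpM2l ?sqr_ge0//.
by rewrite gerBl (A_ge0 gw t0).
Qed.

End Dominated.

Variables (X : Omega -> R) (kx : R).
Hypotheses (mX : meas_on (F t) setT X) (Xk : forall w, `|X w| <= kx).

Section Nonneg.
Variable v : hfun.
Hypotheses (mv : mpred v) (v0 : forall s w e, 0 <= v s w e) (vU : forall s w e, v s w e <= `|U s w e|).

Let S w := \int[pm w]_(x in `]t, T] `*` setT) v x.1 w x.2.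
Let V w := \int[dA A w]_(s in `]t, T]) phint (fun s w e => r s w e * v s w e) s w.

Let Bs (Y : Omega -> R) n := Bset t T n (fun=> Y).
(** Capped at [n] and switched off on [Bset] of level [n], so that the bounded case applies. *)
Let tr Y n : hfun := fun s w e => if (s, w) \in Bs Y n then 0 else Num.min (v s w e) n%:R.

Let tr_bdd Y n s w e : 0 <= tr Y n s w e <= n%:R.
Proof.
rewrite /tr; case: ifP => _; first by rewrite lexx ler0n.
by rewrite le_min v0 ler0n/= ge_min lexx orbT.
Qed.

Let tr_le Y n s w e : tr Y n s w e <= v s w e.
Proof. by rewrite /tr; case: ifP => _ //; rewrite ge_min lexx. Qed.

Let tr_mpred (Y : Omega -> R) ky n : meas_on (F t) setT Y -> (forall w, `|Y w| <= ky) -> mpred (tr Y n).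
Proof.
move=> mY Yk; have Mm := X_mart T mY Yk.
have mB := Bset_measurable n t0 tT Mm.
rewrite /mpred; apply: measurable_fun_ifT => //.
  apply: (measurable_fun_bool true); rewrite setTI.
  rewrite (_ : _ @^-1` _ = Bs Y n `*` setT); first exact: measurableX.
  apply/seteqP; split=> -[[s w] e] /=; first by move/set_mem.
  by case=> + _; exact: mem_set.
by apply: (measurable_minr mv); exact: measurable_cst.
Qed.

Let rv_mpred : mpred (fun s w e => r s w e * v s w e).
Proof. exact: measurable_funM mr mv. Qed.

Let rvU (v' : hfun) : (forall s w e, 0 <= v' s w e <= v s w e) ->
  forall s w e, `|r s w e * v' s w e| <= c * `|U s w e|.
Proof.
move=> h s w e; have /andP[a b] := rc s w e; have /andP[a' b'] := h s w e.
by rewrite ger0_norm ?mulr_ge0// ler_pM// (le_trans b').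
Qed.

Let tr_near Y w : good w -> \forall n \near \oo, forall s, (s, w) \notin Bs Y n.
Proof.
move=> gw; have cY : {within `[t, T], continuous (fun _ : R => Y w)}.
  by apply: continuous_subspaceT => x; exact: cvg_cst.
have := rtr_near t0 tT (fun (_ : R) (_ : Omega) (_ : marks E) => 0) (m := fun=> Y) gw cY.
apply: filterS => n h s; apply/negP => b; have := h s point.
by rewrite /rtr b => /eqP; rewrite oner_eq0.
Qed.

Let trv_near Y w s e : good w -> \forall n \near \oo, tr Y n s w e = v s w e.
Proof.
move=> gw; have h : \forall n \near \oo, v s w e <= n%:R.
  exists (Num.bound (v s w e)) => // n /= kn.
  by apply: le_trans (ltW (archi_boundP (v0 s w e))) _; rewrite ler_nat.
apply: filterS2 (tr_near Y gw) h => n nB vn.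
by rewrite /tr (negbTE (nB s)) min_l.
Qed.

Let S_cvg (Y : Omega -> R) ky w : meas_on (F t) setT Y -> (forall w, `|Y w| <= ky) -> good w ->
  \int[pm w]_(x in `]t, T] `*` setT) tr Y n x.1 w x.2 @[n --> \oo] --> S w.
Proof.
move=> mY Yk gw; have [N NT] := good_jump_lt T gw.
rewrite /S (pm_Rintegral t (mpred_path w mv) NT).
rewrite (_ : (fun n => _) = fun n => \sum_(1 <= i < N.+1 | jump t T w i) jr (tr Y n) w i).
  apply: cvg_big => [|i _]; first exact: add_continuous.
  by apply: cvg_near_cst; exact: trv_near.
by apply/funext => n; exact: (pm_Rintegral t (mpred_path w (tr_mpred n mY Yk)) NT).
Qed.

Let rtr_mpred' (Y : Omega -> R) ky n : meas_on (F t) setT Y -> (forall w, `|Y w| <= ky) ->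
  mpred (fun s w e => r s w e * tr Y n s w e).
Proof. by move=> mY Yk; exact: (measurable_funM mr (tr_mpred n mY Yk)). Qed.

Let rtrU Y n s w e : `|r s w e * tr Y n s w e| <= c * `|U s w e|.
Proof. by apply: rvU => s' w' e'; rewrite tr_le andbT; case/andP: (tr_bdd Y n s' w' e'). Qed.

Let rvU' s w e : `|r s w e * v s w e| <= c * `|U s w e|.
Proof. by apply: rvU => s' w' e'; rewrite v0 lexx. Qed.

Let V_cvg (Y : Omega -> R) ky w : meas_on (F t) setT Y -> (forall w, `|Y w| <= ky) -> good w ->
  itg (dA A w) t T (u2 ^~ w) ->
  \int[dA A w]_(s in `]t, T]) phint (fun s w e => r s w e * tr Y n s w e) s w @[n --> \oo] --> V w.
Proof.
move=> mY Yk gw iu.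
have i1 : itg (dA A w) t T (fun=> 1 : R).
  by apply: (dA_integrable_bdd t0 (ltW tT) gw (c := 1)) => // s _; rewrite normr1.
have i2 : (dA A w).-integrable (rset R `]t, T])
    (EFin \o (fun s => c / 2 * (u2 s w + 1))).
  exact: (integrableZl mI (c / 2) (integrableD mI iu i1)).
have [||||_ cV] := @Rint_dct _ _ _ (dA A w) _
  (fun n s => phint (fun s w e => r s w e * tr Y n s w e) s w)
  (fun s => phint (fun s w e => r s w e * v s w e) s w) _ mI _ _ _ i2 _; last exact: cV.
- by move=> n; apply: measurable_funTS; exact: (ppred_path w (phint_ppred (rtr_mpred' n mY Yk))).
- by apply: measurable_funTS; exact: (ppred_path w (phint_ppred rv_mpred)).
- move=> s; rewrite /= in_itv/= => /andP[ts _]; rewrite /phint (le_trans t0 (ltW ts)).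
  have [||||_ cE] := @EX_dct _ _ _ (phi s w) (fun n e => r s w e * tr Y n s w e)
    (fun e => r s w e * v s w e) (fun e => c * `|U s w e|) _ _ (I1Z c (I1_abs (L2_I1 (U_L2 s w)))); last exact: cE.
  + by move=> n; exact: (mpred_section s w (rtr_mpred' n mY Yk)).
  + exact: (mpred_section s w rv_mpred).
  + by apply: aeW => e; apply: cvgMl_tmp; apply: cvg_near_cst; exact: trv_near.
  + by apply: aeW => e n; exact: rtrU.
- move=> n s; rewrite /= in_itv/= => /andP[ts _].
  have := @dominated_phint _ c (rtr_mpred' n mY Yk) (rtrU Y n) c0 s w 1 (le_trans t0 (ltW ts)) ler01.
  by rewrite mul1r expr1n.
Qed.

Let D w := c / 2 * (Q w + Gam w ^+ 2 * A T w).

Let ID : I1 P D. Proof. exact: I1Z (I1D IQ GA). Qed.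

Let L0 w : good w -> 0 <= Lam r t T w.
Proof. by apply: Lam_ge0 => s w' e; case/andP: (rc s w' e). Qed.

Let LG w : good w -> Lam r t T w <= Gam w.
Proof. exact: (Lam_le_Gam t0 tT mr rc). Qed.

Let VD (v' : hfun) w : mpred v' -> (forall s w e, `|v' s w e| <= c * `|U s w e|) -> good w ->
  itg (dA A w) t T (u2 ^~ w) ->
  `|Lam r t T w * \int[dA A w]_(s in `]t, T]) phint v' s w| <= D w.
Proof.
move=> mv' v'U gw iu; rewrite normrM (ger0_norm (L0 gw)).
apply: le_trans (dominated_dA_le mv' v'U c0 gw (L0 gw) iu) _.
rewrite /D ler_wpM2l ?divr_ge0// lerD2l ler_wpM2r ?(A_ge0 gw)//.
by rewrite lerXn2r ?nnegrE ?L0 ?LG// (le_trans (L0 gw) (LG gw)).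
Qed.

Let IL := Lam_I1 t0 tT IA mr c1 rc.

Let IVg (v' : hfun) : mpred v' -> (forall s w e, `|v' s w e| <= c * `|U s w e|) ->
  I1 P (fun w => Lam r t T w * \int[dA A w]_(s in `]t, T]) phint v' s w).
Proof.
move=> mv' v'U; apply: I1_le_ae _ ID _.
  apply: (measurable_funM (I1_meas IL)).
  exact: (dA_phint_meas t0 (ltW tT) mv').
by apply: filterS2 good_ae u2_int => w gw iu; exact: VD.
Qed.

Let tr_orth (Y : Omega -> R) ky n : meas_on (F t) setT Y -> (forall w, `|Y w| <= ky) ->
  let q w := \int[pm w]_(x in `]t, T] `*` setT) tr Y n x.1 w x.2 -
    \int[dA A w]_(s in `]t, T]) phint (fun s w e => r s w e * tr Y n s w e) s w in
  I1 P (fun w => Y w * (Lam r t T w * q w)) /\ EX P (fun w => Y w * (Lam r t T w * q w)) = 0.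
Proof.
move=> mY Yk.
have hB s w e : (s, w) \in Bs Y n -> tr Y n s w e = 0 by move=> b; rewrite /tr b.
exact: (bounded_comp_orth t0 tT IA G2 mr rc mY Yk (tr_mpred n mY Yk) (tr_bdd Y n) hB).
Qed.

(** No direct bound on the jump integral is at hand. For the truncated integrands its mean under the
    density equals that of the compensator, which [D] dominates, and Fatou's lemma passes to the
    limit. *)
Let LS_I1 : I1 P (fun w => Lam r t T w * S w).
Proof.
have m1 : meas_on (F t) setT (fun=> 1 : R) by apply/FT_fun; exact: measurable_cst.
have b1 (w : Omega) : `|1 : R| <= 1 by rewrite normr1.
pose Sn n w := \int[pm w]_(x in `]t, T] `*` setT) tr (fun=> 1) n x.1 w x.2.
pose Vn n w := \int[dA A w]_(s in `]t, T]) phint (fun s w e => r s w e * tr (fun=> 1) n s w e) s w.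
have IVn n : I1 P (fun w => Lam r t T w * Vn n w) by exact: (IVg (rtr_mpred' n m1 b1) (rtrU _ n)).
have mSn n : measurable_fun setT (Sn n) by exact: (pm_Rint_meas t0 (ltW tT) (tr_mpred n m1 b1)).
have SE n w : 1 * (Lam r t T w * (Sn n w - Vn n w)) + Lam r t T w * Vn n w = Lam r t T w * Sn n w.
  by rewrite mul1r -mulrDr subrK.
have ISn n : I1 P (fun w => Lam r t T w * Sn n w).
  have [I _] := tr_orth n m1 b1.
  apply: (I1_ae _ _ (I1D I (IVn n))); last by apply: aeW => w; exact: SE.
  exact: (measurable_funM (I1_meas IL) (mSn n)).
have Sn0 n w : good w -> 0 <= Sn n w.
  by move=> gw; apply: Rintegral_ge0 => x _; case/andP: (tr_bdd (fun=> 1) n x.1 w x.2).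
have mS : measurable_fun setT S by exact: (pm_Rint_meas t0 (ltW tT) mv).
have [||//] := @I1_fatou _ _ _ P (fun n w => Lam r t T w * Sn n w) _ (EX P D) ISn _
  (measurable_funM (I1_meas IL) mS).
- move=> n; have [I E0] := tr_orth n m1 b1.
  have <- : EX P (fun w => Lam r t T w * Sn n w) = EX P (fun w => `|Lam r t T w * Sn n w|).
    apply: EX_ae; [exact: I1_meas (ISn n)|exact: I1_meas (I1_abs (ISn n))|].
    apply: filterS good_ae => w gw; rewrite ger0_norm//.
    exact: (mulr_ge0 (L0 gw) (Sn0 n w gw)).
  have -> : EX P (fun w => Lam r t T w * Sn n w) = EX P (fun w => Lam r t T w * Vn n w).
    rewrite -[RHS]add0r -E0 -(EXD I (IVn n)); congr EX.
    by apply/funext => w; rewrite SE.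
  apply: (EX_le_ae (IVn n) ID).
  apply: filterS2 good_ae u2_int => w gw iu; apply: le_trans (ler_norm _) _.
  exact: (VD (rtr_mpred' n m1 b1) (rtrU _ n) gw iu).
- apply: filterS good_ae => w gw; apply: cvgMl_tmp.
  exact: (S_cvg m1 b1 gw).
Qed.

Lemma nonneg_comp_orth :
  [/\ I1 P (fun w => Lam r t T w * S w), I1 P (fun w => Lam r t T w * V w) &
   EX P (fun w => X w * (Lam r t T w * (S w - V w))) = 0].
Proof.
have IV : I1 P (fun w => Lam r t T w * V w) by exact: (IVg rv_mpred rvU').
have mX' := F_fun_measurable mX.
have mS : measurable_fun setT S by exact: (pm_Rint_meas t0 (ltW tT) mv).
have mV : measurable_fun setT V by exact: (dA_phint_meas t0 (ltW tT) rv_mpred).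
split=> //.
pose Sn n w := \int[pm w]_(x in `]t, T] `*` setT) tr X n x.1 w x.2.
pose Vn n w := \int[dA A w]_(s in `]t, T]) phint (fun s w e => r s w e * tr X n s w e) s w.
have [||_ EE] := @EX_dct _ _ _ P (fun n w => X w * (Lam r t T w * (Sn n w - Vn n w)))
  (fun w => X w * (Lam r t T w * (S w - V w))) (fun w => kx * (Lam r t T w * S w + D w))
  (fun n => I1_meas (tr_orth n mX Xk).1)
  (measurable_funM mX' (measurable_funM (I1_meas IL) (measurable_funB mS mV)))
  (I1Z kx (I1D LS_I1 ID)).
- apply: filterS2 good_ae u2_int => w gw iu; apply: cvgMl_tmp; apply: cvgMl_tmp.
  by apply: cvgB; [exact: (S_cvg mX Xk gw)|exact: (V_cvg mX Xk gw iu)].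
- apply: filterS2 good_ae u2_int => w gw iu n; rewrite normrM; apply: ler_pM => //.
  rewrite mulrBr; apply: le_trans (ler_normB _ _) _; apply: lerD; last first.
    exact: (VD (rtr_mpred' n mX Xk) (rtrU _ n) gw iu).
  have [N NT] := good_jump_lt T gw.
  rewrite normrM (ger0_norm (L0 gw)) ler_wpM2l ?L0//.
  rewrite /Sn /S (pm_Rintegral t (mpred_path w mv) NT).
  rewrite (pm_Rintegral t (mpred_path w (tr_mpred n mX Xk)) NT).
  rewrite ger0_norm; last by apply: sumr_ge0 => i _; case/andP: (tr_bdd X n (fine (Tn i w)) w (zeta i w)).
  by apply: ler_sum => i _; exact: tr_le.
apply: (cvg_unique _ EE) => //.
rewrite (_ : (fun n => _) = fun=> 0); first exact: cvg_cst.
by apply/funext => n; have [] := tr_orth n mX Xk.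
Qed.

End Nonneg.

Lemma comp_L2_orth :
  let S w := \int[pm w]_(x in `]t, T] `*` setT) U x.1 w x.2 in
  let V w := \int[dA A w]_(s in `]t, T]) phint (fun s w e => r s w e * U s w e) s w in
  [/\ I1 P (fun w => Lam r t T w * S w), I1 P (fun w => Lam r t T w * V w) &
   EX P (fun w => X w * (Lam r t T w * (S w - V w))) = 0].
Proof.
move=> S V.
pose U1 s w e := Num.max (U s w e) 0; pose U2' s w e := Num.max (- U s w e) 0.
have mN : mpred (fun s w e => - U s w e).
  exact: (measurableT_comp (measurable_funN (@measurable_id _ R setT)) mU).
have mU1 : mpred U1 by apply: (measurable_maxr mU); exact: measurable_cst.
have mU2' : mpred U2' by apply: (measurable_maxr mN); exact: measurable_cst.
have U10 s w e : 0 <= U1 s w e by rewrite le_max lexx orbT.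
have U20 s w e : 0 <= U2' s w e by rewrite le_max lexx orbT.
have U1U s w e : U1 s w e <= `|U s w e| by rewrite ge_max normr_ge0 ler_norm.
have U2U s w e : U2' s w e <= `|U s w e| by rewrite ge_max normr_ge0 -normrN ler_norm.
have UE s w e : U s w e = U1 s w e - U2' s w e.
  by rewrite /U1 /U2'; case: (leP 0 (U s w e)); case: (leP 0 (- U s w e)); lra.
pose L := Lam r t T.
pose S1 w := \int[pm w]_(x in `]t, T] `*` setT) U1 x.1 w x.2.
pose S2 w := \int[pm w]_(x in `]t, T] `*` setT) U2' x.1 w x.2.
pose V1 w := \int[dA A w]_(s in `]t, T]) phint (fun s w e => r s w e * U1 s w e) s w.
pose V2 w := \int[dA A w]_(s in `]t, T]) phint (fun s w e => r s w e * U2' s w e) s w.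
have [IS1 IV1 E1] : [/\ I1 P (fun w => L w * S1 w), I1 P (fun w => L w * V1 w) &
    EX P (fun w => X w * (L w * (S1 w - V1 w))) = 0] by exact: nonneg_comp_orth.
have [IS2 IV2 E2] : [/\ I1 P (fun w => L w * S2 w), I1 P (fun w => L w * V2 w) &
    EX P (fun w => X w * (L w * (S2 w - V2 w))) = 0] by exact: nonneg_comp_orth.
have IL := Lam_I1 t0 tT IA mr c1 rc; have mL := I1_meas IL.
have mS : measurable_fun setT S by exact: (pm_Rint_meas t0 (ltW tT) mU).
have mrU : mpred (fun s w e => r s w e * U s w e) by exact: measurable_funM mr mU.
have mV : measurable_fun setT V by exact: (dA_phint_meas t0 (ltW tT) mrU).
have mX' := F_fun_measurable mX.
have rU (v : hfun) : (forall s w e, 0 <= v s w e <= `|U s w e|) ->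
    forall s w e, `|r s w e * v s w e| <= c * `|U s w e|.
  move=> h s w e; have /andP[a b] := rc s w e; have /andP[a' b'] := h s w e.
  by rewrite ger0_norm ?mulr_ge0// ler_pM.
have rU1 : forall s w e, `|r s w e * U1 s w e| <= c * `|U s w e|.
  by apply: rU => s w e; rewrite U10 U1U.
have rU2 : forall s w e, `|r s w e * U2' s w e| <= c * `|U s w e|.
  by apply: rU => s w e; rewrite U20 U2U.
have mr1 : mpred (fun s w e => r s w e * U1 s w e) by exact: measurable_funM mr mU1.
have mr2 : mpred (fun s w e => r s w e * U2' s w e) by exact: measurable_funM mr mU2'.
have aS : \forall w \ae P, L w * S1 w - L w * S2 w = L w * S w.
  apply: filterS good_ae => w gw; rewrite -mulrBr; congr (_ * _).
  have [N NT] := good_jump_lt T gw; rewrite /S /S1 /S2 (pm_Rintegral t (mpred_path w mU) NT).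
  rewrite (pm_Rintegral t (mpred_path w mU1) NT) (pm_Rintegral t (mpred_path w mU2') NT).
  by rewrite -sumrB; apply: eq_bigr => i _; rewrite UE.
have aV : \forall w \ae P, L w * V1 w - L w * V2 w = L w * V w.
  apply: filterS2 good_ae u2_int => w gw iu; rewrite -mulrBr; congr (_ * _).
  have i1 := dominated_dA_int mr1 rU1 c0 gw iu; have i2 := dominated_dA_int mr2 rU2 c0 gw iu.
  rewrite -(RintegralB mI i1 i2); apply: eq_Rintegral => s _; rewrite /phint.
  case: ifP => _; last by rewrite subr0.
  have d1 := dominated_I1 mr1 rU1 s w; have d2 := dominated_I1 mr2 rU2 s w.
  by rewrite -[LHS](EXB d1 d2); apply: eq_Rintegral => e _; rewrite -mulrBr -UE.
rewrite -/L; rewrite -/L in mL; clearbody S1 S2 V1 V2 S V L.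
split.
- by apply: (I1_ae _ aS (I1B IS1 IS2)); exact: measurable_funM.
- by apply: (I1_ae _ aV (I1B IV1 IV2)); exact: measurable_funM.
have bX (f : Omega -> R) : I1 P f -> I1 P (fun w => X w * f w).
  move=> If; apply: I1_le (I1Z kx (I1_abs If)) _.
    exact: (measurable_funM mX' (I1_meas If)).
  by move=> w; rewrite normrM ler_wpM2r.
have IB (S' V' : Omega -> R) : I1 P (fun w => L w * S' w) -> I1 P (fun w => L w * V' w) ->
    I1 P (fun w => X w * (L w * (S' w - V' w))).
  move=> IS' IV'; rewrite (_ : (fun w => _) = fun w => X w * (L w * S' w - L w * V' w)).
    exact/bX/I1B.
  by apply/funext => w; rewrite mulrBr.
have E12 := EXB (IB _ _ IS1 IV1) (IB _ _ IS2 IV2).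
rewrite E1 E2 subrr in E12; rewrite -[RHS]E12.
apply: EX_ae.
- by apply: measurable_funM => //; apply: measurable_funM => //; exact: measurable_funB.
- exact: I1_meas (I1B (IB _ _ IS1 IV1) (IB _ _ IS2 IV2)).
- apply: filterS2 aS aV => w a1 a2; rewrite -[RHS]mulrBr; congr (_ * _).
  by rewrite !mulrBr -a1 -a2; lra.
Qed.

End CompL2.

(** * Strategies *)

Section StrategyIntegral.
Variables (t T M : R).
Hypotheses (t0 : 0 <= t) (tT : t < T) (IA : I1 P (A T)).
Let c : R := Num.max M 1.
Local Notation Gam := (Gam t T M).
Hypotheses (G2 : L2 P Gam).
Variables (r : hfun) (m : nat) (Zw : 'I_m -> proc)
  (H : 'I_m -> nat -> nat -> Omega -> R) (X : Omega -> R) (kx : R) (I : Omega -> R).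
Hypotheses (mr : mpred r) (rc : forall s w e, 0 <= r s w e <= c)
  (MZ : forall j, martingale2 P F t T (Zw j))
  (cZ : forall j, \forall w \ae P, {within `[t, T], continuous (Zw j ^~ w)})
  (mH : forall j n l, (l <= n)%N -> meas_on (F (gridpt t T n l)) setT (H j n l))
  (H1 : forall j n l w, `|H j n l w| <= 1)
  (mX : meas_on (F t) setT X) (Xk : forall w, `|X w| <= kx) (mI : measurable_fun setT I).
Let S n w := \sum_(j < m) msum (Zw j) (gridpt t T n) (H j n) n.+1 w.
Hypothesis SI : \forall w \ae P, S ^~ w @ \oo --> I w.

Let c1 : 1 <= c. Proof. by rewrite le_max lexx orbT. Qed.
Let sF := F_sigma.
Let mF s := @F_measurable s.
Let leF (s s' : R) (h : s <= s') := @F_le s s' h.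
Local Notation g := (gridpt t T).

Let props j n := @msum_props _ _ _ P F sF mF leF t T (Zw j) (g n) (H j n) n.+1 1 (MZ j)
  (gridpt_ge tT n 0) (gridpt_leT tT (leqnn n.+1)) (fun k => ltW (gridpt_lt tT n k))
  (fun k (kn : (k < n.+1)%N) => @mH j n k kn) (fun k x _ => H1 j n k x) n.+1 (leqnn _).

Let S_L2 n : L2 P (S n).
Proof. by apply: L2_sum => j; have [] := props j n. Qed.

Let Ksum : R := m%:R * \sum_(j < m) EX P (fun w => (Zw j T w - Zw j t w) ^+ 2).

Let sqr_sum (x : 'I_m -> R) : (\sum_(j < m) x j) ^+ 2 <= m%:R * \sum_(j < m) x j ^+ 2.
Proof.
elim: m x => [|n IH] x; first by rewrite !big_ord0 expr0n mul0r.
rewrite !big_ord_recr/=.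
have h := IH (fun i => x (widen_ord (leqnSn n) i)).
set y := \sum_(i < n) _ in h *; set z := \sum_(i < n) _ in h *; set u := x ord_max.
have z0 : 0 <= z by apply: sumr_ge0 => i _; exact: sqr_ge0.
rewrite -natr1; case: n {IH x} y z u h z0 => [|n] y z u h z0.
  have y0 : y ^+ 2 = 0 by apply/eqP; rewrite eq_le sqr_ge0 andbT (le_trans h)// mul0r.
  move/eqP: y0; rewrite sqrf_eq0 => /eqP ->; rewrite add0r add0r mul1r; lra.
have n0 : 0 < n.+1%:R :> R by rewrite ltr0n.
have : 2 * y * u <= n.+1%:R^-1 * y ^+ 2 + n.+1%:R * u ^+ 2.
  have := mulr_ge0 (ltW n0) (sqr_ge0 (n.+1%:R^-1 * y - u)).
  rewrite sqrrB !exprMn mulrDr mulrBr.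
  have e1 : n.+1%:R * (n.+1%:R^-1 ^+ 2 * y ^+ 2) = n.+1%:R^-1 * y ^+ 2.
    by rewrite expr2 !mulrA mulfV ?gt_eqF// mul1r.
  have e2 : n.+1%:R * (n.+1%:R^-1 * y * u *+ 2) = 2 * y * u.
    by rewrite mulr2n mulrDr !mulrA mulfV ?gt_eqF// mul1r; ring.
  by rewrite e1 e2; move: (_ * y ^+ 2) (2 * y * u) (_ * u ^+ 2) => a1 a2 a3; lra.
have : n.+1%:R^-1 * y ^+ 2 <= z.
  by rewrite mulrC ler_pdivrMr// mulrC.
move=> h1 h2.
have -> : (n.+1%:R + 1) * (z + u ^+ 2) = n.+1%:R * z + n.+1%:R * u ^+ 2 + z + u ^+ 2 by ring.
have -> : (y + u) ^+ 2 = y ^+ 2 + 2 * y * u + u ^+ 2 by ring.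
rewrite lerD2r; apply: (le_trans (lerD h h2)).
have aux (a1 a2 a3 a4 : R) : a2 <= a3 -> a1 + (a2 + a4) <= a1 + a4 + a3 by lra.
exact: aux.
Qed.

Let S_K n : EX P (fun w => S n w ^+ 2) <= Ksum.
Proof.
have I2 j : I1 P (fun w => msum (Zw j) (g n) (H j n) n.+1 w ^+ 2).
  by have [_ [_ +] _ _] := props j n.
apply: (@le_trans _ _ (EX P (fun w => m%:R *
    \sum_(j < m) msum (Zw j) (g n) (H j n) n.+1 w ^+ 2))).
  apply: EX_le; [by case: (S_L2 n)|by apply: I1Z; exact: I1_sum|].
  by move=> w; exact: sqr_sum.
rewrite (EXZ _ (I1_sum _ I2)) (EX_sum _ I2) ler_wpM2l//.
apply: ler_sum => j _; have [_ _ _] := props j n.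
by rewrite expr1n mul1r gridpt0 gridptT.
Qed.

Let I_L2 : L2 P I.
Proof.
have [] := @I1_fatou _ _ _ P (fun n w => S n w ^+ 2) (fun w => I w ^+ 2) Ksum.
- by move=> n; case: (S_L2 n).
- move=> n; apply: le_trans (S_K n); apply: EX_le; [|by case: (S_L2 n)|].
    by apply: I1_abs; case: (S_L2 n).
  by move=> w; rewrite ger0_norm ?sqr_ge0.
- exact: measurable_funX.
- apply: filterS SI => w cS; rewrite expr2.
  by under eq_fun do rewrite expr2; exact: cvgM.
by move=> I2 _; split.
Qed.

(** With [X] absorbed in the coefficients, [X S_n] is the terminal value of a continuous martingale
    vanishing at [t], to which [orth] applies. *)
Let S_orth n : EX P (fun w => X w * Lam r t T w * S n w) = 0.
Proof.
have m1 j : martingale2 P F t T (fun v w => \sum_(l < n.+1)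
    X w * H j n l w * (Zw j (Num.min v (g n l.+1)) w - Zw j (Num.min v (g n l)) w)).
  apply: (martingale2_sum sF mF leF) => l.
  apply: (cell_martingale2 sF mF leF (c := kx * 1) (MZ j)).
  - exact: gridpt_ge.
  - exact/ltW/gridpt_lt.
  - exact: gridpt_leT.
  - apply/FT_fun; apply: measurable_funM.
      by apply/FT_fun => B mB; apply: (leF (gridpt_ge tT n l)); exact: mX.
    by apply/FT_fun; apply: mH; rewrite -ltnS.
  - by move=> w; rewrite normrM ler_pM.
pose Mt v w := \sum_(j < m) \sum_(l < n.+1)
    X w * H j n l w * (Zw j (Num.min v (g n l.+1)) w - Zw j (Num.min v (g n l)) w).
have MM : martingale2 P F t T Mt by exact: (martingale2_sum sF mF leF).
have cM : \forall w \ae P, {within `[t, T], continuous (Mt ^~ w)}.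
  have : \forall w \ae P, forall j : 'I_m, {within `[t, T], continuous (Zw j ^~ w)}.
    exact: filter_forall.
  apply: filterS => w cw x.
  apply: cvg_big => [|j _]; first exact: add_continuous.
  apply: cvg_big => [|l _]; first exact: add_continuous.
  apply: cvgMl_tmp.
  have cj s : t <= s -> {within `[t, T], continuous (fun v => Zw j (Num.min v s) w)}.
    by move=> ts; exact: within_min ts (cw j).
  by apply: cvgB; [exact: (cj _ (gridpt_ge tT n l.+1) x)|exact: (cj _ (gridpt_ge tT n l) x)].
have [I' E'] := orth t0 tT IA mr c1 rc MM cM G2
  (filterS (fun w gw k => Lam_le_Gam t0 tT (rtr_mpred k t0 tT mr MM)
     (rtr_bdd t T k Mt c1 rc) gw) good_ae).
have Mt0 : Mt t = fun=> 0.
  apply/funext => w; rewrite /Mt big1// => j _; rewrite big1// => l _.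
  by rewrite !min_l ?subrr ?mulr0//; exact: gridpt_ge.
have MtT w : Mt T w = X w * S n w.
  rewrite /Mt /S mulr_sumr; apply: eq_bigr => j _; rewrite /msum mulr_sumr.
  apply: eq_bigr => l _; rewrite !min_r; first by rewrite mulrA.
    by apply: gridpt_leT => //; rewrite ltnW// ltnS ltnW.
  by apply: gridpt_leT.
rewrite Mt0 EX_cst in E'; rewrite -[RHS]E'; congr EX.
by apply/funext => w; rewrite MtT; ring.
Qed.

(** The grid sums are bounded in [L^2] and converge almost surely, which is enough to pass to the
    limit against the square-integrable [X L]. *)
Lemma strategy_integral_orth :
  I1 P (fun w => Lam r t T w * I w) /\ EX P (fun w => X w * (Lam r t T w * I w)) = 0.
Proof.
have IL := Lam_I1 t0 tT IA mr c1 rc; have mL := I1_meas IL.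
have L2L : L2 P (Lam r t T).
  apply: L2_le_ae mL G2 _; apply: filterS good_ae => w gw.
  have L0 : 0 <= Lam r t T w by apply: Lam_ge0 => // s w' e; case/andP: (rc s w' e).
  by rewrite ger0_norm// (le_trans (Lam_le_Gam t0 tT mr rc gw)) ?ler_norm.
have mX' := F_fun_measurable mX.
have XL2 : L2 P (fun w => X w * Lam r t T w) by exact: L2_bddM mX' Xk L2L.
split; first exact: L2M.
have KI n : EX P (fun w => (S n w - I w) ^+ 2) <= 2 * Ksum + 2 * EX P (fun w => I w ^+ 2).
  have I2 := I_L2.2; have S2 := (S_L2 n).2.
  apply: (@le_trans _ _ (EX P (fun w => 2 * S n w ^+ 2 + 2 * I w ^+ 2))).
    apply: EX_le; [by case: (L2B (S_L2 n) I_L2)|by apply: I1D; exact: I1Z|move=> w].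
    by have := sqr_ge0 (S n w + I w); rewrite sqrrD sqrrB; lra.
  rewrite (EXD (I1Z 2 S2) (I1Z 2 I2)) (EXZ 2 S2) (EXZ 2 I2) lerD2r ler_wpM2l//; exact: S_K.
have cv0 : \forall w \ae P, (fun n => S n w - I w) @ \oo --> (0 : R).
  by apply: filterS SI => w h; rewrite -(subrr (I w)); apply: cvgB => //; exact: cvg_cst.
have := L2_bounded_cvg0 XL2 (fun n => L2B (S_L2 n) I_L2) KI cv0.
have XLI := L2M XL2 I_L2.
rewrite (_ : (fun n => _) = fun=> - EX P (fun w => X w * (Lam r t T w * I w))).
  by move=> /(cvg_lim (@Rhausdorff R)); rewrite lim_cst// => /eqP; rewrite oppr_eq0 => /eqP.
apply/funext => n; rewrite -[RHS]sub0r -(S_orth n).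
rewrite [X in _ - X](_ : _ = EX P (fun w => X w * Lam r t T w * I w)); last first.
  by congr EX; apply/funext => w; rewrite mulrA.
by rewrite -(EXB (L2M XL2 (S_L2 n)) XLI); congr EX; apply/funext => w; rewrite mulrBr.
Qed.

End StrategyIntegral.

Section Strategy.
Variables (m : nat) (t T : R) (i : 'I_m) (a : @strategy R dO Omega m).
Hypotheses (t0 : 0 <= t) (tT : t < T) (Sa : strategies_from P Tn zeta W T t i a).
Local Notation th := (theta a).
Local Notation al := (alpha a).
Lemma strategy_thS w n : th n w <= th n.+1 w.
Proof. by have [Sa' _ _] := Sa; have [_ _ + _ _] := Sa' n. Qed.

Lemma strategy_th0 w : th 0 w = t.
Proof. by have [_ _ /(_ w)[]] := Sa. Qed.

Lemma strategy_ge w n : t <= th n w.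
Proof. by rewrite -(strategy_th0 w); exact: (step_mono (fun n => strategy_thS w n)). Qed.

Lemma strategy_leT w n : th n w <= T.
Proof. by have [Sa' _ _] := Sa; have [_ /(_ w)/andP[]] := Sa' n. Qed.

Lemma strategy_stop n : stopping_time F (th n).
Proof. by have [Sa' _ _] := Sa; have [] := Sa' n. Qed.

Lemma strategy_alpha n j : stopped_sigma F (th n) [set w | al n w = j].
Proof. by have [Sa' _ _] := Sa; have [_ _ _ + _] := Sa' n. Qed.

Lemma stop_min_meas (tau : Omega -> R) s : stopping_time F tau -> (forall w, 0 <= tau w) -> 0 <= s ->
  measurable_fun (setT : set (FT s)) (fun w => Num.min (tau w) s).
Proof.
move=> st tau0 s0; apply: (@measurability _ _ _ _ _ _ (@RGenOInfty.G R)) => //.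
  exact: (RGenOInfty.measurableE R).
move=> _ [_ [r ->] <-]; rewrite setTI -[X in measurable X]setCK; apply: measurableC.
rewrite (_ : ~` _ = [set w | Num.min (tau w) s <= r]); last first.
  by apply/seteqP; split=> w /=; rewrite in_itv/= andbT leNgt => /negP.
have [sr|rs] := leP s r.
  rewrite (_ : [set _ | _] = setT); first exact: measurableT.
  by apply/seteqP; split=> w //= _; rewrite ge_min sr orbT.
rewrite (_ : [set _ | _] = [set w | tau w <= r]); last first.
  by apply/seteqP; split=> w /=; rewrite ge_min (leNgt s) rs orbF.
have [r0|r0] := leP 0 r.
  by rewrite FT_measurableE; apply: (F_le (ltW rs)); exact: st.
rewrite (_ : [set _ | _] = set0); first exact: measurable0.
by apply/seteqP; split=> w //= h; have := le_lt_trans (le_trans (tau0 w) h) r0; rewrite ltxx.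
Qed.

Lemma strategy_meas n : measurable_fun setT (th n).
Proof.
have T0 : 0 <= T by rewrite (le_trans t0)// ltW.
have := stop_min_meas (@strategy_stop n) (fun w => le_trans t0 (strategy_ge w n)) T0.
rewrite (_ : (fun w => _) = th n); last by apply/funext => w; rewrite min_l// strategy_leT.
by move=> h; apply: (F_fun_measurable (t := T)); apply/FT_fun.
Qed.

Lemma strategy_fin_ae : \forall w \ae P, exists N, th N w = T.
Proof.
have [_ aa _] := Sa; exists [set w | forall n, th n w < T]; split=> //.
- rewrite (_ : [set _ | _] = \bigcap_n [set w | th n w < T]).
    by apply: bigcapT_measurable => n; rewrite -[X in measurable X]setTI; exact: (measurable_fun_ltr (strategy_meas n) (measurable_cst _)).
  by apply/seteqP; split=> [w h n _|w h n]; [exact: h|exact: (h n I)].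
- move=> w /= h n; rewrite lt_neqAle strategy_leT andbT; apply/eqP => hn.
  by apply: h; exists n.
Qed.

(** The part of [G] after [tau] is the union over rationals [q >= 0] of the rectangles with time
    side []q, +oo[] and base [G & {tau <= q}], which are predictable. *)
Lemma after_meas (tau : Omega -> R) G : (forall w, 0 <= tau w) -> stopped_sigma F tau G ->
  measurable ([set x | tau x.2 < x.1 /\ G x.2] : set PT).
Proof.
move=> tau0 sG.
rewrite (_ : [set _ | _] = \bigcup_(q : rat) (if (0 <= q)%R then
    `]ratr q : R, +oo[%classic `*` (G `&` [set w | tau w <= ratr q]) else set0)).
  apply: bigcupT_measurable_rat => q; case: ifPn => q0; last exact: measurable0.
  by apply: measurable_pred_infty; [rewrite ler0q|apply: sG; rewrite ler0q].
apply/seteqP; split=> [[s w] /= [ts Gw]|[s w] [q _]].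
  have [q] := rat_in_itvoo ts; rewrite in_itv/= => /andP[tq qs].
  exists q => //; rewrite ifT /=; first by rewrite in_itv/= qs; split=> //; split=> //; exact: ltW.
  by rewrite -(ler0q R) (le_trans (tau0 w) (ltW tq)).
by case: ifP => // _ [/= + [Gw tq]]; rewrite in_itv/= andbT => qs; split=> //; exact: le_lt_trans qs.
Qed.

Definition on_mode j : set (R * Omega) :=
  [set x | exists2 k, th k x.2 < x.1 <= th k.+1 x.2 & al k x.2 = j].

Lemma on_mode_meas j : measurable (on_mode j : set PT).
Proof.
have T0 n w : 0 <= th n w by rewrite (le_trans t0)// strategy_ge.
rewrite (_ : on_mode j = \bigcup_n ([set x | th n x.2 < x.1 /\ al n x.2 = j] `\`
  [set x | th n.+1 x.2 < x.1 /\ setT x.2])).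
  apply: bigcupT_measurable => n; apply: measurableD.
    exact: (after_meas (T0 n) (@strategy_alpha n j)).
  apply: (after_meas (T0 n.+1)) => s s0; rewrite setTI; exact: strategy_stop.
apply/seteqP; split=> [[s w] [k /andP[/= a1 a2] ak]|[s w] [n _ [/= [a1 a2] a3]]].
  by exists k => //; split=> //= -[h _]; have := lt_le_trans h a2; rewrite ltxx.
exists n => //=; rewrite a1 leNgt; apply/negP => h; exact: a3.
Qed.

Lemma on_modeE j k s w : th k w < s <= th k.+1 w -> \1_(on_mode j) (s, w) = (al k w == j)%:R :> R.
Proof.
move=> sk; rewrite indicE; congr (_%:R); congr nat_of_bool; apply/idP/idP.
  by rewrite inE => -[k' /= sk' <-]; rewrite (step_uniq (fun n => strategy_thS w n) sk sk').
by move=> /eqP ak; rewrite inE; exists k.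
Qed.

Lemma on_mode_out j s w : ~ (exists k, th k w < s <= th k.+1 w) -> \1_(on_mode j) (s, w) = 0 :> R.
Proof. by move=> h; rewrite indicE memNset// => -[k /= sk _]; apply: h; exists k. Qed.

(** A finite sum over the modes instead of a sum over the switching dates, so that predictability
    follows term by term from that of [on_mode]. It is zero outside the switching intervals. *)
Definition sel (h : 'I_m -> hfun) : hfun := fun s w e => \sum_(j < m) \1_(on_mode j) (s, w) * h j s w e.

Lemma sel_mpred (h : 'I_m -> hfun) : (forall j, mpred (h j)) -> mpred (sel h).
Proof.
move=> mh; apply: measurable_sum => j; apply: measurable_funM; last exact: mh.
apply: (@ppred_mpred _ _ (fun s w => \1_(on_mode j) (s, w) : R)).
rewrite /ppred (_ : (fun x => _) = \1_(on_mode j)); last by apply/funext => -[].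
by apply: measurable_indic; exact: on_mode_meas.
Qed.

Lemma selE (h : 'I_m -> hfun) k s w e : th k w < s <= th k.+1 w -> sel h s w e = h (al k w) s w e.
Proof.
move=> sk; rewrite /sel (bigD1 (al k w))//= (on_modeE _ sk) eqxx mul1r big1 ?addr0// => j ja.
by rewrite (on_modeE _ sk) eq_sym (negbTE ja) mul0r.
Qed.

Lemma sel_out (h : 'I_m -> hfun) s w e : ~ (exists k, th k w < s <= th k.+1 w) -> sel h s w e = 0.
Proof. by move=> h'; rewrite /sel big1// => j _; rewrite on_mode_out// mul0r. Qed.

Lemma sel_bdd (h : 'I_m -> hfun) c : 0 <= c -> (forall j s w e, 0 <= h j s w e <= c) -> forall s w e, 0 <= sel h s w e <= c.
Proof.
move=> c0 hc s w e; have [[k sk]|h'] := pselect (exists k, th k w < s <= th k.+1 w).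
  by rewrite (selE _ _ sk).
by rewrite sel_out// lexx.
Qed.

Lemma mode_atE k s w : th k w < s <= th k.+1 w -> mode_at a s w = al k w.
Proof.
move=> sk; rewrite /mode_at; congr (al _ w).
have h : [set k | th k w < s <= th k.+1 w] k by [].
by have := xgetPex 0%N (ex_intro _ _ h) => /= sk'; exact: (step_uniq (fun n => strategy_thS w n) sk' sk).
Qed.

Lemma rho_ofE (rho : 'I_m -> hfun) s w e : rho_of rho a s w e = sel rho s w e.
Proof.
apply: cvg_lim => //; have [[k sk]|h'] := pselect (exists k, th k w < s <= th k.+1 w).
  rewrite (selE _ _ sk); apply: cvg_near_cst; exists k.+1 => // N /= kN.
  rewrite big_mkord (bigD1 (Ordinal kN))//= sk mul1r big1 ?addr0// => l lk.
  have -> : (th l w < s <= th l.+1 w) = false; last by rewrite mul0r.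
  apply/negbTE/negP => sl; move/eqP: lk; apply.
  exact/val_inj/(step_uniq (fun n => strategy_thS w n) sl sk).
rewrite sel_out//; apply: cvg_near_cst; apply: nearW => N.
rewrite big_mkord big1// => l _; have -> : (th l w < s <= th l.+1 w) = false.
  by apply/negbTE/negP => sl; apply: h'; exists l.
by rewrite mul0r.
Qed.

(** The period containing the grid point [s] is closed on the left: the conditions
    [th k <= s < th k.+1] are known at time [s], as is required of a coefficient of [msum]. *)
Definition on_grid j n l w : R :=
  (`[< exists2 k, th k w <= gridpt t T n l < th k.+1 w & al k w = j >])%:R.

Lemma on_grid_meas j n l : meas_on (F (gridpt t T n l)) setT (on_grid j n l).
Proof.
set s := gridpt t T n l.
have s0 : 0 <= s by rewrite (le_trans t0)// gridpt_ge.
pose B := \bigcup_k (([set w | al k w = j] `&` [set w | th k w <= s]) `&` ~` [set w | th k.+1 w <= s]).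
rewrite (_ : on_grid j n l = \1_B).
  apply/FT_fun/measurable_indic; rewrite FT_measurableE; apply: F_bigcup => k.
  apply: F_setI; first exact: strategy_alpha.
  by apply: F_setC; exact: strategy_stop.
apply/funext => w; rewrite /on_grid indicE; congr (_%:R); congr nat_of_bool.
apply/asboolP/idP => [[k /andP[a1 a2] ak]|]; first by rewrite inE; exists k => //; split=> //=; apply/negP; rewrite -ltNge.
by rewrite inE => -[k _ [[/= ak a1]] /negP]; rewrite -ltNge => a2; exists k => //; rewrite a1.
Qed.

Lemma on_grid_le1 j n l w : `|on_grid j n l w| <= 1.
Proof. by rewrite /on_grid; case: asboolP; rewrite ?normr1 ?normr0. Qed.

Variable Zw : 'I_m -> R -> Omega -> R.
Hypothesis cZ : forall j, \forall w \ae P, {within `[t, T], continuous (Zw j ^~ w)}.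

(** The stochastic integral of [Z] along the modes of the strategy, as a sum of increments of the
    individual integrals [Zw j]; on almost every path the sum stabilises. *)
Definition switched_integral w : R :=
  limn (fun N => \sum_(k < N) (Zw (al k w) (th k.+1 w) w - Zw (al k w) (th k w) w)).

Lemma switched_integralE N w : th N w = T ->
  switched_integral w = \sum_(k < N) (Zw (al k w) (th k.+1 w) w - Zw (al k w) (th k w) w).
Proof.
move=> hN; apply: cvg_lim => //; apply: cvg_near_cst; exists N => // M /= NM.
rewrite -!(big_mkord xpredT (fun k => Zw (al k w) (th k.+1 w) w - Zw (al k w) (th k w) w)).
rewrite (@big_cat_nat _ _ _ N)//= [X in _ + X]big_nat_cond [X in _ + X]big1 ?addr0// => k.
move=> /andP[/andP[Nk _] _].
have hT l : (N <= l)%N -> th l w = T.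
  move=> Nl; apply/eqP; rewrite eq_le strategy_leT -hN.
  exact: (step_mono (fun n => strategy_thS w n)).
by rewrite !hT ?subrr// ltnW.
Qed.

Let gsum n w := \sum_(j < m) msum (Zw j) (gridpt t T n) (on_grid j n) n.+1 w.

(** The indicator of a period is a difference of two indicators of half-lines, to each of which
    [grid_step_cvg] applies. *)
Lemma grid_switched_cvg : \forall w \ae P, gsum ^~ w @ \oo --> switched_integral w.
Proof.
have cZ' : \forall w \ae P, forall j : 'I_m, {within `[t, T], continuous (Zw j ^~ w)}.
  exact: filter_forall.
apply: filterS2 cZ' strategy_fin_ae => w cw [N hN].
have thw := fun n => strategy_thS w n.
rewrite (switched_integralE hN).
pose D k n := \sum_(l < n.+1) (th k w <= gridpt t T n l)%R%:R *
   (Zw (al k w) (gridpt t T n l.+1) w - Zw (al k w) (gridpt t T n l) w) -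
   \sum_(l < n.+1) (th k.+1 w <= gridpt t T n l)%R%:R *
   (Zw (al k w) (gridpt t T n l.+1) w - Zw (al k w) (gridpt t T n l) w).
rewrite (_ : gsum ^~ w = fun n => \sum_(k < N) D k n).
  apply: cvg_big => [|k _]; first exact: add_continuous.
  rewrite (_ : Zw (al k w) (th k.+1 w) w - Zw (al k w) (th k w) w =
     (Zw (al k w) T w - Zw (al k w) (th k w) w) - (Zw (al k w) T w - Zw (al k w) (th k.+1 w) w)); last by ring.
  by apply: cvgB; apply: (grid_step_cvg tT (cw (al k w))); rewrite strategy_ge strategy_leT.
apply/funext => n; rewrite /gsum /msum exchange_big/=.
transitivity (\sum_(l < n.+1) \sum_(k < N) ((th k w <= gridpt t T n l)%R%:R -
   (th k.+1 w <= gridpt t T n l)%R%:R) *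
   (Zw (al k w) (gridpt t T n l.+1) w - Zw (al k w) (gridpt t T n l) w)); last first.
  rewrite exchange_big/=; apply: eq_bigr => k _; rewrite /D -sumrB.
  by apply: eq_bigr => l _; rewrite mulrBl.
apply: eq_bigr => l _; set s := gridpt t T n l.
have ts : th 0 w <= s by rewrite strategy_th0 gridpt_ge.
have sT : s < th N w.
  by rewrite hN -[ltRHS](gridptT t T n); apply: lt_le_trans (gridpt_lt tT n l) _; exact: gridpt_le.
have [k0 k0N k0s] := step_exists_co (th := fun n => th n w) ts sT.
rewrite (bigD1 (Ordinal k0N))//= (bigD1 (al k0 w))//= !big1 ?addr0.
- rewrite /on_grid; case: asboolP => [_|h]; last by exfalso; apply: h; exists k0.
  by case/andP: k0s => -> h; rewrite leNgt h subr0.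
- move=> k kk0; have [h|h] := boolP (th k w <= s < th k.+1 w).
    exfalso; move/eqP: kk0; apply; apply: val_inj => /=; exact: (step_uniq_co thw h k0s).
  move: h; rewrite negb_and -leNgt -ltNge => /orP[h|h].
    by rewrite !leNgt h (lt_le_trans h (thw k)) subrr mul0r.
  by rewrite h (le_trans (thw k) h) subrr mul0r.
- move=> j jk; rewrite /on_grid; case: asboolP => [[k ks kj]|_]; last by rewrite mul0r.
  by exfalso; move/eqP: jk; apply; rewrite -kj (step_uniq_co thw ks k0s).
Qed.

Lemma switched_integral_meas : (forall j s, t <= s <= T -> measurable_fun setT (Zw j s)) ->
  measurable_fun setT switched_integral.
Proof.
move=> mZ; apply: (ae_measurable_cvg cP _ grid_switched_cvg) => n.
apply: measurable_sum => j; apply: measurable_sum => l; apply: measurable_funM.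
  exact: (F_fun_measurable (@on_grid_meas j n l)).
by apply: measurable_funB; apply: mZ; rewrite gridpt_ge// gridpt_leT// ltnW.
Qed.

Lemma pm_step (u : 'I_m -> hfun) (y : hfun) N w : good w -> th N w = T ->
  (forall j, mpred (u j)) -> mpred y ->
  (forall k s e, th k w < s <= th k.+1 w -> y s w e = u (al k w) s w e) ->
  \int[pm w]_(x in `]t, T] `*` setT) y x.1 w x.2 =
  \sum_(k < N) \int[pm w]_(x in `]th k w, th k.+1 w] `*` setT) u (al k w) x.1 w x.2.
Proof.
move=> gw hN mu my yu; have [N' NT] := good_jump_lt T gw.
have NT' k : forall n, (N' <= n)%N -> ((th k w)%:E < Tn n w)%E.
  by move=> n /NT; apply: le_lt_trans; rewrite lee_fin strategy_leT.
rewrite (pm_Rintegral t (mpred_path w my) NT).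
under [RHS]eq_bigr => k _ do rewrite (pm_Rintegral _ (mpred_path w (mu _)) (NT' k.+1)).
rewrite -(strategy_th0 w) -hN; elim: N {hN} => [|N IH].
  by rewrite big_ord0 big_pred0// => n; apply/negbTE/negP => /andP[a1 a2]; have := lt_le_trans a1 a2; rewrite ltxx.
rewrite big_ord_recr/= -IH !(big_mkcond (jump _ _ w)) -big_split/=.
apply: eq_bigr => n _.
rewrite (@jump_cat _ (th N w))//; last exact: strategy_thS.
  case j1: (jump (th 0 w) (th N w) w n); first by rewrite orTb (jump_disj _ j1) addr0.
  rewrite orFb add0r; case: ifPn => // j2; apply: yu.
  by move: j2; rewrite jump_fin => /andP[].
exact: (step_mono (fun n => strategy_thS w n)).
Qed.

End Strategy.

(** * Replacing [U] by an integrand that is square-integrable in the marks everywhere *)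

Section MarkReduction.
Variables (T : R).
Hypothesis T0 : 0 < T.
Let mI (u v : R) : measurable (rset R `]u, v]).
Proof. exact: measurable_itv. Qed.

Definition clip (U : hfun) : hfun := fun s w e => if (0 <= s <= T) then U s w e else 0.

Definition finsq (U : hfun) : set (R * Omega) :=
  [set x | (\int[phiK x]_e ((clip U x.1 x.2 e) ^+ 2)%:E < +oo)%E].

(** Membership in the space gives a finite [phi]-integral of [U^2] only almost everywhere. [reduce]
    is zero where it fails and outside [[0, T]], hence square-integrable in the marks at every point
    and predictable without restriction on time. *)
Definition reduce (U : hfun) : hfun := fun s w e => \1_(finsq U) (s, w) * clip U s w e.

Lemma indic_mpred (D : set (R * Omega)) h : measurable (D : set PT) -> mpred h ->
  mpred (fun s w e => \1_D (s, w) * h s w e).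
Proof.
move=> mD mh; apply: measurable_funM; last exact: mh.
apply: (@ppred_mpred _ _ (fun s w => \1_D (s, w) : R)).
rewrite /ppred (_ : (fun x => _) = \1_D); last by apply/funext => -[].
exact: measurable_indic.
Qed.

Variables (U : hfun).
Hypothesis mU : mark_predictable F `[0, T] U.
Let mC : mpred (clip U) := mark_predictable_mpred mU.
Let C2 (x : PT) : \bar R := (\int[phiK x]_e ((clip U x.1 x.2 e) ^+ 2)%:E)%E.

Let mC2' : mpred (fun s w e => ((clip U s w e) ^+ 2)%:E).
Proof. by apply/measurable_EFinP; exact: measurable_funX. Qed.

Let mC2 : measurable_fun setT C2.
Proof. by apply: (phiK_integral_measurable _ mC2') => s w e; rewrite lee_fin sqr_ge0. Qed.

Let mD : measurable (finsq U : set PT).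
Proof. by have := emeasurable_fun_infty_o measurableT mC2 +oo%E; rewrite setTI. Qed.

Lemma reduce_mpred : mpred (reduce U).
Proof. exact: (indic_mpred mD mC). Qed.

Lemma reduce_fin s w : (\int[phi s w]_e ((reduce U s w e) ^+ 2)%:E < +oo)%E.
Proof.
have [h|h] := pselect (finsq U (s, w) /\ 0 <= s).
  move: h => -[+ s0]; rewrite /finsq /= /phiK /= s0; apply: le_lt_trans.
  apply: ge0_le_integral_dom => e _; first by rewrite lee_fin sqr_ge0.
  by rewrite lee_fin /reduce exprMn ler_piMl ?sqr_ge0.
rewrite (eq_integral (cst 0%E)) ?integral0// => e _; rewrite /reduce /clip.
have [s0|] := leP 0 s; last by move=> _; rewrite /= mulr0 expr0n.
by rewrite indicE memNset ?mul0r ?expr0n// => h'; apply: h.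
Qed.

Let q s w := phint (fun s w e => reduce U s w e ^+ 2) s w.

Lemma phint_reduce_fin s w : 0 <= s ->
  (q s w)%:E = (\int[phi s w]_e ((reduce U s w e) ^+ 2)%:E)%E.
Proof.
move=> s0; rewrite /q /phint s0 /Rintegral fineK// ge0_fin_numE; first exact: reduce_fin.
by apply: integral_ge0 => e _; rewrite lee_fin sqr_ge0.
Qed.

Let mq : ppred q.
Proof. by apply: phint_ppred; apply: measurable_funX; exact: reduce_mpred. Qed.

Variable beta : R.
Hypotheses (b0 : 0 <= beta)
  (Ufin : (\int[P]_w \int[dA A w]_(s in `]0%R, T]) \int[phi s w]_e
     (expR (beta * A s w) * U s w e ^+ 2)%:E < +oo)%E).

Let C2_le w s : good w -> 0 < s <= T ->
  (C2 (s, w) <= \int[phi s w]_e (expR (beta * A s w) * U s w e ^+ 2)%:E)%E.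
Proof.
move=> gw /andP[s0 sT]; rewrite /C2 /phiK /= (ltW s0).
apply: ge0_le_integral_dom => e _; first by rewrite lee_fin sqr_ge0.
rewrite lee_fin /clip (ltW s0) sT /= ler_peMl ?sqr_ge0//.
by rewrite -expR0 ler_expR mulr_ge0// (A_ge0 gw)// ltW.
Qed.

Lemma reduce_moment :
  (\forall w \ae P, itg (dA A w) 0 T (q ^~ w)) /\
  I1 P (fun w => \int[dA A w]_(s in `]0, T]) q s w).
Proof.
have q0 s w : 0 <= q s w.
  by rewrite /q /phint; case: ifP => // _; apply: Rintegral_ge0 => e _; exact: sqr_ge0.
apply: (random_moment (mI 0 T) _ _ _ _ _ Ufin).
- by move=> w; apply: measurable_funTS; exact: ppred_path mq.
- exact: q0.
- by move=> s w; apply: integral_ge0 => e _; rewrite lee_fin mulr_ge0 ?expR_ge0 ?sqr_ge0.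
- apply: (F_fun_measurable (t := T)).
  apply: (dA_integral_measurable (ltW T0) (lexx 0) (g := fun s w => (q s w)%:E)).
    by move=> s w; rewrite lee_fin.
  by apply/measurable_EFinP; exact: ppred_progressive (ltW T0) mq.
- apply: filterS good_ae => w gw s /=; rewrite in_itv/= => sT.
  apply: le_trans (C2_le gw sT); have s0 : 0 <= s by case/andP: sT => /ltW.
  rewrite phint_reduce_fin// /C2 /phiK /= s0; apply: ge0_le_integral_dom => e _; first by rewrite lee_fin sqr_ge0.
  by rewrite lee_fin /reduce exprMn ler_piMl ?sqr_ge0.
Qed.

(** The exponential weight is at least 1, so the moment of [U] bounds the integral of [C2]; finite
    integrals give finiteness almost everywhere, first in [w], then for [dA]. *)
Lemma finsq_ae : \forall w \ae P, {ae dA A w, forall s, (rset R `]0, T]) s -> finsq U (s, w)}.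
Proof.
have mCp : ppred (fun s w => C2 (s, w)).
  by rewrite /ppred (_ : (fun x => _) = C2)//; apply/funext => -[].
pose V w := (\int[dA A w]_(s in `]0%R, T]) C2 (s, w))%E.
have C20 x : (0 <= C2 x)%E by apply: integral_ge0 => e _; rewrite lee_fin sqr_ge0.
have mV : measurable_fun setT V.
  apply: (F_fun_measurable (t := T)).
  apply: (dA_integral_measurable (ltW T0) (lexx 0) (g := fun s w => C2 (s, w))) => //.
  exact: ppred_progressive (ltW T0) mCp.
have V0 w : (0 <= V w)%E by apply: integral_ge0.
have VI : P.-integrable setT V.
  apply/integrableP; split=> //; rewrite (eq_integral V); last by move=> w _; rewrite gee0_abs.
  apply: le_lt_trans Ufin; apply: ae_le_integral_dom => //.
    move=> w; apply: integral_ge0 => s _; apply: integral_ge0 => e _.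
    by rewrite lee_fin mulr_ge0 ?expR_ge0 ?sqr_ge0.
  apply: filterS good_ae => w gw; apply: ge0_le_integral_dom => // s /=.
  by rewrite in_itv/= => sT; exact: C2_le.
apply: filterS (integrable_ae measurableT VI) => w /(_ I); rewrite fin_numE -ltey => /andP[_ Vw].
have : (dA A w).-integrable (rset R `]0, T]) (fun s => C2 (s, w)).
  apply/integrableP; split; first by apply: measurable_funTS; exact: ppred_path mCp.
  by under eq_integral do rewrite gee0_abs//.
move=> /(integrable_ae (mI 0 T)); apply: filterS => s h /h.
by rewrite fin_numE -ltey => /andP[].
Qed.

(** The set on which [U] is altered is predictable and, within []0, T]], null for [dA] on almost
    every path. By the compensator formula its mean number of jumps is zero, so almost surely no
    jump sees the change. *)
Lemma reduce_pm : \forall w \ae P, forall u v, 0 <= u -> v <= T ->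
  \int[pm w]_(x in `]u, v] `*` setT) U x.1 w x.2 = \int[pm w]_(x in `]u, v] `*` setT) reduce U x.1 w x.2.
Proof.
pose H s w (e : marks E) : \bar R := (\1_(~` finsq U) (s, w))%:E.
have mH : mpred H.
  apply/measurable_EFinP; have := @indic_mpred (~` finsq U) (fun _ _ _ => 1) (measurableC mD) (measurable_cst _).
  by rewrite /mpred; under eq_fun do rewrite mulr1.
have H0 s w e : (0 <= H s w e)%E by rewrite lee_fin indicE ler0n.
have := comp_ge0 T (lexx 0) H0 mH.
rewrite [X in _ = X -> _](_ : _ = 0%E); last first.
  pose Z w := (\int[dA A w]_(s in `]0%R, T]) \int[phi s w]_e H s w e)%E.
  apply: le_anti; apply/andP; split; last first.
    by apply: integral_ge0 => w _; apply: integral_ge0 => s _; apply: integral_ge0 => e _.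
  have Hp s w : (\int[phi s w]_e H s w e = (\1_(~` finsq U) (s, w))%:E)%E.
    by rewrite /H integral_cst//= probability_setT mule1.
  have mHp : ppred (fun s w => (\1_(~` finsq U) (s, w) : R)%:E).
    apply/measurable_EFinP; rewrite (_ : (fun x => _) = \1_(~` finsq U)); last by apply/funext => -[].
    by apply: measurable_indic; exact: measurableC.
  rewrite -[leRHS](integral0 P setT); apply: ae_le_integral_dom => //.
  - apply: (F_fun_measurable (t := T)).
    under eq_fun do under eq_integral do rewrite Hp.
    apply: (dA_integral_measurable (ltW T0) (lexx 0) (g := fun s w => (\1_(~` finsq U) (s, w))%:E)).
      by move=> s w; rewrite lee_fin.
    exact: ppred_progressive (ltW T0) mHp.
  - by move=> w; apply: integral_ge0 => s _; apply: integral_ge0 => e _.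
  - apply: filterS finsq_ae => w aeD; under eq_integral do rewrite Hp.
    rewrite (@ge0_ae_eq_integral _ _ _ (dA A w) _ _ (cst 0%E)) ?integral0//.
    + by apply: measurable_funTS; exact: ppred_path mHp.
    + apply: filterS aeD => s h /h hs; rewrite indicE memNset//; exact.
move=> h0.
have mW : measurable_fun setT (fun w => \int[pm w]_(x in `]0%R, T] `*` setT) H x.1 w x.2)%E.
  apply: (F_fun_measurable (t := T)).
  apply: (pm_integral_measurable (ltW T0) (lexx 0) H0).
  exact: mpred_progressive (ltW T0) mH.
have W0 w : (0 <= \int[pm w]_(x in `]0%R, T] `*` setT) H x.1 w x.2)%E by apply: integral_ge0.
have : ae_eq P setT (fun w => \int[pm w]_(x in `]0%R, T] `*` setT) H x.1 w x.2)%E (cst 0%E).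
  apply/ae_eq_integral_abs => //; rewrite -[RHS]h0; apply: eq_integral => w _; exact: gee0_abs.
apply: filterS2 good_ae => w gw /(_ I) hw u v u0 vT.
have [N NT] := good_jump_lt T gw.
have NT' : forall n, (N <= n)%N -> (v%:E < Tn n w)%E.
  by move=> n /NT; apply: le_lt_trans; rewrite lee_fin.
have clipE : \int[pm w]_(x in `]u, v] `*` setT) U x.1 w x.2 = \int[pm w]_(x in `]u, v] `*` setT) clip U x.1 w x.2.
  apply: eq_Rintegral => -[s e]; rewrite inE/= in_itv/= => -[/andP[us sv] _].
  by rewrite /clip (le_trans u0 (ltW us)) (le_trans sv vT).
rewrite clipE (pm_Rintegral u (mpred_path w mC) NT') (pm_Rintegral u (mpred_path w reduce_mpred) NT').
rewrite big_nat_cond [RHS]big_nat_cond; apply: eq_bigr => n /andP[nN jn] /=.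
rewrite /reduce indicE; case: (pselect (finsq U (fine (Tn n w), w))) => [h|h]; first by rewrite mem_set// mul1r.
exfalso; move: hw; rewrite (pm_integral_sum 0 (h := fun x => H x.1 w x.2) (mpred_path w mH) _ NT)//.
rewrite /= sumEFin => -[] /eqP; rewrite psumr_eq0; last by move=> k _; rewrite indicE ler0n.
move=> /allP/(_ n); rewrite mem_index_iota => /(_ nN); rewrite indicE mem_set// oner_eq0 implybF => /negP; apply.
move: jn; rewrite !jump_fin => /andP[-> /andP[un nv]].
by rewrite (le_lt_trans u0 un) (le_trans nv vT).
Qed.

End MarkReduction.

Section MarkEquation.
Variables (T : R).
Hypothesis T0 : 0 < T.
Local Notation clip := (clip T).
Local Notation reduce := (reduce T).
Let mI (u v : R) : measurable (rset R `]u, v]).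
Proof. exact: measurable_itv. Qed.

Lemma pm_integrable_path w (h : hfun) u v : good w -> mpred h ->
  (pm w).-integrable ((rset R `]u, v]) `*` setT) (EFin \o (fun x => h x.1 w x.2)).
Proof.
move=> gw mh; have [N NT] := good_jump_lt v gw.
apply/integrableP; split; first by apply/measurable_EFinP; apply: measurable_funTS; exact: mpred_path mh.
rewrite (_ : (fun x => _) = fun x : TE => (`|h x.1 w x.2|)%:E)//.
rewrite (pm_integral_sum u (h := fun x : TE => (`|h x.1 w x.2|)%:E) _ _ NT)//.
  by rewrite sumEFin ltry.
by apply/measurable_EFinP; apply: measurableT_comp => //; exact: mpred_path mh.
Qed.

Lemma pm_right_cont w (h : hfun) s : good w -> mpred h -> 0 <= s ->
  \int[pm w]_(x in `]v, T] `*` setT) h x.1 w x.2 @[v --> s^'+] -->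
  \int[pm w]_(x in `]s, T] `*` setT) h x.1 w x.2.
Proof.
move=> gw mh s0.
have EE v : 0 <= v -> ((`]0, T]%classic `*` setT) `&` [set x : TE | v < x.1])%classic = `]v, T]%classic `*` setT.
  move=> v0; apply/seteqP; split=> x /=; rewrite !in_itv/=; first by move=> [[/andP[_ ->] _] ->].
  by move=> [/andP[vx xT] _]; rewrite vx xT (le_lt_trans v0).
have mD : measurable ((rset R `]0, T]) `*` (setT : set (marks E))).
  exact: measurableX.
have := @Rint_right_cont _ _ R (pm w) (fun x => h x.1 w x.2) fst _ s mD measurable_fst (pm_integrable_path 0 T gw mh).
rewrite EE//; apply: cvg_trans; apply: near_eq_cvg; near=> v; rewrite EE//.
by rewrite (le_trans s0)// ltW//; near: v; exact: nbhs_right_gt.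
Unshelve. all: by end_near.
Qed.

Lemma pm_cat w (h : hfun) u v z : good w -> mpred h -> u <= v -> v <= z ->
  \int[pm w]_(x in `]u, z] `*` setT) h x.1 w x.2 =
  \int[pm w]_(x in `]u, v] `*` setT) h x.1 w x.2 + \int[pm w]_(x in `]v, z] `*` setT) h x.1 w x.2.
Proof.
move=> gw mh uv vz; have [N NT] := good_jump_leq gw vz.
rewrite !(pm_Rintegral _ (mpred_path w mh) (N := N)); try by move=> n /NT[].
rewrite !(big_mkcond (jump _ _ w)) -big_split/=; apply: eq_bigr => n _.
rewrite (@jump_cat _ v)//.
case j1: (jump u v w n); first by rewrite orTb (jump_disj _ j1) addr0.
by rewrite orFb add0r.
Qed.

Lemma clip_bdd (rho : hfun) M : (forall (t : R) (w : Omega) (e : marks E), 0 <= t <= T -> 0 <= rho t w e <= M) ->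
  forall s w e, 0 <= clip rho s w e <= Num.max M 1.
Proof.
move=> rM s w e; rewrite /clip; case: ifPn => [sT|_]; first have /andP[-> h] := rM s w e sT.
  by rewrite le_max h.
by rewrite lexx le_max ler01 orbT.
Qed.

(** The drift term with [rho - 1] and the compensator of the [q]-integral have the same integrator
    and merge into the single integrand [rho U]. *)
Lemma reduce_dA (U rho : hfun) M beta : mark_predictable F `[0, T] U -> mark_predictable F `[0, T] rho ->
  (forall (t : R) (w : Omega) (e : marks E), 0 <= t <= T -> 0 <= rho t w e <= M) -> 0 <= beta ->
  (\int[P]_w \int[dA A w]_(s in `]0%R, T]) \int[phi s w]_e
     (expR (beta * A s w) * U s w e ^+ 2)%:E < +oo)%E ->
  \forall w \ae P,
    (dA A w).-integrable (rset R `]0, T])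
      (EFin \o (phint (fun s w e => clip rho s w e * reduce U s w e) ^~ w)) /\
    forall u v, 0 <= u -> u <= v -> v <= T ->
    \int[dA A w]_(s in `]u, v]) (\int[phi s w]_e (U s w e * (rho s w e - 1))) +
    \int[dA A w]_(s in `]u, v]) (\int[phi s w]_e U s w e) =
    \int[dA A w]_(s in `]u, v]) phint (fun s w e => clip rho s w e * reduce U s w e) s w.
Proof.
move=> mU mr rM b0 Ufin.
have mc : mpred (clip U) by exact: mark_predictable_mpred.
have mcr : mpred (clip rho) by exact: mark_predictable_mpred.
have reduce_U_mpred : mpred (reduce U) by exact: (reduce_mpred mU).
have rc := clip_bdd rM; set c := Num.max M 1 in rc.
have c1 : 1 <= c by rewrite le_max lexx orbT.
have [qi _] := reduce_moment T0 mU b0 Ufin.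
have fa := finsq_ae T0 mU b0 Ufin.
have mv1 : mpred (fun s w e => reduce U s w e * (clip rho s w e - 1)).
  by apply: measurable_funM => //; apply: measurable_funB => //; exact: measurable_cst.
have mv1' : mpred (fun s w e => clip U s w e * (clip rho s w e - 1)).
  by apply: measurable_funM => //; apply: measurable_funB => //; exact: measurable_cst.
have mv2 : mpred (fun s w e => clip rho s w e * reduce U s w e) by exact: measurable_funM.
have b1 s w e : `|reduce U s w e * (clip rho s w e - 1)| <= c * `|reduce U s w e|.
  rewrite normrM mulrC ler_wpM2r// distrC; exact: bdd_1B.
have b2 s w e : `|clip rho s w e * reduce U s w e| <= c * `|reduce U s w e|.
  by rewrite normrM ler_wpM2r//; have /andP[h1 h2] := rc s w e; rewrite ger0_norm.
have b3 s w e : `|reduce U s w e| <= 1 * `|reduce U s w e| by rewrite mul1r.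
have c0 := le_trans ler01 c1.
apply: filterS3 good_ae qi fa => w gw qw faw.
have fin := reduce_fin T U.
have i1 := dominated_dA_int (lexx 0) T0 reduce_U_mpred fin mv1 b1 c0 gw qw.
have i2 := dominated_dA_int (lexx 0) T0 reduce_U_mpred fin mv2 b2 c0 gw qw.
have i3 := dominated_dA_int (lexx 0) T0 reduce_U_mpred fin reduce_U_mpred b3 ler01 gw qw.
split=> // u v u0 uv vT.
have sub : (`]u, v] : set (measurableTypeR R))%classic `<=` `]0, T]%classic.
  by move=> s /=; rewrite !in_itv/= => /andP[us sv]; rewrite (le_lt_trans u0 us) (le_trans sv).
have ae1 (h1 h2 : hfun) (k : R -> R) : mpred h1 -> mpred h2 ->
    (forall s, (`]u, v] : set (measurableTypeR R))%classic s -> k s = phint h1 s w) ->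
    (forall s, 0 <= s <= T -> finsq T U (s, w) -> forall e, h1 s w e = h2 s w e) ->
    \int[dA A w]_(s in `]u, v]) k s = \int[dA A w]_(s in `]u, v]) phint h2 s w.
  move=> m1 m2 kE h12; rewrite (@eq_Rintegral _ _ _ (dA A w) _ (phint h1 ^~ w)); last first.
    by move=> s; rewrite inE => /kE.
  rewrite /Rintegral; congr fine; apply: ae_eq_integral => //.
  - by apply/measurable_EFinP; apply: measurable_funTS; exact: (ppred_path w (phint_ppred m1)).
  - by apply/measurable_EFinP; apply: measurable_funTS; exact: (ppred_path w (phint_ppred m2)).
  apply: filterS faw => s hs /[dup] suv /sub /[dup] sT /hs fs.
  move: sT; rewrite /= in_itv/= => /andP[/ltW s0 sT].
  rewrite /phint s0; congr EFin; apply: eq_Rintegral => e _; apply: h12 => //.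
  by rewrite s0.
have redE s e : finsq T U (s, w) -> clip U s w e = reduce U s w e.
  by move=> h; rewrite /reduce indicE mem_set// mul1r.
have kE s : (`]u, v] : set (measurableTypeR R))%classic s -> 0 <= s <= T.
  by move=> /sub; rewrite /= in_itv/= => /andP[/ltW ->].
rewrite (ae1 _ _ (fun s => \int[phi s w]_e (U s w e * (rho s w e - 1))) mv1' mv1); last 2 first.
- move=> s /kE h; rewrite /phint; case/andP: (h) => -> _; apply: eq_Rintegral => e _.
  by rewrite /clip h.
- by move=> s _ h e; rewrite redE.
rewrite (ae1 _ _ (fun s => \int[phi s w]_e U s w e) mc reduce_U_mpred); last 2 first.
- by move=> s /kE h; rewrite /phint; case/andP: (h) => -> _; apply: eq_Rintegral => e _; rewrite /clip h.
- by move=> s _ h e; rewrite redE.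
rewrite -RintegralD//; last 2 first.
- exact: integrableS sub i1.
- exact: integrableS sub i3.
apply: eq_Rintegral => s; rewrite inE => /kE /andP[s0 _].
rewrite /phint s0.
have I1a := dominated_I1 reduce_U_mpred fin mv1 b1 s w; have I1b := dominated_I1 reduce_U_mpred fin reduce_U_mpred b3 s w.
rewrite -[LHS]/(EX (phi s w) _ + EX (phi s w) _) -(EXD I1a I1b).
by apply: eq_Rintegral => e _; ring.
Qed.

End MarkEquation.

(** * Measurability of Lebesgue integrals and of values at random times *)

Lemma leb_integral_measurable T (X : R -> Omega -> \bar R) : (forall s w, 0 <= X s w)%E ->
  measurable_fun ([set z | 0 < z.2 <= T] : set (FT T * measurableTypeR R)) (fun z => X z.2 z.1) ->
  measurable_fun setT (fun w => \int[lebesgue_measure]_(s in (`]0%R, T]%classic : set (measurableTypeR R))) X s w)%E.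
Proof.
move=> X0 mX; apply: (F_fun_measurable (t := T)); apply/FT_fun.
have mD : measurable ([set z | 0 < z.2 <= T] : set (FT T * measurableTypeR R)) by exact: measurable_time_itv.
pose k (z : FT T * measurableTypeR R) : \bar R :=
  ((fun z => X z.2 z.1) \_ [set z : FT T * measurableTypeR R | 0 < z.2 <= T]) z.
have mk : measurable_fun setT k by apply/(measurable_restrictT _ mD).
have k0 z : (0 <= k z)%E by rewrite /k patchE; case: ifP.
have h : measurable_fun setT (fun w : FT T => \int[lebesgue_measure]_y k (w, y))%E.
  exact: (@measurable_fun_fubini_tonelli_F _ _ (FT T) (measurableTypeR R) R lebesgue_measure k mk k0).
rewrite (_ : (fun w => _) = (fun w : FT T => \int[lebesgue_measure]_y k (w, y))%E)//.
apply/funext => w; rewrite [LHS]integral_mkcond; apply: eq_integral => s _.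
by rewrite /k !patchE; congr (if _ then _ else _); apply/idP/idP; rewrite !inE/= in_itv.
Qed.

Lemma PT_section s : 0 <= s -> measurable_fun setT (fun w : Omega => (s, w) : PT).
Proof.
move=> s0; apply: (@measurability _ _ _ PT _ _ (PG)) => //.
move=> _ [S [[G FG ->]|[u [v [G [u0 uv FG ->]]]]] <-]; rewrite setTI.
  have mG := F_measurable FG.
  have [->|h] := eqVneq s 0.
    by rewrite (_ : _ @^-1` _ = G)//; apply/seteqP; split=> w //= [].
  by rewrite (_ : _ @^-1` _ = set0)//; apply/seteqP; split=> w //= [/eqP]; rewrite (negbTE h).
have mG := F_measurable FG.
have [h|h] := boolP (u < s <= v).
  by rewrite (_ : _ @^-1` _ = G)//; apply/seteqP; split=> w /= => [[]//|Gw]; rewrite in_itv/= h.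
by rewrite (_ : _ @^-1` _ = set0)//; apply/seteqP; split=> w //= [+ _]; rewrite in_itv/= (negbTE h).
Qed.

Lemma F_ae_cvg v (fn : nat -> Omega -> R) (h : Omega -> R) : (forall n, meas_on (F v) setT (fn n)) ->
  (\forall w \ae P, fn ^~ w @ \oo --> h w) -> meas_on (F v) setT h.
Proof.
move=> mf ch; pose N := ~` [set w | fn ^~ w @ \oo --> h w].
have FN : F v N by exact: F_negligible ch.
apply: (@F_ae v _ _ (fun w => h w * \1_(~` N) w)).
  by apply: filterS ch => w cw; rewrite indicE mem_set ?mulr1//; apply.
apply/FT_fun; apply: (@measurable_fun_cvg _ (FT v) R setT (fun n w => fn n w * \1_(~` N) w)).
  move=> n; apply: measurable_funM; first exact/FT_fun.
  by apply: measurable_indic; apply: measurableC; rewrite FT_measurableE.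
move=> w _; rewrite indicE; have [h0|h0] := pselect (N w).
  by rewrite memNset; [under eq_fun do rewrite mulr0; rewrite mulr0; exact: cvg_cst|move=> /(_ h0)].
rewrite mem_set// mulr1; under eq_fun do rewrite mulr1.
exact: contrapT h0.
Qed.

(** [X] is read at the grid point just below [tau] and continuity passes to the limit. The sum has
    [n + 2] terms because [tau] may equal the last grid point [v]. *)
Lemma random_time_meas T v (X : proc) (tau : Omega -> R) : 0 < v -> v <= T ->
  (forall s, 0 <= s <= v -> meas_on (F v) setT (X s)) ->
  (\forall w \ae P, {within `[0, T], continuous (X ^~ w)}) ->
  measurable_fun (setT : set (FT v)) tau -> (forall w, 0 <= tau w <= v) ->
  meas_on (F v) setT (fun w => X (tau w) w).
Proof.
move=> v0 vT mX cX mt tv.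
pose gp n k := gridpt 0 v n k.
apply: (@F_ae_cvg v (fun n w => \sum_(k < n.+2)
   (gp n k <= tau w < gp n k.+1)%R%:R * X (gp n k) w)).
  move=> n; apply/FT_fun; apply: measurable_sum => k; apply: measurable_funM; last first.
    by apply/FT_fun; apply: mX; rewrite gridpt_ge// gridpt_leT// -ltnS.
  rewrite (_ : (fun w => _) = \1_(tau @^-1` `[gp n k, gp n k.+1[%classic)).
    by apply: measurable_indic; rewrite -[X in measurable X]setTI; apply: mt => //; exact: measurable_itv.
  apply/funext => w; rewrite indicE; congr (_%:R); congr nat_of_bool.
  by apply/idP/idP; rewrite inE/= in_itv.
apply: filterS cX => w /subspace_continuousP cw.
have H n : exists q : R, [/\ 0 <= q <= v, q <= tau w, tau w - q <= (v - 0) / n.+1%:R &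
   \sum_(k < n.+2) (gp n k <= tau w < gp n k.+1)%R%:R * X (gp n k) w = X q w].
  have [k kn kt] := grid_floor v0 n (tv w).
  exists (gp n k); split.
  - by rewrite gridpt_ge// gridpt_leT.
  - by case/andP: kt.
  - by rewrite -(gridptS 0 v n k) lerD2r ltW//; case/andP: kt.
  have kn' : (k < n.+2)%N by [].
  rewrite (bigD1 (Ordinal kn'))//= kt mul1r big1 ?addr0// => l lk.
  have -> : (gp n l <= tau w < gp n l.+1) = false; last by rewrite mul0r.
  apply/negbTE/negP => hl; move/eqP: lk; apply; apply: val_inj => /=.
  exact: (step_uniq_co (th := gp n) (fun j => ltW (gridpt_lt v0 n j)) hl kt).
have [q Hq] := choice H.
rewrite (_ : (fun n => _) = fun n => X (q n) w); last by apply/funext => n; have [] := Hq n.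
have rt : q @ \oo --> tau w.
  apply: (@squeeze_cvgr _ _ _ _ (fun n => tau w - (v - 0) / n.+1%:R) (fun=> tau w)).
  - by apply: nearW => n; have [_ -> h _] := Hq n; rewrite andbT lerBlDr -lerBlDl.
  - by rewrite -[X in _ --> X]subr0; apply: cvgB; [exact: cvg_cst|exact: mesh_cvg].
  - exact: cvg_cst.
have tT : `[0, T]%classic (tau w) by rewrite /= in_itv/=; case/andP: (tv w) => -> /le_trans ->.
have cr : q @ \oo --> within `[0, T] (nbhs (tau w)).
  move=> B nB; have h : \forall n \near \oo, `[0, T]%classic (q n) -> B (q n) := rt _ nB.
  apply: filterS h => n; apply; have [/andP[q0 qv] _ _ _] := Hq n.
  by rewrite /= in_itv/= q0 (le_trans qv).
exact: (@cvg_comp _ _ _ q (X ^~ w) _ _ _ cr (cw (tau w) tT)).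
Qed.

Lemma ppred_fixed_time (X : proc) s : 0 < s -> ppred X -> meas_on (F s) setT (X s).
Proof.
move=> s0 mX; apply/FT_fun.
have mXp := ppred_progressive (ltW s0) mX.
have mD : measurable ([set z | 0 < z.2 <= s] : set (FT s * measurableTypeR R)) by exact: measurable_time_itv.
have mp : measurable_fun (setT : set (FT s)) (fun w => (w, s) : FT s * measurableTypeR R).
  by apply: measurable_fun_pair; [exact: measurable_id|exact: measurable_cst].
move=> _ B mB; rewrite setTI; have := mp measurableT _ (mXp mD B mB); rewrite setTI.
by rewrite (_ : _ @^-1` _ = X s @^-1` B)//; apply/seteqP; split=> w /= => [[]//|h]; rewrite s0 lexx.
Qed.

Lemma leb_Rint_measurable T (X : proc) u : 0 < T -> 0 <= u ->
  measurable_fun ([set z | 0 < z.2 <= T] : set (FT T * measurableTypeR R)) (fun z => X z.2 z.1) ->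
  measurable_fun setT (fun w => \int[lebesgue_measure]_(s in `]u, T]) X s w).
Proof.
move=> T0 u0 mX.
have mXE := measurableT_comp (@EFin_measurable R setT) mX.
have mU : measurable_fun ([set z | 0 < z.2 <= T] : set (FT T * measurableTypeR R)) (fun z => (u < z.2)%R%:R%:E : \bar R).
  apply/measurable_EFinP; rewrite (_ : (fun z => _) = \1_[set z : FT T * measurableTypeR R | u < z.2]).
    apply: measurable_indic; rewrite -[X in measurable X]setTI.
    exact: (measurable_fun_ltr (measurable_cst u) measurable_snd).
  by apply/funext => z; rewrite indicE; congr (_%:R); congr nat_of_bool; apply/idP/idP; rewrite inE.
have key (p : R -> \bar R) (s : R) : (p \_ [set s : R | (u < s)%R]) s = (p s * ((u < s)%R%:R)%:E)%E.
  rewrite patchE; case: (boolP (u < s)) => us; first by rewrite mem_set// mule1.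
  by rewrite memNset ?mule0//; exact/negP.
rewrite (_ : (fun w => _) = fun w => fine (
   \int[lebesgue_measure]_(s in (`]0%R, T]%classic : set (measurableTypeR R))) (maxe (X s w)%:E 0 * (u < s)%R%:R%:E) -
   \int[lebesgue_measure]_(s in (`]0%R, T]%classic : set (measurableTypeR R))) (maxe (- (X s w)%:E) 0 * (u < s)%R%:R%:E))%E).
  apply: measurableT_comp => //; apply: emeasurable_funB.
    apply: leb_integral_measurable.
      by move=> s w; apply: mule_ge0; rewrite ?le_max ?lexx ?orbT// lee_fin ler0n.
    apply: emeasurable_funM => //; apply: measurable_maxe => //; exact: measurable_cst.
  apply: leb_integral_measurable.
    by move=> s w; apply: mule_ge0; rewrite ?le_max ?lexx ?orbT// lee_fin ler0n.
  apply: emeasurable_funM => //; apply: measurable_maxe; last exact: measurable_cst.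
  exact: measurableT_comp.
apply/funext => w; rewrite /Rintegral integralE; congr (fine (_ - _)).
all: rewrite (_ : `]u, T]%classic = (`]0, T] `&` [set s | u < s])%classic); last first.
1,3: apply/seteqP; split=> x /=; rewrite !in_itv/=; [move=> /andP[ux ->]; rewrite ux (le_lt_trans u0)//|by move=> [/andP[_ ->] ->]].
all: rewrite integral_mkcondr; apply: eq_integral => s _; rewrite patchE.
all: case: (boolP (u < s)) => us; [rewrite mem_set// mule1|by rewrite memNset ?mule0//; exact/negP].
all: by rewrite ?funeposE ?funenegE.
Qed.

(** * The reflected system *)

Section System.
Variables (m : nat) (T M betahat : R) (rho : 'I_m -> hfun) (xi : 'I_m -> Omega -> R)
  (f g : 'I_m -> proc) (C : 'I_m -> 'I_m -> proc)
  (Y : 'I_m -> proc) (U : 'I_m -> hfun)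
  (Z : 'I_m -> 'I_d -> proc) (K : 'I_m -> proc).
Hypotheses (T0 : 0 < T) (m2 : (2 <= m)%N) (mrho : forall i, mark_predictable F `[0, T] (rho i))
  (HS : assumption_S P T A rho M) (HD : assumption_D P F T A M betahat xi f g C)
  (HY : solves_reflected_system P Tn zeta W phi A T rho xi f g C M betahat Y U Z K).
Local Notation clip := (clip T).
Local Notation reduce := (reduce T).

(** A fixed exponent inside the open range over which the solution spaces quantify, used to extract
    their content. *)
Definition midbeta : R := (Mprime M ^+ 2 + betahat) / 2.

Lemma midbetaP : Mprime M ^+ 2 < midbeta < betahat /\ 0 <= midbeta.
Proof.
have [Mb _ _ _ _] := HD; have := sqr_ge0 (Mprime M).
by rewrite /midbeta; move: Mb; move: (Mprime M ^+ 2) => x xb x0; split; [apply/andP; split|]; lra.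
Qed.

Lemma IA_T : I1 P (A T).
Proof.
have [_ [eta eta3 fin]] := HS.
have eta1 : 1 <= eta by have := exprn_even_ge0 M (n := 4) isT; move: eta3; lra.
have mA : measurable_fun setT (A T).
  by have [_ mA _ _] := HC; exact: (F_fun_measurable (mA T (ltW T0))).
apply: (@I1_le_ae _ _ _ P _ (fun w => expR (eta * A T w))) => //.
  apply/integrableP; split.
    by apply/measurable_EFinP; apply: measurableT_comp => //; exact: measurable_funM.
  by under eq_integral do rewrite /= ger0_norm ?expR_ge0//.
apply: filterS good_ae => w gw; have A0 := A_ge0 gw (ltW T0).
rewrite ger0_norm//; have := expR_ge1Dx (eta * A T w); have : A T w <= eta * A T w by rewrite ler_peMl.
by move: (eta * A T w) => y; move: (expR y) (A T w) => x z; lra.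
Qed.

Lemma progressive_moment (nu : Omega -> {measure set (measurableTypeR R) -> \bar R}) (X : proc) (beta : R) :
  (forall w, measurable_fun (rset R `]0, T]) (X ^~ w)) -> 0 <= beta ->
  measurable_fun setT (fun w => \int[nu w]_(s in (`]0%R, T]%classic : set (measurableTypeR R))) (X s w ^+ 2)%:E)%E ->
  (\int[P]_w \int[nu w]_(s in (`]0%R, T]%classic : set (measurableTypeR R)))
     (expR (beta * A s w) * X s w ^+ 2)%:E < +oo)%E ->
  (\forall w \ae P, (nu w).-integrable (rset R `]0, T]) (EFin \o (fun s => X s w ^+ 2))) /\
  I1 P (fun w => \int[nu w]_(s in `]0, T]) X s w ^+ 2).
Proof.
move=> mX b0 mI fin.
apply: (@random_moment _ _ _ (measurableTypeR R) R P nu _ (fun s w => X s w ^+ 2) _ _ _ _ _ mI _ fin).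
- exact: measurable_itv.
- by move=> w; apply: measurable_funX.
- by move=> s w; exact: sqr_ge0.
- by move=> s w; rewrite lee_fin mulr_ge0 ?expR_ge0 ?sqr_ge0.
- apply: filterS good_ae => w gw s /=; rewrite in_itv/= => /andP[s0 _].
  by rewrite lee_fin ler_peMl ?sqr_ge0// -expR0 ler_expR mulr_ge0// (A_ge0 gw)// ltW.
Qed.

Lemma progressive_path (X : proc) w : progressive F T X ->
  measurable_fun (rset R `]0, T]) (X ^~ w).
Proof.
move=> pX; have T0' : 0 <= T <= T by rewrite ltW ?lexx.
have mX := progressive_measurable T0' pX.
have mp : measurable_fun (setT : set (measurableTypeR R)) (fun s => (w : FT T, s)).
  by apply: measurable_fun_pair; [exact: measurable_cst|exact: measurable_id].
move=> mD B mB; have mD' : measurable ([set z | 0 < z.2 <= T] : set (FT T * measurableTypeR R)) by exact: measurable_time_itv.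
have := mp measurableT _ (mX mD' B mB); rewrite setTI.
by rewrite (_ : _ @^-1` _ = `]0, T]%classic `&` (X ^~ w) @^-1` B).
Qed.

Lemma f_moment i : (\forall w \ae P, itg (dA A w) 0 T (fun s => f i s w ^+ 2)) /\
  I1 P (fun w => \int[dA A w]_(s in `]0, T]) f i s w ^+ 2).
Proof.
have [_ _ /(_ i)[[pf ff] _] _ _] := HD.
have b0 : 0 <= betahat by have [/andP[_ /ltW h] h'] := midbetaP; exact: le_trans h' h.
apply: (progressive_moment (nu := dA A) _ b0 _ ff); first by move=> w; exact: progressive_path.
apply: (F_fun_measurable (t := T)).
apply: (dA_integral_measurable (ltW T0) (lexx 0) (g := fun s w => (f i s w ^+ 2)%:E)).
  by move=> s w; rewrite lee_fin sqr_ge0.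
apply/measurable_EFinP; apply: measurable_funX.
by apply: progressive_measurable pf; rewrite ltW ?lexx.
Qed.

Lemma g_moment i : (\forall w \ae P, itg lebesgue_measure 0 T (fun s => g i s w ^+ 2)) /\
  I1 P (fun w => \int[lebesgue_measure]_(s in `]0, T]) g i s w ^+ 2).
Proof.
have [_ _ /(_ i)[_ [pg gg]] _ _] := HD.
have b0 : 0 <= betahat by have [/andP[_ /ltW h] h'] := midbetaP; exact: le_trans h' h.
have {}pg := pg ord0.
apply: (progressive_moment (nu := fun=> lebesgue_measure) _ b0); first by move=> w; exact: progressive_path.
  apply: leb_integral_measurable; first by move=> s w; rewrite lee_fin sqr_ge0.
  apply/measurable_EFinP; apply: measurable_funX.
  by apply: progressive_measurable pg; rewrite ltW ?lexx.
by move: gg; under [X in (X < _)%E -> _]eq_integral do under eq_integral do rewrite big_ord1.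
Qed.

Lemma sqr_integrable (nu : {measure set (measurableTypeR R) -> \bar R}) (h : R -> R) : (nu (`]0%R, T]%classic : set (measurableTypeR R)) < +oo)%E ->
  measurable_fun (rset R `]0, T]) h ->
  itg nu 0 T (fun s => h s ^+ 2) ->
  itg nu 0 T h.
Proof.
move=> nuT mh h2; have mI : measurable (rset R `]0, T]) by exact: measurable_itv.
have i1 : itg nu 0 T (fun=> 1 : R).
  apply/integrableP; split; first exact: measurable_cst.
  by rewrite (eq_integral (cst 1%E)) ?integral_cst ?mul1e// => s _ /=; rewrite normr1.
apply: (integrable_le mI mh (integrableD mI h2 i1)) => s _.
have := sqr_ge0 (`|h s| - 1); rewrite sqrrB real_normK ?num_real// expr1n mulr1.
by have := normr_ge0 (h s); move: (h s ^+ 2) (`|h s|) => x y; lra.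
Qed.

Lemma U_fin i : [/\ mark_predictable F `[0, T] (U i) &
  (\int[P]_w \int[dA A w]_(s in `]0%R, T]) \int[phi s w]_e
     (expR (midbeta * A s w) * U i s w e ^+ 2)%:E < +oo)%E].
Proof.
have [HSp _] := HY; have [_ _ /(_ midbeta) h _ _] := HSp i.
by have [bb _] := midbetaP; have [_ _ [mU Ufin] _] := h bb.
Qed.

(** The terms of the equation over []u, v]], written with the reduced integrand and the merged
    [rho U] term. *)
Definition increment (Zw : 'I_m -> proc) i (u v : R) (w : Omega) : R :=
  \int[dA A w]_(s in `]u, v]) f i s w + \int[lebesgue_measure]_(s in `]u, v]) g i s w
  - \int[pm w]_(x in `]u, v] `*` setT) reduce (U i) x.1 w x.2
  + \int[dA A w]_(s in `]u, v]) phint (fun s w e => clip (rho i) s w e * reduce (U i) s w e) s w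
  - (Zw i v w - Zw i u w) + (K i v w - K i u w).

Definition path_ok i w := [/\ good w,
  itg (dA A w) 0 T (f i ^~ w),
  itg lebesgue_measure 0 T (g i ^~ w) &
  (dA A w).-integrable (rset R `]0, T])
      (EFin \o (phint (fun s w e => clip (rho i) s w e * reduce (U i) s w e) ^~ w))].

Lemma reduce_U_mpred i : mpred (reduce (U i)).
Proof. by have [mU _] := U_fin i; exact: (reduce_mpred mU). Qed.

Lemma path_ok_ae i : \forall w \ae P, path_ok i w.
Proof.
have [mU Ufin] := U_fin i; have [_ b0] := midbetaP.
have := reduce_dA T0 mU (mrho i) (fun t w e => HS.1 i t w e) b0 Ufin.
have [_ _ /(_ i)[[pf _] [/(_ ord0) pg _]] _ _] := HD.
move=> rd; have fg := ae_and (f_moment i).1 (g_moment i).1.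
apply: filterS3 rd good_ae fg => w [phw _] gw [fw gw'].
split=> //.
- apply: sqr_integrable fw; last exact: progressive_path.
  by rewrite (dA_itv gw (lexx 0) (ltW T0)) ltry.
- apply: sqr_integrable gw'; last exact: progressive_path.
  by rewrite /= lebesgue_measure_itv/= lte_fin T0 ltry.
Qed.

Lemma increment_cat Zw i u v w : path_ok i w -> 0 <= u -> u <= v -> v <= T ->
  increment Zw i u T w = increment Zw i u v w + increment Zw i v T w.
Proof.
move=> [gw iF ig ir] u0 uv vT; rewrite /increment.
rewrite (Rint_itv_cat u0 uv vT iF) (Rint_itv_cat u0 uv vT ig) (Rint_itv_cat u0 uv vT ir).
by rewrite (pm_cat gw (@reduce_U_mpred i) uv vT); ring.
Qed.

Lemma increment_right_cont Zw i s w : path_ok i w -> 0 <= s -> s < T ->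
  {within `[0, T], continuous (Zw i ^~ w)} -> {within `[0, T], continuous (K i ^~ w)} ->
  increment Zw i v T w @[v --> s^'+] --> increment Zw i s T w.
Proof.
move=> [gw iF ig ir] s0 sT cZ cK.
have wr (z : R -> R) : {within `[0, T], continuous z} -> z v @[v --> s^'+] --> z s.
  move=> /(continuous_within_itvP _ T0)[cz z0 _].
  move: s0; rewrite le_eqVlt => /predU1P[<-//|s0].
  by apply: cvg_at_right_filter; apply: cz; rewrite in_itv/= s0.
rewrite /increment; apply: cvgD; last by apply: cvgB; [exact: cvg_cst|exact: wr].
apply: cvgB; last by apply: cvgB; [exact: cvg_cst|exact: wr].
apply: cvgD; last exact: Rint_itv_right_cont.
apply: cvgB; last exact: (pm_right_cont gw (@reduce_U_mpred i) s0).
by apply: cvgD; exact: Rint_itv_right_cont.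
Qed.

(** The system gives the equation almost surely at each fixed time. It is first obtained at all
    rational times, then at all times by right continuity of both sides, so that it may be used at
    random switching times. *)
Lemma Y_equation : exists Zw : 'I_m -> R -> Omega -> R,
  [/\ forall i, martingale2 P F 0 T (Zw i),
      forall i, \forall w \ae P, {within `[0, T], continuous (Zw i ^~ w)} &
      forall i, \forall w \ae P, Y i T w = xi i w /\
        forall u v, 0 <= u -> u <= v -> v <= T -> Y i u w = Y i v w + increment Zw i u v w].
Proof.
have [HSp HE] := HY.
have H i : exists Zw : R -> Omega -> R, is_ito_integral P F T W (Z i) Zw /\
    \forall w \ae P, Y i T w = xi i w /\
        forall u v, 0 <= u -> u <= v -> v <= T -> Y i u w = Y i v w + increment (fun=> Zw) i u v w.
  have [[Zw iZ EY] _ _] := HE i; exists Zw; split=> //.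
  have [mU Ufin] := U_fin i; have [_ b0] := midbetaP.
  have rd := reduce_dA T0 mU (mrho i) (fun t w e => HS.1 i t w e) b0 Ufin.
  have rp := reduce_pm T0 mU b0 Ufin.
  have EY' t : 0 <= t <= T -> \forall w \ae P, Y i t w = xi i w + increment (fun=> Zw) i t T w.
    move=> tT; have /andP[t0 tT'] := tT.
    apply: filterS3 (EY t tT) rd rp => w -> [_ rdw] rpw.
    rewrite /increment -(rdw t T t0 tT' (lexx T)) -(rpw t T t0 (lexx T)); ring.
  (* Rationals are enumerated by [unpickle], which turns the countable family of null sets into one
     indexed by [nat]. *)
  have EQ : \forall w \ae P, forall n, if (unpickle n : option rat) is Some q then
      0 <= (ratr q : R) <= T -> Y i (ratr q) w = xi i w + increment (fun=> Zw) i (ratr q) T w else True.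
    apply: ae_foralln => n; case: (unpickle n : option rat) => [q|]; last exact: aeW.
    have [h|h] := boolP (0 <= (ratr q : R) <= T); first by apply: filterS (EY' _ h) => w.
    exact: aeW.
  have T0' : 0 <= T <= T by rewrite ltW ?lexx.
  have [_ cY _ _ cK] := HSp i; have [_ cZ _] := iZ.
  have h1 := ae_and (path_ok_ae i) (ae_and cY cK).
  have h2 := ae_and (EY' T T0') cZ.
  apply: filterS3 EQ h1 h2 => w EQw [pw [[cYw _] [_ cKw]]] [ETw cZw].
  have inc0 : increment (fun=> Zw) i T T w = 0.
    have := increment_cat (fun=> Zw) pw (ltW T0) (lexx T) (lexx T).
    by move: (increment _ _ _ _ _) => x; lra.
  have YT : Y i T w = xi i w by rewrite ETw inc0 addr0.
  split=> //.
  have Yall t : 0 <= t -> t <= T -> Y i t w = xi i w + increment (fun=> Zw) i t T w.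
    move=> t0; rewrite le_eqVlt => /predU1P[->|tT]; first exact: ETw.
    pose D s := Y i s w - (xi i w + increment (fun=> Zw) i s T w).
    apply/eqP; rewrite -subr_eq0; apply/eqP; apply: (@right_cont_rat_eq0 R D t T tT).
      apply: cvgB; first by apply: cYw; rewrite t0.
      apply: cvgD; first exact: cvg_cst.
      exact: (increment_right_cont (Zw := fun=> Zw)).
    move=> q /andP[tq qT]; have := EQw (pickle q); rewrite pickleK => /(_ _) EE.
    by rewrite /D EE ?subrr// (ltW qT) (ltW (le_lt_trans t0 tq)).
  move=> u v u0 uv vT; rewrite (Yall u u0 (le_trans uv vT)) (Yall v (le_trans u0 uv) vT).
  rewrite (increment_cat (fun=> Zw) pw u0 uv vT) -[RHS]addrA; congr (_ + _); exact: addrC.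
have [Zw HZ] := choice H; exists Zw; split=> i.
- by have [h _] := HZ i; exact: (ito_martingale2 h).
- by have [[_ h _] _] := HZ i.
- by have [_ h] := HZ i.
Qed.

Section Solution.
Variables (Zw : 'I_m -> proc).
Local Notation incr := (increment Zw).
Hypotheses
  (cZ : forall i, \forall w \ae P, {within `[0, T], continuous (Zw i ^~ w)})
  (YE : forall i, \forall w \ae P, Y i T w = xi i w /\
        forall u v, 0 <= u -> u <= v -> v <= T -> Y i u w = Y i v w + incr i u v w).

Section BarrierPath.
(** The path properties on which the pathwise arguments rest, valid simultaneously for all modes and
    all times. The barrier inequality is recorded candidate by candidate, as
    [Y^j - C(i, j) <= Y^i]. *)
Record regular (w : Omega) : Prop := Regular {
  reg_good : good w;
  reg_ok : forall i, path_ok i w;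
  reg_Z : forall i, {within `[0, T], continuous (Zw i ^~ w)};
  reg_K : forall i, {within `[0, T], continuous (K i ^~ w)};
  reg_Kle : forall i s t, 0 <= s <= t -> t <= T -> K i s w <= K i t w;
  reg_Y : forall i, cadlag T (Y i ^~ w);
  reg_YT : forall i, Y i T w = xi i w;
  reg_YE : forall i u v, 0 <= u -> u <= v -> v <= T -> Y i u w = Y i v w + incr i u v w;
  reg_C : forall i j, {within `[0, T], continuous (C i j ^~ w)};
  reg_C0 : forall i j t, 0 <= t <= T -> 0 <= C i j t w;
  reg_Cii : forall i t, 0 <= t <= T -> C i i t w = 0;
  reg_loop : forall i j l, i != j -> j != l ->
    0 < inf [set C i j t w + C j l t w - C i l t w | t in `[0, T]];
  reg_barrier : forall i j t, j != i -> 0 <= t <= T -> Y j t w - C i j t w <= Y i t w;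
  reg_flat : forall i, (\int[path_diff (fun s => K i (Num.min s T) w)]_(s in `]0%R, T])
             (Y i s w - barrier C Y i s w)%:E = 0)%E }.

Arguments reg_Z {w} _ _.
Arguments reg_K {w} _ _.
Arguments reg_C {w} _ _ _.
Arguments reg_Y {w} _ _.
Arguments reg_ok {w} _ _.

Lemma Y_progressive i : progressive F T (Y i).
Proof.
have [HSp _] := HY; have [_ _ /(_ (midbeta)) h _ _] := HSp i.
by have [bb _] := midbetaP; have [[]] := h bb.
Qed.

Lemma regular_ae : \forall w \ae P, regular w.
Proof.
have [HSp HE] := HY; have [_ _ _ [_ hC hloop _] _] := HD.
have h1 : \forall w \ae P, forall i, [/\ path_ok i w, cadlag T (Y i ^~ w),
    K i 0 w = 0 /\ {within `[0, T], continuous (K i ^~ w)},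
    cadlag T (K i ^~ w) /\ forall s t, 0 <= s <= t -> t <= T -> K i s w <= K i t w &
    {within `[0, T], continuous (Zw i ^~ w)}].
  apply: filter_forall => i; have [_ cY _ [_ incK _] cK] := HSp i.
  apply: filterS3 (ae_and (path_ok_ae i) cY) (ae_and cK incK) (cZ i).
  by move=> w [? ?] [? ?] ?; split.
have h2 : \forall w \ae P, forall i, (Y i T w = xi i w /\
        forall u v, 0 <= u -> u <= v -> v <= T -> Y i u w = Y i v w + incr i u v w) /\
    (\int[path_diff (fun s => K i (Num.min s T) w)]_(s in `]0%R, T])
             (Y i s w - barrier C Y i s w)%:E = 0)%E.
  by apply: filter_forall => i; have [_ _ fl] := HE i; exact: ae_and.
have h3 : \forall w \ae P, forall i j, [/\ {within `[0, T], continuous (C i j ^~ w)},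
                i != j -> forall t, 0 <= t <= T -> 0 <= C i j t w
              & i = j -> forall t, 0 <= t <= T -> C i j t w = 0].
  by apply: filter_forall => i; apply: filter_forall => j; exact: hC.
have h4 : \forall w \ae P, forall i j l, i != j -> j != l ->
    0 < inf [set C i j t w + C j l t w - C i l t w | t in `[0, T]].
  apply: filter_forall => i; apply: filter_forall => j; apply: filter_forall => l.
  have [ij|ij] := boolP (i != j); last by apply: aeW => w.
  have [jl|jl] := boolP (j != l); last by apply: aeW => w.
  by apply: filterS (hloop i j l ij jl) => w.
have h5 : \forall w \ae P, forall n, if (unpickle n : option rat) is Some q then
      0 <= (ratr q : R) <= T -> forall i, barrier C Y i (ratr q) w <= Y i (ratr q) w else True.
  apply: ae_foralln => n; case: (unpickle n : option rat) => [q|]; last exact: aeW.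
  have [h|h] := boolP (0 <= (ratr q : R) <= T); last exact: aeW.
  have : \forall w \ae P, forall i, barrier C Y i (ratr q) w <= Y i (ratr q) w.
    by apply: filter_forall => i; have [_ hb _] := HE i; exact: hb.
  by apply: filterS => w.
have h6 : \forall w \ae P, forall i, barrier C Y i T w <= Y i T w.
  by apply: filter_forall => i; have [_ hb _] := HE i; apply: hb; rewrite ltW ?lexx.
have h12 := ae_and good_ae (ae_and h1 h2).
apply: filterS3 h12 (ae_and h3 h4) (ae_and h5 h6) => w [gw [H1 H2]] [H3 H4] [H5 H6].
split=> //.
- by move=> i; have [] := H1 i.
- by move=> i; have [] := H1 i.
- by move=> i; have [_ _ []] := H1 i.
- by move=> i; have [_ _ _ []] := H1 i.
- by move=> i; have [] := H1 i.
- by move=> i; have [[]] := H2 i.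
- by move=> i; have [[]] := H2 i.
- by move=> i j; have [] := H3 i j.
- move=> i j t tT; have [_ h0 h0'] := H3 i j.
  by have [ij|ij] := eqVneq i j; [rewrite h0'|exact: h0].
- by move=> i t tT; have [_ _] := H3 i i; exact.
(* The barrier inequality is known at rational times and at [T]; right continuity covers the other
   times. *)
- move=> i j t ji /andP[t0]; have cb := fun t => (barrierP C Y m2 i t w).2 j ji.
  rewrite le_eqVlt => /predU1P[->|tT]; first exact: le_trans (cb T) (H6 i).
  pose D s := Y i s w - (Y j s w - C i j s w).
  rewrite -subr_ge0; apply: (@right_cont_rat_ge0 R D t T tT).
    have cYr k : Y k s w @[s --> t^'+] --> Y k t w.
      by have [_ [+ _] _ _ _] := H1 k; apply; rewrite t0.
    apply: cvgB; first exact: cYr.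
    apply: cvgB; first exact: cYr.
    by have [cC _ _] := H3 i j; exact: within_right_cvg T0 t0 tT cC.
  move=> q /andP[tq qT]; rewrite subr_ge0; apply: le_trans (cb _) _.
  have := H5 (pickle q); rewrite pickleK; apply.
  by rewrite (ltW qT) (ltW (le_lt_trans t0 tq)).
- by move=> i; have [] := H2 i.
Qed.

Lemma reg_cont_incr i w : regular w -> cont_incr (fun s => K i (Num.min s T) w).
Proof.
move=> rw; split.
  move=> s t /andP[s0 st]; have st' : Num.min s T <= Num.min t T by rewrite le_min !ge_min st lexx orbT.
  by apply: (reg_Kle rw); rewrite ?st' ?andbT ?le_min ?s0 ?(ltW T0)// ge_min lexx orbT.
have kc : {within `[0, T], continuous (K i ^~ w)} by exact: reg_K.
have h x : `[0, T]%classic (Num.max 0 (Num.min x T)).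
  by rewrite /= in_itv/= le_max lexx/= ge_max (ltW T0) ge_min lexx orbT.
have cc := within_comp_continuous kc (@clamp_continuous R 0 T) h.
have cc' : {within `[0, +oo[%classic, continuous ((K i ^~ w) \o (fun x : R => Num.max 0 (Num.min x T)))} by exact: continuous_subspaceT.
apply: (subspace_eq_continuous _ cc') => v.
rewrite inE/= in_itv/= andbT => v0.
change (K i (Num.max 0 (Num.min v T)) w = K i (Num.min v T) w).
by rewrite max_r// le_min v0 ltW.
Qed.

(** [Y - barrier] is nonnegative with zero [dK]-integral, so [dK] does not charge the open interval
    where it is positive. The barrier may be reached at [v] itself; left continuity of [K] covers
    that end point. *)
Lemma K_flat i w u v : regular w -> 0 <= u -> u < v -> v <= T ->
  (forall s, u < s < v -> barrier C Y i s w < Y i s w) -> K i u w = K i v w.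
Proof.
move=> rw u0 uv vT pos.
pose mu := path_diff (fun s => K i (Num.min s T) w).
have cK := reg_cont_incr i rw.
have mI : measurable (rset R `]0, T]) by exact: measurable_itv.
pose D s := Y i s w - barrier C Y i s w.
have mC j : measurable_fun (rset R `]0, T]) (C i j ^~ w).
  have : measurable_fun (rset R `[0, T]) (C i j ^~ w).
    by apply: subspace_continuous_measurable_fun; [exact: measurable_itv|exact: reg_C rw i j].
  apply: measurable_funS; first exact: measurable_itv.
  by move=> s /=; rewrite !in_itv/= => /andP[/ltW -> ->].
have mY j : measurable_fun (rset R `]0, T]) (Y j ^~ w).
  exact: (progressive_path w (Y_progressive j)).
have mD : measurable_fun (rset R `]0, T]) D.
  by apply: measurable_funB => //; exact: barrier_path_measurable.
have D0 s : 0 <= s <= T -> 0 <= D s.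
  move=> sT; rewrite /D subr_ge0; have [[j ji ->] _] := barrierP C Y m2 i s w.
  exact: (reg_barrier rw).
have : ae_eq mu (rset R `]0, T]) (EFin \o D) (cst 0%E).
  apply/ae_eq_integral_abs => //; first exact/measurable_EFinP.
  rewrite -[RHS](reg_flat rw i); apply: eq_integral => s; rewrite inE/= in_itv/= => /andP[/ltW s0 sT].
  by rewrite ger0_norm// D0// s0.
move=> [N [mN N0 subN]].
have null : (rset R `]u, v[) `<=` N.
  move=> s; rewrite /= in_itv/= => /andP[us sv]; apply: subN => /= h.
  have /h [Ds] : (rset R `]0, T]) s.
    by rewrite /= in_itv/= (le_lt_trans u0 us) (le_trans (ltW sv)).
  have := pos s; rewrite us sv => /(_ isT); rewrite -subr_gt0 -/(D s).
  by move: Ds => ->; rewrite ltxx.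
have Kc x : u < x < v -> K i x w = K i u w.
  move=> /andP[ux xv]; have := path_diff_itv cK u0 (ltW ux).
  rewrite (min_l (le_trans (ltW xv) vT)) (min_l (le_trans (ltW uv) vT)).
  have sx : (rset R `]u, x]) `<=` N.
    by move=> s /=; rewrite in_itv/= => /andP[us sx]; apply: null; rewrite /= in_itv/= us (le_lt_trans sx).
  have -> : path_diff (fun s => K i (Num.min s T) w) `]u, x]%classic = 0%E.
    apply: le_anti; rewrite measure_ge0 andbT -[leRHS]N0.
    by apply: le_measure; rewrite ?inE//; exact: measurable_itv.
  by move=> [/eqP]; rewrite eq_sym subr_eq0 => /eqP.
have cv := within_left_cvg T0 (le_lt_trans u0 uv) vT (reg_K rw i).
apply/esym; apply: (cvg_unique _ cv) => //.
apply: cvg_near_cst; near=> x; apply: Kc; apply/andP; split; near: x.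
  exact: nbhs_left_gt.
exact: nbhs_left_lt.
Unshelve. all: by end_near.
Qed.

(** Away from the jumps of [p] every term of the equation is continuous in time, [dA] and Lebesgue
    measure having no atoms. *)
Lemma Y_continuous_no_jump i w a b : regular w -> 0 <= a -> a < b -> b <= T ->
  (forall n, ~~ jump a b w n) -> {within `[a, b], continuous (Y i ^~ w)}.
Proof.
move=> rw a0 ab bT nj; have gw := reg_good rw; have [_ iF ig ir] := reg_ok rw i.
have [N NT] := good_jump_lt b gw.
pose y v := (\int[dA A w]_(s in `]v, T]) f i s w + \int[lebesgue_measure]_(s in `]v, T]) g i s w
  + \int[dA A w]_(s in `]v, T]) phint (fun s w e => clip (rho i) s w e * reduce (U i) s w e) s w
  + Zw i v w - K i v w).
have Ey v : a <= v <= b -> Y i v w = Y i a w - y a + y v.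
  move=> /andP[av vb]; have vT := le_trans vb bT.
  rewrite (reg_YE rw i a0 av vT) /increment.
  have -> : \int[pm w]_(x in `]a, v] `*` setT) reduce (U i) x.1 w x.2 = 0.
    rewrite (pm_Rintegral a (mpred_path w (reduce_U_mpred i)) (N := N)); last first.
      by move=> n /NT; apply: le_lt_trans; rewrite lee_fin.
    rewrite big_pred0// => n; apply/negbTE; have := nj n; apply: contra.
    by move=> /andP[h1 h2]; rewrite /jump h1 (le_trans h2)// lee_fin.
  rewrite /y (Rint_itv_cat a0 av vT iF) (Rint_itv_cat a0 av vT ig) (Rint_itv_cat a0 av vT ir).
  do 6 (move: (Rintegral _ _ _) => ?).
  by move: (Y i v w) (Zw i v w) (Zw i a w) (K i v w) (K i a w) => *; ring.
have cy : {within `[0, T], continuous y}.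
  have dA0 s : 0 < s -> dA A w [set s] = 0%E by move=> s0; exact: (dA_set1 gw).
  have leb0 s : 0 < s -> lebesgue_measure ([set s] : set (measurableTypeR R)) = 0%E by move=> _; exact: lebesgue_measure_set1.
  have c1 := Rint_continuous T0 dA0 iF; have c2 := Rint_continuous T0 leb0 ig.
  have c3 := Rint_continuous T0 dA0 ir.
  move=> x; apply: cvgB; last exact: (reg_K rw i x).
  apply: cvgD; last exact: (reg_Z rw i x).
  by apply: cvgD; [apply: cvgD; [exact: (c1 x)|exact: (c2 x)]|exact: (c3 x)].
have sub : (`[a, b]%classic : set R) `<=` `[0, T]%classic.
  by move=> s /=; rewrite !in_itv/= => /andP[as_ sb]; rewrite (le_trans a0 as_) (le_trans sb).
have cy' : {within `[a, b], continuous (fun v => Y i a w - y a + y v)}.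
  move=> x; apply: cvgD; first exact: cvg_cst.
  have cy2 : {within `[a, b], continuous y} by exact: (continuous_subspaceW sub cy).
  exact: (cy2 x).
apply: (subspace_eq_continuous _ cy') => v; rewrite inE/= in_itv/= => vab.
by change (Y i a w - y a + y v = Y i v w); rewrite (Ey v vab).
Qed.

End BarrierPath.

(** * Comparison of the payoff with the solution *)

Section Payoff.
Variables (t : R) (i : 'I_m) (a : @strategy R dO Omega m).
Hypotheses (t0 : 0 <= t) (tT : t < T) (Sa : strategies_from P Tn zeta W T t i a).
Local Notation th := (theta a).
Local Notation al := (alpha a).
Definition run_rho : hfun := sel a (fun j => clip (rho j)).
Definition run_U : hfun := sel a (fun j => reduce (U j)).

Lemma run_rho_mpred : mpred run_rho.
Proof. by apply: (sel_mpred t0 Sa) => j; exact: mark_predictable_mpred. Qed.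

Lemma run_U_mpred : mpred run_U.
Proof. by apply: (sel_mpred t0 Sa) => j; exact: reduce_U_mpred. Qed.

Lemma run_rho_bdd s w e : 0 <= run_rho s w e <= Num.max M 1.
Proof.
apply: (sel_bdd Sa); first by rewrite le_max ler01 orbT.
by move=> j; apply: clip_bdd => t' w' e' h; exact: HS.1.
Qed.

Lemma density_ratioE w : density_ratio Tn zeta phi A T rho a t w = Lam run_rho t T w.
Proof.
have EE s e : t < s <= T -> rho_of rho a s w e = run_rho s w e.
  move=> /andP[ts sT]; rewrite (rho_ofE Sa) /run_rho /sel; apply: eq_bigr => j _.
  by rewrite /clip (le_trans t0 (ltW ts)) sT.
rewrite /density_ratio /Lam /jprod /cint; congr (_ * _).
  congr (limn _); apply/funext => N; apply: eq_bigr => n jn; rewrite /jr EE//.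
  by move: jn; rewrite -/(jump t T w n) jump_fin => /andP[].
congr expR; apply: eq_Rintegral => s; rewrite inE/= in_itv/= => /[dup] sT /andP[ts _].
by rewrite /phint (le_trans t0 (ltW ts)); apply: eq_Rintegral => e _; rewrite EE.
Qed.

Definition run_S (w : Omega) : R := \int[pm w]_(x in `]t, T] `*` setT) run_U x.1 w x.2.
Definition run_V (w : Omega) : R :=
  \int[dA A w]_(s in `]t, T]) phint (fun s w e => run_rho s w e * run_U s w e) s w.

(** [n] indexes the period during which [T] is reached: exactly [n] switches occur strictly before
    [T], and only these are charged. *)
Definition last_switch w n := (forall k, (k <= n)%N -> th k w < T) /\ th n.+1 w = T.

Lemma last_switch_ex w : (exists N, th N w = T) -> exists n, last_switch w n.
Proof.
move=> ex; have exb : exists N, th N w == T by have [N hN] := ex; exists N; apply/eqP.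
case: (ex_minnP exb) => -[|n] /eqP hn nmin; first by move: tT; rewrite -hn (strategy_th0 Sa) ltxx.
exists n; split=> // k kn; rewrite lt_neqAle (strategy_leT Sa) andbT; apply/negP => /nmin.
by rewrite leqNgt ltnS kn.
Qed.

Lemma total_costE w n : last_switch w n ->
  total_cost T C a w = (\sum_(k < n) C (al k w) (al k.+1 w) (th k.+1 w) w)%:E.
Proof.
move=> [hlt hT]; rewrite /total_cost; apply/cvg_lim; first exact: ereal_hausdorff.
apply: cvg_near_cst; near=> s.
have sT : s < T by near: s; exact: nbhs_left_lt.
have ns : th n w < s by near: s; apply: nbhs_left_gt; exact: hlt.
have thw k := strategy_thS Sa w k.
apply/cvg_lim; first exact: ereal_hausdorff.
apply: cvg_near_cst; exists n => // N /= nN.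
rewrite (@big_cat_nat _ _ _ n)//= [X in (_ + X)%E]big_nat_cond [X in (_ + X)%E]big1 ?adde0.
  rewrite big_mkord sumEFin; congr EFin; apply: eq_bigr => k _.
  rewrite (_ : (_ <= s) = true) ?mulr1//; apply: le_trans (ltW ns).
  by apply: (step_mono thw); exact: ltn_ord.
move=> k /andP[/andP[nk _] _]; rewrite (_ : (_ <= s) = false) ?mulr0//.
apply/negbTE; rewrite -ltNge (lt_le_trans sT)// -hT; exact: (step_mono thw).
Unshelve. all: by end_near.
Qed.

(** Two sources of loss are excluded: growth of [K] inside a period and a strict inequality at a
    switch. The conditions are open at the ends of a period, where continuity of [K] takes over, and
    leave out a switch decided at [T], which is free. *)
Definition optimal_path w :=
  (forall k s, th k w < s < th k.+1 w -> barrier C Y (al k w) s w < Y (al k w) s w) /\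
  forall k, th k.+1 w < T -> Y (al k w) (th k.+1 w) w =
    Y (al k.+1 w) (th k.+1 w) w - C (al k w) (al k.+1 w) (th k.+1 w) w.

(** The equation of the mode in force is used on each period, and the sum over the periods is
    rearranged by [sum_switch]. *)
Lemma payoff_identity w : regular w -> (exists N, th N w = T) ->
  exists kappa : R, [/\ 0 <= kappa, payoff A T xi f g C t a w =
    (Y i t w + (run_S w - run_V w + switched_integral a Zw w) - kappa)%:E &
    optimal_path w -> kappa = 0].
Proof.
move=> rw /last_switch_ex[n ln]; have [hlt hT] := ln.
have thw k := strategy_thS Sa w k; have th0 := strategy_th0 Sa w.
have thge k : 0 <= th k w := le_trans t0 (strategy_ge Sa w k).
have thT k : th k w <= T := strategy_leT Sa w k.
have gw := reg_good rw.
have al0 : al 0 w = i by have [_ _ /(_ w)[]] := Sa.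
have modeT : mode_at a T w = al n w by apply: (mode_atE Sa); rewrite hlt// hT lexx.
have mI (u v : R) : measurable (rset R `]u, v]) by exact: measurable_itv.
have sub k : (rset R `]th k w, th k.+1 w]) `<=` `]0, T]%classic.
  by move=> s /=; rewrite !in_itv/= => /andP[h1 h2]; rewrite (le_lt_trans (thge k) h1) (le_trans h2).
have cells (nu : {measure set (measurableTypeR R) -> \bar R}) (X : 'I_m -> R -> R) (y : R -> R) :
    (forall j, nu.-integrable (rset R `]0, T]) (EFin \o X j)) ->
    (forall k s, th k w < s <= th k.+1 w -> y s = X (al k w) s) ->
    \int[nu]_(s in `]t, T]) y s = \sum_(k < n.+1) \int[nu]_(s in `]th k w, th k.+1 w]) X (al k w) s.
  move=> iX yX; rewrite -th0 -hT.
  apply: (step_Rintegral (th := fun k => th k w) thw (X := fun k => X (al k w)) _ _).2.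
    by move=> k _; apply: integrableS (iX (al k w)); [exact: mI|exact: mI|exact: sub].
  by move=> k s _; exact: yX.
have iF j : itg (dA A w) 0 T (f j ^~ w) by have [] := reg_ok rw j.
have ig j : itg lebesgue_measure 0 T (g j ^~ w) by have [] := reg_ok rw j.
have ir j : (dA A w).-integrable (rset R `]0, T])
   (EFin \o (phint (fun s w e => clip (rho j) s w e * reduce (U j) s w e) ^~ w)) by have [] := reg_ok rw j.
have EF := cells (dA A w) (fun j s => f j s w) (fun s => f (mode_at a s w) s w) iF
  (fun k s sk => congr1 (fun j => f j s w) (mode_atE Sa sk)).
have EG := cells lebesgue_measure (fun j s => g j s w) (fun s => g (mode_at a s w) s w) ig
  (fun k s sk => congr1 (fun j => g j s w) (mode_atE Sa sk)).
have EV : run_V w = \sum_(k < n.+1) \int[dA A w]_(s in `]th k w, th k.+1 w])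
    phint (fun s w e => clip (rho (al k w)) s w e * reduce (U (al k w)) s w e) s w.
  apply: (cells (dA A w) (fun j s => phint (fun s w e => clip (rho j) s w e * reduce (U j) s w e) s w)) ir _ => k s sk.
  rewrite /phint; case: ifP => // _; apply: eq_Rintegral => e _.
  by rewrite /run_rho /run_U !(selE Sa _ _ sk).
have ES : run_S w = _ := pm_step Sa gw hT reduce_U_mpred run_U_mpred (fun k s e sk => selE Sa (fun j => reduce (U j)) e sk).
have EI := switched_integralE Sa Zw hT.
pose dK k := K (al k w) (th k.+1 w) w - K (al k w) (th k w) w.
pose dY k := Y (al k w) (th k.+1 w) w - Y (al k.+1 w) (th k.+1 w) w.
pose c k := C (al k w) (al k.+1 w) (th k.+1 w) w.
have dK0 k : 0 <= dK k by rewrite subr_ge0; apply: (reg_Kle rw); rewrite ?thge ?thw ?thT.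
have slack0 k : 0 <= dY k + c k.
  have [Sa' _ _] := Sa; have [_ _ _ _ /(_ w) ne] := Sa' k.
  by have := reg_barrier rw ne (t := th k.+1 w); rewrite thge thT => /(_ isT); rewrite /dY /c -subr_ge0 => h; apply: le_trans h _; rewrite le_eqVlt; apply/orP; left; apply/eqP; ring.
(* The loss consists of the growth of the [K] of the modes in force and of the slack
   [Y^i - (Y^j - C(i, j))] at each switch before [T]. *)
exists (\sum_(k < n.+1) dK k + \sum_(k < n) (dY k + c k)); split.
- by apply: addr_ge0; apply: sumr_ge0.
- rewrite /payoff (total_costE ln) modeT EF EG -EFinB; congr EFin.
  have := sum_switch (fun k => Y (al k w) (th k w) w) (fun k => Y (al k w) (th k.+1 w) w) n.
  rewrite th0 al0 hT (reg_YT rw).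
  set SY := \sum_(k < n.+1) _ => ESY.
  have ESI : SY = \sum_(k < n.+1) incr (al k w) (th k w) (th k.+1 w) w.
    by apply: eq_bigr => k _; rewrite (reg_YE rw (al k w) (thge k) (thw k) (thT k.+1)) addrC addKr.
  have E1 : \sum_(k < n.+1) \int[dA A w]_(s in `]th k w, th k.+1 w]) f (al k w) s w +
      \sum_(k < n.+1) \int[lebesgue_measure]_(s in `]th k w, th k.+1 w]) g (al k w) s w -
      run_S w + run_V w - switched_integral a Zw w + \sum_(k < n.+1) dK k = SY.
    by rewrite ESI ES EV EI -big_split/= -sumrB -big_split/= -sumrB -big_split.
  have E3 : \sum_(k < n) (dY k + c k) = \sum_(k < n) dY k + \sum_(k < n) c k by rewrite big_split.
  rewrite E3; move: ESY E1.
  move: (\sum_(k < n) dY k) (\sum_(k < n.+1) dK k) SY {ESI} => x1 x2 x3.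
  move: (\sum_(k < n) c k) => x4.
  move: (\sum_(k < n.+1) _) (\sum_(k < n.+1) _) => x5 x6.
  move: (run_S w) (run_V w) (switched_integral a Zw w) (Y i t w) (xi _ w) => x7 x8 x9 x10 x11 E1 E2.
  lra.
- move=> [flat sw]; rewrite [X in X + _]big1 ?add0r => [|k _].
    rewrite big1// => k _; rewrite /dY /c sw; first by ring.
    by apply: hlt; exact: ltn_ord.
  rewrite /dK; apply/eqP; rewrite subr_eq0; apply/eqP.
  move: (thw k); rewrite le_eqVlt => /predU1P[->//|kk].
  by apply/esym; apply: (K_flat rw (thge k) kk (thT _)) => s; exact: flat.
Qed.

End Payoff.

Section PayoffMeasurable.
Variables (t : R) (i : 'I_m) (a : @strategy R dO Omega m).
Hypotheses (t0 : 0 <= t) (tT : t < T) (Sa : strategies_from P Tn zeta W T t i a).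
Local Notation th := (theta a).
Local Notation al := (alpha a).
Let on_ppred j : ppred (fun s w => \1_(on_mode a j) (s, w) : R).
Proof.
rewrite /ppred (_ : (fun x => _) = \1_(on_mode a j)); last by apply/funext => -[].
by apply: measurable_indic; exact: (on_mode_meas t0 Sa).
Qed.

Let sel_progressive (X : 'I_m -> proc) : (forall j, progressive F T (X j)) ->
  measurable_fun ([set z | 0 < z.2 <= T] : set (FT T * measurableTypeR R))
    (fun z => \sum_(j < m) \1_(on_mode a j) (z.2, z.1) * X j z.2 z.1).
Proof.
move=> pX; apply: measurable_sum => j; apply: measurable_funM.
  exact: (ppred_progressive (ltW T0) (on_ppred j)).
by apply: progressive_measurable (pX j); rewrite ltW ?lexx.
Qed.

(** The payoff evaluates [f], [g] and [xi] at the mode in force, for which no measurability is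
    visible. [B] replaces this by sums over modes weighted by predictable indicators, and the cost
    by a limit of measurable partial sums. *)
Lemma payoff_measurable : exists2 B : Omega -> R, measurable_fun setT B &
  \forall w \ae P, payoff A T xi f g C t a w = (B w)%:E.
Proof.
have [_ hxi hfg [hC _ _ _] _] := HD.
pose Bx w := \sum_(j < m) \1_(on_mode a j) (T, w) * xi j w.
pose Bf w := \int[dA A w]_(s in `]t, T]) \sum_(j < m) \1_(on_mode a j) (s, w) * f j s w.
pose Bg w := \int[lebesgue_measure]_(s in `]t, T]) \sum_(j < m) \1_(on_mode a j) (s, w) * g j s w.
pose Dn N w := \sum_(k < N) C (al k w) (al k.+1 w) (th k.+1 w) w * (th k.+1 w < T)%R%:R.
pose D w := limn (Dn ^~ w).
have mBx : measurable_fun setT Bx.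
  apply: measurable_sum => j; apply: measurable_funM.
    exact: (F_fun_measurable (ppred_fixed_time T0 (on_ppred j))).
  by have [mx _] := hxi j; exact: (F_fun_measurable mx).
have mBf : measurable_fun setT Bf.
  apply: (F_fun_measurable (t := T)).
  apply: (dA_Rint_measurable t0 (ltW T0)); apply: sel_progressive => j.
  by have [[]] := hfg j.
have mBg : measurable_fun setT Bg.
  apply: (leb_Rint_measurable (X := fun s w => \sum_(j < m) \1_(on_mode a j) (s, w) * g j s w) T0 t0); apply: sel_progressive => j.
  by have [_ [pg _]] := hfg j; exact: pg ord0.
have al_ind k j : measurable_fun setT (fun w => (al k w == j)%:R : R).
  rewrite (_ : (fun w => _) = \1_[set w | al k w = j]).
    apply: measurable_indic; apply: (F_measurable (t := T)).
    have := strategy_alpha Sa k j (ltW T0).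
    rewrite (_ : [set w | th k w <= T] = setT) ?setIT//.
    by apply/seteqP; split=> w //= _; exact: (strategy_leT Sa).
  apply/funext => w; rewrite indicE; congr (_%:R); congr nat_of_bool.
  by apply/eqP/idP; rewrite inE.
have mDn N : measurable_fun setT (Dn N).
  apply: measurable_sum => k; apply: measurable_funM.
    rewrite (_ : (fun w => _) = fun w => \sum_(j < m) \sum_(l < m)
        (al k w == j)%:R * (al k.+1 w == l)%:R * C j l (th k.+1 w) w).
      apply: measurable_sum => j; apply: measurable_sum => l; apply: measurable_funM.
        by apply: measurable_funM; exact: al_ind.
      apply: (F_fun_measurable (t := T)).
      apply: (random_time_meas (T := T) T0 (lexx T)).
      - move=> s sT; apply: (meas_on_le (fun s s' => @F_le s s') (s := s)); last exact: hC.
        by case/andP: sT.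
      - by have [_ _ _ [_ hCc _ _] _] := HD; apply: filterS (hCc j l) => w [].
      - have := stop_min_meas (strategy_stop Sa k.+1) (fun w => le_trans t0 (strategy_ge Sa w k.+1)) (ltW T0).
        rewrite (_ : (fun w => _) = th k.+1)//.
        by apply/funext => w; rewrite min_l// (strategy_leT Sa).
      - by move=> w; rewrite (le_trans t0 (strategy_ge Sa w k.+1)) (strategy_leT Sa).
    apply/funext => w; rewrite (bigD1 (al k w))//= (bigD1 (al k.+1 w))//= !eqxx !mul1r.
    rewrite [X in _ = _ + X + _]big1 ?addr0; last by move=> l /negbTE h; rewrite eq_sym h mulr0 mul0r.
    by rewrite big1 ?addr0// => j /negbTE h; apply: big1 => l _; rewrite eq_sym h !mul0r.
  rewrite (_ : (fun w => _) = \1_[set w | th k.+1 w < T]).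
    apply: measurable_indic; rewrite -[X in measurable X]setTI.
    exact: (measurable_fun_ltr (strategy_meas t0 tT Sa k.+1) (measurable_cst T)).
  apply/funext => w; rewrite indicE; congr (_%:R); congr nat_of_bool.
  by apply/idP/idP; rewrite inE.
have DE w n : last_switch a w n -> Dn ^~ w @ \oo --> \sum_(k < n) C (al k w) (al k.+1 w) (th k.+1 w) w.
  move=> [hlt hT]; apply: cvg_near_cst; exists n => // N /= nN.
  rewrite /Dn -(big_mkord xpredT (fun k => C (al k w) (al k.+1 w) (th k.+1 w) w * (th k.+1 w < T)%R%:R)).
  rewrite (@big_cat_nat _ _ _ n)//= [X in _ + X]big_nat_cond [X in _ + X]big1 ?addr0.
    by rewrite big_mkord; apply: eq_bigr => k _; rewrite hlt ?mulr1.
  move=> k /andP[/andP[nk _] _]; rewrite (_ : (_ < T) = false) ?mulr0//.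
  by apply/negbTE; rewrite -leNgt -hT; apply: (step_mono (fun k => strategy_thS Sa w k)).
have finw := strategy_fin_ae t0 tT Sa.
have mD : measurable_fun setT D.
  apply: (ae_measurable_cvg cP mDn); apply: filterS finw => w ex.
  have [n ln] := last_switch_ex tT Sa ex.
  by rewrite /D (cvg_lim _ (DE w n ln))//; exact: DE.
exists (fun w => Bx w + Bf w + Bg w - D w).
  by apply: measurable_funB => //; apply: measurable_funD => //; exact: measurable_funD.
apply: filterS finw => w ex; have [n ln] := last_switch_ex tT Sa ex; have [hlt hT] := ln.
have thw k := strategy_thS Sa w k.
have selm (X : 'I_m -> R) s : t < s <= T -> \sum_(j < m) \1_(on_mode a j) (s, w) * X j = X (mode_at a s w).
  rewrite -(strategy_th0 Sa w) -{1}hT => /andP[ts sT].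
  have [k _ sk] := step_exists (th := fun k => th k w) ts sT.
  rewrite (mode_atE Sa sk) (bigD1 (al k w))//= (on_modeE Sa _ sk) eqxx mul1r big1 ?addr0// => j jk.
  by rewrite (on_modeE Sa _ sk) eq_sym (negbTE jk) mul0r.
rewrite /payoff (total_costE Sa ln) -EFinB; congr EFin.
rewrite /D (cvg_lim _ (DE w n ln))//; congr (_ + _ + _ - _).
- by rewrite /Bx (selm (fun j => xi j w)) ?tT ?lexx.
- by apply: eq_Rintegral => s; rewrite inE/= in_itv/= => sT; rewrite (selm (fun j => f j s w)).
- by apply: eq_Rintegral => s; rewrite inE/= in_itv/= => sT; rewrite (selm (fun j => g j s w)).
Qed.

End PayoffMeasurable.

Lemma xi_L2 j : L2 P (xi j).
Proof.
have [bb /(_ j)[mx Ix] _ _ _] := HD.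
have mxi := F_fun_measurable mx; split=> //.
have mx2 : measurable_fun setT (fun w => xi j w ^+ 2) by exact: measurable_funX.
apply/integrableP; split; first exact/measurable_EFinP.
apply: le_lt_trans Ix; apply: ae_le_integral_dom => //.
- by apply/measurable_EFinP; exact: measurableT_comp.
- by move=> w; rewrite lee_fin mulr_ge0 ?expR_ge0 ?sqr_ge0.
apply: filterS good_ae => w gw.
rewrite /= ger0_norm ?sqr_ge0// lee_fin ler_peMl ?sqr_ge0// -[leLHS]expR0 ler_expR mulr_ge0//.
  by rewrite ltW// (le_lt_trans _ bb)// sqr_ge0.
by rewrite (A_ge0 gw)// ltW.
Qed.

(** * Orthogonality along a strategy and integrability of [Y] *)

Section RunMean.
Variables (t : R) (i : 'I_m).
Hypotheses (t0 : 0 <= t) (tT : t < T) (MZ : forall j, martingale2 P F 0 T (Zw j)).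
Local Notation Gam := (Gam t T M).
Let IA : I1 P (A T) := IA_T.

(** The sign of [M] is read off the bounds on [rho] at a point of [Omega]; total mass one provides
    such a point. *)
Let Omega_inh : exists w : Omega, True.
Proof.
apply: contrapT => h; have := @probability_setT _ _ _ P.
rewrite (_ : setT = set0); first by rewrite measure0 => /eqP; rewrite eqe eq_sym oner_eq0.
by apply/seteqP; split=> w // _; apply: h; exists w.
Qed.

Let M0 : 0 <= M.
Proof.
have [w _] := Omega_inh.
by have /andP[h1 h2] := HS.1 i 0 w point (introT andP (conj (lexx 0) (ltW T0))); exact: le_trans h1 h2.
Qed.

Lemma Gam_L2 : L2 P Gam /\ I1 P (fun w => Gam w ^+ 2 * A T w).
Proof.
have [_ [eta eta3 fin]] := HS.
have mA : measurable_fun setT (A T).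
  by have [_ mA _ _] := HC; exact: (F_fun_measurable (mA T (ltW T0))).
have Ie : I1 P (fun w => expR (eta * A T w)).
  apply/integrableP; split.
    by apply/measurable_EFinP; apply: measurableT_comp => //; exact: measurable_funM.
  by under eq_integral do rewrite /= ger0_norm ?expR_ge0//.
exact: (Gam_moments t0 tT IA M0 eta3 Ie).
Qed.

Let c1 : 1 <= Num.max M 1.
Proof. by rewrite le_max lexx orbT. Qed.

Let G2 := Gam_L2.1.
Let GA := Gam_L2.2.

Let qsum (s : R) (w : Omega) : R := \sum_(j < m) phint (fun s w e => reduce (U j) s w e ^+ 2) s w.

Let mI : measurable (rset R `]t, T]).
Proof. exact: measurable_itv. Qed.

Let subI : (rset R `]t, T]) `<=` `]0, T]%classic.
Proof. by move=> s /=; rewrite !in_itv/= => /andP[ts ->]; rewrite (le_lt_trans t0). Qed.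

Let qm j := let Uf := U_fin j in
  reduce_moment T0 Uf.1 (midbetaP).2 Uf.2.

Let q_int : \forall w \ae P, forall j : 'I_m,
  (dA A w).-integrable (rset R `]0, T])
    (EFin \o (phint (fun s w e => reduce (U j) s w e ^+ 2) ^~ w)).
Proof. by apply: filter_forall => j; have [] := qm j. Qed.

(** At each [(s, w)] the integrand coincides with some [reduce (U j)] or with zero, so its square
    integral is bounded by the sum over the finitely many modes. *)
Lemma run_orth (r u : hfun) (X : Omega -> R) kx : mpred r ->
  (forall s w e, 0 <= r s w e <= Num.max M 1) -> mpred u ->
  (forall s w, (exists j, forall e, u s w e = reduce (U j) s w e) \/ forall e, u s w e = 0) ->
  meas_on (F t) setT X -> (forall w, `|X w| <= kx) ->
  let S w := \int[pm w]_(x in `]t, T] `*` setT) u x.1 w x.2 in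
  let V w := \int[dA A w]_(s in `]t, T]) phint (fun s w e => r s w e * u s w e) s w in
  [/\ I1 P (fun w => Lam r t T w * S w), I1 P (fun w => Lam r t T w * V w) &
   EX P (fun w => X w * (Lam r t T w * (S w - V w))) = 0].
Proof.
move=> mr rc mu hu mX Xk S V.
have u2fin s w : (\int[phi s w]_e (u s w e ^+ 2)%:E < +oo)%E.
  have [[j hj]|h] := hu s w.
    rewrite (eq_integral (fun e => (reduce (U j) s w e ^+ 2)%:E)); first exact: reduce_fin.
    by move=> e _; rewrite hj.
  rewrite (eq_integral (cst 0%E)) ?integral0// => e _; by rewrite h expr0n.
have mu2 : mpred (fun s w e => u s w e ^+ 2) by exact: measurable_funX.
have q0 j s w : 0 <= phint (fun s w e => reduce (U j) s w e ^+ 2) s w.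
  by rewrite /phint; case: ifP => // _; apply: Rintegral_ge0 => e _; exact: sqr_ge0.
have uq s w : `|phint (fun s w e => u s w e ^+ 2) s w| <= qsum s w.
  have qs0 : 0 <= qsum s w by apply: sumr_ge0.
  have [[j hj]|h] := hu s w.
    rewrite (_ : phint _ s w = phint (fun s w e => reduce (U j) s w e ^+ 2) s w).
      by rewrite ger0_norm// /qsum (bigD1 j)//= lerDl; apply: sumr_ge0.
    by rewrite /phint; case: ifP => // _; apply: eq_Rintegral => e _; rewrite hj.
  rewrite (_ : phint _ s w = 0) ?normr0//.
  rewrite /phint; case: ifP => // _; rewrite -(EX_cst (phi s w) 0).
  by apply: eq_Rintegral => e _; rewrite h expr0n.
have qs_int w : (forall j : 'I_m, (dA A w).-integrable (rset R `]0, T])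
    (EFin \o (phint (fun s w e => reduce (U j) s w e ^+ 2) ^~ w))) ->
    itg (dA A w) t T (qsum ^~ w).
  move=> iq; rewrite (_ : EFin \o _ = fun s => (\sum_(j < m) (phint (fun s w e => reduce (U j) s w e ^+ 2) s w)%:E)%E).
    apply: integrable_sum => // j _; apply: integrableS (iq j) => //; exact: measurable_itv.
  by apply/funext => s; rewrite /= -sumEFin.
have mup w : measurable_fun (rset R `]t, T]) (phint (fun s w e => u s w e ^+ 2) ^~ w).
  by apply: measurable_funTS; exact: (ppred_path w (phint_ppred mu2)).
have u2int : \forall w \ae P, (dA A w).-integrable (rset R `]t, T])
    (EFin \o (phint (fun s w e => u s w e ^+ 2) ^~ w)).
  by apply: filterS q_int => w iq; apply: (integrable_le mI (mup w) (qs_int w iq)) => s _.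
have IQ : I1 P (fun w => \int[dA A w]_(s in `]t, T]) phint (fun s w e => u s w e ^+ 2) s w).
  apply: (@I1_le_ae _ _ _ P _ (fun w => \sum_(j < m)
     \int[dA A w]_(s in `]0, T]) phint (fun s w e => reduce (U j) s w e ^+ 2) s w)).
  - exact: (dA_phint_meas t0 (ltW tT) mu2).
  - by apply: I1_sum => j; have [] := qm j.
  apply: filterS2 u2int q_int => w iu iq.
  have iqt := qs_int w iq.
  apply: (@le_trans _ _ (\int[dA A w]_(s in `]t, T]) qsum s w)).
    apply: le_trans (le_normr_Rintegral mI iu) _.
    by apply: le_Rintegral => //; first [move=> s _; exact: uq|exact: integrable_abse iu].
  rewrite /qsum (_ : \int[dA A w]_(s in `]t, T]) _ = \sum_(j < m)
      \int[dA A w]_(s in `]t, T]) phint (fun s w e => reduce (U j) s w e ^+ 2) s w); last first.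
    have iqj (j : 'I_m) : (dA A w).-integrable (rset R `]t, T])
       (EFin \o (phint (fun s w e => reduce (U j) s w e ^+ 2) ^~ w)).
      by apply: integrableS (iq j) => //; exact: measurable_itv.
    rewrite /Rintegral (_ : (\int[_]_(s in _) _)%E = (\sum_(j < m)
        \int[dA A w]_(s in `]t, T]) (phint (fun s w e => reduce (U j) s w e ^+ 2) s w)%:E)%E); last first.
      by rewrite -integral_sum//; apply: eq_integral => s _; rewrite -sumEFin.
    by rewrite sum_fine// => j _; exact: (integrable_fin_num mI (iqj j)).
  apply: ler_sum => j _; rewrite (Rint_itv_cat (lexx 0) t0 (ltW tT) (iq j)) lerDr.
  by apply: Rintegral_ge0 => s _; exact: q0.
exact: (comp_L2_orth t0 tT IA G2 GA mr rc mu u2fin u2int IQ mX Xk).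
Qed.

Lemma strategy_orth (a : @strategy R dO Omega m) (X : Omega -> R) kx :
  strategies_from P Tn zeta W T t i a -> meas_on (F t) setT X -> (forall w, `|X w| <= kx) ->
  let L := Lam (run_rho a) t T in
  let Mt w := run_S t a w - run_V t a w + switched_integral a Zw w in
  [/\ I1 P L, measurable_fun setT Mt, I1 P (fun w => L w * Mt w) & EX P (fun w => X w * (L w * Mt w)) = 0].
Proof.
move=> Sa mX Xk L Mt.
have mr : mpred (run_rho a) by exact: (run_rho_mpred t0 Sa).
have rc := run_rho_bdd Sa.
have mu : mpred (run_U a) by exact: (run_U_mpred t0 Sa).
have hu s w : (exists j, forall e, run_U a s w e = reduce (U j) s w e) \/
    forall e, run_U a s w e = 0.
  have [[k sk]|h] := pselect (exists k, theta a k w < s <= theta a k.+1 w).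
    by left; exists (alpha a k w) => e; exact: (selE Sa _ _ sk).
  by right => e; exact: sel_out.
have [IS IV ESV] := run_orth mr rc mu hu mX Xk.
have cZ' j : \forall w \ae P, {within `[t, T], continuous (Zw j ^~ w)}.
  apply: filterS (cZ j) => w; apply: continuous_subspaceW.
  by move=> s /=; rewrite !in_itv/= => /andP[ts ->]; rewrite (le_trans t0).
have mZ j s : t <= s <= T -> measurable_fun setT (Zw j s).
  move=> /andP[ts sT]; have [mz _ _] := MZ j.
  by apply: (F_fun_measurable (t := s)); apply: mz; rewrite (le_trans t0).
have msi : measurable_fun setT (switched_integral a Zw) by exact: (switched_integral_meas t0 tT Sa cZ' mZ).
have [II EI] := strategy_integral_orth t0 tT IA G2 mr rc (fun j => martingale2S t0 (MZ j)) cZ'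
  (fun j n l _ => @on_grid_meas m t T i a t0 tT Sa j n l) (on_grid_le1 t T a) mX Xk msi
  (grid_switched_cvg t0 tT Sa cZ').
have IL : I1 P L := Lam_I1 t0 tT IA mr c1 rc.
have mS : measurable_fun setT (run_S t a) by exact: (pm_Rint_meas t0 (ltW tT) mu).
have mV : measurable_fun setT (run_V t a).
  by apply: (dA_phint_meas t0 (ltW tT)); exact: measurable_funM.
have mM : measurable_fun setT Mt by apply: measurable_funD => //; exact: measurable_funB.
have E1 w : L w * Mt w = (L w * run_S t a w - L w * run_V t a w)
    + L w * switched_integral a Zw w by rewrite /Mt mulrDr mulrBr.
have ILM : I1 P (fun w => L w * Mt w).
  rewrite (_ : (fun w => _) = fun w => (L w * run_S t a w - L w * run_V t a w)
    + L w * switched_integral a Zw w); last exact/funext.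
  by apply: I1D => //; exact: I1B.
split=> //.
have mX' := F_fun_measurable mX.
have bddX (h : Omega -> R) : I1 P h -> I1 P (fun w => X w * h w).
  move=> Ih; apply: I1_le (I1Z kx (I1_abs Ih)) _; first by apply: measurable_funM => //; exact: I1_meas Ih.
  by move=> w; rewrite normrM ler_wpM2r.
have I3 := bddX _ (I1B IS IV); have I4 := bddX _ II.
rewrite (_ : EX P _ = EX P (fun w => X w * (L w * run_S t a w - L w * run_V t a w) +
   X w * (L w * switched_integral a Zw w))); last first.
  by congr EX; apply/funext => w; rewrite E1 mulrDr.
rewrite (EXD I3 I4) EI addr0 -[RHS]ESV; congr EX; apply/funext => w.
by rewrite -mulrBr.
Qed.

(** With [x = Gam] the right-hand side leads to the moments [Gam^2 A_T] for [dA] and [Gam^2 T] for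
    Lebesgue measure, both integrable. *)
Lemma young_Rintegral (nu : {measure set (measurableTypeR R) -> \bar R}) (h : R -> R) (x mass : R) :
  0 <= x -> nu (rset R `]t, T]) = mass%:E ->
  itg nu 0 T h ->
  itg nu 0 T (fun s => h s ^+ 2) ->
  x * `|\int[nu]_(s in `]t, T]) h s| <= 2^-1 * (\int[nu]_(s in `]0, T]) h s ^+ 2 + x ^+ 2 * mass).
Proof.
move=> x0 nuE ih0 ih20.
have ih : itg nu t T h by apply: integrableS ih0 => //; exact: measurable_itv.
have ih2 : itg nu t T (fun s => h s ^+ 2).
  by apply: integrableS ih20 => //; exact: measurable_itv.
apply: (@le_trans _ _ (2^-1 * (\int[nu]_(s in `]t, T]) h s ^+ 2 + x ^+ 2 * mass))); last first.
  rewrite ler_wpM2l ?invr_ge0// lerD2r (Rint_itv_cat (lexx 0) t0 (ltW tT) ih20) lerDr.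
  by apply: Rintegral_ge0 => s _; exact: sqr_ge0.
have i1 : itg nu t T (fun=> x ^+ 2).
  apply/integrableP; split; first exact: measurable_cst.
  rewrite (eq_integral (cst (x ^+ 2)%:E)); last by move=> s _; rewrite /= ger0_norm ?sqr_ge0.
  by rewrite integral_cst//= nuE -EFinM ltry.
have ia := integrable_abse ih.
have ixa : itg nu t T (fun s => x * `|h s|) by exact: (integrableZl mI x ia).
have ir : itg nu t T (fun s => 2^-1 * (h s ^+ 2 + x ^+ 2)).
  exact: (integrableZl mI (2^-1) (integrableD mI ih2 i1)).
apply: (@le_trans _ _ (\int[nu]_(s in `]t, T]) (x * `|h s|))).
  by rewrite (RintegralZl x mI ia) ler_wpM2l//; exact: le_normr_Rintegral.
apply: (@le_trans _ _ (\int[nu]_(s in `]t, T]) (2^-1 * (h s ^+ 2 + x ^+ 2)))).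
  apply: le_Rintegral => // s _; have := sqr_ge0 (`|h s| - x); rewrite sqrrB real_normK ?num_real//.
  by rewrite -mulr_natr [x * _]mulrC; move: (h s ^+ 2) (x ^+ 2) (`|h s| * x) => y1 y2 y3; lra.
rewrite (RintegralZl 2^-1 mI (integrableD mI ih2 i1)) (RintegralD mI ih2 i1) Rintegral_cst//=.
by rewrite nuE.
Qed.

Let LamG (r : hfun) w : mpred r -> (forall s w e, 0 <= r s w e <= Num.max M 1) -> good w -> 0 <= Lam r t T w <= Gam w.
Proof.
move=> mr rc gw; rewrite (Lam_le_Gam t0 tT mr rc gw) andbT.
by apply: Lam_ge0 => // s w' e; case/andP: (rc s w' e).
Qed.

Let Y_meas : meas_on (F t) setT (Y i t).
Proof. by have [HSp _] := HY; have [aY _ _ _ _] := HSp i; apply: aY; rewrite t0 ltW. Qed.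

(** The spaces control [Y] in a time-integrated sense, not at a fixed [t]. Integrability of [L Y_t]
    is read off the equation, with the density of rate [rho i], each term being integrable against
    [L]. *)
Let Lam_Y_I1 : I1 P (fun w => Lam (clip (rho i)) t T w * Y i t w).
Proof.
have [HSp _] := HY; have [_ _ _ [pK incK K2] cK] := HSp i.
have [_ /(_ i)[mxi xi2] /(_ i)[[pf _] [/(_ ord0) pg _]] _ _] := HD.
have b0 : 0 <= betahat by have [/andP[_ /ltW h] h'] := midbetaP; exact: le_trans h' h.
have mr : mpred (clip (rho i)) by exact: mark_predictable_mpred.
have rc := clip_bdd (HS.1 i).
set L := Lam _ t T.
have IL : I1 P L := Lam_I1 t0 tT IA mr c1 rc.
have mL := I1_meas IL.
have L2L : L2 P L.
  apply: L2_le_ae mL G2 _; apply: filterS good_ae => w gw.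
  by have /andP[l0 l1] := LamG mr rc gw; rewrite ger0_norm// (le_trans l1) ?ler_norm.
have m1 : meas_on (F t) setT (fun _ : Omega => 0 : R) by apply/FT_fun; exact: measurable_cst.
have k1 (w : Omega) : `|0 : R| <= 0 by rewrite normr0.
have hu s w : (exists j, forall e, reduce (U i) s w e = reduce (U j) s w e) \/ forall e, reduce (U i) s w e = 0.
  by left; exists i.
have [IS IV _] := run_orth mr rc (@reduce_U_mpred i) hu m1 k1.
have mxi' : measurable_fun setT (xi i) := F_fun_measurable mxi.
have Ixi := L2M L2L (xi_L2 i).
have T00 : 0 <= T <= T by rewrite ltW ?lexx.
have mf : measurable_fun setT (fun w => \int[dA A w]_(s in `]t, T]) f i s w).
  apply: (F_fun_measurable (t := T)); apply: (dA_Rint_measurable t0 (ltW T0)).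
  exact: progressive_measurable pf.
have mg : measurable_fun setT (fun w => \int[lebesgue_measure]_(s in `]t, T]) g i s w).
  apply: (leb_Rint_measurable (X := g i) T0 t0); exact: progressive_measurable pg.
have If : I1 P (fun w => L w * \int[dA A w]_(s in `]t, T]) f i s w).
  have [fi If2] := f_moment i.
  apply: I1_le_ae (I1Z 2^-1 (I1D If2 GA)) _; first exact: measurable_funM.
  have ok := path_ok_ae i.
  apply: filterS3 good_ae fi ok => w gw fw [_ fw1 _ _].
  have /andP[l0 l1] := LamG mr rc gw.
  have G0 := le_trans l0 l1.
  rewrite normrM (ger0_norm l0); apply: (@le_trans _ _ (Gam w * `|\int[dA A w]_(s in `]t, T]) f i s w|)).
    by rewrite ler_wpM2r.
  apply: le_trans (young_Rintegral G0 (dA_itv gw t0 (ltW tT)) fw1 fw) _.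
  by rewrite ler_wpM2l ?invr_ge0// lerD2l ler_wpM2l ?sqr_ge0// gerBl (A_ge0 gw).
have Ig : I1 P (fun w => L w * \int[lebesgue_measure]_(s in `]t, T]) g i s w).
  have [gi Ig2] := g_moment i.
  have IGT : I1 P (fun w => Gam w ^+ 2 * T).
    by under eq_fun do rewrite mulrC; exact: I1Z G2.2.
  apply: I1_le_ae (I1Z 2^-1 (I1D Ig2 IGT)) _; first exact: measurable_funM.
  have ok := path_ok_ae i.
  apply: filterS3 good_ae gi ok => w gw fw [_ _ fw1 _].
  have /andP[l0 l1] := LamG mr rc gw.
  have G0 := le_trans l0 l1.
  have lt : lebesgue_measure (rset R `]t, T]) = (T - t)%:E.
    by rewrite lebesgue_measure_itv/= lte_fin tT EFinN EFinB.
  rewrite normrM (ger0_norm l0); apply: (@le_trans _ _ (Gam w * `|\int[lebesgue_measure]_(s in `]t, T]) g i s w|)).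
    by rewrite ler_wpM2r.
  apply: le_trans (young_Rintegral G0 lt fw1 fw) _.
  by rewrite ler_wpM2l ?invr_ge0// lerD2l ler_wpM2l ?sqr_ge0// gerBl.
have IZ : I1 P (fun w => L w * (Zw i T w - Zw i t w)).
  have [_ z2 _] := MZ i; apply: L2M => //; apply: L2B; apply: z2; rewrite ?t0 ?(ltW tT)//.
have mKs s : 0 <= s <= T -> measurable_fun setT (K i s).
  move=> /andP[s0 sT]; move=> _ B mB; rewrite setTI.
  have := PT_section s0 measurableT (pK B mB); rewrite setTI.
  rewrite (_ : _ @^-1` _ = K i s @^-1` B)//; apply/seteqP; split=> w /=; first by move=> [].
  by move=> KB; split=> //; split=> //; rewrite /= in_itv/= s0 sT.
have KT2 : L2 P (K i T).
  split; first exact: mKs.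
  apply/integrableP; split; first exact/measurable_EFinP/measurable_funX/mKs.
  by apply: le_lt_trans K2; under eq_integral do rewrite /= ger0_norm ?sqr_ge0//.
have IK : I1 P (fun w => L w * (K i T w - K i t w)).
  apply: L2M => //; apply: L2_le_ae KT2 _.
    by apply: measurable_funB; apply: mKs; rewrite // t0 ltW.
  apply: filterS2 incK cK => w [_ inc] [K0 _].
  have h1 : K i 0 w <= K i t w by apply: inc; rewrite ?lexx ?t0// ltW.
  have h2 : K i t w <= K i T w by apply: inc; rewrite ?lexx// t0 ltW.
  move: h1; rewrite K0 => h1; rewrite !ger0_norm ?subr_ge0//; first by rewrite gerBl.
  exact: le_trans h1 h2.
have Iall := I1D (I1B (I1D (I1B (I1D (I1D Ixi If) Ig) IS) IV) IZ) IK.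
apply: I1_ae Iall; first by apply: measurable_funM => //; exact: (F_fun_measurable Y_meas).
apply: filterS (YE i) => w [YT Yinc].
rewrite (Yinc t T t0 (ltW tT) (lexx T)) YT /increment.
do 4 (move: (Rintegral _ _ _) => ?).
rewrite -/L; by move: (L w) (xi i w) (Zw i T w) (Zw i t w) (K i T w) (K i t w) => *; ring.
Qed.

Let trunc (x : R) (n : nat) := Num.max (- n%:R) (Num.min x n%:R).

Let trunc_bdd x n : `|trunc x n| <= n%:R.
Proof. by rewrite ler_norml /trunc le_max lexx/= ge_max ge_min lexx orbT andbT -subr_ge0 opprK addr_ge0. Qed.

Let trunc_le x n : `|trunc x n| <= `|x|.
Proof.
rewrite /trunc ler_norml le_max le_min (lerNnormlW (lexx `|x|)) ge_max ge_min ler_norm/= andbT.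
apply/andP; split; last by apply: (@le_trans _ _ 0); rewrite ?oppr_le0.
by apply/orP; right; apply: (@le_trans _ _ 0); rewrite ?oppr_le0.
Qed.

Let trunc_cvg x : trunc x n @[n --> \oo] --> x.
Proof.
apply: cvg_near_cst; have [n _ hn] : \forall n \near \oo, `|x| <= n%:R by exact: nbhs_infty_ger.
exists n => // k /hn /=; rewrite ler_norml => /andP[h1 h2].
by rewrite /trunc (min_l h2) max_r.
Qed.

Let trunc_meas n : meas_on (F t) setT (fun w => trunc (Y i t w) n).
Proof.
apply/FT_fun; apply: measurable_maxr; first exact: measurable_cst.
by apply: measurable_minr; [exact/FT_fun|exact: measurable_cst].
Qed.

Let tr_abs n : meas_on (F t) setT (fun w => `|trunc (Y i t w) n|).
Proof. by apply/FT_fun; apply: measurableT_comp => //; exact/FT_fun. Qed.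

Let trb n w : `| `|trunc (Y i t w) n| | <= n%:R. Proof. by rewrite normr_id. Qed.

(** Bounded truncations of [|Y_t|] keep their mean under the density, so [E|Y_t|] is bounded by
    [E|L Y_t|] through Fatou's lemma. *)
Lemma Y_I1 : I1 P (Y i t).
Proof.
have mr : mpred (clip (rho i)) by exact: mark_predictable_mpred.
have rc := clip_bdd (HS.1 i).
have mY := F_fun_measurable Y_meas.
have mtr n := F_fun_measurable (trunc_meas n).
have [] := @I1_fatou _ _ _ P (fun n w => `|trunc (Y i t w) n|) (fun w => `|Y i t w|)
  (EX P (fun w => `|Lam (clip (rho i)) t T w * Y i t w|)).
- by move=> n; apply: (@I1_bdd _ _ _ P _ n%:R); [exact: measurableT_comp|exact: trb].
- move=> n; have [I1a E1a] := EX_Lam t0 tT IA G2 mr rc (tr_abs n) (trb n).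
  rewrite (_ : EX P _ = EX P (fun w => `|trunc (Y i t w) n|)); last by congr EX; apply/funext => w; rewrite normr_id.
  rewrite -E1a; apply: EX_le_ae => //; first exact: (I1_abs Lam_Y_I1).
  apply: filterS good_ae => w gw; have /andP[l0 _] := LamG mr rc gw.
  by rewrite normrM (ger0_norm l0) ler_wpM2l.
- exact: measurableT_comp.
- by apply: aeW => w; apply: cvg_norm; exact: trunc_cvg.
move=> Ia _; apply: I1_le Ia _ => //.
Qed.

(** The same truncation in the opposite direction: integrability of [Y_t] now gives that of [L Y_t]
    for every rate bounded by [max(M, 1)]. *)
Lemma Lam_Y (r : hfun) (X : Omega -> R) kx : mpred r -> (forall s w e, 0 <= r s w e <= Num.max M 1) ->
  meas_on (F t) setT X -> (forall w, `|X w| <= kx) ->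
  I1 P (fun w => Lam r t T w * Y i t w) /\
  EX P (fun w => X w * (Lam r t T w * Y i t w)) = EX P (fun w => X w * Y i t w).
Proof.
move=> mr rc mX Xk; have mY := F_fun_measurable Y_meas.
have IL : I1 P (Lam r t T) := Lam_I1 t0 tT IA mr c1 rc.
have mL := I1_meas IL.
have ILY : I1 P (fun w => Lam r t T w * Y i t w).
  have [] := @I1_fatou _ _ _ P (fun n w => Lam r t T w * `|trunc (Y i t w) n|) (fun w => Lam r t T w * `|Y i t w|)
    (EX P (fun w => `|Y i t w|)).
  - by move=> n; have [] := EX_Lam t0 tT IA G2 mr rc (tr_abs n) (trb n).
  - move=> n; have [I1a E1a] := EX_Lam t0 tT IA G2 mr rc (tr_abs n) (trb n).
    rewrite (_ : EX P _ = EX P (fun w => Lam r t T w * `|trunc (Y i t w) n|)).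
      rewrite E1a; apply: EX_le; [|exact: I1_abs Y_I1|by move=> w; exact: trunc_le].
      by apply: (@I1_bdd _ _ _ P _ n%:R) => //; exact: (F_fun_measurable (tr_abs n)).
    apply: EX_ae; [exact/measurableT_comp/(I1_meas I1a)|exact: I1_meas I1a|].
    apply: filterS good_ae => w gw; have /andP[l0 _] := LamG mr rc gw.
    by rewrite ger0_norm// mulr_ge0.
  - by apply: measurable_funM => //; exact: measurableT_comp.
  - by apply: aeW => w; apply: cvgMl_tmp; apply: cvg_norm; exact: trunc_cvg.
  move=> Ia _; apply: I1_le_ae Ia _; first exact: measurable_funM.
  apply: filterS good_ae => w gw; have /andP[l0 _] := LamG mr rc gw.
  by rewrite normrM (ger0_norm l0).
split=> //.
have mX' := F_fun_measurable mX.
have mtr n := F_fun_measurable (trunc_meas n).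
have tc w : (fun n => trunc (Y i t w) n) @ \oo --> Y i t w by exact: trunc_cvg.
have cA : EX P (fun w => X w * (Lam r t T w * trunc (Y i t w) n)) @[n --> \oo] -->
    EX P (fun w => X w * (Lam r t T w * Y i t w)).
  apply: (proj2 (@EX_dct _ _ _ P (fun n w => X w * (Lam r t T w * trunc (Y i t w) n)) _
    (fun w => kx * `|Lam r t T w * Y i t w|) _ _ _ _ _)).
  - by move=> n; apply: measurable_funM => //; exact: measurable_funM.
  - by apply: measurable_funM => //; exact: I1_meas ILY.
  - exact: I1Z (I1_abs ILY).
  - by apply: aeW => w; apply: cvgMl_tmp; apply: cvgMl_tmp; exact: tc.
  - apply: aeW => w n; rewrite normrM; apply: ler_pM => //.
    by rewrite !normrM ler_wpM2l.
have cB : EX P (fun w => X w * trunc (Y i t w) n) @[n --> \oo] --> EX P (fun w => X w * Y i t w).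
  apply: (proj2 (@EX_dct _ _ _ P (fun n w => X w * trunc (Y i t w) n) _
    (fun w => kx * `|Y i t w|) _ _ _ _ _)).
  - by move=> n; exact: measurable_funM.
  - exact: measurable_funM.
  - exact: I1Z (I1_abs Y_I1).
  - by apply: aeW => w; apply: cvgMl_tmp; exact: tc.
  - by move=> *; apply: aeW => w n; rewrite normrM; apply: ler_pM.
apply: (cvg_unique _ cA) => //; apply: cvg_trans cB; apply: near_eq_cvg; apply: nearW => n /=.
have mXt : meas_on (F t) setT (fun w => X w * trunc (Y i t w) n).
  by apply/FT_fun; apply: measurable_funM; exact/FT_fun.
have Xtb w : `|X w * trunc (Y i t w) n| <= kx * n%:R by rewrite normrM; apply: ler_pM.
have [_ <-] := EX_Lam t0 tT IA G2 mr rc mXt Xtb.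
by congr EX; apply/funext => w; rewrite mulrCA.
Qed.

End RunMean.

Section GainBound.
Variables (t : R) (i : 'I_m).
Hypotheses (t0 : 0 <= t) (MZ : forall j, martingale2 P F 0 T (Zw j)).
Let J := gain P Tn zeta W phi A T rho xi f g C t.
Local Notation optimal := (optimal_path).

Let Y_Ft : t <= T -> meas_on (F t) setT (Y i t).
Proof. by move=> tT; have [HSp _] := HY; have [+ _ _ _ _] := HSp i; apply; rewrite t0. Qed.

Let EX_indic_bdd (B : set Omega) w : `|\1_B w : R| <= 1.
Proof. by rewrite indicE; case: (w \in B); rewrite ?normr1 ?normr0. Qed.

Let indic_Ft (B : set Omega) : F t B -> meas_on (F t) setT (\1_B : Omega -> R).
Proof.
move=> FB; apply: measurable_meas_on; [exact: F_sigma|exact: F_setT|].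
by apply: measurable_indic; rewrite FT_measurableE.
Qed.

(** Density times payoff is written [Z1 - H], where [Z1] is integrable with conditional mean [Y_t]
    and [H] is the loss weighted by the density; this is the form in which the conditional
    expectation is controlled. *)
Definition gain_decomposed a := exists Z1 H : Omega -> R,
  [/\ I1 P Z1, forall B, F t B -> EX P (fun w => \1_B w * Z1 w) = EX P (fun w => \1_B w * Y i t w),
    measurable_fun setT H, forall w, 0 <= H w &
    (\forall w \ae P, (density_ratio Tn zeta phi A T rho a t w)%:E * payoff A T xi f g C t a w = (Z1 w - H w)%:E)%E /\
    ((t < T -> \forall w \ae P, optimal a w) -> \forall w \ae P, H w = 0)].

Lemma gain_decomposition_lt a : t < T -> strategies_from P Tn zeta W T t i a -> gain_decomposed a.
Proof.
move=> tT Sa; pose L := Lam (run_rho a) t T.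
have mr : mpred (run_rho a) by exact: (run_rho_mpred t0 Sa).
have rc := run_rho_bdd Sa.
have mX0 : meas_on (F t) setT (\1_set0 : Omega -> R) by apply: indic_Ft; have [] := F_sigma t.
have [IL mM ILM _] := strategy_orth t0 tT MZ Sa mX0 (@EX_indic_bdd set0).
pose Mt w := run_S t a w - run_V t a w + switched_integral a Zw w.
have [ILY _] := Lam_Y i t0 tT MZ mr rc mX0 (@EX_indic_bdd set0).
have mY := F_fun_measurable (Y_Ft (ltW tT)).
have [B mB BE] := payoff_measurable t0 tT Sa.
pose kap w := Y i t w + Mt w - B w.
have key : \forall w \ae P, [/\ 0 <= L w, 0 <= kap w & optimal a w -> kap w = 0].
  have := ae_and BE (ae_and (regular_ae) (strategy_fin_ae t0 tT Sa)).
  apply: filterS => w [Bw [rw fw]].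
  have [k [k0 pE ko]] := payoff_identity t0 tT Sa rw fw.
  have kE : kap w = k.
    by move: pE; rewrite Bw => -[BwE]; rewrite /kap BwE /Mt; ring.
  rewrite kE; split=> //; apply: Lam_ge0 => [s w' e|]; last exact: reg_good rw.
  by case/andP: (rc s w' e).
(* The weighted loss is known to be nonnegative almost surely; the maximum with 0 makes it so
   everywhere. *)
exists (fun w => L w * Y i t w + L w * Mt w), (fun w => Num.max 0 (L w * kap w)).
have mL := I1_meas IL.
have mk : measurable_fun setT kap by apply: measurable_funB => //; exact: measurable_funD.
split.
- exact: I1D.
- move=> G FG; have mG := indic_Ft FG.
  have [_ _ _ E1] := strategy_orth t0 tT MZ Sa mG (@EX_indic_bdd G).
  have [_ E2] := Lam_Y i t0 tT MZ mr rc mG (@EX_indic_bdd G).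
  have bI (k : Omega -> R) : I1 P k -> I1 P (fun w => \1_G w * k w).
    move=> Ik; apply: I1_le (I1_abs Ik) _.
      by apply: measurable_funM; [exact: (F_fun_measurable mG)|exact: I1_meas Ik].
    by move=> w; rewrite normrM -[leRHS]mul1r ler_wpM2r.
  rewrite -E2 -[RHS]addr0 -E1 -(EXD (bI _ ILY) (bI _ ILM)); congr EX; apply/funext => w.
  by rewrite mulrDr.
- by apply: measurable_maxr => //; exact: measurable_funM.
- by move=> w; rewrite le_max lexx.
split.
  apply: filterS2 key BE => w [L0 k0 _] ->.
  rewrite (density_ratioE t0 Sa) -/(L w) -EFinM; congr EFin.
  rewrite (max_r (mulr_ge0 L0 k0)) /kap.
  generalize (L w) (Y i t w) (Mt w) (B w) => *.
  ring.
by move=> /(_ tT) ho; apply: filterS2 key ho => w [_ _ h] /h ->; rewrite mulr0 maxxx.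
Qed.

(** At [t = T] the grids degenerate and the case is direct: the density ratio is 1, no switch is
    charged, and the default value of [mode_at] is the initial mode. *)
Lemma gain_decomposition_T a : t = T -> strategies_from P Tn zeta W T t i a -> gain_decomposed a.
Proof.
move=> tT Sa; exists (xi i), (cst 0).
have [_ _ Sa0] := Sa.
have thT k w : theta a k w = T.
  by apply/eqP; rewrite eq_le (strategy_leT Sa)/= -tT (strategy_ge Sa).
have YX : \forall w \ae P, Y i t w = xi i w by rewrite tT; apply: filterS (YE i) => w [].
split=> //.
- exact: L2_I1 (xi_L2 i).
- move=> B FB; have mB := F_fun_measurable (indic_Ft FB).
  apply: EX_ae; try (apply: measurable_funM => //).
  + exact: I1_meas (L2_I1 (xi_L2 i)).
  + by apply: (F_fun_measurable (Y_Ft _)); rewrite tT.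
  + by apply: filterS YX => w ->.
split; last by move=> _; exact: aeW.
apply: filterS good_ae => w gw.
rewrite (density_ratioE t0 Sa) tT (Lam_same _ _ gw) mul1e /payoff.
rewrite set_itv_ge ?bnd_simp ?ltxx// !Rintegral_set0 !addr0 subr0.
have -> : mode_at a T w = i.
  by rewrite /mode_at xgetPN ?(Sa0 w).2// => k /=; rewrite !thT ltxx.
rewrite (_ : total_cost _ _ _ _ = 0%E) ?sube0//.
apply: cvg_lim; first exact: ereal_hausdorff.
apply: cvg_near_cst; near=> s.
rewrite /switching_cost eseries0// => n _ _; rewrite thT.
have /negbTE -> : ~~ (T <= s) by rewrite -ltNge; near: s; exact: nbhs_left_lt.
by rewrite mulr0.
Unshelve. all: by end_near.
Qed.

Lemma gain_bounds a : t <= T -> strategies_from P Tn zeta W T t i a ->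
  (\forall w \ae P, J a w <= (Y i t w)%:E)%E /\
  ((t < T -> \forall w \ae P, optimal a w) -> \forall w \ae P, J a w = (Y i t w)%:E).
Proof.
move=> tT Sa.
have [Z1 [H [IZ YZ mH H0 [XE Ho]]]] : gain_decomposed a.
  by move: tT; rewrite le_eqVlt => /predU1P[h|h]; [exact: gain_decomposition_T|exact: gain_decomposition_lt].
have mY := Y_Ft tT.
have IY : I1 P (Y i t).
  move: (tT); rewrite le_eqVlt => /predU1P[h|h]; last exact: (Y_I1 i t0 h MZ).
  apply: (I1_ae _ _ (L2_I1 (xi_L2 i))); first exact: (F_fun_measurable mY).
  by rewrite h; apply: filterS (YE i) => w [->].
have mX : measurable_fun setT (fun w => (density_ratio Tn zeta phi A T rho a t w)%:E * payoff A T xi f g C t a w)%E.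
  apply: (@ae_measurable_fun _ _ _ P cP setT (fun w => (Z1 w - H w)%:E)).
    by apply: filterS XE => w -> _.
  by apply/measurable_EFinP; apply: measurable_funB => //; exact: I1_meas IZ.
have sF := F_sigma t.
have mF : F t `<=` measurable by exact: F_measurable.
split; first exact: (cond_exp_le sF mF mY IY IZ YZ mH H0 mX XE).
by move=> ho; exact: (cond_exp_eq sF mF mY IY IZ YZ mH H0 mX XE (Ho ho)).
Qed.

End GainBound.

(** * The optimal strategy *)

Section HittingPath.
(** Distance of [Y^j] from a single candidate [l]. The barrier is reached when one of these finitely
    many nonnegative functions vanishes, which avoids handling their minimum. *)
Definition gap j l s w := Y j s w - (Y l s w - C j l s w).

Definition hit_set (q : R) j w : set R :=
  [set s | q <= s <= T /\ Y j s w = barrier C Y j s w] `|` [set T].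

Lemma gap_ge0 w j l s : regular w -> l != j -> 0 <= s <= T -> 0 <= gap j l s w.
Proof. by move=> rw lj sT; rewrite subr_ge0 (reg_barrier rw). Qed.

Lemma barrier_gapP w j s : regular w -> 0 <= s <= T ->
  Y j s w = barrier C Y j s w <-> exists2 l, l != j & gap j l s w = 0.
Proof.
move=> rw sT; have [[l lj bE] bge] := barrierP C Y m2 j s w; split.
  by move=> YE'; exists l => //; rewrite /gap -bE -YE' subrr.
move=> [k kj /eqP]; rewrite subr_eq0 => /eqP Yk; apply/eqP.
by rewrite eq_le {1}Yk bge//= bE (reg_barrier rw).
Qed.

Lemma barrier_le w j s : regular w -> 0 <= s <= T -> barrier C Y j s w <= Y j s w.
Proof. by move=> rw sT; have [[l lj ->] _] := barrierP C Y m2 j s w; exact: (reg_barrier rw). Qed.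

Lemma gap_right_cvg w j l (s : R) : regular w -> 0 <= s < T -> gap j l v w @[v --> s^'+] --> gap j l s w.
Proof.
move=> rw /andP[s0 sT]; have cY k := (reg_Y rw k).1 s.
apply: cvgB; first by apply: cY; rewrite s0.
apply: cvgB; first by apply: cY; rewrite s0.
have cc : {within `[0, T], continuous (C j l ^~ w)} by move=> x; exact: (@reg_C w rw j l x).
exact: (within_right_cvg T0 s0 sT cc).
Qed.

Lemma hit_inf_bounds q j w : q <= T -> q <= inf (hit_set q j w) <= T.
Proof.
move=> qT; apply/andP; split.
  by apply: lb_le_inf; [exists T; right|move=> s [[/andP[]//]|/= ->]].
by apply: ge_inf; [exists q => s [[/andP[]//]|/= ->]|right].
Qed.

Lemma hit_inf_lt q j w s : q <= s <= T -> s < inf (hit_set q j w) -> Y j s w <> barrier C Y j s w.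
Proof.
move=> qs + YE'; apply/negP; rewrite -leNgt; apply: ge_inf; last by left.
by exists q => u [[/andP[]//]|/= ->]; case/andP: qs; exact: le_trans.
Qed.

(** If the barrier were not touched at the infimum, the finitely many gaps would be positive there
    and, by right continuity, on a whole interval to the right, contradicting the infimum. *)
Lemma hit_attained q j w : regular w -> 0 <= q <= T -> inf (hit_set q j w) < T ->
  Y j (inf (hit_set q j w)) w = barrier C Y j (inf (hit_set q j w)) w.
Proof.
move=> rw /andP[q0 qT]; have /andP[qs sT'] := hit_inf_bounds j w qT.
set s := inf _ in qs sT' *; move=> sT.
have [//|ne] := eqVneq (Y j s w) (barrier C Y j s w).
have s0 := le_trans q0 qs.
have pos l : l != j -> \forall v \near s^'+, 0 < gap j l v w.
  move=> lj; have g0 : 0 < gap j l s w.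
    rewrite lt_def gap_ge0 ?s0// andbT; apply/eqP => h.
    by move/eqP: ne; apply; apply/(barrier_gapP _ rw); [rewrite s0|exists l].
  have s0T : 0 <= s < T by rewrite s0.
  exact: (cvgr_gt (gap j l s w) (@gap_right_cvg w j l s rw s0T)).
have : \forall v \near s^'+, forall l, l != j -> 0 < gap j l v w.
  by apply: filter_forall => l; have [->|lj] := eqVneq l j; [exact: nearW|apply: filterS (pos l lj)].
move=> [e /= e0 he].
pose s' := Num.min T (s + e / 2).
have ss' : s < s' by rewrite lt_min sT ltrDl divr_gt0.
have : s' <= s.
  apply: lb_le_inf; first by exists T; right.
  move=> v [[/andP[qv vT] hv]|/= ->]; last by rewrite ge_min lexx.
  have sv : s <= v by apply: ge_inf; [exists q => u [[/andP[]//]|/= ->]|left; rewrite /= qv].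
  rewrite leNgt; apply/negP; rewrite lt_min => /andP[_ ve].
  have v0T : 0 <= v <= T by rewrite (le_trans q0 qv).
  have [l lj gl] := (barrier_gapP j rw v0T).1 hv.
  move: sv; rewrite le_eqVlt => /predU1P[sv|sv].
    by move/eqP: ne; rewrite sv hv.
  have /he/(_ sv l lj) : ball s e v.
    by rewrite /ball/= ltr0_norm ?subr_lt0// opprB ltrBlDl (lt_le_trans ve)// lerD2l; lra.
  by rewrite gl ltxx.
by rewrite leNgt ss'.
Qed.

Lemma hit_iff q j w s : regular w -> 0 <= q <= T -> 0 <= s < T ->
  inf (hit_set q j w) <= s <-> exists2 u, q <= u <= s & exists2 l, l != j & gap j l u w = 0.
Proof.
move=> rw /[dup] qT' /andP[q0 qT] /andP[s0 sT]; split=> [hs|[u /andP[qu us] [l lj gl]]].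
  have /andP[h1 h2] := hit_inf_bounds j w qT; have h3 := le_lt_trans hs sT.
  exists (inf (hit_set q j w)); first by rewrite h1.
  by apply/(barrier_gapP j rw); [rewrite (le_trans q0 h1)|exact: hit_attained].
have uT : u <= T by rewrite (le_trans us (ltW sT)).
apply: le_trans us; apply: ge_inf; first by exists q => v [[/andP[]//]|/= ->].
left; split; first by rewrite qu.
by apply/(barrier_gapP j rw); [rewrite (le_trans q0 qu)|exists l].
Qed.

(** Describes the existence of a zero by countably many values at times up to [s]. With [T_k] the
    last jump not after the zero, the gap is continuous on [[T_k, T_{k+1}[]. On a compact piece of
    it, ending at [s] or at distance [1 / (p + 1)] before the next jump, a nonnegative continuous
    function vanishes somewhere exactly when its values at rational times become arbitrarily small.
    Rationals are clamped to [[0, s]] so that the time [s] itself is represented, and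
    [v + 1 / (p + 1) <= s] keeps the comparison with the next jump observable at time [s]. *)
Lemma gap_hit_iff q j l w s : regular w -> l != j -> 0 <= q -> q <= s -> s < T ->
  (exists2 u, q <= u <= s & gap j l u w = 0) <->
  exists k p, forall n, exists r : rat, let v := Num.max 0 (Num.min (ratr r) s) in
    [/\ q <= v, (Tn k w <= v%:E)%E, gap j l v w < n.+1%:R^-1 &
      (s%:E < Tn k.+1 w)%E \/ v + p.+1%:R^-1 <= s /\ ((v + p.+1%:R^-1)%:E < Tn k.+1 w)%E].
Proof.
move=> rw lj q0 qs sT; have gw := reg_good rw; have s0 := le_trans q0 qs; split.
  move=> [u /andP[qu us] gu]; have u0 := le_trans q0 qu.
  have [k Tku Tk1] : exists2 k, (Tn k w <= u%:E)%E & (u%:E < Tn k.+1 w)%E.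
    have [N hN] := good_jump_lt u gw.
    have [n uTn nmin] := @ex_minnP (fun n => (u%:E < Tn n w)%E) (ex_intro _ N (hN N (leqnn N))).
    case: n uTn nmin => [|k] uTn nmin.
      by have [_ _ Tn0 _] := HT; move: uTn; rewrite Tn0 lte_fin ltNge u0.
    by exists k => //; rewrite leNgt; apply/negP => /nmin; rewrite ltnn.
  have small n : \forall v \near u^'+, gap j l v w < n.+1%:R^-1.
    have uT : 0 <= u < T by rewrite u0 (le_lt_trans us).
    by apply: (cvgr_lt (gap j l u w) (@gap_right_cvg w j l u rw uT)); rewrite gu invr_gt0.
  have pick n (b : R) : u < b -> b <= s -> exists r : rat, let v := Num.max 0 (Num.min (ratr r) s) in
      [/\ q <= v, (Tn k w <= v%:E)%E, gap j l v w < n.+1%:R^-1 & v < b].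
    move=> ub bs; have [e /= e0 he] := small n.
    have ub' : u < Num.min b (u + e) by rewrite lt_min ub ltrDl.
    have [r] := rat_in_itvoo ub'; rewrite in_itv/= lt_min => /andP[ur /andP[rb re]].
    exists r; have -> : Num.max 0 (Num.min (ratr r) s) = ratr r :> R.
      by rewrite min_l ?max_r// ?(ltW (lt_le_trans rb bs))// (le_trans u0 (ltW ur)).
    split=> //; first by rewrite (le_trans qu (ltW ur)).
      by apply: (le_trans Tku); rewrite lee_fin ltW.
    by apply: he => //=; rewrite ltr0_norm ?subr_lt0// opprB ltrBlDl.
  have [sTk|Tks] := ltP s%:E (Tn k.+1 w).
    exists k, 0%N => n; move: us; rewrite le_eqVlt => /predU1P[us|us].
      (* A rational beyond [s] is clamped to [s]; this is how a zero located at [s] is reached. *)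
      have s1 : s < s + 1 by rewrite ltrDl.
      have [r] := rat_in_itvoo s1.
      rewrite in_itv/= => /andP[sr _]; exists r => /=.
      by rewrite (min_r (ltW sr)) (max_r s0); split=> //; [rewrite -us|rewrite -us gu invr_gt0|left].
    have [r [h1 h2 h3 _]] := pick n s us (lexx s).
    by exists r; split=> //; left.
  have [b bE] : exists b, Tn k.+1 w = b%:E.
    by move: Tk1 Tks; case: (Tn k.+1 w) => // b _ _; exists b.
  rewrite bE lte_fin in Tk1; rewrite bE lee_fin in Tks.
  (* Twice the margin: [v] will be chosen within [1 / (p + 1)] of [u] and must still keep the
     distance [1 / (p + 1)] from the next jump [b]. *)
  have [p hp] : exists p, u + 2 * p.+1%:R^-1 < b.
    have /ltr_add_invr[p hp] : u < u + (b - u) / 2 by rewrite ltrDl divr_gt0 ?subr_gt0.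
    by exists p; move: hp; move: (p.+1%:R^-1 : R) => x; lra.
  have ip : 0 < p.+1%:R^-1 :> R by rewrite invr_gt0.
  have up : u < u + p.+1%:R^-1 by rewrite ltrDl.
  have ups : u + p.+1%:R^-1 <= s by move: ip hp Tks; move: (p.+1%:R^-1 : R) => x *; lra.
  exists k, p => n; have [r [h1 h2 h3 h4]] := pick n (u + p.+1%:R^-1) up ups.
  exists r; split=> //; right; rewrite bE lte_fin; move: ip h4 hp; rewrite -/(Num.max 0 (Num.min (ratr r) s)); move: (Num.max 0 (Num.min (ratr r) s)) (p.+1%:R^-1 : R) => z x *; split; lra.
move=> [k [p hr]].
(* End of the compact interval on which the minimum of the gap is taken: [s] if the next jump comes
   later, otherwise a point strictly before that jump. *)
pose b := if (s%:E < Tn k.+1 w)%E then s else fine (Tn k.+1 w) - p.+1%:R^-1.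
pose a := Num.max q (fine (Tn k w)).
have [_ _ Tle _ _] := gw; have mT : {homo (Tn ^~ w) : x y / (x <= y)%N >-> (x <= y)%E}.
  by apply: homo_leq => //; exact: le_trans.
have Tk0 n : (0 <= Tn n w)%E by have [_ _ Tz _] := HT; rewrite -(Tz w); exact: mT.
have Tka : Tn k w = (fine (Tn k w))%:E.
  have [r [_ h _ _]] := hr 0%N; rewrite fineK// ge0_fin_numE//; exact: le_lt_trans h (ltry _).
have bT : (b%:E < Tn k.+1 w)%E.
  rewrite /b; case: ifPn => //; rewrite -leNgt => h.
  have Tf : Tn k.+1 w \is a fin_num by rewrite ge0_fin_numE//; exact: le_lt_trans h (ltry _).
  by rewrite -[ltRHS](fineK Tf) lte_fin ltrBlDr ltrDl invr_gt0.
have bs : b <= s.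
  rewrite /b; case: ifPn => //; rewrite -leNgt => h.
  have Tf : Tn k.+1 w \is a fin_num by rewrite ge0_fin_numE//; exact: le_lt_trans h (ltry _).
  rewrite lerBlDr; move: h; rewrite -(fineK Tf) lee_fin => h; apply: (le_trans h).
  by rewrite lerDl invr_ge0.
have hv n : exists2 v, a <= v <= b & gap j l v w < n.+1%:R^-1.
  have [r] := hr n => /=; set v := Num.max 0 _; move=> [qv Tv gv Tvb]; exists v => //.
  rewrite /a ge_max qv -lee_fin -Tka Tv/= /b; case: ifPn => sT'; first by rewrite ge_max s0 ge_min lexx orbT.
  case: Tvb => [|[_]]; first by rewrite (negbTE sT').
  move: sT'; rewrite -leNgt => h.
  have Tf : Tn k.+1 w \is a fin_num by rewrite ge0_fin_numE//; exact: le_lt_trans h (ltry _).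
  by rewrite -[X in (_ < X)%E](fineK Tf) lte_fin => /ltW; rewrite lerBrDr.
have qa : q <= a by rewrite le_max lexx.
have ab : a <= b by have [v /andP[h1 h2] _] := hv 0%N; exact: le_trans h1 h2.
have a0 := le_trans q0 qa; have bT' : b <= T := le_trans bs (ltW sT).
have nj n : ~~ jump a b w n.
  rewrite /jump; apply/negP => /andP[h1 h2]; have [nk|kn] := leqP n k.
    have := lt_le_trans h1 (mT _ _ nk); rewrite Tka lte_fin ltNge /a le_max lexx orbT//.
  by have := lt_le_trans bT (le_trans (mT _ _ kn) h2); rewrite ltxx.
have [c /andP[ac cb] hc] : exists2 c, a <= c <= b & forall v, a <= v <= b -> gap j l c w <= gap j l v w.
  move: ab; rewrite le_eqVlt => /predU1P[ab|ab].
    by exists a => [|v]; rewrite ab ?lexx// -eq_le => /eqP ->.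
  have cY i := Y_continuous_no_jump (i := i) rw a0 ab bT' nj.
  have cC : {within `[a, b], continuous (C j l ^~ w)}.
    have c0 : {within `[0, T], continuous (C j l ^~ w)} by move=> x; exact: (@reg_C w rw j l x).
    apply: continuous_subspaceW c0 => v /=; rewrite !in_itv/= => /andP[h1 h2].
    by rewrite (le_trans a0 h1) (le_trans h2).
  have cg : {within `[a, b], continuous (gap j l ^~ w)}.
    by move=> x; apply: cvgB; [exact: (cY j x)|apply: cvgB; [exact: (cY l x)|exact: (cC x)]].
  by have [c ac hc] := EVT_min (ltW ab) cg; exists c; [rewrite in_itv/= in ac|move=> v hv'; apply: hc; rewrite in_itv].
exists c; first by rewrite (le_trans qa ac) (le_trans cb bs).
apply/eqP; rewrite eq_le gap_ge0 ?(le_trans a0 ac) ?(le_trans cb bT')// andbT.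
rewrite leNgt; apply/negP => /ltr_add_invr[n]; rewrite add0r => hn.
have [v vab gv] := hv n; have := lt_trans gv hn.
by rewrite ltNge hc.
Qed.

End HittingPath.

Section HittingTimes.
Lemma Y_random_time k v (tau : Omega -> R) : 0 <= v <= T ->
  measurable_fun (setT : set (FT v)) tau -> (forall w, 0 <= tau w <= v) ->
  meas_on (F v) setT (fun w => Y k (tau w) w).
Proof.
move=> v0T mt tv; have /andP[v0 vT] := v0T.
have [HSp _] := HY; have [aY _ _ _ _] := HSp k.
have mY0 : meas_on (F v) setT (Y k 0).
  by move=> B mB; apply: (F_le v0); apply: aY => //; rewrite lexx ltW.
apply/FT_fun; rewrite (_ : (fun w => _) = fun w => if 0 < tau w then Y k (tau w) w else Y k 0 w).
  apply: measurable_fun_if => //; first exact: measurable_fun_ltr (measurable_cst _) mt.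
    rewrite setTI; have mYk := progressive_measurable v0T (Y_progressive k).
    refine (@measurable_comp _ _ _ (FT v) (FT v * measurableTypeR R)%type R [set z : FT v * measurableTypeR R | 0 < z.2 <= v]
      (fun z : FT v * measurableTypeR R => Y k z.2 z.1) _ (fun w => (w, tau w)) _ _ mYk _).
    - exact: measurable_time_itv.
    - by move=> _ [w /= tw <-] /=; move: tw => ->; case/andP: (tv w).
    - by apply: measurable_funTS; apply: measurable_fun_pair.
  by apply: measurable_funTS; exact/FT_fun.
apply/funext => w; case: ifPn => //; rewrite -leNgt => h.
by congr (Y k _ w); apply/eqP; rewrite eq_le h; case/andP: (tv w).
Qed.

Lemma C_random_time j k v (tau : Omega -> R) : 0 <= v <= T ->
  measurable_fun (setT : set (FT v)) tau -> (forall w, 0 <= tau w <= v) ->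
  meas_on (F v) setT (fun w => C j k (tau w) w).
Proof.
move=> /andP[v0 vT] mt tv; have [_ _ _ [aC cC _ _] _] := HD.
have mC s : 0 <= s <= v -> meas_on (F v) setT (C j k s).
  by move=> /andP[s0 sv] B mB; apply: (F_le sv); apply: aC => //; rewrite s0 (le_trans sv).
move: v0; rewrite le_eqVlt => /predU1P[v0|v0].
  rewrite (_ : (fun w => _) = C j k 0); first by apply: mC; rewrite lexx -v0 lexx.
  by apply/funext => w; congr (C j k _ w); apply/eqP; rewrite eq_le andbC {2}v0.
by apply: (random_time_meas v0 vT mC _ mt tv); apply: filterS (cC j k) => w [].
Qed.

Lemma F_ae_set s (S S' : set Omega) : (\forall w \ae P, S w <-> S' w) -> F s S -> F s S'.
Proof.
move=> SS FS.
have : meas_on (F s) setT (fun w => w \in S').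
  apply: (F_ae (f := fun w => w \in S)).
    by apply: filterS SS => w h; apply/idP/idP; rewrite !inE => /h.
  apply/FT_fun; apply: (measurable_fun_bool true); rewrite setTI.
  rewrite (_ : _ @^-1` _ = S); first by rewrite FT_measurableE.
  by apply/funext => w /=; rewrite propeqE; split=> [/eqP|]; [rewrite eqb_id inE|rewrite -inE => ->].
move=> /(_ [set true] _); rewrite setTI (_ : _ @^-1` _ = S'); first exact.
by apply/funext => w /=; rewrite propeqE; split=> [/eqP|]; [rewrite eqb_id inE|rewrite -inE => ->].
Qed.

(** Without right continuity of the filtration the event must be decided by [F s] itself.
    [gap_hit_iff] presents it, on regular paths, through countable unions and intersections of
    events of [F s]; completeness absorbs the other paths. *)
Lemma hit_stopping (q : Omega -> R) (al : Omega -> 'I_m) : stopping_time F q ->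
  (forall w, 0 <= q w <= T) -> (forall j, stopped_sigma F q [set w | al w = j]) ->
  stopping_time F (fun w => inf (hit_set (q w) (al w) w)).
Proof.
move=> sq qT Sal s s0.
have [Ts|sT] := leP T s.
  rewrite (_ : [set _ | _] = setT); first exact: F_setT.
  apply/seteqP; split=> // w _ /=; apply: (@le_trans _ _ T) => //.
  by have /andP[_ q1] := qT w; have /andP[] := hit_inf_bounds (al w) w q1.
pose V (z : rat) : R := Num.max 0 (Num.min (ratr z) s).
have Vs (z : rat) : 0 <= V z <= s by rewrite /V le_max lexx/= ge_max s0 ge_min lexx orbT.
pose D (j l : 'I_m) (k p n : nat) (r : rat) : set (FT s) := [set w | al w = j] `&` [set w | q w <= V r] `&` [set w | (Tn k w <= (V r)%:E)%E] `&`
  [set w | gap j l (V r) w < n.+1%:R^-1] `&`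
  ([set w | (s%:E < Tn k.+1 w)%E] `|` [set w | V r + p.+1%:R^-1 <= s /\ ((V r + p.+1%:R^-1)%:E < Tn k.+1 w)%E]).
have mTn k u : 0 <= u -> u <= s -> measurable ([set w | (u%:E < Tn k w)%E] : set (FT s)).
  move=> u0 us; rewrite (_ : [set _ | _] = ~` [set w | (Tn k w <= u%:E)%E]).
    by apply: measurableC; rewrite FT_measurableE; apply: (F_le us); exact: (Tn_stopping k u0).
  by apply/funext => w /=; rewrite propeqE ltNge; split=> /negP.
have mD j l k p n (r : rat) : measurable (D j l k p n r : set (FT s)).
  have /andP[v0 vs] := Vs r.
  have [HSp _] := HY; have [_ _ _ [aC _ _ _] _] := HD.
  have v0T : 0 <= V r <= T by rewrite v0 (le_trans vs (ltW sT)).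
  have mY k' : measurable_fun (setT : set (FT s)) (Y k' (V r)).
    by apply/FT_fun => B mB; apply: (F_le vs); have [aY _ _ _ _] := HSp k'; exact: aY.
  have mC : measurable_fun (setT : set (FT s)) (C j l (V r)).
    by apply/FT_fun => B mB; apply: (F_le vs); exact: aC.
  apply: measurableI; last first.
    apply: measurableU; first exact: mTn.
    have [h|h] := boolP (V r + p.+1%:R^-1 <= s).
      rewrite (_ : [set _ | _] = [set w | ((V r + p.+1%:R^-1)%:E < Tn k.+1 w)%E]); last first.
        by apply/funext => w /=; rewrite propeqE; split=> [[]|].
      by apply: mTn => //; rewrite addr_ge0 ?invr_ge0.
    by rewrite (_ : [set _ | _] = set0) ?measurable0//; apply/seteqP; split=> // w [].
  apply: measurableI; last first.
    have mg : measurable_fun (setT : set (FT s)) (gap j l (V r)).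
      by apply: measurable_funB => //; exact: measurable_funB.
    have mc : measurable_fun (setT : set (FT s)) (fun=> n.+1%:R^-1 : R) by exact: measurable_cst.
    by have := measurable_fun_ltr mg mc measurableT (Y := [set true]) I; rewrite setTI.
  apply: measurableI; last by rewrite FT_measurableE; apply: (F_le vs); exact: (Tn_stopping k v0).
  by rewrite FT_measurableE; apply: (F_le vs); exact: Sal.
pose S := \bigcup_j \bigcup_(l in [set l | l != j]) \bigcup_k \bigcup_p \bigcap_n \bigcup_z D j l k p n z.
have mS : measurable (S : set (FT s)).
  apply: countable_bigcupT_measurable => [|j]; first exact: countableP.
  apply: fin_bigcup_measurable => [|l _]; first exact: finite_finset.
  apply: bigcupT_measurable => k; apply: bigcupT_measurable => p; apply: bigcapT_measurable => n.
  exact: bigcupT_measurable_rat.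
apply: (@F_ae_set s S); last by rewrite -FT_measurableE.
apply: filterS (regular_ae) => w rw.
have s0T : 0 <= s < T by rewrite s0.
have /andP[q0 _] := qT w.
apply: iff_trans (iff_sym (hit_iff (al w) rw (qT w) s0T)); split.
  move=> [j _ [l lj [k _ [p _ h]]]].
  have aj : al w = j by have [r _ [[[[]]]]] := h 0%N I.
  have qs : q w <= s.
    by have [r _ [[[[_ h2] _] _] _]] := h 0%N I; apply: (le_trans h2); case/andP: (Vs r).
  have := (gap_hit_iff rw lj q0 qs sT).2; case=> [|u uqs gu].
    by exists k, p => n; have [r _ [[[[_ h1] h2] h3] h4]] := h n I; exists r.
  by exists u => //; exists l; rewrite aj.
move=> [u /andP[qu us] [l lj gu]]; have qs := le_trans qu us.
have [|k [p h]] := (gap_hit_iff rw lj q0 qs sT).1; first by exists u; rewrite ?qu.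
exists (al w) => //; exists l => //; exists k => //; exists p => // n _.
by have [r [h1 h2 h3 h4]] := h n; exists r => //; do 4 split=> //.
Qed.

(** [pick] breaks ties in a way that depends only on the truth values of finitely many comparisons.
    The default [j] is never returned, since a maximiser different from [j] exists. *)
Definition next_mode j (s : R) w : 'I_m :=
  odflt j [pick l | (l != j) && [forall k, (k != j) ==>
    (Y k s w - C j k s w <= Y l s w - C j l s w)]].

Lemma next_modeP j s w : next_mode j s w != j /\ forall k, k != j ->
  Y k s w - C j k s w <= Y (next_mode j s w) s w - C j (next_mode j s w) s w.
Proof.
rewrite /next_mode; case: pickP => /= [l /andP[lj /forallP h]|h].
  by split=> // k kj; exact: (implyP (h k)).
have [[l lj bE] bge] := barrierP C Y m2 j s w.
have /negP[] := negbT (h l); rewrite lj/=; apply/forallP => k; apply/implyP => kj.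
by rewrite -bE bge.
Qed.

(** The mode is determined by the finite table [B] of comparisons between candidates. On [th <= s]
    they may be evaluated at [tau], the minimum of [th], [s] and [T], where they are measurable for
    [F v]. *)
Lemma next_mode_stopped (th : Omega -> R) j c : stopping_time F th -> (forall w, 0 <= th w <= T) ->
  stopped_sigma F th [set w | next_mode j (th w) w = c].
Proof.
move=> sth thT s s0; pose v := Num.min s T; pose tau w := Num.min (th w) v.
have v0 : 0 <= v by rewrite le_min s0 ltW.
have v0T : 0 <= v <= T by rewrite v0 ge_min lexx orbT.
have vs : v <= s by rewrite ge_min lexx.
have th0 w : 0 <= th w by case/andP: (thT w).
have mt : measurable_fun (setT : set (FT v)) tau := stop_min_meas sth th0 v0.
have tv w : 0 <= tau w <= v by rewrite le_min th0 v0 ge_min lexx orbT.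
pose X k w := Y k (tau w) w - C j k (tau w) w.
have mX k : measurable_fun (setT : set (FT v)) (X k).
  by apply: measurable_funB; apply/FT_fun; [exact: Y_random_time|exact: C_random_time].
pose b k l : set (FT v) := [set w | X k w <= X l w].
have mb k l : measurable (b k l) by rewrite -[X in measurable X]setTI; exact: measurable_fun_ler.
pose D (B : {ffun 'I_m * 'I_m -> bool}) : set (FT v) :=
  \bigcap_kl (if B kl then b kl.1 kl.2 else ~` b kl.1 kl.2).
have mD B : measurable (D B).
  rewrite -[D B]setCK setC_bigcap; apply/measurableC/fin_bigcup_measurable; first exact: finite_finset.
  by move=> kl _; apply: measurableC; case: (B kl); [|apply: measurableC]; exact: mb.
pose mode (B : {ffun 'I_m * 'I_m -> bool}) := odflt j [pick l | (l != j) && [forall k, (k != j) ==> B (k, l)]].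
have inD w B : D B w -> next_mode j (tau w) w = mode B.
  move=> DB; rewrite /next_mode /mode; congr odflt; apply: eq_pick => l /=; congr andb.
  apply: eq_forallb => k; congr implb.
  have := DB (k, l) I => /=; case: (B (k, l)) => [h|/negP/negbTE h]; first exact: h.
  exact: h.
apply: (F_le vs); rewrite -FT_measurableE.
have tauE w : th w <= s -> tau w = th w.
  by move=> h; rewrite /tau min_l// le_min h; case/andP: (thT w).
rewrite (_ : _ `&` _ = (\bigcup_(B in [set B | mode B == c]) D B) `&` [set w : FT v | th w <= v]).
  apply: measurableI; last by rewrite FT_measurableE; exact: sth.
  by apply: fin_bigcup_measurable => [|B _]; [exact: finite_finset|exact: mD].
apply/seteqP; split=> w /= [].
  move=> nm ths; split; last by rewrite -(tauE w ths) ge_min lexx orbT.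
  pose B := [ffun kl : 'I_m * 'I_m => X kl.1 w <= X kl.2 w].
  have DB : D B w by move=> kl _; rewrite ffunE; case: ifPn => // /negP.
  by exists B => //=; rewrite -(inD w B DB) (tauE w ths) nm.
move=> [B /eqP BE DB] thv; have ths := le_trans thv vs.
by split=> //; rewrite -(tauE w ths) (inD w B DB).
Qed.

End HittingTimes.

Section BarrierStrategy.
Variables (t : R) (i : 'I_m).
Hypothesis tT : 0 <= t <= T.
Local Notation follows := (follows_barrier P Tn zeta W T C Y t i).
(** The property carried through the recursion: stopping time, range and measurability of the mode
    are established together, since the next hitting time is a stopping time only in the presence of
    all three. *)
Definition stopped_mode (th : Omega -> R) (al : Omega -> 'I_m) :=
  [/\ stopping_time F th, forall w, 0 <= th w <= T &
      forall j, stopped_sigma F th [set w | al w = j]].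

Lemma stopped_mode_cst : stopped_mode (fun=> t) (fun=> i).
Proof.
have tt s : 0 <= s -> F s [set w : Omega | t <= s].
  move=> _; have [ts|st] := leP t s.
    by rewrite (_ : [set _ | _] = setT); [exact: F_setT|apply/seteqP; split].
  rewrite (_ : [set _ | _] = set0); first by have [] := F_sigma s.
  by apply/seteqP; split.
split=> // j s s0; have [ij|ij] := eqVneq i j.
  by rewrite (_ : [set w | i = j] = setT) ?setTI; [exact: tt|apply/seteqP; split].
rewrite (_ : [set w | i = j] = set0) ?set0I; first by have [] := F_sigma s.
by apply/seteqP; split=> // w /= /eqP; rewrite (negbTE ij).
Qed.

Lemma stopped_mode_hit th al : stopped_mode th al ->
  stopping_time F (fun w => inf (hit_set (th w) (al w) w)) /\
  forall w, th w <= inf (hit_set (th w) (al w) w) /\ 0 <= inf (hit_set (th w) (al w) w) <= T.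
Proof.
move=> [sn bn an]; split.
  exact: (hit_stopping sn bn an).
move=> w; have /andP[b0 b1] := bn w; have /andP[h0 h1] := hit_inf_bounds (al w) w b1.
by rewrite h1 andbT (le_trans b0).
Qed.

Lemma follows_invariant a n : follows a -> stopped_mode (theta a n) (alpha a n).
Proof.
move=> [a0 aS]; elim: n => [|n ih].
  rewrite (_ : theta a 0 = fun=> t); last by apply/funext => w; have [] := a0 w.
  by rewrite (_ : alpha a 0 = fun=> i); [exact: stopped_mode_cst|apply/funext => w; have [] := a0 w].
have [thE _ san] := aS n; have [h1 h2] := stopped_mode_hit ih.
have E1 : theta a n.+1 = fun w => inf (hit_set (theta a n w) (alpha a n w) w) by exact/funext.
by split=> // [|w]; rewrite E1//; have [] := h2 w.
Qed.

Lemma follows_is_strategy a : follows a -> is_strategy P Tn zeta W T a.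
Proof.
move=> fa n; have [sn bn an] := follows_invariant n fa; split=> // w.
  have [_ aS] := fa; have [-> _ _] := aS n.
  by have /andP[_ b1] := bn w; case/andP: (hit_inf_bounds (alpha a n w) w b1).
by have [_ aS] := fa; have [_ /(_ w)[]] := aS n.
Qed.

Lemma follows_before a w n s : follows a -> theta a n w <= s < theta a n.+1 w -> regular w ->
  barrier C Y (alpha a n w) s w < Y (alpha a n w) s w.
Proof.
move=> fa /andP[h1 h2] rw; have [_ /(_ w)/andP[b0 b1] _] := follows_invariant n fa.
have [_ /(_ w)/andP[_ b2] _] := follows_invariant n.+1 fa.
have sT := le_trans (ltW h2) b2; have s0 := le_trans b0 h1.
have := fa.2 n; case=> thE _ _; rewrite thE in h2.
have ne : Y (alpha a n w) s w <> barrier C Y (alpha a n w) s w.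
  by apply: (hit_inf_lt (q := theta a n w)) => //; rewrite h1.
by rewrite lt_neqAle (barrier_le (alpha a n w) rw) ?s0// andbT; apply/eqP => h; exact: ne.
Qed.

Lemma follows_switch a w n : follows a -> regular w -> theta a n.+1 w < T ->
  Y (alpha a n w) (theta a n.+1 w) w =
  Y (alpha a n.+1 w) (theta a n.+1 w) w - C (alpha a n w) (alpha a n.+1 w) (theta a n.+1 w) w.
Proof.
move=> fa rw; have [_ /(_ w)b _] := follows_invariant n fa.
have := fa.2 n; case=> thE /(_ w)[ne mx] _ hT.
have bE : Y (alpha a n w) (theta a n.+1 w) w = barrier C Y (alpha a n w) (theta a n.+1 w) w.
  by rewrite thE in hT *; exact: (hit_attained rw b hT).
have [[l lj lE] bge] := barrierP C Y m2 (alpha a n w) (theta a n.+1 w) w.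
apply/eqP; rewrite eq_le bE bge// andbT lE; exact: mx.
Qed.

Lemma follows_optimal a w : follows a -> regular w -> optimal_path a w.
Proof.
move=> fa rw; split=> [k s /andP[h1 h2]|k hk]; last exact: follows_switch.
by apply: follows_before; rewrite ?(ltW h1).
Qed.

Let reg_C_cont w j l : regular w -> {within `[0, T], continuous (C j l ^~ w)}.
Proof. by move=> rw x; exact: (@reg_C w rw j l x). Qed.

(** Either the times are eventually equal to their limit, and [y] is the value there, or they stay
    strictly below it, and [y] is the left limit. Both cases are needed in the same form: limits
    along the sequence. *)
Let monotone_limits (th : nat -> R) w : regular w -> (forall n, th n <= th n.+1) -> (forall n, 0 <= th n <= T) ->
  exists z (y : 'I_m -> R), [/\ 0 <= z <= T, forall k, Y k (th n) w @[n --> \oo] --> y k &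
    forall j l, C j l (th n) w @[n --> \oo] --> C j l z w].
Proof.
move=> rw mth bth; have nth' : {homo th : x y / (x <= y)%N >-> x <= y} by exact/nondecreasing_seqP.
have ub : has_ubound (range th) by exists T => _ [n _ <-]; case/andP: (bth n).
have cth := nondecreasing_cvgn nth' ub; set z := sup (range th) in cth.
have thz n : th n <= z by apply: ub_le_sup => //; exists n.
have z0 : 0 <= z by apply: le_trans (thz 0%N); case/andP: (bth 0%N).
have zT : z <= T by apply: ge_sup; [exists (th 0%N), 0%N|move=> _ [n _ <-]; case/andP: (bth n)].
have [[N thN]|ne] := pselect (exists N, th N = z).
  have eqz n : (N <= n)%N -> th n = z by move=> Nn; apply/eqP; rewrite eq_le thz/= -thN; exact: nth'.
  exists z, (fun k => Y k z w); split=> [|k|j l]; first by rewrite z0.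
    by apply: cvg_near_cst; exists N => // n /= /eqz ->.
  by apply: cvg_near_cst; exists N => // n /= /eqz ->.
have ltz n : th n < z by rewrite lt_neqAle thz andbT; apply/eqP => h; apply: ne; exists n.
have zp : 0 < z by apply: le_lt_trans (ltz 0%N); case/andP: (bth 0%N).
have lc (X : R -> R) (x : R) : X v @[v --> z^'-] --> x -> X (th n) @[n --> \oo] --> x.
  by move=> /cvg_at_leftP; apply; split.
exists z, (fun k => lim (Y k v w @[v --> z^'-])); split=> [|k|j l]; first by rewrite z0.
  by apply: (lc (Y k ^~ w)); apply: (reg_Y rw k).2; rewrite zp.
by apply: (lc (C j l ^~ w)); exact: (within_left_cvg T0 zp zT (reg_C_cont rw)).
Qed.

(* Along an infinite chain of switches before [T] the left limits of the [Y^k]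
   would gain a fixed positive amount every two switches. *)
Lemma follows_finite a w : follows a -> regular w -> exists n, theta a n w = T.
Proof.
move=> fa rw; apply: contrapT => /forallNP hn.
have bth n : 0 <= theta a n w <= T by have [_ /(_ w)] := follows_invariant n fa.
have lth n : theta a n w < T by rewrite lt_neqAle; have /andP[_ ->] := bth n; rewrite andbT; exact/eqP.
have mth n : theta a n w <= theta a n.+1 w by have [_ _ + _ _] := follows_is_strategy fa n.
have [z [y [zT cy cC]]] := monotone_limits (th := fun n => theta a n w) rw mth bth.
(* The triangle defect at the limit time exceeds [8 dl]. Two switches lose at most [6 dl] in
   approximation errors, which leaves a gain of [2 dl]. *)
have [dl [d0 hd]] : exists dl : R, 0 < dl /\ forall j k l : 'I_m, j != k -> k != l ->
    8 * dl < C j k z w + C k l z w - C j l z w.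
  have tri (j k l : 'I_m) : \forall dl \near (0 : R)^'+, j != k -> k != l ->
      8 * dl < C j k z w + C k l z w - C j l z w.
    have [jk|jk] := boolP (j != k); last by apply: nearW.
    have [kl|kl] := boolP (k != l); last by apply: nearW.
    have := reg_loop rw jk kl; set S := [set _ | _ in _] => Sp.
    have hS : has_inf S by apply: contrapT => /inf_out h; move: Sp; rewrite h ltxx.
    have Sz : inf S <= C j k z w + C k l z w - C j l z w.
      by apply: ge_inf; [exact: hS.2|exists z => //=; rewrite in_itv].
    have p8 : 0 < inf S / 8 by rewrite divr_gt0.
    apply: filterS (nbhs_right_lt p8) => x xS _ _; apply: lt_le_trans Sz.
    by rewrite mulrC -ltr_pdivlMr.
  have tri1 (j k : 'I_m) := filter_forall _ (tri j k).
  have tri2 (j : 'I_m) := filter_forall _ (tri1 _ j).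
  have := filterI (nbhs_right_gt (0 : R)) (filter_forall _ (tri2 _ _)).
  by move=> /(_ _ _ _ _) h; have [dl [h1 h2]] := filter_ex h; exists dl.
have n1 (k : 'I_m) : \forall n \near \oo, `|y k - Y k (theta a n w) w| < dl.
  by move/cvgrPdist_lt: (cy k); exact.
have n2 (j l : 'I_m) : \forall n \near \oo, `|C j l z w - C j l (theta a n w) w| < dl.
  by move/cvgrPdist_lt: (cC j l); exact.
have n3 (j : 'I_m) := filter_forall _ (n2 j).
have [N _ hN] : \forall n \near \oo, (forall k, `|y k - Y k (theta a n w) w| < dl) /\
    forall j l, `|C j l z w - C j l (theta a n w) w| < dl.
  exact: (filterI (filter_forall _ n1) (filter_forall _ (n3 _))).
pose al n := alpha a n w.
(* Three approximation errors: two values of [Y] and one cost. *)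
have step n : (N <= n)%N -> y (al n) + C (al n) (al n.+1) z w <= y (al n.+1) + 3 * dl.
  move=> Nn; have [h1 h2] := hN n.+1 (leqW Nn).
  have := follows_switch fa rw (lth n.+1); rewrite -/(al n) -/(al n.+1).
  have := h1 (al n); have := h1 (al n.+1); have := h2 (al n) (al n.+1).
  rewrite !ltr_norml => /andP[? ?] /andP[? ?] /andP[? ?] ?; lra.
have two n : (N <= n)%N -> y (al n) + 2 * dl <= y (al n.+2).
  move=> Nn; have s1 := step n Nn; have s2 := step n.+1 (leqW Nn).
  have ne k : al k != al k.+1 by rewrite eq_sym; have [_ _ _ _] := follows_is_strategy fa k; exact.
  have := hd _ _ _ (ne n) (ne n.+1); have := reg_C0 rw (al n) (al n.+2) zT; lra.
have grow k : y (al N) + k%:R * (2 * dl) <= y (al (N + k.*2)%N).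
  elim: k => [|k ih]; first by rewrite addn0 mul0r addr0.
  have := two (N + k.*2)%N (leq_addr _ _); rewrite doubleS !addnS => h.
  apply: le_trans h; rewrite -natr1; lra.
pose B := \sum_k `|y k|.
have yB k : `|y k| <= B by rewrite /B (bigD1 k)//= lerDl sumr_ge0.
(* All [y k] lie in [[-B, B]], so a total gain of [2 B + 1] is impossible. *)
have [k _ hk] : \forall k \near \oo, (2 * B + 1) / (2 * dl) <= k%:R by exact: nbhs_infty_ger.
have := hk k (leqnn k) => /=; rewrite ler_pdivrMr ?mulr_gt0// => kB.
have := grow k; have := yB (al N); have := yB (al (N + k.*2)%N).
rewrite !ler_norml => /andP[? ?] /andP[? ?] ?; lra.
Qed.

Lemma follows_strategies_from a : follows a -> strategies_from P Tn zeta W T t i a.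
Proof.
move=> fa; split; [exact: follows_is_strategy| |exact: fa.1].
have ng : P.-negligible [set w | forall n, theta a n w < T].
  have := regular_ae; apply: negligibleS => w /= h rw.
  by have [n hn] := follows_finite fa rw; have := h n; rewrite hn ltxx.
by apply: measure_negligible => //; exact: cP.
Qed.

Let star := fix star n : (Omega -> R) * (Omega -> 'I_m) := if n is n'.+1 then
  let th w := inf (hit_set ((star n').1 w) ((star n').2 w) w) in
  (th, fun w => next_mode ((star n').2 w) (th w) w) else (fun=> t, fun=> i).

Let next_stopped th al : stopped_mode th al ->
  let th' w := inf (hit_set (th w) (al w) w) in
  stopped_mode th' (fun w => next_mode (al w) (th' w) w).
Proof.
move=> inv th'; have [_ _ an] := inv; have [s' b'] := stopped_mode_hit inv.
split=> // [w|c s s0]; first by have [] := b' w.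
(* Splitting by the current mode [j] turns the random argument of [next_mode] into a fixed one;
   [th <= th'] allows the event [al = j] to be read at time [th]. *)
rewrite (_ : _ `&` _ = \bigcup_j ([set w | al w = j] `&` [set w | th w <= s] `&`
    ([set w | next_mode j (th' w) w = c] `&` [set w | th' w <= s]))); last first.
  apply/seteqP; split=> w /=.
    move=> [h1 h2]; exists (al w) => //=; split=> //; split=> //.
    by apply: le_trans h2; have [] := b' w.
  by move=> [j _ /= [[<- _] [h1 h2]]].
rewrite -FT_measurableE; apply: fin_bigcup_measurable => [|j _]; first exact: finite_finset.
apply: measurableI; rewrite FT_measurableE; first exact: an.
by apply: next_mode_stopped => // w; have [] := b' w.
Qed.

Lemma follows_exists : exists a, follows a.
Proof.
have inv n : stopped_mode (star n).1 (star n).2.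
  by elim: n => [|n ih]; [exact: stopped_mode_cst|exact: next_stopped].
exists (Strategy (fun n => (star n).1) (fun n => (star n).2)); split=> // n.
split=> // [w|j]; first exact: next_modeP.
by have [_ _] := inv n.+1; exact.
Qed.

End BarrierStrategy.

End Solution.
End System.
End Model.

Theorem theorem4p1 (R : realType) (dO : measure_display)
    (Omega : measurableType dO) (P : probability Omega R)
    (E : ptopologicalType) (d m : nat) (T : R)
    (Tn : nat -> Omega -> \bar R) (zeta : nat -> Omega -> marks E)
    (W : 'I_d -> R -> Omega -> R)
    (phi : R -> Omega -> probability (marks E) R) (A : R -> Omega -> R)
    (rho : 'I_m -> R -> Omega -> marks E -> R) (M betahat : R)
    (xi : 'I_m -> Omega -> R) (f g : 'I_m -> R -> Omega -> R)
    (C : 'I_m -> 'I_m -> R -> Omega -> R)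
    (Y : 'I_m -> R -> Omega -> R) (U : 'I_m -> R -> Omega -> marks E -> R)
    (Z : 'I_m -> 'I_d -> R -> Omega -> R) (K : 'I_m -> R -> Omega -> R) :
  let F := filtration P Tn zeta W in
  let v := value P Tn zeta W phi A T rho xi f g C in
  let J := gain P Tn zeta W phi A T rho xi f g C in
  0 < T -> (2 <= m)%N ->
  measure_is_complete P ->
  borel_space R E ->
  marked_point_process P Tn zeta ->
  wiener_process P W ->
  mpp_wiener_independent P Tn zeta W ->
  continuous_compensator P Tn zeta W phi A ->
  (forall i, mark_predictable F `[0, T] (rho i)) ->
  assumption_S P T A rho M ->
  assumption_D P F T A M betahat xi f g C ->
  solves_reflected_system P Tn zeta W phi A T rho xi f g C M betahat Y U Z K ->
  forall (i : 'I_m) (t : R), 0 <= t <= T ->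
  [/\ is_ess_sup P [set J t a | a in strategies_from P Tn zeta W T t i]
        (fun w => (Y i t w)%:E),
      \forall w \ae P, (Y i t w)%:E = v t i w,
      exists a, follows_barrier P Tn zeta W T C Y t i a
    & forall a, follows_barrier P Tn zeta W T C Y t i a ->
        strategies_from P Tn zeta W T t i a /\
        \forall w \ae P, J t a w = v t i w].
Proof.
move=> F v J T0 m2 cP _ HT HW HI HC mrho HS HD HY i t tT.
have /andP[t0 tT'] := tT.
have [Zw [MZ cZ YE]] := Y_equation cP HT HW HI HC T0 mrho HS HD HY.
have bounds a := gain_bounds cP HT HW HC T0 m2 mrho HS HD HY cZ YE (i := i) t0 MZ (a := a) tT'.
have strat a := follows_strategies_from cP HT HW HC T0 m2 mrho HS HD HY cZ YE (i := i) tT (a := a).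
have [a0 fa0] := follows_exists cP HT HW HC T0 m2 mrho HS HD HY cZ YE i tT.
have opt a : follows_barrier P Tn zeta W T C Y t i a -> \forall w \ae P, J t a w = (Y i t w)%:E.
  move=> fa; apply: (bounds a (strat a fa)).2 => _.
  apply: filterS (regular_ae cP HT HW HC T0 m2 mrho HS HD HY cZ YE) => w rw.
  exact: (follows_optimal cP HT HW HC T0 m2 mrho HS HD HY cZ YE (i := i) tT fa rw).
have [HSp _] := HY; have [aY _ _ _ _] := HSp i.
have supY : is_ess_sup P [set J t a | a in strategies_from P Tn zeta W T t i] (fun w => (Y i t w)%:E).
  split.
  - by apply/measurable_EFinP; exact: (F_fun_measurable cP HT HW (aY t tT)).
  - by move=> _ [a Sa <-]; exact: (bounds a Sa).1.
  (* [Y^i_t] is itself the gain of a strategy, so every upper bound dominates it. *)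
  - move=> X _ hX; have := hX (J t a0); move=> /(_ (ex_intro2 _ _ a0 (strat a0 fa0) erefl)).
    by apply: filterS2 (opt a0 fa0) => w ->.
have vE : \forall w \ae P, (Y i t w)%:E = v t i w.
  have [_ Ys Yl] := supY.
  have [mv vs vl] : is_ess_sup P [set J t a | a in strategies_from P Tn zeta W T t i] (v t i).
    (* [value] is chosen among the essential suprema; the candidate [Y^i_t] shows that there is
       one. *)
    by apply: xgetPex; exists (fun w => (Y i t w)%:E).
  have [mY _ _] := supY.
  by apply: filterS2 (Yl _ mv vs) (vl _ mY Ys) => w h1 h2; apply/eqP; rewrite eq_le h1.
split=> //; first by exists a0.
move=> a fa; split; first exact: strat.
by apply: filterS2 (opt a fa) vE => w ->.
Qed.
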